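(* Let $(\mathcal N,F_0)$ be an odd $\theta_q$-summable pre-Breuer-Fredholm module for the unital Banach $*$-algebra $\mathcal A$, for some $q$ with $0<q\le1$. Let $P=\frac12(\operatorname{sign}(F_0)+1)$. For each unitary $u\in\mathcal A$ with $[F_0,u]\in Li_0^{q/2}$, the path $F_t^u=F_0+t(uF_0u^*-F_0)$, $t\in[0,1]$, lies in $\mathcal M_q=F_0+(Li_0^q)_{F_0}$ and, for every $r\ge0$, $$\operatorname{ind}(PuP)=sf(\{F_t^u\})=\frac1{C_{r,q}}\int_0^1\tau\Big[\frac{d}{dt}(F_t^u)\,f_r\big(1-(F_t^u)^2\big)\Big]dt,$$ where $f_r(T)=|T|^{-r}e^{-|T|^{-1/q}}$ and $C_{r,q}=\int_{-1}^1(1-u^2)^{-r}e^{-(1-u^2)^{-1/q}}\,du$.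
   Context: $\mathcal N$ is a semifinite von Neumann algebra (separable predual) with faithful normal semifinite trace $\tau$. For $S\in\mathcal N$, $t>0$: $\mu_t(S)=\inf\{\|SE\| : E\in\mathcal N\text{ a projection},\ \tau(1-E)\le t\}$. For $0<p\le1$, $Li_0^p=\{T\in\mathcal N:\mu_t(T)=o((1/\log t)^p)\text{ as }t\to\infty\}$. The function $x\mapsto x^{-r}e^{-x^{-1/q}}$ on $[0,\infty)$ is $0$ at $x=0$. $\operatorname{sign}(x)=1$ for $x\ge0$, $-1$ for $x<0$. $\mathcal K_{\mathcal N}$ is the norm-closed two-sided ideal generated by the elements of finite trace, $\pi:\mathcal N\to\mathcal N/\mathcal K_{\mathcal N}$; $T\in\mathcal N$ is Breuer-Fredholm if $\pi(T)$ is invertible. An odd $\theta_q$-summable pre-Breuer-Fredholm module for $\mathcal A$: $\mathcal A$ is continuously represented in $\mathcal N$ (elements identified with their images, unitaries with unitaries), $F_0\in\mathcal N$ is a self-adjoint Breuer-Fredholm operator, $1-F_0^2\in Li_0^q$, $[F_0,a]\in\mathcal K_{\mathcal N}$ for all $a\in\mathcal A$ and $[F_0,a]\in Li_0^{q/2}$ for a dense set of $a\in\mathcal A$. $(Li_0^q)_{F_0}=\{X\in Li_0^{q/2}: X=X^*,\ F_0X+XF_0\in Li_0^q\}$. $\operatorname{ind}(PuP)$ is the Breuer-Fredholm index of $PuP$ as an element of $P\mathcal NP$: $\tau$ of the projection onto its kernel in $PH$ minus $\tau$ of the projection onto the kernel of $Pu^*P$ in $PH$. Spectral flow: for a norm-continuous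 path $\{F_t\}_{t\in[a,b]}$ of self-adjoint Breuer-Fredholm operators let $P_t=\chi_{[0,\infty)}(F_t)$; for a fine enough partition (so that $\pi(P_t)$, which is continuous in $t$, varies by less than $1$ on each subinterval), $sf(\{F_t\})=\sum_i\operatorname{ind}(P_{t_{i-1}}P_{t_i})$, where $\operatorname{ind}(PQ)=\tau([\operatorname{ran}Q\cap\ker P])-\tau([\ker Q\cap\operatorname{ran}P])$ is the index of $PQ:\operatorname{ran}Q\to\operatorname{ran}P$. If all $F_t\in F_a+\mathcal K_{\mathcal N}$ (as here), this equals $\operatorname{ind}(P_aP_b)$. *)

(* Defs.v *)
From HB Require Import structures.
From mathcomp Require Import all_boot all_order all_algebra.
From mathcomp Require Import complex.
From mathcomp Require Import all_classical all_reals all_analysis.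

Set Implicit Arguments.
Unset Strict Implicit.
Unset Printing Implicit Defensive.

Import Order.TTheory GRing.Theory Num.Theory.
Import numFieldNormedType.Exports.

Local Open Scope classical_set_scope.
Local Open Scope complex_scope.
Local Open Scope ring_scope.

(* Inner products are linear in the first argument, conjugate-linear in the
   second. *)
HB.mixin Record isHilbert (R : realType) H of CompleteNormedModule R[i] H := {
  hdot : {dot H for (@Num.conj R[i])};
  hdot_norm : forall x : H, `|x| ^+ 2 = hdot x x
}.

#[short(type="hilbertType")]
HB.structure Definition Hilbert (R : realType) :=
  {H of CompleteNormedModule R[i] H & isHilbert R H}.

(* The involution is not required to be isometric. *)
HB.mixin Record isBanachStarAlgebra (R : realType) A
    of CompleteNormedModule R[i] A := {
  amul : A -> A -> A;
  aone : A;
  astar : A -> A;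
  amulA : associative amul;
  amul1 : left_id aone amul;
  amulr1 : right_id aone amul;
  amul_linearl : forall b : A, linear (amul^~ b);
  amul_linearr : forall a : A, linear (amul a);
  anormM_le : forall a b : A, `|amul a b| <= `|a| * `|b|;
  astarK : involutive astar;
  astarD : {morph astar : a b / a + b};
  astarZ : forall (c : R[i]) (a : A), astar (c *: a) = Num.conj c *: astar a;
  astarM : forall a b : A, astar (amul a b) = amul (astar b) (astar a)
}.

#[short(type="banachStarAlgType")]
HB.structure Definition BanachStarAlgebra (R : realType) :=
  {A of CompleteNormedModule R[i] A & isBanachStarAlgebra R A}.

Definition unitary_elt (R : realType) (A : banachStarAlgType R) (u : A) :=
  amul (astar u) u = aone /\ amul u (astar u) = aone :> A.

Section BoundedOperators.
Variables (R : realType) (H : hilbertType R).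

Definition bounded_op : {pred (H -> H)} :=
  [pred f : H -> H | `[< linear f /\ continuous f >]].

Record bop := Bop { bop_fun :> H -> H; _ : bop_fun \in bounded_op }.

HB.instance Definition _ := [isSub for bop_fun].
HB.instance Definition _ := [Choice of bop by <:].

Lemma bounded_opP (f : H -> H) :
  reflect (linear f /\ continuous f) (f \in bounded_op).
Proof. by rewrite inE; exact: asboolP. Qed.

Lemma bop_linear (T : bop) : linear T.
Proof. by case: T => f /= /bounded_opP[]. Qed.

Lemma bop_continuous (T : bop) : continuous T.
Proof. by case: T => f /= /bounded_opP[]. Qed.

HB.instance Definition _ (T : bop) :=
  GRing.isLinear.Build R[i] H H *:%R T (@bop_linear T).

Lemma bopP (S T : bop) : (forall x, S x = T x) -> S = T.
Proof. by move=> e; apply: val_inj; apply/funext. Qed.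

Fact bounded_op_submod : subsemimod_closed bounded_op.
Proof.
split; first split.
- apply/bounded_opP; split; last by move=> x; exact: cvg_cst.
  by move=> a x y; rewrite /= scaler0 addr0.
- move=> f g /bounded_opP[fl fc] /bounded_opP[gl gc]; apply/bounded_opP.
  split; last by move=> x; apply: cvgD; [exact: fc|exact: gc].
  have fgE z : (f + g) z = f z + g z by [].
  by move=> a x y; rewrite !fgE fl gl scalerDr addrACA.
- move=> c f /bounded_opP[fl fc]; apply/bounded_opP.
  split; last by move=> x; apply: cvgZr; exact: fc.
  have cfE z : (c *: f) z = c *: f z by [].
  by move=> a x y; rewrite !cfE fl scalerDr !scalerA mulrC.
Qed.

HB.instance Definition _ := GRing.SubChoice_isSubLmodule.Build
  R[i] (H -> H) bounded_op bop bounded_op_submod.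

Fact bop_one_subproof : (id : H -> H) \in bounded_op.
Proof. by apply/bounded_opP; split => // x; exact: cvg_id. Qed.

Fact bop_mul_subproof (S T : bop) : (S \o T) \in bounded_op.
Proof.
apply/bounded_opP; split; first by move=> a x y; rewrite /= !linearP.
by move=> x; apply: continuous_comp; exact: bop_continuous.
Qed.

Definition bop_one := Bop bop_one_subproof.
Definition bop_mul S T := Bop (bop_mul_subproof S T).

Lemma bop_addE (S T : bop) x : (S + T) x = S x + T x. Proof. by []. Qed.
Lemma bop_scaleE (c : R[i]) (T : bop) x : (c *: T) x = c *: T x.
Proof. by []. Qed.

Fact bop_mulA : associative bop_mul. Proof. by move=> *; exact: bopP. Qed.
Fact bop_mul1 : left_id bop_one bop_mul. Proof. by move=> *; exact: bopP. Qed.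
Fact bop_mulr1 : right_id bop_one bop_mul. Proof. by move=> *; exact: bopP. Qed.
Fact bop_mulDl : left_distributive bop_mul +%R.
Proof. by move=> *; exact: bopP. Qed.
Fact bop_mulDr : right_distributive bop_mul +%R.
Proof. by move=> S T U; apply: bopP => x; exact: (raddfD S). Qed.

HB.instance Definition _ := GRing.Zmodule_isPzRing.Build bop
  bop_mulA bop_mul1 bop_mulr1 bop_mulDl bop_mulDr.

Definition opnorm (T : bop) : R :=
  sup [set complex.Re `|T x| | x in [set x : H | `|x| <= 1]].

Lemma Re_norm (x : H) : (complex.Re `|x|)%:C = `|x|.
Proof. by apply: RRe_real; exact: normr_real. Qed.

Lemma opnorm_has_sup (T : bop) :
  has_sup [set complex.Re `|T x| | x in [set x : H | `|x| <= 1]].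
Proof.
split; first by exists (complex.Re `|T 0|); exists 0 => //=; rewrite normr0.
have : bounded_near T (nbhs (0 : H)).
  by apply/linear_bounded_continuous; exact: bop_continuous.
move=> /linear_boundedP /pinfty_ex_gt0 [M M0 /= TM].
exists (complex.Re M) => _ [x /= x1 <-].
have := le_trans (TM x) (ler_wpM2l (ltW M0) x1).
by rewrite mulr1 lecE => /andP[].
Qed.

Lemma opnorm_le_unit (T : bop) (x : H) :
  `|x| <= 1 -> `|T x| <= (opnorm T)%:C.
Proof.
move=> x1; rewrite -Re_norm lecR; apply: sup_upper_bound.
  exact: opnorm_has_sup.
by exists x.
Qed.

Lemma opnorm_le (T : bop) (c : R) :
  (forall x : H, `|x| <= 1 -> `|T x| <= c%:C) -> opnorm T <= c.
Proof.
move=> Tc; apply: ge_sup; first by case: (opnorm_has_sup T).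
by move=> _ [x /= x1 <-]; have := Tc x x1; rewrite -Re_norm lecR.
Qed.

Lemma opnormP (T : bop) (x : H) : `|T x| <= (opnorm T)%:C * `|x|.
Proof.
have [->|x0] := eqVneq x 0; first by rewrite linear0 !normr0 mulr0.
have nx : 0 < `|x| by rewrite normr_gt0.
rewrite -ler_pdivrMr// mulrC -{1}(@ger0_norm _ `|x|^-1) ?invr_ge0//.
rewrite -normrZ -linearZ; apply: opnorm_le_unit.
by rewrite normrZ ger0_norm ?invr_ge0// mulVf// gt_eqF.
Qed.

Definition bop_norm (T : bop) : R[i] := (opnorm T)%:C.

Fact bop_norm_triangle (S T : bop) : bop_norm (S + T) <= bop_norm S + bop_norm T.
Proof.
rewrite /bop_norm -rmorphD lecR; apply: opnorm_le => x x1.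
rewrite rmorphD bop_addE (le_trans (ler_normD _ _))//.
by rewrite lerD// opnorm_le_unit.
Qed.

Fact bop_norm_eq0 (T : bop) : bop_norm T = 0 -> T = 0.
Proof.
move=> T0; apply: bopP => x; apply/normr0_eq0/le_anti.
by rewrite normr_ge0 (le_trans (opnormP T x))// -/(bop_norm T) T0 mul0r.
Qed.

Lemma opnorm_ge0 (T : bop) : 0 <= opnorm T.
Proof.
rewrite -lecR; apply: (le_trans (normr_ge0 (T 0))).
by apply: opnorm_le_unit; rewrite normr0.
Qed.

Lemma bop_norm_scale_le (c : R[i]) (T : bop) :
  bop_norm (c *: T) <= `|c| * bop_norm T.
Proof.
have ncE : (complex.Re `|c|)%:C = `|c| by apply: RRe_real; exact: normr_real.
rewrite -ncE -rmorphM lecR; apply: opnorm_le => x x1.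
have -> : (complex.Re `|c| * opnorm T)%:C = `|c| * (opnorm T)%:C.
  by rewrite -{2}ncE; exact: rmorphM.
rewrite bop_scaleE normrZ.
by rewrite ler_wpM2l// opnorm_le_unit.
Qed.

Fact bop_norm_scale (c : R[i]) (T : bop) : bop_norm (c *: T) = `|c| * bop_norm T.
Proof.
apply/le_anti; rewrite bop_norm_scale_le/=.
have [->|c0] := eqVneq c 0.
  by rewrite normr0 mul0r /bop_norm lecR opnorm_ge0.
have nc : 0 < `|c| by rewrite normr_gt0.
rewrite -ler_pdivlMl// -normfV.
by rewrite -[X in bop_norm X <= _](scale1r T) -(mulVf c0) -scalerA bop_norm_scale_le.
Qed.

HB.instance Definition _ := Lmodule_isNormed.Build R[i] bop
  bop_norm_triangle bop_norm_scale bop_norm_eq0.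

Lemma bop_normE (T : bop) : `|T| = (opnorm T)%:C. Proof. by []. Qed.
Lemma bop_mulE (S T : bop) x : (S * T) x = S (T x). Proof. by []. Qed.
Lemma bop_oneE x : (1 : bop) x = x. Proof. by []. Qed.

End BoundedOperators.

Section OperatorAlgebras.
Variables (R : realType) (H : hilbertType R).
Local Notation B := (bop H).
Implicit Types (S T X : B) (N : set B) (tau : B -> \bar R).

(* Existence is the Riesz representation theorem; the default is never met. *)
Definition adj T : B :=
  xget 0 [set S : B | forall x y : H, hdot (T x) y = hdot x (S y)].

Definition selfadjoint T := adj T = T.
Definition positive_op T := forall x : H, 0 <= hdot (T x) x.
Definition op_le S T := positive_op (T - S).
Definition projection T := T * T = T /\ adj T = T.
Definition ker_op T : set H := [set x | T x = 0].
Definition commutator S T := S * T - T * S.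

(* The orthogonal projection onto a closed subspace [V]. *)
Definition proj_onto (V : set H) : B :=
  xget 0 [set E : B | projection E /\ range E = V].

Definition commutant (N : set B) : set B :=
  [set T | forall S, N S -> S * T = T * S].

Definition von_neumann_algebra N :=
  (forall T, N T -> N (adj T)) /\ commutant (commutant N) = N.

Definition positive_part N : set B := [set T | N T /\ positive_op T].

(* The predual of [N] is its space of ultraweakly continuous functionals
   S |-> \sum_k <S xi_k, eta_k>, with the norm of the dual of [N]. *)
Definition normal_functional N (phi : B -> R[i]) :=
  exists xi eta : nat -> H,
    [/\ cvgn (series (fun k => complex.Re `|xi k| ^+ 2)),
        cvgn (series (fun k => complex.Re `|eta k| ^+ 2)) &
        forall S, N S ->
          series (fun k => hdot (S (xi k)) (eta k)) @ \oo --> (phi S : R[i]^o)].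

Definition separable_predual N :=
  exists phi_ : nat -> B -> R[i],
    (forall n, normal_functional N (phi_ n)) /\
    forall phi, normal_functional N phi -> forall e : R, 0 < e ->
      exists n, forall S, N S -> opnorm S <= 1 ->
        `|phi S - phi_ n S| <= e%:C.

Definition directed_ops (D : set B) :=
  D !=set0 /\
  forall S T, D S -> D T -> exists2 X, D X & op_le S X /\ op_le T X.

Definition is_op_lub N (D : set B) S :=
  [/\ positive_part N S,
      forall T, D T -> op_le T S &
      forall X, positive_part N X -> (forall T, D T -> op_le T X) -> op_le S X].

(* Only the values of [tau] on the positive part of [N] matter. *)
Record fns_trace N tau : Prop := FnsTrace {
  trace_ge0 : forall T, positive_part N T -> (0 <= tau T)%E;
  trace_add : forall S T, positive_part N S -> positive_part N T ->
    tau (S + T) = (tau S + tau T)%E;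
  trace_scale : forall (c : R) T, 0 <= c -> positive_part N T ->
    tau (c%:C *: T) = (c%:E * tau T)%E;
  trace_cyclic : forall T, N T -> tau (adj T * T) = tau (T * adj T);
  trace_faithful : forall T, positive_part N T -> tau T = 0%E -> T = 0;
  trace_normal : forall D S, D `<=` positive_part N -> directed_ops D ->
    is_op_lub N D S -> tau S = ereal_sup (tau @` D);
  trace_semifinite : forall T, positive_part N T -> T <> 0 ->
    exists S, [/\ positive_part N S, S <> 0, op_le S T & (tau S < +oo)%E]
}.

Definition finite_trace_pos N tau : set B :=
  [set T | positive_part N T /\ (tau T < +oo)%E].

(* [T] belongs to the trace ideal and the linear extension of [tau] takes the
   value [z] at [T]. *)
Definition trace_is N tau T (z : R[i]) :=
  exists T1 T2 T3 T4 : B,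
    [/\ (finite_trace_pos N tau T1 /\ finite_trace_pos N tau T2),
        (finite_trace_pos N tau T3 /\ finite_trace_pos N tau T4),
        T = (T1 - T2) + 'i *: (T3 - T4) &
        z = (fine (tau T1) - fine (tau T2)) +i*
            (fine (tau T3) - fine (tau T4))].

Definition closed_ideal N (J : set B) :=
  [/\ J `<=` N, J 0, forall S T, J S -> J T -> J (S + T),
      forall S T, N S -> J T -> J (S * T) /\ J (T * S) & closed J].

Definition compact_ideal N tau : set B :=
  [set T | forall J, closed_ideal N J -> finite_trace_pos N tau `<=` J -> J T].

(* Invertibility, resp. norm, of the class of [T] in the quotient of [N] by
   [compact_ideal N tau]. *)
Definition breuer_fredholm N tau T :=
  N T /\ exists S, [/\ N S, compact_ideal N tau (T * S - 1) &
                       compact_ideal N tau (S * T - 1)].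

Definition quotient_norm N tau T : R :=
  inf [set opnorm (T - X) | X in compact_ideal N tau].

Definition sing_val N tau (t : R) S : R :=
  inf [set opnorm (S * E) | E in
        [set E : B | [/\ N E, projection E & (tau (1 - E)%R <= t%:E)%E]]].

Definition Li0 N tau (p : R) : set B :=
  [set T | N T /\ forall e : R, 0 < e ->
     \forall t \near +oo, sing_val N tau t T <= e * ((ln t)^-1) `^ p].

Definition Li0_tangent N tau (q : R) (F0 : B) : set B :=
  [set X | [/\ Li0 N tau (q / 2) X, selfadjoint X &
               Li0 N tau q (F0 * X + X * F0)]].

Definition Mq N tau (q : R) (F0 : B) : set B :=
  [set F0 + X | X in Li0_tangent N tau q F0].

(* [E] is the projection-valued spectral measure of the self-adjoint operator
   [T], and [mu x] is the scalar measure <E(.) x, x>. *)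
Definition spectral_measure T (E : set (measurableTypeR R) -> B)
    (mu : H -> {measure set (measurableTypeR R) -> \bar R}) :=
  [/\ forall A, measurable A -> projection (E A),
      forall A A', measurable A -> measurable A' -> E (A `&` A') = E A * E A',
      E setT = 1 /\ E `[- opnorm T, opnorm T]%classic = 1,
      forall x A, measurable A -> mu x A = (complex.Re (hdot (E A x) x))%:E &
      forall x : H, hdot (T x) x = (\int[mu x]_l l)%:C].

(* The bounded Borel functional calculus of a self-adjoint operator, f(T) being
   determined by its quadratic form. *)
Definition borel_calculus (f : R -> R) T : B :=
  xget 0 [set X : B | exists E mu, spectral_measure T E mu /\
    forall x : H, hdot (X x) x = (\int[mu x]_l f l)%:C].

Definition abs_op T : B :=
  xget 0 [set S : B | positive_op S /\ S * S = adj T * T].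

Definition sign_fun (x : R) : R := if 0 <= x then 1 else -1.

(* On the whole line, with value 0 also for x < 0, which is irrelevant. *)
Definition theta_fun (r q x : R) : R :=
  if x <= 0 then 0 else x `^ (- r) * expR (- (x `^ (- q^-1))).

Definition theta_op (r q : R) T : B := borel_calculus (theta_fun r q) (abs_op T).

Definition theta_const (r q : R) : R :=
  \int[lebesgue_measure]_(x in `[-1, 1]) theta_fun r q (1 - x ^+ 2).

Definition tau_dim tau (V : set H) : \bar R := tau (proj_onto V).

(* The Breuer-Fredholm index of [P T P] in the corner algebra of the
   projection [P]. *)
Definition corner_index tau (P T : B) : \bar R :=
  (tau_dim tau (range P `&` ker_op (P * T * P)%R) -
   tau_dim tau (range P `&` ker_op (P * adj T * P)%R))%E.

(* The index of [P Q : ran Q -> ran P]. In both indices the two terms are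
   finite as soon as the difference is, since +oo - +oo = -oo in [\bar R]. *)
Definition pair_index tau (P Q : B) : \bar R :=
  (tau_dim tau (range Q `&` ker_op P) - tau_dim tau (ker_op Q `&` range P))%E.

Definition nonneg_proj T : B := borel_calculus \1_[set x : R | 0 <= x] T.

Section SpectralFlow.
Variables (N : set B) (tau : B -> \bar R) (F : R -> B) (a b : R).

Definition knot (s : seq R) (i : nat) : R := nth b (a :: s) i.

Definition fine_partition (s : seq R) :=
  itv_partition a b s /\
  forall i : nat, (i < size s)%N -> forall t t' : R,
    t \in `[knot s i, knot s i.+1] -> t' \in `[knot s i, knot s i.+1] ->
    quotient_norm N tau (nonneg_proj (F t) - nonneg_proj (F t')) < 1.

Definition flow_sum (s : seq R) : \bar R :=
  (\sum_(0 <= i < size s)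
     pair_index tau (nonneg_proj (F (knot s i))) (nonneg_proj (F (knot s i.+1))))%E.

Definition is_spectral_flow (v : \bar R) :=
  [/\ {within `[a, b], continuous F},
      forall t, t \in `[a, b] -> selfadjoint (F t) /\ breuer_fredholm N tau (F t),
      exists s, fine_partition s &
      forall s, fine_partition s -> flow_sum s = v].

End SpectralFlow.

Definition norm_derivative (F : R -> B) (t : R) : B :=
  lim ((h^-1)%:C *: (F (t + h) - F t) @[h --> 0^']).

Definition conj_path (F0 U : B) (t : R) : B :=
  F0 + t%:C *: (U * F0 * adj U - F0).

Record continuous_representation N (A : banachStarAlgType R) (rho : A -> B) :
    Prop := ContinuousRepresentation {
  rep_mem : forall a, N (rho a);
  rep_linear : linear rho;
  rep_mul : forall a b, rho (amul a b) = rho a * rho b;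
  rep_one : rho aone = 1;
  rep_star : forall a, rho (astar a) = adj (rho a);
  rep_continuous : continuous rho
}.

Record pre_breuer_fredholm_module N tau (q : R) (A : banachStarAlgType R)
    (rho : A -> B) (F0 : B) : Prop := PreBreuerFredholmModule {
  mod_rep : continuous_representation N rho;
  mod_selfadjoint : selfadjoint F0;
  mod_fredholm : breuer_fredholm N tau F0;
  mod_summable : Li0 N tau q (1 - F0 ^+ 2);
  mod_compact : forall a, compact_ideal N tau (commutator F0 (rho a));
  mod_dense : dense [set a | Li0 N tau (q / 2) (commutator F0 (rho a))]
}.

End OperatorAlgebras.

(* Main.v *)
Require Import Defs.
From HB Require Import structures.
From mathcomp Require Import all_boot all_order all_algebra.
From mathcomp Require Import complex ring lra zify.
From mathcomp Require Import all_classical all_reals all_analysis.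
From mathcomp Require Import measurable_realfun.

Set Implicit Arguments.
Unset Strict Implicit.
Unset Printing Implicit Defensive.

Import Order.TTheory GRing.Theory Num.Theory.
Import numFieldNormedType.Exports.

Local Open Scope classical_set_scope.
Local Open Scope complex_scope.
Local Open Scope ring_scope.

(** With k(F) = f_r(1 - F^2), the one-form X |-> tau (X k(F)) is exact on M_q:
    compressing F - J, where J = sign F_0, by a finite projection E commuting
    with J reduces it to finite traces, where a polynomial k has the primitive
    given by tau (E K(F)), K' = k; then k is approximated by polynomials and E
    tends to 1. Hence the integral I(A, A') along a segment is additive, and
    I(A, sign A) is invariant under unitary conjugation, so that
    I(F_0, F_1) = I(sign F_0, sign F_1) for F_1 = u F_0 u^-1.

    For two symmetries 2P - 1 and 2Q - 1, put D = Q - P and b = 1 - P - Q, so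
    that D b = - b D and D^2 + b^2 = 1. Along the segment k is a function of D^2
    and the trace of 2D k is carried by the kernel of b, because the sign of b
    anticommutes with D. There D = 1 on ran Q /\ ker P and D = -1 on
    ker Q /\ ran P, so the integral is C_{r,q} times the index of the pair. *)

(** * The underlying real inner product *)

(** What shapes the proof is uniformity. Exactness is proved for compressions and transferred by a
    limit, so the operators 1 - F^2 must be controlled at once for all points of a segment and all
    compressions. Membership in Li_0^p is therefore recast as [usm]: at each dyadic scale an
    operator splits into a part small in norm and a part of controlled trace norm, with constants
    common to the family. Sums, products and conjugates are then immediate, and the finiteness of
    tau(f_r(S)) is a sum over dyadic shells, on which f_r decays like exp(- h 2^n) while the trace
    grows at most like exp(e 2^n), for e small against h.

    Continuity of S |-> f_r(S) in trace norm is obtained from continuity in operator norm by writing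
    f_r as the square of another theta function.

    The Borel calculus of the statement selects an arbitrary spectral measure. It is identified with
    the calculus built from Bernstein polynomials through an estimate at approximate eigenvectors
    that both satisfy.

    On the index side, the signs of all the F_t differ by elements of Li_0^{q/2}, so the projections
    P_t agree modulo the compact ideal and the pair indices add up along any partition. *)

Section HilbertReal.
Variables (R : realType) (H : hilbertType R).
Implicit Types (x y z : H) (a c e : R).

(** The real form determines the complex one ([hdotE]), hence operators and their adjoints. Working
    with it keeps all scalar estimates in the ordered field R. *)
Definition rdot x y : R := complex.Re (hdot x y).
Definition sqn x : R := rdot x x.

Lemma rdotC x y : rdot x y = rdot y x.
Proof.
rewrite /rdot; have -> : hdot x y = (hdot y x)^*%C.
  by have := hermC (@hdot R H) x y; rewrite /= expr0 mul1r.
by case: (hdot y x).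
Qed.

Lemma rdotDl x y z : rdot (x + y) z = rdot x z + rdot y z.
Proof.
rewrite /rdot; have -> : hdot (x + y) z = hdot x z + hdot y z by exact: linearDl.
by case: (hdot x z); case: (hdot y z).
Qed.

Lemma rdotNl x z : rdot (- x) z = - rdot x z.
Proof.
rewrite /rdot; have -> : hdot (- x) z = - hdot x z by exact: linearNl.
by case: (hdot x z).
Qed.

Lemma rdotBl x y z : rdot (x - y) z = rdot x z - rdot y z.
Proof. by rewrite rdotDl rdotNl. Qed.

Lemma rdotDr x y z : rdot z (x + y) = rdot z x + rdot z y.
Proof. by rewrite rdotC rdotDl !(rdotC z). Qed.

Lemma rdotNr x z : rdot z (- x) = - rdot z x.
Proof. by rewrite rdotC rdotNl (rdotC z). Qed.

Lemma rdotBr x y z : rdot z (x - y) = rdot z x - rdot z y.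
Proof. by rewrite rdotDr rdotNr. Qed.

Lemma rdotZl c x y : rdot (c%:C *: x) y = c * rdot x y.
Proof.
rewrite /rdot; have -> : hdot (c%:C *: x) y = c%:C * hdot x y by exact: linearZl_LR.
by case: (hdot x y) => u v /=; rewrite mul0r subr0.
Qed.

Lemma rdotZr c x y : rdot x (c%:C *: y) = c * rdot x y.
Proof. by rewrite rdotC rdotZl rdotC. Qed.

Lemma rdot0l x : rdot 0 x = 0.
Proof. by rewrite -(scale0r 0) -[0 in X in X *: _]/(0%:C) rdotZl mul0r. Qed.

Lemma rdot0r x : rdot x 0 = 0.
Proof. by rewrite rdotC rdot0l. Qed.

Lemma rdotil x y : rdot ('i *: x) y = - complex.Im (hdot x y).
Proof.
rewrite /rdot; have -> : hdot ('i *: x) y = 'i * hdot x y by exact: linearZl_LR.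
by case: (hdot x y) => u v /=; rewrite mul0r mul1r sub0r.
Qed.

Lemma hdotE x y : hdot x y = rdot x y +i* rdot x ('i *: y).
Proof.
rewrite (rdotC x ('i *: y)) rdotil /rdot.
have -> : hdot y x = (hdot x y)^*%C.
  by have := hermC (@hdot R H) y x; rewrite /= expr0 mul1r.
by case: (hdot x y) => u v /=; rewrite opprK.
Qed.

Lemma normE x : `|x| ^+ 2 = (sqn x)%:C.
Proof.
have h := hdot_norm x; rewrite h.
have r : hdot x x \is Num.real by rewrite -h ger0_real// exprn_ge0.
by rewrite /sqn /rdot RRe_real.
Qed.

Lemma sqn_norm x : sqn x = complex.Re `|x| ^+ 2.
Proof.
have := normE x; rewrite -{1}(Re_norm x) -rmorphXn /= => h.
by apply/eqP; rewrite -(inj_eq (@complexI R)) h.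
Qed.

Lemma Re_norm_ge0 x : 0 <= complex.Re `|x|.
Proof. by have := normr_ge0 x; rewrite lecE => /andP[]. Qed.

Lemma sqn_ge0 x : 0 <= sqn x.
Proof. by rewrite sqn_norm sqr_ge0. Qed.
Hint Resolve sqn_ge0 : core.

Lemma norm_sqrt x : `|x| = (Num.sqrt (sqn x))%:C.
Proof. by rewrite sqn_norm sqrtr_sqr ger0_norm ?Re_norm_ge0// Re_norm. Qed.

Lemma sqn0 : sqn 0 = 0. Proof. exact: rdot0l. Qed.

Lemma sqn_eq0 x : sqn x = 0 -> x = 0.
Proof. by move=> h; apply: normr0_eq0; rewrite norm_sqrt h sqrtr0. Qed.

Lemma sqnD x y : sqn (x + y) = sqn x + sqn y + 2 * rdot x y.
Proof. rewrite /sqn !rdotDl !rdotDr (rdotC y x); ring. Qed.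

Lemma sqnB x y : sqn (x - y) = sqn x + sqn y - 2 * rdot x y.
Proof. rewrite /sqn !rdotBl !rdotBr (rdotC y x); ring. Qed.

Lemma sqnZ c x : sqn (c%:C *: x) = c ^+ 2 * sqn x.
Proof. rewrite /sqn rdotZl rdotZr; ring. Qed.

Lemma sqnN x : sqn (- x) = sqn x.
Proof. by rewrite /sqn rdotNl rdotNr opprK. Qed.

Lemma sqnBC x y : sqn (x - y) = sqn (y - x).
Proof. by rewrite -sqnN opprB. Qed.

Lemma rdot_sqr_le x y : rdot x y ^+ 2 <= sqn x * sqn y.
Proof.
have := sqn_ge0 y; rewrite le_eqVlt => /orP[/eqP y0|y0].
  by rewrite (sqn_eq0 (esym y0)) rdot0r sqn0 mulr0 expr0n.
have := sqn_ge0 ((sqn y)%:C *: x - (rdot x y)%:C *: y).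
rewrite sqnB !sqnZ rdotZl rdotZr => h.
rewrite -subr_ge0 -(pmulr_rge0 _ y0).
apply: le_trans h _; rewrite le_eqVlt; apply/orP; left; apply/eqP; ring.
Qed.

Lemma rdot_le x y c : 0 < c -> 2 * rdot x y <= c * sqn x + c^-1 * sqn y.
Proof.
move=> c0; have := sqn_ge0 (c%:C *: x - y); rewrite sqnB sqnZ rdotZl => h.
rewrite -(ler_pM2l c0) mulrDr (mulrA c c^-1) mulfV ?gt_eqF// mul1r.
by nra.
Qed.

Lemma sqnD_le x y : sqn (x + y) <= 2 * sqn x + 2 * sqn y.
Proof. by have := sqn_ge0 (x - y); rewrite sqnB sqnD => h; lra. Qed.

Lemma rdot_eq0 x : (forall y, rdot x y = 0) -> x = 0.
Proof. by move=> h; apply: sqn_eq0; exact: h. Qed.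

Definition hlim (u : nat -> H) (l : H) :=
  forall e, 0 < e -> exists n0, forall n, (n0 <= n)%N -> sqn (u n - l) <= e.

Lemma norm_le_sqn x e : 0 <= e -> (`|x| <= e%:C) = (sqn x <= e ^+ 2).
Proof.
move=> e0; rewrite norm_sqrt lecR -[in RHS]ler_sqrt ?sqr_ge0//.
by rewrite sqrtr_sqr ger0_norm.
Qed.

Lemma posC (e : R[i]) : 0 < e -> e = (complex.Re e)%:C /\ 0 < complex.Re e.
Proof. by case: e => u v; rewrite ltcE /= => /andP[/eqP -> u0]; split. Qed.

Lemma hlimP (u : nat -> H) l : hlim u l <-> u @ \oo --> l.
Proof.
split.
  move=> h; apply/cvgrPdist_le => e /posC[-> e0].
  have [n0 hn] := h _ (exprn_gt0 2 e0).
  exists n0 => // n /= n0n; rewrite norm_le_sqn ?(ltW e0)// sqnBC; exact: hn.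
move/cvgrPdist_le => h e e0.
have s0 : 0 < Num.sqrt e by rewrite sqrtr_gt0.
have /h [n0 _ hn] : 0 < (Num.sqrt e)%:C by rewrite ltcR.
exists n0 => n n0n; have := hn n n0n.
by rewrite norm_le_sqn ?(ltW s0)// sqr_sqrtr ?(ltW e0)// sqnBC.
Qed.

Lemma cauchy_hlim (u : nat -> H) :
  (forall e, 0 < e -> exists n0, forall m n, (n0 <= m)%N -> (n0 <= n)%N ->
     sqn (u m - u n) <= e) -> exists l, hlim u l.
Proof.
move=> h; have : cvg (u @ \oo).
  apply/cauchy_cvgP/cauchy_ballP => e /posC[-> e0].
  have e2 : 0 < complex.Re e / 2 by lra.
  have [n0 hn] := h _ (exprn_gt0 2 e2).
  exists (u @` [set n | (n0 <= n)%N], u @` [set n | (n0 <= n)%N]) => /=.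
    by split; exists n0 => // n /= ?; exists n.
  case=> _ _ /= [[m hm <-] [n hn' <-]]; rewrite -ball_normE /=.
  apply: (@le_lt_trans _ _ (complex.Re e / 2)%:C); last by rewrite ltcR; lra.
  by rewrite norm_le_sqn ?(ltW e2)//; exact: hn.
move=> hc; exists (lim (u @ \oo)); apply/hlimP; exact: hc.
Qed.

Lemma hlim_unique (u : nat -> H) l l' : hlim u l -> hlim u l' -> l = l'.
Proof.
move=> h1 h2; apply/eqP; rewrite -subr_eq0; apply/eqP/sqn_eq0/eqP.
rewrite eq_le sqn_ge0 andbT; apply/ler_addgt0Pl => e e0; rewrite addr0.
have e4 : 0 < e / 4 by lra.
have [n1 k1] := h1 _ e4; have [n2 k2] := h2 _ e4.
have := k1 (maxn n1 n2) (leq_maxl _ _); have := k2 (maxn n1 n2) (leq_maxr _ _).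
move=> a1 a2; have := sqnD_le (l - u (maxn n1 n2)) (u (maxn n1 n2) - l').
by rewrite addrA subrK (sqnBC l (u _)); lra.
Qed.

Lemma hlim_rdot (u : nat -> H) l y c :
  hlim u l -> (forall n, rdot (u n) y <= c) -> rdot l y <= c.
Proof.
move=> h hc; apply/ler_addgt0Pl => e e0.
have y1 : 0 < sqn y + 1 by have := sqn_ge0 y; lra.
have [n0 hn] := h _ (divr_gt0 (exprn_gt0 2 e0) y1).
have hc0 := hc n0.
suff : rdot (l - u n0) y <= e by rewrite rdotBl; lra.
apply: le_trans (ler_norm _) _.
rewrite -(@ler_pXn2r _ 2)// ?nnegrE ?(ltW e0)//.
rewrite real_normK ?num_real// (le_trans (rdot_sqr_le _ _))//.
rewrite sqnBC; have := hn n0 (leqnn _); rewrite ler_pdivlMr// => hh.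
apply: le_trans hh; apply: ler_wpM2l => //; lra.
Qed.

Lemma inv_small e : 0 < e -> exists n0 : nat, forall n, (n0 <= n)%N -> (n.+1%:R)^-1 < e.
Proof.
move=> e0; have [k] := ltr_add_invr e0; rewrite add0r => hk.
exists k => n h; apply: le_lt_trans hk.
by rewrite lef_pV2 ?posrE ?ltr0n// ler_nat ltnS.
Qed.

(* The representing vector minimises [sqn z - 2 l z] over [V]. *)
Lemma riesz (V : set H) (l : H -> R) (c : R) :
  V 0 -> (forall a x y, V x -> V y -> V (a%:C *: x + y)) ->
  (forall u z, (forall n, V (u n)) -> hlim u z -> V z) ->
  (forall a x y, l (a%:C *: x + y) = a * l x + l y) -> 0 <= c ->
  (forall x, l x ^+ 2 <= c * sqn x) ->
  exists2 z, V z & forall h, V h -> l h = rdot h z.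
Proof.
move=> V0 VD Vc lD c0 lb.
have lZ a x : l (a%:C *: x) = a * l x.
  have l0 : l 0 = 0.
    have := lb 0; rewrite sqn0 mulr0 => h0; apply/eqP; rewrite -sqrf_eq0 eq_le h0.
    exact: sqr_ge0.
  by have := lD a x 0; rewrite addr0 l0 addr0.
have VZ a x : V x -> V (a%:C *: x) by move=> Vx; rewrite -[_ *: _]addr0; exact: VD.
have VDD x y : V x -> V y -> V (x + y).
  by move=> Vx Vy; rewrite -[x](scale1r) -[1]/(1%:C); exact: VD.
have lDD x y : l (x + y) = l x + l y.
  by rewrite -[x in LHS](scale1r) -[1]/(1%:C) lD mul1r.
pose J z := sqn z - 2 * l z.
have Jlow z : - c <= J z.
  rewrite /J; have hb := lb z; have s0 := sqn_ge0 z.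
  have [//|hl] := leP (- c) (sqn z - 2 * l z).
  have : (sqn z + c) ^+ 2 < (2 * l z) ^+ 2.
    by rewrite ltrXn2r// ?nnegrE; lra.
  have := sqr_ge0 (c - sqn z); lra.
pose S := [set J z | z in V].
have Si : has_inf S.
  split; first by exists (J 0); exists 0.
  by exists (- c) => _ [z _ <-].
set d := inf S.
have dle z : V z -> d <= J z by move=> Vz; apply: ge_inf; [case: Si|exists z].
have ex n : exists z, V z /\ J z <= d + (n.+1%:R)^-1.
  have n0 : 0 < (n.+1%:R : R)^-1 by rewrite invr_gt0.
  have [_ [z Vz <-] hz] := inf_adherent n0 Si.
  by exists z; split => //; exact: ltW.
have [u hu] := choice ex.
(* The parallelogram law at the midpoint, which lies in V, shows that a minimising sequence is
   Cauchy. *)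
have para m n : sqn (u m - u n) <= 2 * ((m.+1%:R)^-1 + (n.+1%:R)^-1).
  have Vm : V ((2^-1)%:C *: (u m + u n)).
    by apply: VZ; apply: VDD; [case: (hu m)|case: (hu n)].
  have := dle _ Vm; rewrite /J sqnB sqnZ lZ lDD sqnD.
  have [_] := hu m; have [_] := hu n; rewrite /J.
  move: (m.+1%:R^-1) (n.+1%:R^-1) => p q; clearbody d => h1 h2 h3; lra.
have [z hz] : exists z, hlim u z.
  apply: cauchy_hlim => e e0.
  have e4 : 0 < e / 4 by lra.
  have [n0 mono] := inv_small e4.
  exists n0 => m n /mono hm /mono hn; have := para m n; move: (m.+1%:R^-1) (n.+1%:R^-1) hm hn => p q; lra.
have Vz : V z by apply: Vc hz => n; case: (hu n).
exists z => // h Vh.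
(* First variation at the minimum: this quadratic in t is nonnegative, so its linear coefficient
   vanishes. *)
have key t : 0 <= t ^+ 2 * sqn h + 2 * t * (rdot h z - l h).
  have lin n : d <= J (u n + t%:C *: h).
    by apply: dle; rewrite addrC; apply: VD => //; case: (hu n).
  have : forall n, rdot (u n) (- (2 * t)%:C *: h) <= t ^+ 2 * sqn h - 2 * t * l h + (n.+1%:R)^-1.
    move=> n; have := lin n; have [_] := hu n; rewrite /J sqnD lDD lZ sqnZ rdotZr.
    rewrite -rmorphN rdotZr; move: (n.+1%:R^-1) => p; clearbody d; lra.
  move=> hn.
  suff : rdot z (- (2 * t)%:C *: h) <= t ^+ 2 * sqn h - 2 * t * l h.
    by rewrite -rmorphN rdotZr rdotC; lra.
  apply/ler_addgt0Pl => e e0.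
  have [n1 hn1] := inv_small e0.
  have hz' : hlim (fun n => u (n1 + n)%N) z.
    move=> e' e'0; have [n0 hh] := hz _ e'0; exists n0 => n hn'.
    by apply: hh; rewrite (leq_trans hn')// leq_addl.
  apply: (hlim_rdot hz') => n; apply: le_trans (hn _) _.
  by rewrite addrC lerD2r; apply/ltW/hn1; exact: leq_addr.
have s0 := sqn_ge0 h.
set w := rdot h z - l h in key.
suff : w = 0 by rewrite /w; lra.
apply/eqP; rewrite -sqrf_eq0; apply/eqP.
have p : 0 < sqn h + 1 by lra.
(* Up to the shift by 1, which keeps the denominator positive, this is the minimum of the quadratic
   in t. *)
have := key (- w / (sqn h + 1)).
have -> : (- w / (sqn h + 1)) ^+ 2 * sqn h + 2 * (- w / (sqn h + 1)) * w =
  - (w ^+ 2 * (sqn h + 2) / (sqn h + 1) ^+ 2).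
  by field; rewrite gt_eqF.
rewrite oppr_ge0 pmulr_lle0 ?invr_gt0 ?exprn_gt0// => hh.
apply/eqP; rewrite eq_le sqr_ge0 andbT.
by rewrite pmulr_lle0 in hh; lra.
Qed.

End HilbertReal.
#[global] Hint Extern 0 (is_true (0 <= sqn _)) => exact: sqn_ge0 : core.

(** * Bounded operators *)

Section Operators.
Variables (R : realType) (H : hilbertType R).
Local Notation B := (bop H).
Implicit Types (x y z : H) (a c e : R) (S T : B).

Lemma bop_oppE T x : (- T) x = - T x. Proof. by []. Qed.
Lemma bop_subE S T x : (S - T) x = S x - T x. Proof. by []. Qed.
Lemma bop_zeroE x : (0 : B) x = 0. Proof. by []. Qed.
Lemma bopD T x y : T (x + y) = T x + T y. Proof. exact: linearD. Qed.
Lemma bopN T x : T (- x) = - T x. Proof. exact: linearN. Qed.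
Lemma bopB T x y : T (x - y) = T x - T y. Proof. exact: linearB. Qed.
Lemma bopZ T (k : R[i]) x : T (k *: x) = k *: T x. Proof. exact: linearZ. Qed.
Lemma bop0 T : T 0 = 0. Proof. exact: linear0. Qed.
Definition bopE := (bop_addE, bop_scaleE, bop_mulE, bop_oneE, bop_subE, bop_oppE, bop_zeroE).

Lemma bop_scaleAl (k : R[i]) S T : (k *: S) * T = k *: (S * T).
Proof. by apply: bopP => x. Qed.

Lemma bop_scaleAr (k : R[i]) S T : S * (k *: T) = k *: (S * T).
Proof. by apply: bopP => x; rewrite !bopE bopZ. Qed.

Lemma sqn_opnorm T x : sqn (T x) <= opnorm T ^+ 2 * sqn x.
Proof.
have := opnormP T x; rewrite !norm_sqrt -rmorphM lecR => h.
rewrite -[sqn (T x)](sqr_sqrtr (sqn_ge0 _)) -[sqn x](sqr_sqrtr (sqn_ge0 _)).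
by rewrite -exprMn ler_pXn2r// nnegrE ?mulr_ge0 ?sqrtr_ge0 ?opnorm_ge0.
Qed.

Lemma opnorm_le_sqn T c : 0 <= c -> (forall x, sqn (T x) <= c ^+ 2 * sqn x) ->
  opnorm T <= c.
Proof.
move=> c0 h; apply: opnorm_le => x; rewrite -[1]/(1%:C) !norm_le_sqn// expr1n => x1. apply: le_trans (h x) _.
by rewrite ler_piMr// sqr_ge0.
Qed.

Lemma sqn_opnorm_le T c x : opnorm T <= c -> sqn (T x) <= c ^+ 2 * sqn x.
Proof.
move=> h; apply: le_trans (sqn_opnorm _ _) _; rewrite ler_wpM2r//.
by rewrite ler_pXn2r// nnegrE ?opnorm_ge0// (le_trans (opnorm_ge0 T) h).
Qed.

Lemma opnormD S T : opnorm (S + T) <= opnorm S + opnorm T.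
Proof. by have := ler_normD S T; rewrite !bop_normE -rmorphD lecR. Qed.

Lemma opnormN T : opnorm (- T) = opnorm T.
Proof. by apply: complexI; rewrite -!bop_normE normrN. Qed.

Lemma opnormB S T : opnorm (S - T) <= opnorm S + opnorm T.
Proof. by rewrite -(opnormN T) opnormD. Qed.

Lemma opnormBC S T : opnorm (S - T) = opnorm (T - S).
Proof. by rewrite -opnormN opprB. Qed.

Lemma opnorm0 : opnorm (0 : B) = 0.
Proof. by apply: complexI; rewrite -!bop_normE normr0. Qed.

Lemma opnorm_eq0 T : opnorm T = 0 -> T = 0.
Proof. by move=> h; apply: normr0_eq0; rewrite bop_normE h. Qed.

Lemma opnormZ c T : opnorm (c%:C *: T) = `|c| * opnorm T.
Proof.
by apply: complexI; rewrite rmorphM /= -!bop_normE normrZ normc_def /= expr0n addr0 sqrtr_sqr.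
Qed.

Lemma opnormM S T : opnorm (S * T) <= opnorm S * opnorm T.
Proof.
apply: opnorm_le_sqn => [|x]; first by rewrite mulr_ge0 ?opnorm_ge0.
rewrite bop_mulE; apply: le_trans (sqn_opnorm _ _) _; rewrite exprMn -(mulrA (opnorm S ^+ 2)).
by apply: ler_wpM2l; [exact: sqr_ge0|exact: sqn_opnorm].
Qed.

Lemma opnorm1 : opnorm (1 : B) <= 1.
Proof. by apply: opnorm_le_sqn => // x; rewrite expr1n mul1r. Qed.

Lemma opnormM_le S T a c : opnorm S <= a -> opnorm T <= c -> opnorm (S * T) <= a * c.
Proof.
by move=> h1 h2; apply: le_trans (opnormM _ _) _; rewrite ler_pM ?opnorm_ge0.
Qed.

Lemma bop_mk (f : H -> H) c : linear f -> 0 <= c -> (forall x, sqn (f x) <= c * sqn x) ->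
  exists T : B, forall x, T x = f x.
Proof.
move=> fl c0 fb.
pose fL : {linear H -> H} := HB.pack f (GRing.isLinear.Build R[i] H H *:%R f fl).
have fc : continuous f.
  apply: (linear_bounded_continuous fL).1; apply/linear_boundedP.
  exists (Num.sqrt c)%:C; split; first by rewrite realE lecR sqrtr_ge0.
  move=> r hr x; have r0 : 0 < r by apply: le_lt_trans hr; rewrite lecR sqrtr_ge0.
  have [er r1] := posC r0; rewrite er in hr *; rewrite !norm_sqrt -rmorphM lecR.
  apply: (@le_trans _ _ (Num.sqrt c * Num.sqrt (sqn x))).
    by rewrite -sqrtrM// ler_wsqrtr// fb.
  by rewrite ler_wpM2r ?sqrtr_ge0//; move: hr; rewrite ltcR => /ltW.
have fb' : f \in @bounded_op R H by apply/bounded_opP.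
by exists (Bop fb').
Qed.

Lemma bop_real_linear T a x y : T (a%:C *: x + y) = a%:C *: T x + T y.
Proof. exact: bop_linear. Qed.

Lemma rdot_ext S T : (forall x y, rdot (S x) y = rdot (T x) y) -> S = T.
Proof.
move=> h; apply: bopP => x; apply/eqP; rewrite -subr_eq0; apply/eqP.
by apply: rdot_eq0 => y; rewrite rdotBl h subrr.
Qed.

Lemma rdot_hdot S T : (forall x y, rdot (T x) y = rdot x (S y)) ->
  forall x y, hdot (T x) y = hdot x (S y).
Proof.
move=> h x y; rewrite !hdotE; congr (_ +i* _); first exact: h.
by rewrite h bopZ.
Qed.

(** Riesz for x |-> <T x, y>, with y fixed. Uniqueness of the representing vector makes its choice
    linear in y, and testing against the vector itself bounds it. *)
Lemma adj_exists T : exists S : B, forall x y, rdot (T x) y = rdot x (S y).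
Proof.
have ex y : exists z, forall x, rdot (T x) y = rdot x z.
  have [z _ hz] : exists2 z, [set: H] z & forall x, [set: H] x -> rdot (T x) y = rdot x z.
    apply: (@riesz _ _ setT (fun x => rdot (T x) y) (opnorm T ^+ 2 * sqn y)) => //.
    - by move=> a x1 x2; rewrite bop_real_linear rdotDl rdotZl.
    - by rewrite mulr_ge0 ?sqr_ge0.
    - move=> x; apply: le_trans (rdot_sqr_le _ _) _.
      by rewrite mulrAC ler_wpM2r// sqn_opnorm.
  by exists z => x; apply: hz.
have [s hs] := choice ex.
have uniq y z : (forall x, rdot x y = rdot x z) -> y = z.
  move=> h; apply/eqP; rewrite -subr_eq0; apply/eqP/rdot_eq0 => x.
  by rewrite rdotBl ![rdot _ x]rdotC h subrr.
have sl : linear s.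
  move=> k x y; apply: uniq => z; rewrite rdotDr.
  have ZK (w v : H) : rdot w (k *: v) = rdot (Num.conj k *: w) v.
    rewrite /rdot; have -> : hdot (Num.conj k *: w) v = Num.conj k * hdot w v by exact: linearZl_LR.
    by have -> : hdot w (k *: v) = Num.conj k * hdot w v by exact: linearZr_LR.
  by rewrite ZK -!hs bopZ rdotDr ZK.
have [S hS] : exists S : B, forall x, S x = s x.
  apply: (@bop_mk s (opnorm T ^+ 2)) => //; first exact: sqr_ge0.
  move=> y; have := hs y (s y); rewrite -/(sqn (s y)) => h.
  have := rdot_sqr_le (T (s y)) y; rewrite h => h2.
  have := sqn_opnorm T (s y) => h3; have s0 := sqn_ge0 (s y).
  have [->|s1] := eqVneq (sqn (s y)) 0; first by rewrite mulr_ge0 ?sqr_ge0.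
  have sp : 0 < sqn (s y) by rewrite lt_def s1.
  rewrite -(ler_pM2l sp) -expr2; apply: le_trans h2 _.
  by rewrite mulrA ler_wpM2r// mulrC.
by exists S => x y; rewrite hS hs.
Qed.

Lemma adj_spec T : forall x y, hdot (T x) y = hdot x (adj T y).
Proof.
rewrite /adj; case: xgetP => [S _ h //|h].
have [S hS] := adj_exists T; exfalso; apply: (h S); exact: rdot_hdot.
Qed.

Lemma adjP T x y : rdot (T x) y = rdot x (adj T y).
Proof. by rewrite /rdot adj_spec. Qed.

Lemma adjPr T x y : rdot x (T y) = rdot (adj T x) y.
Proof. by rewrite rdotC adjP rdotC. Qed.

Lemma adj_eq S T : (forall x y, rdot (T x) y = rdot x (S y)) -> adj T = S.
Proof.
move=> h; apply: rdot_ext => x y; rewrite rdotC -adjP rdotC.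
by rewrite rdotC h rdotC.
Qed.

Lemma adjK T : adj (adj T) = T.
Proof. by apply: adj_eq => x y; rewrite rdotC -adjP rdotC. Qed.

Lemma adjD S T : adj (S + T) = adj S + adj T.
Proof. by apply: adj_eq => x y; rewrite !bopE rdotDl rdotDr !adjP. Qed.

Lemma adjN T : adj (- T) = - adj T.
Proof. by apply: adj_eq => x y; rewrite !bopE rdotNl rdotNr !adjP. Qed.

Lemma adjB S T : adj (S - T) = adj S - adj T.
Proof. by rewrite adjD adjN. Qed.

Lemma adjM S T : adj (S * T) = adj T * adj S.
Proof. by apply: adj_eq => x y; rewrite !bopE !adjP. Qed.

Lemma adj1 : adj (1 : B) = 1. Proof. by apply: adj_eq. Qed.
Lemma adj0 : adj (0 : B) = 0.
Proof. by apply: adj_eq => x y; rewrite !bopE rdot0l rdot0r. Qed.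

Lemma adjZ c T : adj (c%:C *: T) = c%:C *: adj T.
Proof. by apply: adj_eq => x y; rewrite !bopE rdotZl rdotZr adjP. Qed.

Lemma rdoti x y : rdot ('i *: x) y = - rdot x ('i *: y).
Proof.
have e : hdot y x = (hdot x y)^*%C.
  by have := hermC (@hdot R H) y x; rewrite /= expr0 mul1r.
by rewrite (rdotC x) !rdotil e; case: (hdot x y) => u v /=; rewrite opprK.
Qed.

Lemma adji T : adj ('i *: T) = - ('i *: adj T).
Proof. by apply: adj_eq => x y; rewrite !bopE rdoti rdotNr adjP bopZ. Qed.

Lemma opnorm_adj T : opnorm (adj T) = opnorm T.
Proof.
have h S : opnorm (adj S) <= opnorm S.
  apply: opnorm_le_sqn => [|y]; first exact: opnorm_ge0.
  have hh := rdot_sqr_le (S (adj S y)) y.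
  rewrite adjP -/(sqn (adj S y)) in hh.
  have h3 := sqn_opnorm S (adj S y).
  have [->|s1] := eqVneq (sqn (adj S y)) 0; first by rewrite mulr_ge0 ?sqr_ge0.
  have sp : 0 < sqn (adj S y) by rewrite lt_def s1 /=.
  rewrite -(ler_pM2l sp) -expr2; apply: le_trans hh _.
  by rewrite mulrA ler_wpM2r// mulrC.
by apply/eqP; rewrite eq_le h -{1}(adjK T) h.
Qed.

Definition psd T := adj T = T /\ forall x, 0 <= rdot (T x) x.

Lemma sa_dot T x y : adj T = T -> rdot (T x) y = rdot x (T y).
Proof. by move=> h; rewrite adjP h. Qed.

Lemma quad_ext S T : adj S = S -> adj T = T ->
  (forall x, rdot (S x) x = rdot (T x) x) -> S = T.
Proof.
move=> hS hT h; apply: rdot_ext => x y.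
have := h (x + y); rewrite !bopD !rdotDl !rdotDr !h.
rewrite (sa_dot y x hS) (sa_dot y x hT) ![rdot y _]rdotC; lra.
Qed.

(** A nonnegative complex form has no imaginary part; at x + y and x + i y this polarises to
    self-adjointness. *)
Lemma positive_opE T : positive_op T <-> psd T.
Proof.
split=> [h|[hT h] x].
  have hr x : 0 <= rdot (T x) x by have := h x; rewrite lecE /= => /andP[].
  have him x : rdot (T x) ('i *: x) = 0.
    by have := h x; rewrite hdotE lecE /= => /andP[/eqP ->].
  split => //; apply: adj_eq => x y.
  have := him (x + y); rewrite scalerDr !bopD !rdotDl !rdotDr !him => h1.
  rewrite !add0r !addr0 in h1.
  have := him (x + 'i *: y).
  have ii (z : H) : 'i *: ('i *: z) = - z by rewrite scalerA -expr2 sqrCi scaleN1r.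
  rewrite scalerDr ii !bopD !rdotDl !rdotDr him bopZ rdotNr !rdotNr !rdoti ii rdotNr.
  rewrite him (rdotC x (T y)); lra.
rewrite hdotE lecE /= h andbT; apply/eqP.
have : rdot (T x) ('i *: x) = - rdot (T x) ('i *: x).
  by rewrite {1}rdotC rdoti (sa_dot x _ hT) bopZ.
lra.
Qed.

(** Polarisation: 4 <T x, y> is the difference of the quadratic form at x + y and x - y, and the
    choice y = T x / c finishes. Norm bounds of self-adjoint operators thus reduce to their
    quadratic forms. *)
Lemma sa_opnorm T c : 0 <= c -> adj T = T ->
  (forall x, `|rdot (T x) x| <= c * sqn x) -> opnorm T <= c.
Proof.
move=> c0 hT h.
have key x y : rdot (T x) y <= c * (sqn x + sqn y) / 2.
  have := h (x + y); have := h (x - y); rewrite !ler_norml => /andP[h1 _] /andP[_ h2].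
  have e4 : 4 * rdot (T x) y = rdot (T (x + y)) (x + y) - rdot (T (x - y)) (x - y).
    rewrite bopD bopB !rdotDl !rdotDr !rdotNl !rdotNr (sa_dot y x hT) (rdotC y); ring.
  rewrite sqnD in h2; rewrite sqnB in h1; lra.
apply: opnorm_le_sqn => // x.
have [c1|c1] := eqVneq c 0.
  have := key x (T x); rewrite c1 mul0r mul0r -/(sqn (T x)) expr0n mul0r.
  by [].
have cp : 0 < c by rewrite lt_def c1.
have := key x ((c^-1)%:C *: T x); rewrite rdotZr -/(sqn (T x)) sqnZ => h1.
have : c * (c^-1 * sqn (T x)) <= c * (c * (sqn x + c^-1 ^+ 2 * sqn (T x)) / 2).
  by rewrite ler_pM2l.
have -> : c * (c^-1 * sqn (T x)) = sqn (T x) by field.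
have -> : c * (c * (sqn x + c^-1 ^+ 2 * sqn (T x)) / 2) = (c ^+ 2 * sqn x + sqn (T x)) / 2.
  by field.
lra.
Qed.

Lemma rdot_opnorm T x : `|rdot (T x) x| <= opnorm T * sqn x.
Proof.
rewrite -(@ler_pXn2r _ 2)// ?nnegrE ?mulr_ge0 ?opnorm_ge0//.
rewrite real_normK ?num_real// (le_trans (rdot_sqr_le _ _))//.
by rewrite exprMn [sqn x ^+ 2]expr2 mulrA ler_wpM2r// sqn_opnorm.
Qed.

Lemma quad_disc (a b d : R) : 0 <= a -> 0 <= d ->
  (forall t, 0 <= a + 2 * t * b + t ^+ 2 * d) -> b ^+ 2 <= a * d.
Proof.
move=> a0 d0 h; have [d1|d1] := eqVneq d 0.
  have [->|b0] := eqVneq b 0; first by rewrite d1 mulr0 expr0n.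
  have := h (- (a + 1) / (2 * b)); rewrite d1 mulr0 addr0.
  have -> : 2 * (- (a + 1) / (2 * b)) * b = - (a + 1) by field.
  lra.
have dp : 0 < d by rewrite lt_def d1.
have := h (- b / d).
have -> : a + 2 * (- b / d) * b + (- b / d) ^+ 2 * d = (a * d - b ^+ 2) / d by field.
by rewrite pmulr_lge0 ?invr_gt0// subr_ge0.
Qed.

Lemma psd_cs T x y : psd T -> rdot (T x) y ^+ 2 <= rdot (T x) x * rdot (T y) y.
Proof.
move=> [hT h]; apply: quad_disc => // t.
have := h (x + t%:C *: y); rewrite bopD bopZ !rdotDl !rdotDr !rdotZl !rdotZr.
rewrite (sa_dot y x hT) (rdotC y); lra.
Qed.

Lemma psd_sqn_le T x c : psd T -> opnorm T <= c -> sqn (T x) <= c * rdot (T x) x.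
Proof.
move=> hp hc; have := psd_cs x (T x) hp; rewrite -/(sqn (T x)) => h.
have h2 : rdot (T (T x)) (T x) <= c * sqn (T x).
  apply: le_trans (ler_norm _) _; apply: le_trans (rdot_opnorm _ _) _.
  by rewrite ler_wpM2r.
have q0 := hp.2 x; have c0 := le_trans (opnorm_ge0 T) hc.
have [->|s1] := eqVneq (sqn (T x)) 0; first by rewrite mulr_ge0.
have sp : 0 < sqn (T x) by rewrite lt_def s1 /=.
rewrite -(ler_pM2l sp) -expr2; apply: le_trans h _.
rewrite mulrC; apply: le_trans (ler_wpM2r q0 h2) _.
by rewrite le_eqVlt; apply/orP; left; apply/eqP; ring.
Qed.

Lemma psd_eq0 T x : psd T -> rdot (T x) x = 0 -> T x = 0.
Proof.
move=> hT h; apply: sqn_eq0; have := psd_sqn_le x hT (lexx _); rewrite h mulr0.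
by move=> h1; apply/eqP; rewrite eq_le h1 sqn_ge0.
Qed.

Lemma proj_sqn (E : B) x : projection E -> rdot (E x) x = sqn (E x).
Proof. by move=> [h1 h2]; rewrite /sqn -{1}h1 bopE (sa_dot _ _ h2). Qed.

Lemma proj_psd (E : B) : projection E -> psd E.
Proof. by move=> h; split; [case: h|move=> x; rewrite proj_sqn]. Qed.

Lemma projC (E : B) : projection E -> projection (1 - E).
Proof.
move=> [h1 h2]; split; last by rewrite adjB adj1 h2.
by rewrite mulrBl mul1r mulrBr mulr1 h1 subrr subr0.
Qed.

Lemma proj_pyth (E : B) x : projection E -> sqn x = sqn (E x) + sqn ((1 - E) x).
Proof.
move=> hE; rewrite -!proj_sqn//; last exact: projC.
by rewrite bopE rdotBl addrC subrK.
Qed.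

Lemma proj_opnorm (E : B) : projection E -> opnorm E <= 1.
Proof.
move=> hE; apply: opnorm_le_sqn => // x; rewrite expr1n mul1r (proj_pyth x hE).
by rewrite lerDl.
Qed.

Lemma proj_id (E : B) x : projection E -> range E x -> E x = x.
Proof. by move=> [h1 _] [y _ <-]; rewrite -bop_mulE h1. Qed.

Lemma proj_unique (E F : B) : projection E -> projection F -> range E = range F -> E = F.
Proof.
move=> hE hF h.
have e1 : F * E = E.
  by apply: bopP => x; rewrite bopE; apply: proj_id => //; rewrite -h; exists x.
have e2 : E * F = F.
  by apply: bopP => x; rewrite bopE; apply: proj_id => //; rewrite h; exists x.
by have := congr1 (@adj _ _) e1; rewrite adjM hE.2 hF.2 e2 => ->.
Qed.

Definition closed_subspace (V : set H) :=
  [/\ V 0, forall (k : R[i]) x y, V x -> V y -> V (k *: x + y) &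
     forall u z, (forall n, V (u n)) -> hlim u z -> V z].

(** The projection of x is the vector of V that represents h |-> <h, x> on V; orthogonality of the
    difference to V gives linearity, idempotence and self-adjointness. *)
Lemma proj_exists (V : set H) : closed_subspace V -> exists2 E : B, projection E & range E = V.
Proof.
move=> [V0 VD Vc].
have ex x : exists z, V z /\ forall h, V h -> rdot h (x - z) = 0.
  have [z Vz hz] : exists2 z, V z & forall h, V h -> rdot h x = rdot h z.
    apply: (@riesz _ _ V (fun h => rdot h x) (sqn x)) => //.
    - by move=> a y z; exact: VD.
    - by move=> a y z; rewrite rdotDl rdotZl.
    - by move=> y; rewrite mulrC rdot_sqr_le.
  by exists z; split => // h Vh; rewrite rdotBr hz// subrr.
have [p hp] := choice ex.
have VN x y : V x -> V y -> V (y - x).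
  by move=> Vx Vy; have := VD (-1) x y Vx Vy; rewrite scaleN1r addrC.
have uniq x z : V z -> (forall h, V h -> rdot h (x - z) = 0) -> p x = z.
  move=> Vz hz; apply/eqP; rewrite -subr_eq0; apply/eqP/sqn_eq0.
  have [Vp hp'] := hp x; have Vd := VN _ _ Vz Vp.
  have -> : sqn (p x - z) = rdot (p x - z) (x - z) - rdot (p x - z) (x - p x).
    by rewrite /sqn -rdotBr; congr rdot; rewrite opprB [RHS]addrC addrA subrK.
  by rewrite hz// hp'// subrr.
have pl : linear p.
  move=> k x y; apply: uniq; first by apply: VD; [case: (hp x)|case: (hp y)].
  move=> h Vh; have [Vx hx] := hp x; have [Vy hy] := hp y.
  rewrite opprD addrACA -scalerBr rdotDr hy// addr0.
  have ZK (w v : H) : rdot w (k *: v) = rdot (Num.conj k *: w) v.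
    rewrite /rdot; have -> : hdot (Num.conj k *: w) v = Num.conj k * hdot w v by exact: linearZl_LR.
    by have -> : hdot w (k *: v) = Num.conj k * hdot w v by exact: linearZr_LR.
  by rewrite ZK hx// -[_ *: h]addr0; apply: VD.
have pyth x : sqn (p x) <= 1 * sqn x.
  have [Vp hp'] := hp x; have := hp' _ Vp; rewrite rdotBr -/(sqn (p x)) => h.
  have := sqn_ge0 (x - p x); rewrite sqnB (rdotC x); lra.
have [E hE] := bop_mk pl ler01 pyth.
have pid x : V x -> p x = x.
  by move=> Vx; apply: uniq => // h _; rewrite subrr rdot0r.
exists E.
  split.
    by apply: bopP => x; rewrite bopE !hE pid//; case: (hp x).
  apply: adj_eq => x y; rewrite !hE; have [Vx hx] := hp x; have [Vy hy] := hp y.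
  have := hx _ Vy; have := hy _ Vx; rewrite !rdotBr (rdotC (p y)) (rdotC (p y) (p x)); lra.
apply/seteqP; split => x; first by move=> [y _ <-]; rewrite hE; case: (hp y).
by move=> Vx; exists x => //; rewrite hE pid.
Qed.

Lemma proj_ontoE (V : set H) (E : B) : projection E -> range E = V -> proj_onto V = E.
Proof.
move=> hE hV; rewrite /proj_onto; case: xgetP => [F _ [hF h]|h]; last by case: (h E).
by apply: proj_unique => //; rewrite h hV.
Qed.

Lemma bop_hlim T (u : nat -> H) l : hlim u l -> hlim (fun n => T (u n)) (T l).
Proof.
move=> h e e0; have p : 0 < opnorm T ^+ 2 + 1 by have := sqr_ge0 (opnorm T); lra.
have [n0 hn] := h _ (divr_gt0 e0 p); exists n0 => n /hn; rewrite ler_pdivlMr// => h1.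
rewrite -bopB; apply: le_trans (sqn_opnorm _ _) _; apply: le_trans h1.
by rewrite mulrC ler_wpM2l// lerDl.
Qed.

Lemma ker_closed_subspace T : closed_subspace (ker_op T).
Proof.
split.
- by rewrite /ker_op /= bop0.
- by move=> k x y; rewrite /ker_op /= bopD bopZ => -> ->; rewrite scaler0 addr0.
- move=> u z hu /(bop_hlim T) h; rewrite /ker_op /=.
  apply: (hlim_unique h) => e e0; exists 0%N => n _.
  by rewrite (hu n) subr0 sqn0 ltW.
Qed.

End Operators.

(** * Bernstein polynomials *)

Section Modulus.
Variable R : realType.
Implicit Types (f g : R -> R) (x y e c : R).

Definition unit01 x := 0 <= x <= 1.

Lemma cont_bounded f : continuous f -> exists2 M, 0 < M & forall x, unit01 x -> `|f x| <= M.
Proof.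
move=> fc; have [c c01 hc] : exists2 c, c \in `[0, 1] & forall t, t \in `[0, 1] -> `|f t| <= `|f c|.
  apply: (@EVT_max _ (fun x => `|f x|)) => //.
  by apply: continuous_subspaceT => x; apply: continuous_comp; [exact: fc|exact: norm_continuous].
exists (`|f c| + 1) => [|x hx]; first by rewrite ltr_wpDl.
by rewrite (le_trans (hc x _))// lerDl.
Qed.

(** A Lebesgue number argument. Only x is confined to the unit interval; y may leave it. *)
Lemma cont_uniform f e : continuous f -> 0 < e ->
  exists2 d, 0 < d & forall x y, unit01 x -> `|x - y| <= d -> `|f x - f y| <= e.
Proof.
move=> fc e0.
have K : compact `[0, 1 : R]%classic by exact: segment_compact.
move/compact_near_coveringP : K => /(_ R (0 : R)^'+ (fun d x => forall y, `|x - y| <= d -> `|f x - f y| <= e)).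
have h x : `[0, 1]%classic x -> \forall x' \near x & d \near (0 : R)^'+,
    forall y, `|x' - y| <= d -> `|f x' - f y| <= e.
  move=> _; have e2 : 0 < e / 2 by lra.
  have [r /= r0 hr] : \forall z \near x, `|f x - f z| <= e / 2.
    by have /cvgrPdist_le := fc x; apply.
  exists ([set z | `|x - z| < r / 2], [set d | d < r / 2]); first split => /=.
  - by exists (r / 2) => //=; lra.
  - by apply: nbhs_right_lt; lra.
  move=> [x' d] /= [h1 h2] y h3.
  have a1 : `|f x - f x'| <= e / 2 by apply: hr => /=; lra.
  have a2 : `|f x - f y| <= e / 2.
    apply: hr => /=; have := ler_distD x' x y; lra.
  have := ler_distD (f x) (f x') (f y); rewrite (distrC (f x') (f x)); lra.
move=> /(_ _ h) hh.
have [d d0 hd] : exists2 d, 0 < d & `[0, 1]%classic `<=` (fun x => forall y, `|x - y| <= d -> `|f x - f y| <= e).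
  near (0 : R)^'+ => d; exists d => //; near: d; exact: hh.
by exists d => // x y hx; apply: hd; rewrite /= in_itv.
Unshelve. all: by end_near. Qed.

Definition modl f e c := forall x y, unit01 x -> unit01 y -> `|f x - f y| <= e + c * (x - y) ^+ 2.

(** Close pairs are handled by uniform continuity, distant ones by the bound 2 M <= 2 M (x - y)^2 /
    d^2. A quadratic error is what the variance of the Bernstein weights can control. *)
Lemma cont_modl f e : continuous f -> 0 < e -> exists2 c, 0 <= c & modl f e c.
Proof.
move=> fc e0; have [M M0 hM] := cont_bounded fc; have [d d0 hd] := cont_uniform fc e0.
exists (2 * M / d ^+ 2) => [|x y hx hy]; first by rewrite divr_ge0 ?sqr_ge0//; lra.
have [h|h] := leP (`|x - y|) d.
  apply: le_trans (hd _ _ hx h) _; rewrite lerDl mulr_ge0 ?sqr_ge0//.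
  by rewrite divr_ge0 ?sqr_ge0//; lra.
have h1 : `|f x - f y| <= 2 * M.
  by have := ler_normB (f x) (f y); have := hM _ hx; have := hM _ hy; lra.
have h2 : d ^+ 2 <= (x - y) ^+ 2.
  by rewrite -[X in _ <= X]real_normK ?num_real// ler_pXn2r ?nnegrE ?(ltW d0)// ltW.
apply: le_trans h1 _; apply: (@le_trans _ _ (2 * M / d ^+ 2 * (x - y) ^+ 2)); last by rewrite lerDr ltW.
rewrite mulrAC ler_pdivlMr ?exprn_gt0// ler_wpM2l//; lra.
Qed.
End Modulus.

Section Bernstein.
Variable R : realType.
Local Notation P := {poly R}.
Implicit Types (n k l : nat) (p q : P).

Definition bern n k : P := ('X ^+ k * (1 - 'X) ^+ (n - k)) *+ 'C(n, k).

Lemma bern_sum n : \sum_(k < n.+1) bern n k = 1.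
Proof.
have := exprDn (1 - 'X : P) 'X n; rewrite subrK expr1n => ->.
by apply: eq_bigr => k _; rewrite /bern mulrC.
Qed.

Lemma bern_sum1 n : \sum_(k < n.+1) bern n k *+ k = 'X *+ n.
Proof.
case: n => [|n]; first by rewrite big_ord1 !mulr0n.
rewrite big_ord_recl mulr0n add0r.
transitivity (\sum_(i < n.+1) 'X * bern n i *+ n.+1); last first.
  by rewrite sumrMnl -mulr_sumr bern_sum mulr1.
apply: eq_bigr => k _; rewrite lift0 /bern subSS mulrnAr -!mulrnA mulrA -exprS.
by congr (_ *+ _); rewrite mulnC -mul_bin_diag mulnC.
Qed.

Lemma bern_sum2 n : \sum_(k < n.+1) bern n k *+ (k * k.-1) = 'X ^+ 2 *+ (n * n.-1).
Proof.
case: n => [|n]; first by rewrite big_ord1 !mulr0n.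
rewrite big_ord_recl mulr0n add0r.
transitivity (\sum_(i < n.+1) 'X * (bern n i *+ i) *+ n.+1); last first.
  by rewrite sumrMnl -mulr_sumr bern_sum1 mulrnAr -mulrnA -expr2 mulnC.
apply: eq_bigr => k _; rewrite lift0 /bern subSS -!mulrnA mulrnAr -mulrnA mulrA -exprS.
congr (_ *+ _); have := mul_bin_diag n.+1 k; rewrite /= => h; rewrite mulnA (mulnC _ k.+1) -h.
by rewrite -mulnA mulnC.
Qed.

(** The variance of the binomial law, as an identity of polynomials and not of functions, because it
    will be evaluated at operators. *)
Lemma bern_var n :
  \sum_(k < n.+2) ((k%:R / n.+1%:R)%:P - 'X) ^+ 2 * bern n.+1 k = n.+1%:R^-1 *: ('X * (1 - 'X)).
Proof.
have n0 : (n.+1%:R : R) != 0 by rewrite pnatr_eq0.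
apply: (@scalerI _ _ (n.+1%:R ^+ 2)); first by rewrite expf_neq0.
rewrite scalerA expr2 mulfK// -expr2.
transitivity (\sum_(k < n.+2) (bern n.+1 k *+ (k * k.-1) + bern n.+1 k *+ k
   - ('X *+ (2 * n.+1)%N) * (bern n.+1 k *+ k) + ('X ^+ 2 *+ (n.+1 * n.+1)) * bern n.+1 k)).
  rewrite scaler_sumr; apply: eq_bigr => k _.
  rewrite -mul_polyC polyCM.
  set a := n.+1%:R; have e : (a ^-1)%:P * a%:P = 1 by rewrite -polyCM mulVf.
  set b := bern _ _.
  have -> : (k%:R / a)%:P = (k%:R : P) * (a^-1)%:P by rewrite polyCM polyC_natr.
  have ea : a%:P = (n.+1%:R : P) by rewrite /a polyC_natr.
  have ek : (k * k.-1)%:R = (k%:R ^+ 2 - k%:R : P).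
    by case: (k : nat) => [|m]; [rewrite expr0n subr0|rewrite /= -natrX -natrB ?leq_pmulr//; congr (_%:R); nia].
  rewrite -[b *+ (k * _)]mulr_natr -[b *+ k]mulr_natr -['X *+ _]mulr_natr -[_ ^+ 2 *+ _]mulr_natr ek !natrM -ea.
  have -> : a%:P * a%:P * ((k%:R * (a^-1)%:P - 'X) ^+ 2 * b) = (k%:R * ((a^-1)%:P * a%:P) - a%:P * 'X) ^+ 2 * b by ring.
  rewrite e; ring.
rewrite !big_split /= sumrN -!big_distrr /= bern_sum bern_sum1 bern_sum2 -mul_polyC polyC_natr.
rewrite -(mulr_natr ('X ^+ 2) (n.+1 * n.+1.-1)) -(mulr_natr 'X n.+1) -(mulr_natr 'X (2 * n.+1)).
rewrite -(mulr_natr ('X ^+ 2) (n.+1 * n.+1)) !natrM /= -[n.+1%:R]natr1; ring.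
Qed.

(** Certificates of positivity on [0, 1] that survive the substitution of an operator 0 <= A <= 1.
    Pointwise nonnegativity of a polynomial would not do at this stage, as no functional calculus is
    available yet. *)
Inductive ppos : P -> Prop :=
| ppos_gen c (s : P) a b : 0 <= c -> ppos (c *: (s ^+ 2 * ('X ^+ a * (1 - 'X) ^+ b)))
| ppos_add p q : ppos p -> ppos q -> ppos (p + q).

Lemma ppos0 : ppos 0.
Proof. by rewrite -(scale0r (1 ^+ 2 * ('X ^+ 0 * (1 - 'X) ^+ 0))); exact: ppos_gen. Qed.

Lemma pposM p q : ppos p -> ppos q -> ppos (p * q).
Proof.
move=> hp; elim: hp q => [c s a b c0|p1 p2 _ h1 _ h2] q hq; last by rewrite mulrDl; apply: ppos_add; auto.
elim: hq => [c' s' a' b' c'0|q1 q2 _ h1 _ h2]; last by rewrite mulrDr; apply: ppos_add.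
rewrite -scalerAl -scalerAr scalerA.
have -> : s ^+ 2 * ('X ^+ a * (1 - 'X) ^+ b) * (s' ^+ 2 * ('X ^+ a' * (1 - 'X) ^+ b')) =
  (s * s') ^+ 2 * ('X ^+ (a + a') * (1 - 'X) ^+ (b + b')).
  by rewrite !exprD; ring.
by apply: ppos_gen; rewrite mulr_ge0.
Qed.

Lemma ppos_sum (I : Type) (r : seq I) (F : I -> P) : (forall i, ppos (F i)) -> ppos (\sum_(i <- r) F i).
Proof. by move=> h; elim/big_ind : _ => //; [exact: ppos0|exact: ppos_add]. Qed.

Lemma pposC c : 0 <= c -> ppos c%:P.
Proof. by move=> /(ppos_gen 1 0 0); rewrite expr1n !mul1r !expr0 -mul_polyC mulr1. Qed.

Lemma ppos_sqr p : ppos (p ^+ 2).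
Proof. by have := ppos_gen p 0 0 (ler01 : 0 <= 1 :> R); rewrite scale1r !expr0 !mulr1. Qed.

Lemma ppos_bern n k : ppos (bern n k).
Proof.
have := ppos_gen 1 k (n - k) (ler0n R 'C(n, k)).
by rewrite expr1n mul1r scaler_nat.
Qed.

Definition Bpol (f : R -> R) n : P := \sum_(k < n.+2) f (k%:R / n.+1%:R) *: bern n.+1 k.

Lemma nat_frac n (k : 'I_n.+2) : unit01 (k%:R / n.+1%:R : R).
Proof.
rewrite /unit01 divr_ge0//= ler_pdivrMr ?ltr0n// mul1r ler_nat.
by have := ltn_ord k.
Qed.

(* [h] need only be controlled by the squared distance of its arguments, because
   [(s - t)^2 <= 2 (s - X)^2 + 2 (t - X)^2] and the Bernstein variance is [X (1 - X) / n]. *)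
Lemma bern2_ppos n m (h : R -> R -> R) e c : 0 <= c ->
  (forall x y, unit01 x -> unit01 y -> - (e + c * (x - y) ^+ 2) <= h x y) ->
  ppos ((e + 2 * c * (n.+1%:R^-1 + m.+1%:R^-1))%:P +
   \sum_(k < n.+2) \sum_(l < m.+2) h (k%:R / n.+1%:R) (l%:R / m.+1%:R) *: (bern n.+1 k * bern m.+1 l)).
Proof.
move=> c0 hh.
have Bn := bern_sum n.+1; have Bm := bern_sum m.+1.
have Vn := bern_var n; have Vm := bern_var m.
pose xk (k : 'I_n.+2) := k%:R / n.+1%:R : R; pose yl (l : 'I_m.+2) := l%:R / m.+1%:R : R.
pose b k l := bern n.+1 k * bern m.+1 l.
have S1 : \sum_(k < n.+2) \sum_(l < m.+2) b k l = 1.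
  under eq_bigr => k _ do rewrite -big_distrr /= Bm mulr1.
  exact: Bn.
have S2 : \sum_(k < n.+2) \sum_(l < m.+2) ((xk k)%:P - 'X) ^+ 2 * b k l = n.+1%:R^-1 *: ('X * (1 - 'X)).
  under eq_bigr => k _ do (under eq_bigr => l _ do rewrite /b mulrA; rewrite -big_distrr /= Bm mulr1).
  exact: Vn.
have S3 : \sum_(k < n.+2) \sum_(l < m.+2) ((yl l)%:P - 'X) ^+ 2 * b k l = m.+1%:R^-1 *: ('X * (1 - 'X)).
  under eq_bigr => k _ do (under eq_bigr => l _ do rewrite /b mulrCA; rewrite -big_distrr /= Vm).
  by rewrite -big_distrl /= Bn mul1r.
(* Write 1 as (1 - X + X^2) + X (1 - X). The second summand, times the rate, is what the two
   variances supply, and 2 (x - X)^2 + 2 (y - X)^2 = (x - y)^2 + (x + y - 2 X)^2 turns them into the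
   error term plus a square. *)
have -> : (e + 2 * c * (n.+1%:R^-1 + m.+1%:R^-1))%:P +
   \sum_(k < n.+2) \sum_(l < m.+2) h (xk k) (yl l) *: b k l =
   (2 * c * (n.+1%:R^-1 + m.+1%:R^-1))%:P * ((1 - 'X) + 'X ^+ 2) +
   \sum_(k < n.+2) \sum_(l < m.+2) (((e + c * (xk k - yl l) ^+ 2 + h (xk k) (yl l))%:P +
      c%:P * ((xk k)%:P + (yl l)%:P - 'X *+ 2) ^+ 2) * b k l).
  transitivity ((2 * c * (n.+1%:R^-1 + m.+1%:R^-1))%:P * ((1 - 'X) + 'X ^+ 2) +
    \sum_(k < n.+2) \sum_(l < m.+2) (e%:P * b k l + (2 * c)%:P * (((xk k)%:P - 'X) ^+ 2 * b k l)
      + (2 * c)%:P * (((yl l)%:P - 'X) ^+ 2 * b k l) + h (xk k) (yl l) *: b k l)); last first.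
    congr (_ + _); apply: eq_bigr => k _; apply: eq_bigr => l _.
    have key (e' c' x' y' h' b' X : P) : e' * b' + (2 * c') * ((x' - X) ^+ 2 * b') +
        (2 * c') * ((y' - X) ^+ 2 * b') + h' * b' =
        ((e' + c' * ((x' - y') * (x' - y')) + h') + c' * (x' + y' - X *+ 2) ^+ 2) * b' by ring.
    have e2 : (2 * c)%:P = 2 * c%:P :> P by rewrite polyCM polyC_natr.
    have e3 : ((xk k - yl l) ^+ 2)%:P = ((xk k)%:P - (yl l)%:P) * ((xk k)%:P - (yl l)%:P) :> P.
      by rewrite expr2 polyCM polyCB.
    have e4 : (e + c * (xk k - yl l) ^+ 2 + h (xk k) (yl l))%:P =
       e%:P + c%:P * ((xk k - yl l) ^+ 2)%:P + (h (xk k) (yl l))%:P :> P.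
      by rewrite polyCD [(e + _)%:P]polyCD [(c * _)%:P]polyCM.
    by rewrite -mul_polyC e2 key e4 e3.
  have Vn' : \sum_(k < n.+2) ((xk k)%:P - 'X) ^+ 2 * bern n.+1 k = n.+1%:R^-1 *: ('X * (1 - 'X)) := Vn.
  under [in RHS]eq_bigr => k _ do rewrite !big_split /= -!big_distrr /= Bm !mulr1.
  rewrite !big_split /= -!big_distrr /= Bn Vn' S3 -!mul_polyC.
  have key (e' c' x' y' X s : P) : e' + c' * (x' + y') + s =
     c' * (x' + y') * (1 - X + X ^+ 2) + (e' * 1 + c' * (x' * (X * (1 - X))) + c' * (y' * (X * (1 - X))) + s) by ring.
  by rewrite polyCD [in LHS]polyCM [in RHS]polyCM polyCD -key.
apply: ppos_add.
  apply: pposM; first by apply: pposC; rewrite !mulr_ge0 ?addr_ge0 ?invr_ge0.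
  apply: ppos_add; last exact: ppos_sqr.
  by have := ppos_gen 1 0 1 (ler01 : 0 <= 1 :> R); rewrite scale1r expr1n mul1r expr0 mul1r expr1.
apply: ppos_sum => k; apply: ppos_sum => l; apply: pposM; last by apply: pposM; exact: ppos_bern.
apply: ppos_add; last by apply: pposM; [exact: pposC|exact: ppos_sqr].
apply: pposC; have := hh _ _ (nat_frac k) (nat_frac l); rewrite -/(xk k) -/(yl l); lra.
Qed.

(** Over the product weights, which sum to 1, the difference takes the shape treated by
    [bern2_ppos], even for different degrees. *)
Lemma Bpol_dist f g n m : Bpol f n - Bpol g m =
  \sum_(k < n.+2) \sum_(l < m.+2) (f (k%:R / n.+1%:R) - g (l%:R / m.+1%:R)) *: (bern n.+1 k * bern m.+1 l).
Proof.
under eq_bigr => k _ do (under eq_bigr => l _ do rewrite scalerBl; rewrite sumrB).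
rewrite sumrB; congr (_ - _).
  apply: eq_bigr => k _.
  by rewrite -scaler_sumr -mulr_sumr bern_sum mulr1.
rewrite [RHS]exchange_big /=; apply: eq_bigr => l _.
rewrite -scaler_sumr; congr (_ *: _).
by rewrite -big_distrl /= bern_sum mul1r.
Qed.

(** The defect of multiplicativity is a double sum as well, with a kernel that vanishes on the
    diagonal. *)
Lemma Bpol_mul f g n : Bpol f n * Bpol g n - Bpol (fun x => f x * g x) n =
  \sum_(k < n.+2) \sum_(l < n.+2) (f (k%:R / n.+1%:R) * (g (l%:R / n.+1%:R) - g (k%:R / n.+1%:R)))
     *: (bern n.+1 k * bern n.+1 l).
Proof.
under [RHS]eq_bigr => k _ do (under eq_bigr => l _ do rewrite mulrBr scalerBl; rewrite sumrB).
rewrite sumrB; congr (_ - _).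
  rewrite /Bpol big_distrl /=; apply: eq_bigr => k _; rewrite big_distrr /=.
  by apply: eq_bigr => l _; rewrite -scalerAl -scalerAr scalerA.
apply: eq_bigr => k _; rewrite -scaler_sumr; congr (_ *: _).
by rewrite -big_distrr /= bern_sum mulr1.
Qed.

Lemma Bpol_pos f n : (forall x, unit01 x -> 0 <= f x) -> ppos (Bpol f n).
Proof.
move=> h; apply: ppos_sum => k; rewrite -mul_polyC; apply: pposM; last exact: ppos_bern.
by apply: pposC; apply: h; exact: nat_frac.
Qed.

Lemma BpolD a f g n : Bpol (fun x => a * f x + g x) n = a *: Bpol f n + Bpol g n.
Proof.
rewrite /Bpol scaler_sumr -big_split; apply: eq_bigr => k _ /=.
by rewrite scalerDl scalerA.
Qed.

Lemma Bpol_cst a n : Bpol (fun=> a) n = a%:P.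
Proof. by rewrite /Bpol -scaler_sumr bern_sum -mul_polyC mulr1. Qed.

Lemma Bpol_id n : Bpol id n = 'X.
Proof.
rewrite /Bpol; have n0 : (n.+1%:R : R) != 0 by rewrite pnatr_eq0.
apply: (@scalerI _ _ n.+1%:R) => //; rewrite scaler_sumr -[RHS]/(n.+1%:R *: 'X).
rewrite scaler_nat -(bern_sum1 n.+1); apply: eq_bigr => k _.
by rewrite scalerA mulrC divfK// scaler_nat.
Qed.

End Bernstein.

(** * Continuous functional calculus *)

Section Calculus.
Variables (R : realType) (H : hilbertType R).
Local Notation B := (bop H).
Implicit Types (a c e : R) (S T A W : B) (p q : {poly R}) (f g : R -> R).

Definition peval p A : B := \sum_(i < size p) (p`_i)%:C *: A ^+ i.

Lemma peval_wide p A n : (size p <= n)%N -> peval p A = \sum_(i < n) (p`_i)%:C *: A ^+ i.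
Proof.
move=> h; rewrite /peval (big_ord_widen n (fun i => (p`_i)%:C *: A ^+ i) h).
rewrite big_mkcond /=; apply: eq_bigr => i _.
by case: ltnP => // hi; rewrite nth_default// scale0r.
Qed.

Lemma pevalD p q A : peval (p + q) A = peval p A + peval q A.
Proof.
pose n := maxn (size p) (size q).
rewrite (@peval_wide (p + q) A n) ?size_polyD// (@peval_wide p A n) ?leq_maxl//.
rewrite (@peval_wide q A n) ?leq_maxr// -big_split /=; apply: eq_bigr => i _.
by rewrite coefD rmorphD scalerDl.
Qed.

Lemma pevalZ a p A : peval (a *: p) A = a%:C *: peval p A.
Proof.
rewrite (@peval_wide (a *: p) A (size p)) ?size_scale_leq// /peval scaler_sumr.
by apply: eq_bigr => i _; rewrite coefZ rmorphM scalerA.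
Qed.

Lemma pevalN p A : peval (- p) A = - peval p A.
Proof. by rewrite -scaleN1r pevalZ rmorphN scaleN1r. Qed.

Lemma pevalB p q A : peval (p - q) A = peval p A - peval q A.
Proof. by rewrite pevalD pevalN. Qed.

Lemma pevalC a A : peval a%:P A = a%:C *: (1 : B).
Proof.
by rewrite (@peval_wide _ _ 1) ?size_polyC ?leq_b1// big_ord1 coefC /= expr0.
Qed.

Lemma peval1 A : peval 1 A = 1. Proof. by rewrite pevalC scale1r. Qed.
Lemma peval0 A : peval 0 A = 0. Proof. by rewrite pevalC scale0r. Qed.

Lemma pevalMX p A : peval (p * 'X) A = peval p A * A.
Proof.
rewrite (@peval_wide (p * 'X) A (size p).+1); last first.
  by rewrite (leq_trans (size_polyMleq _ _))// size_polyX addn2.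
rewrite big_ord_recl coefMX eqxx scale0r add0r /peval mulr_suml.
by apply: eq_bigr => i _; rewrite lift0 coefMX /= exprSr bop_scaleAl.
Qed.

Lemma peval_comm p A W : W * A = A * W -> W * peval p A = peval p A * W.
Proof.
move=> h; elim/poly_ind: p => [|p a hp]; first by rewrite peval0 mulr0 mul0r.
rewrite pevalD pevalMX pevalC mulrDr mulrDl mulrA hp -!mulrA h.
by rewrite bop_scaleAl bop_scaleAr mulr1 mul1r.
Qed.

Lemma pevalM p q A : peval (p * q) A = peval p A * peval q A.
Proof.
elim/poly_ind: p => [|p a hp]; first by rewrite mul0r peval0 mul0r.
rewrite mulrDl -mulrA (mulrC 'X) mulrA pevalD pevalMX hp mul_polyC pevalZ.
rewrite pevalD pevalMX pevalC mulrDl bop_scaleAl mul1r -!mulrA.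
by rewrite (@peval_comm q A A).
Qed.

Lemma pevalX A : peval 'X A = A.
Proof. by rewrite -['X]mul1r pevalMX peval1 mul1r. Qed.

Lemma peval_exp p n A : peval (p ^+ n) A = peval p A ^+ n.
Proof. by elim: n => [|n h]; rewrite ?expr0 ?peval1// !exprS pevalM h. Qed.

Lemma peval_sa p A : adj A = A -> adj (peval p A) = peval p A.
Proof.
move=> h; elim/poly_ind: p => [|p a hp]; first by rewrite peval0 adj0.
rewrite pevalD pevalMX pevalC adjD adjM hp h adjZ adj1; congr (_ + _).
exact: peval_comm.
Qed.

Definition unit_op A := psd A /\ psd (1 - A).

Lemma psdD S T : psd S -> psd T -> psd (S + T).
Proof.
move=> [s1 s2] [t1 t2]; split; first by rewrite adjD s1 t1.
by move=> x; rewrite bopE rdotDl addr_ge0.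
Qed.

Lemma psdZ a S : 0 <= a -> psd S -> psd (a%:C *: S).
Proof.
move=> a0 [s1 s2]; split; first by rewrite adjZ s1.
by move=> x; rewrite bopE rdotZl mulr_ge0.
Qed.

Lemma psd0 : psd (0 : B).
Proof. by split=> [|x]; [exact: adj0|rewrite bopE rdot0l]. Qed.

Lemma psd1 : psd (1 : B).
Proof. split=> [|x]; first exact: adj1. exact: sqn_ge0. Qed.

Lemma psd_conj S W : psd S -> psd (adj W * S * W).
Proof.
move=> [s1 s2]; split; first by rewrite !adjM adjK s1 mulrA.
by move=> x; rewrite !bopE -adjPr.
Qed.

Lemma psd_sqr W : psd (adj W * W).
Proof. by have := psd_conj W psd1; rewrite mulr1. Qed.

Lemma psd_sa_conj S W : adj W = W -> psd S -> psd (W * S * W).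
Proof. by move=> h1 h2; rewrite -{1}h1; apply: psd_conj. Qed.

Lemma psd_peval_sqr s r A : adj A = A -> psd (peval r A) -> psd (peval (s ^+ 2 * r) A).
Proof.
move=> hA hr; have -> : s ^+ 2 * r = s * r * s by ring.
by rewrite !pevalM; apply: psd_sa_conj => //; exact: peval_sa.
Qed.

(** Even powers are pulled out as squares, which leaves exponents 0 or 1. The remaining case is X (1
    - X) = (1 - X)^2 X + X^2 (1 - X). *)
Lemma unit_op_mon A i j : unit_op A -> psd (peval ('X ^+ i * (1 - 'X) ^+ j) A).
Proof.
move=> [hA hB]; have sA : adj A = A by case: hA.
have pX : psd (peval 'X A) by rewrite pevalX.
have pY : psd (peval (1 - 'X) A) by rewrite pevalB peval1 pevalX.
rewrite -(odd_double_half i) -(odd_double_half j) !exprD -!muln2 !exprM.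
have -> : 'X ^+ odd i * 'X ^+ i./2 ^+ 2 * ((1 - 'X) ^+ odd j * (1 - 'X) ^+ j./2 ^+ 2) =
  ('X ^+ i./2 * (1 - 'X) ^+ j./2) ^+ 2 * ('X ^+ odd i * (1 - 'X) ^+ odd j) :> {poly R} by ring.
apply: psd_peval_sqr => //.
case: (odd i); case: (odd j); rewrite ?expr0 ?expr1 ?mulr1 ?mul1r ?peval1 //; last exact: psd1.
have -> : 'X * (1 - 'X) = (1 - 'X) ^+ 2 * 'X + 'X ^+ 2 * (1 - 'X) :> {poly R} by ring.
by rewrite pevalD; apply: psdD; apply: psd_peval_sqr.
Qed.

Lemma ppos_psd p A : unit_op A -> ppos p -> psd (peval p A).
Proof.
move=> hA; elim=> [c s a b c0|p1 p2 _ h1 _ h2]; last by rewrite pevalD; exact: psdD.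
rewrite pevalZ; apply: psdZ => //; apply: psd_peval_sqr; last exact: unit_op_mon.
by case: hA => -[].
Qed.

Definition rate c n m : R := 2 * c * (n.+1%:R^-1 + m.+1%:R^-1).

(** The positivity certificate for h and for - h bounds the quadratic form from both sides. *)
Lemma bern2_bound n m (h : R -> R -> R) e c A : unit_op A -> 0 <= e -> 0 <= c ->
  (forall x y : R, unit01 x -> unit01 y -> `|h x y| <= e + c * (x - y) ^+ 2) ->
  opnorm (peval (\sum_(k < n.+2) \sum_(l < m.+2)
    h (k%:R / n.+1%:R) (l%:R / m.+1%:R) *: (bern R n.+1 k * bern R m.+1 l)) A) <= e + rate c n m.
Proof.
move=> hA e0 c0 hh; have sA : adj A = A by case: hA => -[].
rewrite /rate; set S := \sum_(k < _) _; set d := e + _.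
have d0 : 0 <= d by rewrite addr_ge0// !mulr_ge0 ?addr_ge0 ?invr_ge0.
apply: sa_opnorm => //; first exact: peval_sa.
have h1 : psd (peval (d%:P + S) A).
  apply: ppos_psd => //; apply: bern2_ppos => // x y hx hy.
  by have := hh x y hx hy; rewrite ler_norml => /andP[].
have h2 : psd (peval (d%:P - S) A).
  have := ppos_psd hA (@bern2_ppos R n m (fun x y : R => - h x y) e c c0 _).
  have -> : \sum_(k < n.+2) \sum_(l < m.+2)
    - h (k%:R / n.+1%:R) (l%:R / m.+1%:R) *: (bern R n.+1 k * bern R m.+1 l) = - S.
    by rewrite /S -sumrN; apply: eq_bigr => k _; rewrite -sumrN; apply: eq_bigr => l _; rewrite scaleNr.
  apply => x y hx hy; rewrite lerN2; apply: le_trans (ler_norm _) (hh x y hx hy).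
move=> x; have := h1.2 x; have := h2.2 x; rewrite [peval (_ - _) _]pevalB pevalD pevalC !bopE !rdotDl rdotNl !rdotZl.
by rewrite -/(sqn x) ler_norml => a1 a2; apply/andP; split; clearbody d S; lra.
Qed.

Definition oplim (T : nat -> B) S := forall e, 0 < e -> exists n0, forall n, (n0 <= n)%N -> opnorm (S - T n) <= e.

Lemma op_complete (T : nat -> B) :
  (forall e, 0 < e -> exists n0, forall m n, (n0 <= m)%N -> (n0 <= n)%N -> opnorm (T m - T n) <= e) ->
  exists S, oplim T S.
Proof.
move=> h; have ex x : exists l, hlim (fun n => T n x) l.
  apply: cauchy_hlim => e e0.
  have p : 0 < sqn x + 1 by have := sqn_ge0 x; lra.
  have q : 0 < Num.sqrt (e / (sqn x + 1)) by rewrite sqrtr_gt0 divr_gt0.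
  have [n0 hn] := h _ q; exists n0 => m n hm hn'.
  have := sqn_opnorm_le x (hn m n hm hn'); rewrite sqr_sqrtr ?divr_ge0 ?(ltW e0) ?(ltW p)// bopE => h1.
  apply: le_trans h1 _; rewrite mulrAC ler_pdivrMr// ler_wpM2l ?(ltW e0)//; lra.
have [s hs] := choice ex.
have key e : 0 < e -> exists n0, forall n, (n0 <= n)%N -> forall x, sqn (s x - T n x) <= e ^+ 2 * sqn x.
  move=> e0; have [n0 hn0] := h _ e0; exists n0 => n hn x.
  apply/ler_addgt0Pl => d d0.
  set a := e ^+ 2 * sqn x; have a0 : 0 <= a by rewrite mulr_ge0 ?sqr_ge0.
  have h2 : hlim (fun k => T k x - T n x) (s x - T n x).
    by move=> r /(hs x)[k0 hk]; exists k0 => k /hk; rewrite opprB addrA subrK.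
  have h3 : hlim (fun k => T (n0 + k)%N x - T n x) (s x - T n x).
    by move=> r /h2[k0 hk]; exists k0 => k hk0; apply: hk; rewrite (leq_trans hk0)// leq_addl.
  set z := s x - T n x in h3 *.
  have [z1|z1] := eqVneq (sqn z) 0; first by rewrite z1 addr_ge0// ltW.
  have zp : 0 < sqn z by rewrite lt_def z1 /=.
  have h4 : rdot z z <= Num.sqrt (a * sqn z).
    apply: (hlim_rdot h3) => k.
    apply: le_trans (ler_norm _) _; rewrite -sqrtr_sqr; apply: ler_wsqrtr.
    apply: le_trans (rdot_sqr_le _ _) _; apply: ler_wpM2r => //.
    by rewrite -bop_subE; apply: sqn_opnorm_le; apply: hn0; rewrite ?leq_addr.
  suff : sqn z <= a by move: d0; lra.
  rewrite -/(sqn z) in h4.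
  have : sqn z ^+ 2 <= a * sqn z.
    rewrite -[X in _ <= X](sqr_sqrtr (mulr_ge0 a0 (sqn_ge0 z))).
    by rewrite ler_pXn2r// nnegrE ?sqrtr_ge0.
  by rewrite expr2 ler_pM2r.
have sl : linear s.
  move=> k x y; apply: (hlim_unique (hs (k *: x + y))).
  have h1 := bop_hlim (k *: (1 : B)) (hs x).
  move=> e e0; have e4 : 0 < e / 4 by lra.
  have [n1 k1] := h1 _ e4; have [n2 k2] := hs y _ e4.
  exists (maxn n1 n2) => n; rewrite geq_max => /andP[/k1 a1 /k2 a2].
  rewrite bopD bopZ opprD addrACA; apply: le_trans (sqnD_le _ _) _.
  rewrite !bopE in a1; lra.
have [n0 k0] := key 1 ltr01.
have [S hS] : exists S : B, forall x, S x = s x.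
  apply: (@bop_mk _ _ s (2 + 2 * opnorm (T n0) ^+ 2)) => // [|x].
    by rewrite addr_ge0// mulr_ge0// sqr_ge0.
  have := sqnD_le (s x - T n0 x) (T n0 x); rewrite subrK.
  have := k0 _ (leqnn _) x; have := sqn_opnorm (T n0) x; rewrite expr1n; lra.
exists S => e e0; have [n1 k1] := key _ e0; exists n1 => n hn.
by apply: opnorm_le_sqn => [|x]; rewrite ?(ltW e0)// bopE hS; exact: k1.
Qed.

Lemma oplim_unique (T : nat -> B) S S' : oplim T S -> oplim T S' -> S = S'.
Proof.
move=> h1 h2; apply/eqP; rewrite -subr_eq0; apply/eqP/opnorm_eq0/eqP.
rewrite eq_le opnorm_ge0 andbT; apply/ler_addgt0Pl => e e0; rewrite addr0.
have e4 : 0 < e / 2 by lra.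
have [n1 k1] := h1 _ e4; have [n2 k2] := h2 _ e4.
have := k1 (maxn n1 n2) (leq_maxl _ _); have := k2 (maxn n1 n2) (leq_maxr _ _).
set n := maxn _ _ => a1 a2; have := opnormD (S - T n) (T n - S').
rewrite addrA subrK (opnormBC (T n)); move: (opnorm _) (opnorm _) (opnorm _) a1 a2 => u v w; lra.
Qed.

Lemma oplim_psd (T : nat -> B) S : oplim T S -> (forall n, psd (T n)) -> psd S.
Proof.
move=> h hp; split.
  apply: (oplim_unique _ h) => e e0; have [n0 hn] := h e e0; exists n0 => n hn'.
  by rewrite -(hp n).1 -adjB opnorm_adj hn.
move=> x; rewrite -[0]addr0; apply/ler_addgt0Pl => e e0.
have p : 0 < sqn x + 1 by have := sqn_ge0 x; lra.
have [n0 hn] := h _ (divr_gt0 e0 p).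
have := rdot_opnorm (S - T n0) x; have := hn _ (leqnn n0).
have := (hp n0).2 x; rewrite bopE rdotBl => h1 h2.
rewrite ler_norml => /andP[h3 _].
have : opnorm (S - T n0) * sqn x <= e.
  apply: le_trans (ler_wpM2r (sqn_ge0 x) h2) _.
  by rewrite mulrAC ler_pdivrMr// ler_wpM2l ?(ltW e0)//; lra.
lra.
Qed.

Lemma oplim_comm (T : nat -> B) S W : oplim T S -> (forall n, W * T n = T n * W) -> W * S = S * W.
Proof.
move=> h hc.
have p : 0 < opnorm W + 1 by have := opnorm_ge0 W; lra.
have h1 : oplim (fun n => W * T n) (W * S).
  move=> e e0; have [n0 hn] := h _ (divr_gt0 e0 p); exists n0 => n hn'.
  rewrite -mulrBr; apply: le_trans (opnormM _ _) _.
  apply: le_trans (ler_wpM2l (opnorm_ge0 _) (hn _ hn')) _.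
  by rewrite mulrC mulrAC ler_pdivrMr// ler_wpM2l ?(ltW e0)//; lra.
apply: oplim_unique h1 _ => e e0; have [n0 hn] := h _ (divr_gt0 e0 p); exists n0 => n hn'.
rewrite hc -mulrBl; apply: le_trans (opnormM _ _) _.
apply: le_trans (ler_wpM2r (opnorm_ge0 _) (hn _ hn')) _.
by rewrite mulrAC ler_pdivrMr// ler_wpM2l ?(ltW e0)//; lra.
Qed.

Lemma oplimD (T T' : nat -> B) S S' a : oplim T S -> oplim T' S' ->
  oplim (fun n => a%:C *: T n + T' n) (a%:C *: S + S').
Proof.
move=> h h' e e0; have e2 : 0 < e / 2 by lra.
have p : 0 < `|a| + 1 by have := normr_ge0 a; lra.
have [n1 k1] := h _ (divr_gt0 e2 p); have [n2 k2] := h' _ e2.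
exists (maxn n1 n2) => n; rewrite geq_max => /andP[/k1 a1 /k2 a2].
rewrite opprD addrACA -scalerBr; apply: le_trans (opnormD _ _) _; rewrite opnormZ.
have : `|a| * opnorm (S - T n) <= e / 2.
  apply: le_trans (ler_wpM2l (normr_ge0 a) a1) _.
  by rewrite mulrC mulrAC ler_pdivrMr// ler_wpM2l ?(ltW e2)//; lra.
lra.
Qed.

Lemma oplimM (T T' : nat -> B) S S' : oplim T S -> oplim T' S' -> oplim (fun n => T n * T' n) (S * S').
Proof.
move=> h h' e e0; have e2 : 0 < e / 2 by lra.
have p : 0 < opnorm S + 1 by have := opnorm_ge0 S; lra.
have p' : 0 < opnorm S' + 1 by have := opnorm_ge0 S'; lra.
have [n0 k0] := h' _ ltr01.
have [n1 k1] := h' _ (divr_gt0 e2 p).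
have q : 0 < opnorm S' + 2 by have := opnorm_ge0 S'; lra.
have [n2 k2] := h _ (divr_gt0 e2 q).
exists (maxn n0 (maxn n1 n2)) => n; rewrite !geq_max => /and3P[/k0 a0 /k1 a1 /k2 a2].
have -> : S * S' - T n * T' n = S * (S' - T' n) + (S - T n) * T' n.
  by rewrite mulrBr mulrBl addrA subrK.
have t' : opnorm (T' n) <= opnorm S' + 2.
  have := opnormB S' (S' - T' n); rewrite opprB addrC subrK; lra.
apply: le_trans (opnormD _ _) _.
have h1 : opnorm (S * (S' - T' n)) <= e / 2.
  apply: le_trans (opnormM_le (lexx _) a1) _.
  by rewrite mulrC mulrAC ler_pdivrMr// ler_wpM2l ?(ltW e2)//; lra.
have h2 : opnorm ((S - T n) * T' n) <= e / 2.
  apply: le_trans (opnormM_le a2 t') _.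
  by rewrite divfK ?gt_eqF.
lra.
Qed.

(** The opaque existence proof seals the definition of [Phi], so that conversion never unfolds the
    limit; [PhiE] is the only access. *)
Fact Phi_subproof f A : {S : B | S = xget 0 [set K | oplim (fun n => peval (Bpol f n) A) K]}.
Proof. by exists (xget 0 [set K | oplim (fun n => peval (Bpol f n) A) K]). Qed.
(* The functional calculus of a continuous [f] at an operator [0 <= A <= 1], as
   the norm limit of the Bernstein polynomials of [f]. *)
Definition Phi f A : B := sval (Phi_subproof f A).
Lemma PhiE f A : Phi f A = xget 0 [set K | oplim (fun n => peval (Bpol f n) A) K].
Proof. exact: (svalP (Phi_subproof f A)). Qed.

Lemma Phi_dist f g e c A n m : unit_op A -> 0 <= e -> 0 <= c ->
  (forall x y : R, unit01 x -> unit01 y -> `|f x - g y| <= e + c * (x - y) ^+ 2) ->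
  opnorm (peval (Bpol f n) A - peval (Bpol g m) A) <= e + rate c n m.
Proof.
move=> hA e0 c0 h; rewrite -pevalB Bpol_dist.
exact: (@bern2_bound n m (fun x y : R => f x - g y)).
Qed.

Lemma small_rate e c : 0 < e -> 0 <= c -> exists n0, forall n m, (n0 <= n)%N -> (n0 <= m)%N ->
  rate c n m <= e.
Proof.
rewrite /rate => e0 c0; have p : 0 < 4 * (c + 1) by lra.
have [n0 hn] := inv_small (divr_gt0 e0 p); exists n0 => n m /hn h1 /hn h2.
apply: (@le_trans _ _ (2 * (c + 1) * (e / (4 * (c + 1)) + e / (4 * (c + 1))))).
  by apply: ler_pM; rewrite ?mulr_ge0 ?addr_ge0 ?invr_ge0//; [lra|rewrite lerD// ltW].
rewrite le_eqVlt; apply/orP; left; apply/eqP; field.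
by rewrite gt_eqF//; lra.
Qed.

Lemma PhiP f A : continuous f -> unit_op A -> oplim (fun n => peval (Bpol f n) A) (Phi f A).
Proof.
move=> fc hA; rewrite PhiE; case: xgetP => [K _ //|h]; exfalso.
have [|S hS] := @op_complete (fun n => peval (Bpol f n) A); last exact: (h S).
move=> e e0; have e2 : 0 < e / 2 by lra.
have [c c0 hc] := cont_modl fc e2; have [n0 hn] := small_rate e2 c0.
exists n0 => m n h1 h2; apply: le_trans (Phi_dist _ _ hA (ltW e2) c0 hc) _.
by have := hn _ _ h1 h2; lra.
Qed.

(** The polynomial depends on f and e but not on A. Norm continuity, locality, unitary covariance
    and the reduction of exactness to polynomials all rest on this uniformity. *)
Lemma Phi_poly f e : continuous f -> 0 < e ->
  exists p, forall A, unit_op A -> opnorm (Phi f A - peval p A) <= e.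
Proof.
move=> fc e0; have e3 : 0 < e / 3 by lra.
have [c c0 hc] := cont_modl fc e3; have [n0 hn] := small_rate e3 c0.
exists (Bpol f n0) => A hA.
have [n1 hn1] := PhiP fc hA e3.
have h1 := hn1 _ (leq_maxr n0 n1).
have h2 := Phi_dist (maxn n0 n1) n0 hA (ltW e3) c0 hc.
have h3 := hn _ _ (leq_maxl n0 n1) (leqnn n0).
set p := peval (Bpol f (maxn n0 n1)) A in h1 h2.
have -> : Phi f A - peval (Bpol f n0) A = (Phi f A - p) + (p - peval (Bpol f n0) A).
  by rewrite addrA subrK.
by have := opnormD (Phi f A - p) (p - peval (Bpol f n0) A); lra.
Qed.

Lemma Phi_pos f A : continuous f -> unit_op A -> (forall x : R, unit01 x -> 0 <= f x) -> psd (Phi f A).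
Proof.
move=> fc hA hf; apply: oplim_psd (PhiP fc hA) _ => n.
by apply: ppos_psd => //; exact: Bpol_pos.
Qed.

Lemma Phi_comm f A W : continuous f -> unit_op A -> W * A = A * W -> W * Phi f A = Phi f A * W.
Proof. by move=> fc hA hW; apply: oplim_comm (PhiP fc hA) _ => n; exact: peval_comm. Qed.

Lemma Phi_sa f A : continuous f -> unit_op A -> adj (Phi f A) = Phi f A.
Proof.
move=> fc hA; apply: (oplim_unique _ (PhiP fc hA)) => e e0.
have [n0 hn] := PhiP fc hA e0; exists n0 => n h.
have sA : adj A = A by case: hA => -[].
by rewrite -(peval_sa (Bpol f n) sA) -adjB opnorm_adj hn.
Qed.

Lemma Phi_lin f g a A : continuous f -> continuous g -> unit_op A ->
  Phi (fun x => a * f x + g x) A = a%:C *: Phi f A + Phi g A.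
Proof.
move=> fc gc hA; apply: (@oplim_unique (fun n => peval (Bpol (fun x => a * f x + g x) n) A)).
  by apply: PhiP => // x; apply: cvgD; [apply: cvgM; [exact: cvg_cst|exact: fc]|exact: gc].
have := oplimD a (PhiP fc hA) (PhiP gc hA).
by under [X in oplim X _]eq_fun => n do rewrite -pevalZ -pevalD -BpolD.
Qed.

Lemma Phi_cst a A : unit_op A -> Phi (fun=> a) A = a%:C *: (1 : B).
Proof.
move=> hA; have fc : continuous (fun _ : R => a) by move=> x; exact: cvg_cst.
apply: (oplim_unique (PhiP fc hA)) => e e0; exists 0%N => n _.
by rewrite Bpol_cst pevalC subrr opnorm0 ltW.
Qed.

Lemma Phi_id A : unit_op A -> Phi id A = A.
Proof.
move=> hA; have fc : continuous (@id R) by move=> x; exact: cvg_id.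
apply: (oplim_unique (PhiP fc hA)) => e e0; exists 0%N => n _.
by rewrite Bpol_id pevalX subrr opnorm0 ltW.
Qed.

Lemma Phi_mul f g A : continuous f -> continuous g -> unit_op A ->
  Phi (fun x => f x * g x) A = Phi f A * Phi g A.
Proof.
move=> fc gc hA.
have fgc : continuous (fun x => f x * g x) by move=> x; apply: cvgM; [exact: fc|exact: gc].
have h1 := oplimM (PhiP fc hA) (PhiP gc hA).
apply: (oplim_unique (PhiP fgc hA)) => e e0.
have e3 : 0 < e / 3 by lra.
have [M M0 hM] := cont_bounded fc.
have e4 : 0 < e / 3 / M by rewrite divr_gt0.
have [c c0 hc] := cont_modl gc e4.
have c1 : 0 <= M * c by rewrite mulr_ge0// ltW.
have [n0 hn0] := small_rate e3 c1; have [n1 hn1] := h1 _ e3.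
exists (maxn n0 n1) => n; rewrite geq_max => /andP[k0 k1].
set p := peval (Bpol f n) A * peval (Bpol g n) A.
set r := peval (Bpol _ n) A.
have h2 : opnorm (p - r) <= e / 3 + e / 3.
  rewrite /p /r -pevalM -pevalB Bpol_mul.
  apply: le_trans (@bern2_bound n n (fun x y : R => f x * (g y - g x)) (e / 3) (M * c) A hA (ltW e3) c1 _) _.
    move=> x y hx hy; rewrite normrM.
    apply: le_trans (ler_pM (normr_ge0 _) (normr_ge0 _) (hM x hx) (hc y x hy hx)) _.
    rewrite mulrDr mulrCA divff ?gt_eqF// mulr1 mulrA.
    by rewrite -[(x - y) ^+ 2]sqrrN opprB.
  by rewrite lerD2l hn0.
have := hn1 _ k1; rewrite -/p => h3.
have := opnormD (Phi f A * Phi g A - p) (p - r); rewrite addrA subrK.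
move: (opnorm _) (opnorm _) (opnorm _) h2 h3 => u v w; clear; lra.
Qed.

Lemma Phi_ext f g A : (forall x : R, unit01 x -> f x = g x) -> Phi f A = Phi g A.
Proof.
move=> h; rewrite !PhiE; have -> // : Bpol f = Bpol g.
by apply: funext => n; apply: eq_bigr => k _; congr (_ *: _); apply: h; exact: nat_frac.
Qed.

Lemma Phi_le f g A : continuous f -> continuous g -> unit_op A ->
  (forall x : R, unit01 x -> f x <= g x) -> forall x, rdot (Phi f A x) x <= rdot (Phi g A x) x.
Proof.
move=> fc gc hA h x.
have := Phi_pos (f := fun x => -1 * f x + g x) _ hA _.
rewrite Phi_lin// => -[||_ /(_ x)].
- by move=> z; apply: cvgD; [apply: cvgM; [exact: cvg_cst|exact: fc]|exact: gc].
- by move=> z /h; lra.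
rewrite !bopE rdotDl rdotZl; lra.
Qed.

(** The functions e + c (g - a)^2 + (f - v) and e + c (g - a)^2 - (f - v) are nonnegative, hence so
    are their forms at A: near an approximate eigenvector of g(A) with value a, f(A) acts like v. *)
Lemma Phi_local f g v a e c A : continuous f -> continuous g -> unit_op A ->
  (forall l : R, unit01 l -> `|f l - v| <= e + c * (g l - a) ^+ 2) ->
  forall y, `|rdot (Phi f A y) y - v * sqn y| <= e * sqn y + c * sqn (Phi g A y - a%:C *: y).
Proof.
move=> fc gc hA h y.
have gac : continuous (fun l => 1 * g l + - a) by move=> z; apply: cvgD; [apply: cvgM; [exact: cvg_cst|exact: gc]|exact: cvg_cst].
have g2c : continuous (fun l => (1 * g l + - a) * (1 * g l + - a)) by move=> z; apply: cvgM; exact: gac.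
pose G l := c * ((1 * g l + - a) * (1 * g l + - a)) + e.
have Gc : continuous G by move=> z; apply: cvgD; [apply: cvgM; [exact: cvg_cst|exact: g2c]|exact: cvg_cst].
have cc (k : R) : continuous (fun _ : R => k) by move=> z; exact: cvg_cst.
have EG : rdot (Phi G A y) y = e * sqn y + c * sqn (Phi g A y - a%:C *: y).
  rewrite /G Phi_lin// Phi_cst// Phi_mul// Phi_lin// Phi_cst// !bopE rdotDl !rdotZl addrC.
  set D := (1%:C *: Phi g A + (- a)%:C *: (1 : B)).
  have sD : adj D = D by rewrite adjD !adjZ adj1 Phi_sa.
  have Dy : D y = Phi g A y - a%:C *: y by rewrite /D !bopE scale1r rmorphN scaleNr.
  by rewrite -Dy (sa_dot _ _ sD).
have h1 : rdot (Phi (fun l => 1 * f l + - v) A y) y <= rdot (Phi G A y) y.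
  apply: Phi_le => // [z|z hz].
    by apply: cvgD; [apply: cvgM; [exact: cvg_cst|exact: fc]|exact: cvg_cst].
  by have := h z hz; rewrite /G ler_norml => /andP[_]; lra.
have h2 : rdot (Phi (fun l => (-1) * f l + v) A y) y <= rdot (Phi G A y) y.
  apply: Phi_le => // [z|z hz].
    by apply: cvgD; [apply: cvgM; [exact: cvg_cst|exact: fc]|exact: cvg_cst].
  by have := h z hz; rewrite /G ler_norml => /andP[]; lra.
rewrite -EG ler_norml; move: h1 h2.
rewrite !Phi_lin// !Phi_cst// !bopE !rdotDl !rdotZl -/(sqn y).
move: (rdot _ _) (rdot _ _) (sqn y) => u w s h1 h2; clear -h1 h2.
by apply/andP; split; lra.
Qed.

(** The local estimate is applied to (f - f(s))^2, whose form at x is the squared distance from f(A)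
    x to f(s) x. *)
Lemma Phi_eigen f A s x : continuous f -> unit_op A -> unit01 s -> A x = s%:C *: x ->
  Phi f A x = (f s)%:C *: x.
Proof.
move=> fc hA hs hx; apply/eqP; rewrite -subr_eq0; apply/eqP/sqn_eq0/eqP.
rewrite eq_le sqn_ge0 andbT.
have cc (k : R) : continuous (fun _ : R => k) by move=> z; exact: cvg_cst.
pose F l := 1 * f l + - f s.
have Fc : continuous F by move=> z; apply: cvgD; [apply: cvgM; [exact: cvg_cst|exact: fc]|exact: cvg_cst].
have F2 : continuous (fun l => F l * F l) by move=> z; apply: cvgM; exact: Fc.
have ic : continuous (@id R) by move=> z; exact: cvg_id.
have EF : Phi F A x = Phi f A x - (f s)%:C *: x.
  by rewrite /F Phi_lin// Phi_cst// !bopE scale1r rmorphN scaleNr.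
have E2 : rdot (Phi (fun l => F l * F l) A x) x = sqn (Phi f A x - (f s)%:C *: x).
  by rewrite Phi_mul// bopE (sa_dot _ _ (Phi_sa Fc hA)) EF.
rewrite -E2; apply/ler_addgt0Pl => e e0; rewrite addr0.
have p : 0 < sqn x + 1 by have := sqn_ge0 x; lra.
have q := divr_gt0 e0 p.
have [c c0 hc] := cont_modl F2 q.
have := @Phi_local (fun l => F l * F l) id 0 s (e / (sqn x + 1)) c A F2 ic hA _ x.
rewrite Phi_id// hx subrr sqn0 mulr0 mul0r subr0 addr0 => h.
apply: le_trans (ler_norm _) (le_trans (h _) _) => [l hl|]; last first.
  by rewrite mulrAC ler_pdivrMr// ler_wpM2l ?(ltW e0)//; lra.
have := hc l s hl hs; have F0 : F s = 0 by rewrite /F mul1r subrr.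
  by rewrite F0 mulr0 subr0.
Qed.

Lemma unit_opnorm A : unit_op A -> opnorm A <= 1.
Proof.
move=> [[sA pA] [_ pB]]; apply: sa_opnorm => // x; rewrite ger0_norm// mul1r.
by have := pB x; rewrite !bopE rdotBl -/(sqn x); lra.
Qed.

Lemma peval_lip p : exists2 k, 0 <= k & forall A A', opnorm A <= 1 -> opnorm A' <= 1 ->
  opnorm (peval p A) <= k /\ opnorm (peval p A - peval p A') <= k * opnorm (A - A').
Proof.
elim/poly_ind: p => [|p a [k k0 hk]].
  exists 0 => // A A' _ _; rewrite !peval0 subrr opnorm0 mul0r; split=> //.
exists (2 * k + `|a|) => [|A A' h1 h2]; first by rewrite addr_ge0// mulr_ge0.
have [a1 a2] := hk A A' h1 h2; have [a3 _] := hk A' A h2 h1.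
have na := normr_ge0 a; have d0 := opnorm_ge0 (A - A').
rewrite !pevalD !pevalMX !pevalC; split.
  apply: le_trans (opnormD _ _) _; rewrite opnormZ.
  have b1 := opnormM_le a1 h1; have b2 := ler_wpM2l na (opnorm1 H).
  lra.
rewrite opprD addrACA subrr addr0.
have -> : peval p A * A - peval p A' * A' = (peval p A - peval p A') * A + peval p A' * (A - A').
  by rewrite mulrBl mulrBr addrA subrK.
apply: le_trans (opnormD _ _) _.
have b1 := opnormM_le a2 h1; have b2 := opnormM_le a3 (lexx (opnorm (A - A'))).
have b3 := mulr_ge0 na d0; lra.
Qed.

Lemma Phi_norm_cont f e : continuous f -> 0 < e -> exists2 d, 0 < d &
  forall A A', unit_op A -> unit_op A' -> opnorm (A - A') <= d -> opnorm (Phi f A - Phi f A') <= e.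
Proof.
move=> fc e0; have e3 : 0 < e / 3 by lra.
have [p hp] := Phi_poly fc e3; have [k k0 hk] := peval_lip p.
have k1 : 0 < k + 1 by lra.
exists (e / 3 / (k + 1)) => [|A A' hA hA' h]; first exact: divr_gt0.
have [_ h1] := hk A A' (unit_opnorm hA) (unit_opnorm hA').
have h2 := hp A hA; have h3 := hp A' hA'.
have h4 : k * opnorm (A - A') <= e / 3.
  apply: le_trans (ler_wpM2l k0 h) _; rewrite mulrC mulrAC ler_pdivrMr// ler_wpM2l ?(ltW e3)//; lra.
have -> : Phi f A - Phi f A' = (Phi f A - peval p A) + (peval p A - peval p A') - (Phi f A' - peval p A').
  by rewrite addrA subrK opprB addrA subrK.
have := opnormB (Phi f A - peval p A + (peval p A - peval p A')) (Phi f A' - peval p A').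
have := opnormD (Phi f A - peval p A) (peval p A - peval p A').
move: (opnorm _) (opnorm _) (opnorm _) (opnorm _) (opnorm _) h1 h2 h3 h4 => *; lra.
Qed.

End Calculus.

(** * Absolute value and positive part *)

Section AbsoluteValue.
Variables (R : realType) (H : hilbertType R).
Local Notation B := (bop H).
Implicit Types (a c e L : R) (S T A W : B) (f g : R -> R).

Lemma cont_modl_itv f e M : continuous f -> 0 < e -> 0 < M ->
  exists2 c, 0 <= c & forall x y : R, `|x| <= M -> `|y| <= M -> `|f x - f y| <= e + c * (x - y) ^+ 2.
Proof.
move=> fc e0 M0; pose F s := f (2 * M * s - M).
have Fc : continuous F.
  move=> s; apply: continuous_comp; last exact: fc.
  by apply: cvgB; [apply: cvgM; [exact: cvg_cst|exact: cvg_id]|exact: cvg_cst].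
have [c c0 hc] := cont_modl Fc e0.
exists (c / (2 * M) ^+ 2) => [|x y hx hy]; first by rewrite divr_ge0 ?sqr_ge0.
have r z : `|z| <= M -> unit01 ((z + M) / (2 * M)) /\ F ((z + M) / (2 * M)) = f z.
  rewrite ler_norml => /andP[z1 z2]; split.
    rewrite /unit01 divr_ge0 ?ler_pdivrMr//=; lra.
  by rewrite /F; congr f; field; rewrite gt_eqF.
have [ux fx] := r x hx; have [uy fy] := r y hy.
have := hc _ _ ux uy; rewrite fx fy => h; apply: le_trans h _.
rewrite le_eqVlt; apply/orP; left; apply/eqP; field; rewrite gt_eqF//; lra.
Qed.

Definition usqr L S : B := (L^-1 ^+ 2)%:C *: (S * S).

Lemma usqr_unit L S : 0 < L -> adj S = S -> opnorm S <= L -> unit_op (usqr L S).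
Proof.
move=> L0 sS hS; have pS : psd (S * S) by rewrite -{1}sS; exact: psd_sqr.
split; first by apply: psdZ => //; exact: sqr_ge0.
split; first by rewrite adjB adj1 adjZ pS.1.
move=> x; rewrite !bopE rdotBl rdotZl (sa_dot _ _ sS) -!/(sqn _) subr_ge0.
have := sqn_opnorm_le x hS => h; apply: le_trans (ler_wpM2l (sqr_ge0 _) h) _.
by rewrite mulrA -exprMn mulVf ?gt_eqF// expr1n mul1r.
Qed.

(* [f] applied to the absolute value of [S], for [opnorm S <= L] *)
Definition sfun L f S : B := Phi (fun y => f (L * Num.sqrt y)) (usqr L S).

Lemma sfun_cont L f : continuous f -> continuous (fun y => f (L * Num.sqrt y)).
Proof.
move=> fc y; apply: (@continuous_comp _ _ _ (fun y => L * Num.sqrt y) f); last exact: fc.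
by apply: cvgM; [exact: cvg_cst|exact: sqrt_continuous].
Qed.

Lemma sqrt01 (x : R) : unit01 x -> 0 <= Num.sqrt x <= 1.
Proof.
by move=> /andP[x0 x1]; rewrite sqrtr_ge0/= -sqrtr1 ler_wsqrtr.
Qed.

Section fixed.
Variables (L : R) (S : B) (L0 : 0 < L) (sS : adj S = S) (hS : opnorm S <= L).
Let u := usqr_unit L0 sS hS.

Lemma sfun_sa f : continuous f -> adj (sfun L f S) = sfun L f S.
Proof. by move=> fc; apply: Phi_sa => //; exact: sfun_cont. Qed.

Lemma sfun_psd f : continuous f -> (forall x, 0 <= x <= L -> 0 <= f x) -> psd (sfun L f S).
Proof.
move=> fc h; apply: Phi_pos => //; first exact: sfun_cont.
move=> x /sqrt01/andP[s0 s1]; apply: h; rewrite mulr_ge0 ?(ltW L0)//=.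
by rewrite ler_piMr// ltW.
Qed.

Lemma sfun_mul f g : continuous f -> continuous g ->
  sfun L (fun x => f x * g x) S = sfun L f S * sfun L g S.
Proof. by move=> fc gc; apply: Phi_mul => //; exact: sfun_cont. Qed.

Lemma sfun_comm2 f W : continuous f -> W * (S * S) = (S * S) * W -> W * sfun L f S = sfun L f S * W.
Proof.
move=> fc h; apply: Phi_comm => //; first exact: sfun_cont.
by rewrite /usqr bop_scaleAl bop_scaleAr h.
Qed.

Lemma sfun_comm f W : continuous f -> W * S = S * W -> W * sfun L f S = sfun L f S * W.
Proof. by move=> fc h; apply: sfun_comm2 => //; rewrite mulrA h -!mulrA h. Qed.

Lemma sfun_le f g : continuous f -> continuous g -> (forall x, 0 <= x <= L -> f x <= g x) ->
  forall y, rdot (sfun L f S y) y <= rdot (sfun L g S y) y.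
Proof.
move=> fc gc h; apply: Phi_le => //; try exact: sfun_cont.
move=> x /sqrt01/andP[s0 s1]; apply: h; rewrite mulr_ge0 ?(ltW L0)//=.
by rewrite ler_piMr// ltW.
Qed.

Lemma sfun_eigen f s x : continuous f -> 0 <= s <= L -> S x = s%:C *: x -> sfun L f S x = (f s)%:C *: x.
Proof.
move=> fc /andP[s0 sL] h; rewrite /sfun.
have := @Phi_eigen _ _ (fun y => f (L * Num.sqrt y)) (usqr L S) ((L^-1 * s) ^+ 2) x (sfun_cont fc) u.
rewrite sqrtr_sqr ger0_norm ?mulr_ge0 ?invr_ge0 ?(ltW L0)// mulrA mulfV ?gt_eqF// mul1r.
apply.
  rewrite /unit01 sqr_ge0/= expr_le1// ?mulr_ge0 ?invr_ge0 ?(ltW L0)//.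
  by rewrite mulrC ler_pdivrMr// mul1r.
rewrite /usqr !bopE h bopZ h !scalerA -!rmorphM; congr (_%:C *: _).
by rewrite exprMn -mulrA -expr2.
Qed.

Definition absv := sfun L id S.
Let idc : continuous (@id R). Proof. by move=> x; exact: cvg_id. Qed.

Lemma absv_psd : psd absv.
Proof. by apply: sfun_psd => // x /andP[]. Qed.

Lemma absv_sqr : absv * absv = S * S.
Proof.
rewrite /absv -sfun_mul// /sfun (@Phi_ext _ _ _ (fun y => L ^+ 2 * y + 0)); last first.
  by move=> x /andP[x0 _]; rewrite mulrACA -!expr2 sqr_sqrtr// addr0.
have cc (k : R) : continuous (fun _ : R => k) by move=> z; exact: cvg_cst.
rewrite (@Phi_lin _ _ id (fun=> 0))// Phi_id// Phi_cst// scale0r addr0 /usqr scalerA -rmorphM.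
by rewrite -exprMn mulfV ?gt_eqF// expr1n scale1r.
Qed.

Lemma absv_comm W : W * S = S * W -> W * absv = absv * W.
Proof. exact: sfun_comm. Qed.

(** Q commutes with S^2, hence with |S|, so (|S| + Q) (|S| - Q) = 0. On the range of the difference
    both positive operators then vanish. *)
Lemma absv_unique (Q : B) : psd Q -> Q * Q = S * S -> Q = absv.
Proof.
move=> hQ eQ; have cQ : Q * absv = absv * Q by apply: sfun_comm2 => //; rewrite -eQ mulrA.
have hA := absv_psd; apply/esym/eqP; rewrite -subr_eq0; apply/eqP/bopP => x.
set D := absv - Q; set y := D x.
have sD : adj D = D by rewrite adjB hA.1 hQ.1.
have e0 : (absv + Q) * D = 0.
  by rewrite mulrDl !mulrBr -cQ absv_sqr eQ addrA subrK subrr.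
have : rdot (absv y) y + rdot (Q y) y = 0.
  by rewrite -rdotDl -bop_addE /y -bop_mulE e0 bopE rdot0l.
have a0 := hA.2 y; have q0 := hQ.2 y => h.
have ha : absv y = 0 by apply: psd_eq0 => //; lra.
have hq : Q y = 0 by apply: psd_eq0 => //; lra.
apply: sqn_eq0; rewrite -/y /sqn {1}/y (sa_dot _ _ sD) /D !bopE ha hq subrr.
exact: rdot0r.
Qed.

Lemma abs_opE : abs_op S = absv.
Proof.
rewrite /abs_op; case: xgetP => [Q _ [/positive_opE h1 h2]|h].
  by apply: absv_unique => //; rewrite h2 sS.
exfalso; apply: (h absv); split; first by apply/positive_opE; exact: absv_psd.
by rewrite absv_sqr sS.
Qed.

(** The value a may be negative or exceed L, since the characterisation by approximate eigenvectors
    tests a whole symmetric interval. *)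
Lemma sfun_local f M e : continuous f -> 0 < e -> L <= M ->
  exists2 c, 0 <= c & forall a y, `|a| <= M ->
    `|rdot (sfun L f S y) y - f a * sqn y| <= e * sqn y + c * sqn (absv y - a%:C *: y).
Proof.
move=> fc e0 LM; have M0 : 0 < M by apply: lt_le_trans LM.
have [c c0 hc] := cont_modl_itv fc e0 M0; exists c => // a y ha.
apply: (@Phi_local _ _ (fun y => f (L * Num.sqrt y)) (fun y => L * Num.sqrt y)) => //.
- exact: sfun_cont.
- exact: (@sfun_cont L id).
- move=> l /sqrt01/andP[s0 s1]; apply: hc => //.
  by rewrite ger0_norm ?mulr_ge0 ?(ltW L0)// (le_trans _ LM)// ler_piMr// ltW.
Qed.

End fixed.

Lemma sfun_norm_cont L f e : 0 < L -> continuous f -> 0 < e -> exists2 d, 0 < d &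
  forall S S', adj S = S -> adj S' = S' -> opnorm S <= L -> opnorm S' <= L -> opnorm (S - S') <= d ->
  opnorm (sfun L f S - sfun L f S') <= e.
Proof.
move=> L0 fc e0; have [d d0 hd] := @Phi_norm_cont R H _ e (sfun_cont fc (L := L)) e0.
exists (d * L / 2) => [|S S' s1 s2 h1 h2 h]; first by rewrite divr_gt0// mulr_gt0.
apply: hd; try exact: usqr_unit.
rewrite /usqr -scalerBr opnormZ ger0_norm ?sqr_ge0//.
have -> : S * S - S' * S' = S * (S - S') + (S - S') * S' by rewrite mulrBr mulrBl addrA subrK.
have b1 := opnormM_le h1 h; have b2 := opnormM_le h h2.
have b3 := opnormD (S * (S - S')) ((S - S') * S').
apply: (@le_trans _ _ (L^-1 ^+ 2 * (L * (d * L / 2) + d * L / 2 * L))).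
  apply: ler_wpM2l; first exact: sqr_ge0.
  apply: le_trans b3 _; exact: lerD.
rewrite le_eqVlt; apply/orP; left; apply/eqP; field; by rewrite gt_eqF.
Qed.

(** The approximation is by polynomials in S^2, because [sfun] is a function of the absolute
    value. *)
Lemma sfun_poly L f e : 0 < L -> continuous f -> 0 < e -> exists p : {poly R},
  forall S, adj S = S -> opnorm S <= L -> opnorm (sfun L f S - peval p (S * S)) <= e.
Proof.
move=> L0 fc e0; have [p hp] := @Phi_poly R H _ e (sfun_cont fc (L := L)) e0.
exists (p \Po ((L^-1 ^+ 2) *: 'X)) => S sS hS.
have -> : peval (p \Po ((L^-1 ^+ 2) *: 'X)) (S * S) = peval p (usqr L S).
  elim/poly_ind: {hp} p => [|p c h]; first by rewrite comp_poly0 !peval0.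
  rewrite comp_poly_MXaddC !pevalD !pevalM h pevalZ !pevalX !pevalC.
  by rewrite /usqr.
by apply: hp; exact: usqr_unit.
Qed.

(** Sealed like [Phi]. The bound [opnorm S + 1] is positive even for S = 0. *)
Fact abp_subproof S : {A : B | A = absv (opnorm S + 1) S}.
Proof. by exists (absv (opnorm S + 1) S). Qed.
Definition abp S : B := sval (abp_subproof S).
Lemma abpE S : abp S = absv (opnorm S + 1) S. Proof. exact: (svalP (abp_subproof S)). Qed.

Lemma abpP S : adj S = S -> [/\ psd (abp S), abp S * abp S = S * S &
  forall W, W * S = S * W -> W * abp S = abp S * W].
Proof.
move=> sS; have L0 : 0 < opnorm S + 1 by have := opnorm_ge0 S; lra.
have hS : opnorm S <= opnorm S + 1 by lra.
rewrite abpE; split; [exact: absv_psd|exact: absv_sqr|move=> W; exact: absv_comm].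
Qed.

(* [abp S + S = 2 S^+], so [pker S] is the spectral projection of [S] for
   the half line [x <= 0], and [pker (- S)] that for [0 <= x]. *)
Fact pker_subproof S : {E : B | E = proj_onto (ker_op (abp S + S))}.
Proof. by exists (proj_onto (ker_op (abp S + S))). Qed.
Definition pker S : B := sval (pker_subproof S).
Lemma pkerE S : pker S = proj_onto (ker_op (abp S + S)). Proof. exact: (svalP (pker_subproof S)). Qed.

Lemma pkerP S : projection (pker S) /\ range (pker S) = ker_op (abp S + S).
Proof.
have [E hE hr] := proj_exists (ker_closed_subspace (abp S + S)).
by rewrite pkerE (proj_ontoE hE hr).
Qed.

Lemma pker_proj S : projection (pker S). Proof. exact: (pkerP S).1. Qed.

Lemma pker_ker S x : (abp S + S) (pker S x) = 0.
Proof.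
have [_ h] := pkerP S; have : range (pker S) (pker S x) by exists x.
by rewrite h.
Qed.

Lemma pker_id S x : (abp S + S) x = 0 -> pker S x = x.
Proof. by have [h1 h] := pkerP S => hx; apply: proj_id => //; rewrite h. Qed.

Lemma sa_comm_adj S W : adj S = S -> W * S = S * W -> adj W * S = S * adj W.
Proof. by move=> sS h; have := congr1 (@adj _ _) h; rewrite !adjM sS. Qed.

(** W and its adjoint both leave the kernel that defines [pker S] invariant, so W commutes with the
    projection onto it. *)
Lemma pker_comm S W : adj S = S -> W * S = S * W -> W * pker S = pker S * W.
Proof.
move=> sS hW; have [_ _ hc] := abpP sS.
have key V : V * S = S * V -> pker S * V * pker S = V * pker S.
  move=> hV; apply: bopP => x; rewrite !bopE; apply: pker_id.
  have e : V * (abp S + S) = (abp S + S) * V by rewrite mulrDr mulrDl hc// hV.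
  by rewrite -bop_mulE -e bopE pker_ker bop0.
have [_ sp] := pker_proj S.
have h1 := key _ hW; have := key _ (sa_comm_adj sS hW).
by move/(congr1 (@adj _ _)); rewrite !adjM adjK sp mulrA h1 => ->.
Qed.

Lemma pker_neg S x : adj S = S -> rdot (S (pker S x)) (pker S x) <= 0.
Proof.
move=> sS; have [hA _ _] := abpP sS.
have := pker_ker S x; rewrite bopE => /eqP; rewrite addrC addr_eq0 => /eqP ->.
by rewrite rdotNl oppr_le0 hA.2.
Qed.

(* [|S| - S] maps into the kernel of [|S| + S] *)
Lemma pker_compl S x : adj S = S -> S ((1 - pker S) x) = abp S ((1 - pker S) x).
Proof.
move=> sS; have [hA h2 hc] := abpP sS; set y := (1 - pker S) x.
have cA : S * abp S = abp S * S by exact: hc.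
set D := abp S - S; have sD : adj D = D by rewrite adjB hA.1 sS.
have e0 : (abp S + S) * D = 0.
  by rewrite mulrDl !mulrBr h2 cA addrA subrK subrr.
have ep z : pker S (D z) = D z by apply: pker_id; rewrite -bop_mulE e0 bopE.
have : D y = 0.
  apply: rdot_eq0 => z; rewrite (sa_dot _ _ sD) -ep adjPr (pker_proj S).2.
  by rewrite /y -bop_mulE mulrBr mulr1 (pker_proj S).1 subrr bopE rdot0l.
by rewrite /D bopE => /eqP; rewrite subr_eq0 => /eqP.
Qed.

Lemma pker_pos S x : adj S = S -> 0 <= rdot (S ((1 - pker S) x)) ((1 - pker S) x).
Proof. by move=> sS; rewrite pker_compl//; have [hA _ _] := abpP sS; exact: hA.2. Qed.

Lemma pker_pos0 S x : adj S = S -> rdot (S ((1 - pker S) x)) ((1 - pker S) x) = 0 -> (1 - pker S) x = 0.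
Proof.
move=> sS; rewrite pker_compl// => h; have [hA _ _] := abpP sS.
set y := (1 - pker S) x in h *; have hy := psd_eq0 hA h.
have : pker S y = y by apply: pker_id; rewrite bopE hy /y pker_compl// -/y hy addr0.
by rewrite /y -bop_mulE mulrBr mulr1 (pker_proj S).1 subrr bopE.
Qed.

End AbsoluteValue.

(** * Spectral families *)

Section SpectralFamily.
Variables (R : realType) (H : hilbertType R).
Local Notation B := (bop H).

Lemma proj_le (P Q : B) : projection P -> projection Q -> P * Q = P -> Q * P = P.
Proof. by move=> hP hQ h; have := congr1 (@adj _ _) h; rewrite adjM hP.2 hQ.2. Qed.

(** Strong convergence of increasing projections. The limit is built as the complement of the
    projection onto the common kernel, so that commutation passes to it by invariance of that
    kernel. *)
Lemma proj_lim (Q : nat -> B) : (forall n, projection (Q n)) ->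
  (forall n k, (n <= k)%N -> Q n * Q k = Q n) ->
  exists P : B, [/\ projection P, forall n, Q n * P = Q n,
    forall x, hlim (fun n => Q n x) (P x) &
    forall W, (forall n, W * Q n = Q n * W) -> W * P = P * W].
Proof.
move=> hQ hm.
have dist x n k : (n <= k)%N -> sqn (Q k x - Q n x) = sqn (Q k x) - sqn (Q n x).
  move=> h; rewrite sqnB.
  have -> : rdot (Q k x) (Q n x) = sqn (Q n x).
    by rewrite adjP (hQ k).2 -bop_mulE (proj_le (hQ n) (hQ k) (hm _ _ h)) -proj_sqn// rdotC.
  ring.
have ex x : exists l, hlim (fun n => Q n x) l.
  apply: cauchy_hlim => e e0.
  have nd : nondecreasing_seq (fun n => sqn (Q n x)).
    by move=> n k h; rewrite -subr_ge0 -dist.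
  have bd : has_ubound (range (fun n => sqn (Q n x))).
    by exists (sqn x) => _ [n _ <-]; rewrite (proj_pyth x (hQ n)) lerDl.
  have := nondecreasing_is_cvgn nd bd.
  move=> /cvgrPdist_le /(_ (e / 2)) [|n0 _ hn]; first by lra.
  exists n0 => m n h1 h2.
  have key a b : (n0 <= a)%N -> (a <= b)%N -> sqn (Q b x - Q a x) <= e.
    move=> ha hb; rewrite dist//; have := hn _ ha; have := hn _ (leq_trans ha hb).
    by rewrite /= !ler_norml => /andP[a1 a2] /andP[b1 b2]; lra.
  have [h|h] := leqP m n; first by rewrite sqnBC; exact: key.
  by apply: key => //; exact: ltnW.
pose V := [set x : H | forall n, Q n x = 0].
have cV : closed_subspace V.
  split => [n|k x y hx hy n|u z hu hz n]; first exact: bop0.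
    by rewrite bopD bopZ hx hy scaler0 addr0.
  have [_ _ h] := ker_closed_subspace (Q n).
  by apply: h hz => k; exact: hu.
have [Z hZ rZ] := proj_exists cV.
have VZ x n : Q n (Z x) = 0 by have : range Z (Z x) by [exists x]; rewrite rZ; apply.
have ZV x : (forall n, Q n x = 0) -> Z x = x by move=> h; apply: proj_id => //; rewrite rZ.
have QZ n : Q n * Z = 0 by apply: bopP => x; rewrite bopE VZ.
have QP n : Q n * (1 - Z) = Q n by rewrite mulrBr QZ mulr1 subr0.
have hP := projC hZ.
exists (1 - Z); split => //.
- move=> x; have [l hl] := ex x.
  have lx : Z (l - x) = l - x.
    apply: ZV => k; apply: (hlim_unique (u := fun n => Q k (Q n x - x))).
      apply: bop_hlim => e e0; have [n1 hn] := hl e e0; exists n1 => n /hn.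
      by rewrite opprB addrA subrK.
    move=> e e0; exists k => n hn.
    by rewrite bopB -bop_mulE hm// subrr subr0 sqn0 ltW.
  have Pl : (1 - Z) l = l.
    apply: (hlim_unique (bop_hlim (1 - Z) hl)) => e e0; have [n1 hn] := hl e e0.
    by exists n1 => n /hn; rewrite -{1}(bop_mulE (1 - Z)) (proj_le (hQ n) hP (QP n)).
  suff -> : (1 - Z) x = l by [].
  apply/eqP; rewrite -Pl eq_sym -subr_eq0 -bopB; apply/eqP.
  by rewrite -lx -bop_mulE mulrBl mul1r hZ.1 subrr.
- move=> W hW.
  have key U : (forall n, U * Q n = Q n * U) -> Z * U * Z = U * Z.
    move=> hU; apply: bopP => x; rewrite !bopE; apply: ZV => n.
    by rewrite -bop_mulE -hU bopE VZ bop0.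
  have hWa n : adj W * Q n = Q n * adj W by apply: sa_comm_adj => //; exact: (hQ n).2.
  have h1 := key _ hW; have := key _ hWa.
  move/(congr1 (@adj _ _)); rewrite !adjM adjK hZ.2 mulrA h1 => e.
  by rewrite mulrBr mulrBl mulr1 mul1r e.
Qed.

Lemma quad_split (K W : B) (x : H) : projection W -> W * K = K * W ->
  rdot (K x) x = rdot (K (W x)) (W x) + rdot (K ((1 - W) x)) ((1 - W) x).
Proof.
move=> hW c.
have key (V : B) : projection V -> V * K = K * V -> rdot (K (V x)) (V x) = rdot (K (V x)) x.
  by move=> [v1 v2] cV; rewrite adjPr v2 -!bop_mulE cV -mulrA v1.
rewrite (key _ hW c) (key _ (projC hW)); last by rewrite mulrBr mulrBl c mulr1 mul1r.
by rewrite -rdotDl -bopD; congr rdot; congr (K _); rewrite !bopE addrC subrK.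
Qed.

Variables (T : B) (sT : adj T = T).
Implicit Types (x y z : H) (l m a b : R).

Lemma shift_sa l : adj (T - l%:C *: (1 : B)) = T - l%:C *: (1 : B).
Proof. by rewrite adjB adjZ adj1 sT. Qed.

Lemma shift_quad l y : rdot ((T - l%:C *: (1 : B)) y) y = rdot (T y) y - l * sqn y.
Proof. by rewrite !bopE rdotDl rdotNl rdotZl. Qed.

(** Here E l stands for the closed half line up to l. The strictness in [spf_gt] is what makes the
    family monotone and right continuous. *)
Record specfam (E : R -> B) : Prop := Specfam {
  spf_proj : forall l, projection (E l);
  spf_comm : forall l W, W * T = T * W -> W * E l = E l * W;
  spf_le : forall l x, rdot (T (E l x)) (E l x) <= l * sqn (E l x);
  spf_ge : forall l x, l * sqn ((1 - E l) x) <= rdot (T ((1 - E l) x)) ((1 - E l) x);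
  spf_gt : forall l x, rdot (T ((1 - E l) x)) ((1 - E l) x) <= l * sqn ((1 - E l) x) ->
    (1 - E l) x = 0
}.

Lemma pker_specfam : specfam (fun l => pker (T - l%:C *: (1 : B))).
Proof.
split => l; first exact: pker_proj.
- move=> W h; apply: pker_comm; first exact: shift_sa.
  by rewrite mulrBr mulrBl h bop_scaleAl bop_scaleAr mulr1 mul1r.
- by move=> x; have := pker_neg x (shift_sa l); rewrite shift_quad subr_le0.
- by move=> x; have := pker_pos x (shift_sa l); rewrite shift_quad subr_ge0.
- move=> x h; apply: (pker_pos0 (shift_sa l)); rewrite shift_quad.
  have := pker_pos x (shift_sa l); rewrite shift_quad subr_ge0 => h2.
  by apply/eqP; rewrite subr_eq0 eq_le h h2.
Qed.

Variables (spf : R -> B) (hE : specfam spf).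
Let spf_proj := spf_proj hE.
Let spf_comm := spf_comm hE.
Let spf_le := spf_le hE.
Let spf_ge := spf_ge hE.
Let spf_gt := spf_gt hE.

Lemma spf_commT l : T * spf l = spf l * T. Proof. exact: spf_comm. Qed.

Lemma spf_mono l m : l <= m -> spf l * spf m = spf l.
Proof.
move=> lm; apply/esym/eqP; rewrite -subr_eq0 -{1}[spf l]mulr1 -mulrBr.
have c : spf l * (1 - spf m) = (1 - spf m) * spf l.
  by rewrite mulrBr mulrBl mulr1 mul1r (spf_comm m (esym (spf_commT l))).
apply/eqP/bopP => x; rewrite c bopE; apply: spf_gt.
have := spf_le l ((1 - spf m) x).
have -> : spf l ((1 - spf m) x) = (1 - spf m) (spf l x) by rewrite -!bop_mulE c.
by move=> h; apply: le_trans h _; apply: ler_wpM2r.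
Qed.

Lemma spf_top l : opnorm T <= l -> spf l = 1.
Proof.
move=> h; apply/eqP; rewrite eq_sym -subr_eq0; apply/eqP/bopP => x; rewrite bop_zeroE.
apply: spf_gt; apply: le_trans (ler_norm _) _; apply: le_trans (rdot_opnorm _ _) _.
exact: ler_wpM2r.
Qed.

Lemma spf_bot l : l < - opnorm T -> spf l = 0.
Proof.
move=> h; apply/bopP => x; rewrite bop_zeroE; apply/sqn_eq0/eqP.
rewrite eq_le sqn_ge0 andbT; have := spf_le l x; have := rdot_opnorm T (spf l x).
rewrite ler_norml => /andP[h1 _] h2; have h3 := sqn_ge0 (spf l x); nra.
Qed.

Definition F x l := rdot (spf l x) x.

Lemma sub_proj l m : l <= m -> projection (spf m - spf l).
Proof.
move=> lm; have h1 := spf_mono lm; have h2 := proj_le (spf_proj l) (spf_proj m) h1.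
split; last by rewrite adjB (spf_proj l).2 (spf_proj m).2.
by rewrite mulrBl !mulrBr (spf_proj l).1 (spf_proj m).1 h1 h2 subrr subr0.
Qed.

Lemma F_sub x l m : l <= m -> F x m - F x l = sqn ((spf m - spf l) x).
Proof. by move=> lm; rewrite -proj_sqn; [rewrite bopE rdotBl|exact: sub_proj]. Qed.

Lemma F_nd x : nondecreasing (F x).
Proof. by move=> l m lm; rewrite -subr_ge0 F_sub. Qed.

Lemma F_rc x : right_continuous (F x).
Proof.
move=> l; pose m (n : nat) := l + n.+1%:R^-1.
have ml n : l <= m n by rewrite lerDl invr_ge0.
have [P [hP QP cP comP]] : exists P : B, [/\ projection P, forall n, (1 - spf (m n)) * P = 1 - spf (m n),
    forall x, hlim (fun n => (1 - spf (m n)) x) (P x) &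
    forall W, (forall n, W * (1 - spf (m n)) = (1 - spf (m n)) * W) -> W * P = P * W].
  apply: proj_lim => [n|n k nk]; first exact/projC/spf_proj.
  have h : m k <= m n by rewrite lerD2l lef_pV2 ?posrE// ler_nat.
  rewrite mulrBl !mulrBr !mul1r !mulr1 (proj_le (spf_proj _) (spf_proj _) (spf_mono h)).
  by rewrite opprB addrA subrK.
(* the limit of [spf (m n) - spf l] is zero, as [T = l] on its range *)
have PE : P = 1 - spf l.
  have comT : T * P = P * T by apply: comP => n; rewrite mulrBr mulrBl spf_commT mulr1 mul1r.
  have comL : spf l * P = P * spf l.
    by apply: comP => n; rewrite mulrBr mulrBl mulr1 mul1r (spf_comm (m n) (esym (spf_commT l))).
  have h1 : spf l * P = 0.
    apply: bopP => z; rewrite bopE; apply: (hlim_unique (bop_hlim (spf l) (cP z))) => e e0.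
    exists 0%N => n _.
    by rewrite -bop_mulE mulrBr mulr1 spf_mono// subrr !bopE subrr sqn0 ltW.
  apply/eqP; rewrite eq_sym -subr_eq0; apply/eqP/bopP => z; rewrite bop_zeroE.
  have e1 : (1 - spf l - P) z = (1 - spf l) ((1 - P) z).
    by rewrite -bop_mulE mulrBl mul1r mulrBr mulr1 h1 subr0 addrAC.
  rewrite e1; apply: spf_gt; rewrite -e1; set w := (1 - spf l - P) z.
  have hw n : rdot (T w) w <= m n * sqn w.
    have : spf (m n) w = w.
      apply/eqP; rewrite -subr_eq0 -[X in _ - X]bop_oneE -bop_subE -oppr_eq0 -bop_oppE opprB; apply/eqP.
      have := proj_le (projC (spf_proj (m n))) hP (QP n) => PQ.
      rewrite /w -bop_mulE mulrBr QP mulrBr mulr1 mulrBl mul1r.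
      have -> : spf (m n) * spf l = spf l by apply: proj_le (spf_mono (ml n)); exact: spf_proj.
      by rewrite subrr subr0 subrr.
    by move=> e; rewrite -e; exact: spf_le.
  have [s0|s0] := eqVneq (sqn w) 0; first by have := hw 0%N; rewrite s0 !mulr0.
  have sp : 0 < sqn w by rewrite lt_def s0 /=.
  apply/ler_addgt0Pl => e e0; have [n0 hn] := inv_small (divr_gt0 e0 sp).
  apply: le_trans (hw n0) _; rewrite /m mulrDl addrC lerD2r -ler_pdivlMr//.
  exact/ltW/hn.
have cF : forall e, 0 < e -> exists n, F x (m n) - F x l <= e.
  move=> e e0; have [n0 hn] := cP x e e0; exists n0; rewrite F_sub//.
  have := hn _ (leqnn n0); rewrite PE -bop_subE; congr (sqn (fun_of_bop _ x) <= _) || idtac.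
  by rewrite opprB addrC addrA subrK -[in X in X -> _]sqnN -bop_oppE opprB.
apply/cvgrPdist_le => e e0; have [n hn] := cF e e0.
have mn : l < m n by rewrite ltrDl invr_gt0.
near=> t; have lt : l <= t by near: t; exact: nbhs_right_ge.
have tm : t <= m n by near: t; exact: nbhs_right_le.
rewrite distrC ger0_norm ?subr_ge0 ?F_nd//; apply: le_trans hn.
by rewrite lerD2r F_nd.
Unshelve. all: by end_near. Qed.

Definition cumF x : cumulative R R :=
  HB.pack (F x) (isCumulative.Build R _ R (F x) (@F_nd x) (@F_rc x)).

Definition mus x : {measure set (measurableTypeR R) -> \bar R} := lebesgue_stieltjes_measure (cumF x).

Lemma mus_itv x a b : a <= b -> mus x `]a, b]%classic = (F x b - F x a)%:E.
Proof.
move=> ab; rewrite /mus /= /lebesgue_stieltjes_measure /measure_extension/=.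
have := @measurable_mu_extE _ _ _ (wlength (cumF x) : {measure set (ocitv_type R) -> \bar R}) _ (is_ocitv a b).
by move=> /= ->; rewrite wlength_itv_bnd.
Qed.

(** Identities between scalar spectral measures are proved through this: it suffices to compare
    distribution functions on half-open intervals. *)
Lemma mus_unique x (nu : {measure set (measurableTypeR R) -> \bar R}) :
  (forall a b, a <= b -> nu `]a, b]%classic = (F x b - F x a)%:E) ->
  forall A, measurable A -> mus x A = nu A.
Proof.
move=> h A mA; apply: lebesgue_stieltjes_measure_unique => // _ [[a b]] _ <- /=.
have [ab|ba] := leP a b; first by rewrite h// -mus_itv.
by rewrite set_itv_ge ?measure0// bnd_simp -leNgt ltW.
Qed.

Lemma F_top x l : opnorm T <= l -> F x l = sqn x.
Proof. by move=> h; rewrite /F spf_top. Qed.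

Lemma F_bot x l : l < - opnorm T -> F x l = 0.
Proof. by move=> h; rewrite /F spf_bot// bopE rdot0l. Qed.

Lemma mus_setT x : mus x setT = (sqn x)%:E.
Proof.
pose G (n : nat) := `]- (opnorm T + n.+1%:R), opnorm T + n.+1%:R]%classic : set (measurableTypeR R).
have GT : \bigcup_n G n = setT.
  apply/seteqP; split => // t _.
  have M0 := opnorm_ge0 T; have := archi_boundP (normr_ge0 t); set n := Num.bound _ => hn.
  exists n => //; rewrite /G /= in_itv /=; move: hn; rewrite ltr_norml -natr1 => /andP[h1 h2].
  by apply/andP; split; lra.
have := @nondecreasing_cvg_mu _ _ _ (mus x) G _ _ _.
rewrite GT => /(_ _ _ _) h.
have {}h : mus x \o G @ \oo --> mus x setT.
  apply: h => [i|//|n m nm]; first exact: measurable_itv.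
  apply/subsetPset => t; rewrite /G /= !in_itv /= => /andP[h1 h2].
  have : n.+1%:R <= m.+1%:R :> R by rewrite ler_nat.
  by move=> h3; apply/andP; split; lra.
have e : mus x \o G = cst (sqn x)%:E.
  apply/funext => n /=; have n0 : 0 < n.+1%:R :> R by rewrite ltr0n.
  have M0 := opnorm_ge0 T.
  have h1 : - (opnorm T + n.+1%:R) <= opnorm T + n.+1%:R by lra.
  have h2 : opnorm T <= opnorm T + n.+1%:R by lra.
  have h3 : - (opnorm T + n.+1%:R) < - opnorm T by lra.
  by have := mus_itv x h1; rewrite F_top// F_bot// subr0.
by rewrite e in h; apply: (cvg_unique _ h) => //; exact: cvg_cst.
Qed.

Lemma mus_lty x A : measurable A -> (mus x A < +oo)%E.
Proof.
move=> mA; apply: (@le_lt_trans _ _ (sqn x)%:E); last by rewrite ltry.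
by rewrite -mus_setT; apply: le_measure; rewrite ?inE//.
Qed.

Definition mr x A : R := fine (mus x A).

Lemma mrE x A : measurable A -> mus x A = (mr x A)%:E.
Proof. by move=> mA; rewrite /mr fineK// ge0_fin_numE// mus_lty. Qed.

Lemma mr_setT x : mr x setT = sqn x. Proof. by rewrite /mr mus_setT. Qed.

Lemma mr_ge0 x A : 0 <= mr x A. Proof. exact: fine_ge0. Qed.

Lemma mus_add x W A : projection W -> W * T = T * W -> measurable A ->
  mr x A = mr (W x) A + mr ((1 - W) x) A.
Proof.
move=> hW cW mA; apply: EFin_inj; rewrite EFinD -!mrE//.
pose nu : {measure set (measurableTypeR R) -> \bar R} := measure_add (mus (W x)) (mus ((1 - W) x)).
have nuE (C : set (measurableTypeR R)) : nu C = (mus (W x) C + mus ((1 - W)%R x) C)%E by exact: measure_addE.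
rewrite (@mus_unique x nu)// => a b ab; rewrite nuE !mus_itv// -EFinD; congr (_%:E).
have key l : F (W x) l + F ((1 - W) x) l = F x l.
  by rewrite /F [RHS](@quad_split (spf l) W)//; apply: spf_comm.
rewrite -!key; ring.
Qed.

Lemma mr_setDI x A C : measurable A -> measurable C -> mr x C = mr x (A `&` C) + mr x (C `\` A).
Proof.
move=> mA mC; apply: EFin_inj; rewrite EFinD -!mrE//; try exact: measurableI; try exact: measurableD.
rewrite -measureU//; [|exact: measurableI|exact: measurableD|].
- by rewrite setIC setUC setDUK' || (congr (mus x _); apply/seteqP; split => t /=; [have [?|?] := pselect (A t); [left|right]|move=> [[]|[]]]).
- by apply/seteqP; split => // t [[? _] [_ ?]].
Qed.

Lemma mr_le x A C : measurable A -> measurable C -> A `<=` C -> mr x A <= mr x C.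
Proof.
move=> mA mC AC; rewrite -lee_fin -!mrE//; apply: le_measure => //; rewrite inE//.
Qed.

(* [Q] is the spectral projection of the Borel set [A] *)
Definition specproj A (Q : B) := [/\ projection Q, forall W, W * T = T * W -> W * Q = Q * W &
  forall x C, measurable C -> mr x (A `&` C) = mr (Q x) C].

Lemma specproj_sqn A Q x : specproj A Q -> sqn (Q x) = mr x A.
Proof. by move=> [_ _ h]; rewrite -mr_setT -h// setIT. Qed.

Lemma specproj_unique A Q Q' : specproj A Q -> specproj A Q' -> Q = Q'.
Proof.
move=> h h'; have [hQ _ _] := h; have [hQ' _ _] := h'.
apply: quad_ext; [exact: hQ.2|exact: hQ'.2|move=> x].
by rewrite !proj_sqn// (specproj_sqn x h) (specproj_sqn x h').
Qed.

Lemma specprojI A A' Q Q' : measurable A -> measurable A' -> specproj A Q -> specproj A' Q' ->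
  specproj (A `&` A') (Q * Q').
Proof.
move=> mA mA' [hQ cQ rQ] [hQ' cQ' rQ'].
have c : Q * Q' = Q' * Q by apply: cQ'; apply/esym/cQ.
split.
- split; last by rewrite adjM hQ.2 hQ'.2.
  by rewrite -mulrA (mulrA Q') -c -mulrA hQ'.1 mulrA hQ.1.
- by move=> W hW; rewrite mulrA cQ// -mulrA cQ'// mulrA.
- move=> x C mC; rewrite bopE -rQ// -rQ'; last exact: measurableI.
  by rewrite setIA (setIC A').
Qed.

Lemma F_min x l m : F (spf l x) m = F x (Num.min m l).
Proof.
rewrite /F adjPr (spf_proj l).2 -!bop_mulE (spf_comm m (esym (spf_commT l))).
rewrite -mulrA (spf_proj l).1; case: (leP m l) => h; first by rewrite spf_mono.
by rewrite (proj_le (spf_proj l) (spf_proj m) (spf_mono (ltW h))).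
Qed.

Lemma specproj_itv a b : a <= b -> specproj `]a, b]%classic (spf b - spf a).
Proof.
move=> ab; have hQ := sub_proj ab; split => //.
  by move=> W hW; rewrite mulrBr mulrBl !spf_comm.
have FQ x l : F ((spf b - spf a) x) l = F x (Num.min l b) - F x (Num.min l a).
  have e : (spf b - spf a) x = (1 - spf a) (spf b x).
    by rewrite -bop_mulE mulrBl mul1r spf_mono.
  have := @quad_split (spf l) (spf a) (spf b x) (spf_proj a) (spf_comm l (esym (spf_commT a))).
  rewrite -e -!/(F _ _) !F_min.
  have -> : Num.min (Num.min l a) b = Num.min l a by rewrite -minA (min_l ab).
  by move=> ->; ring.
move=> x C mC; apply: EFin_inj; rewrite -mrE; last exact: measurableI.
pose nu : {measure set (measurableTypeR R) -> \bar R} := mrestr (mus x) (measurable_itv `]a, b] : measurable (`]a, b]%classic : set (measurableTypeR R))).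
have nuE (D : set (measurableTypeR R)) : nu D = mus x (D `&` `]a, b]%classic) by [].
rewrite -mrE//; transitivity (nu C); first by rewrite nuE setIC.
apply/esym/mus_unique => // c d cd; rewrite nuE.
have -> : `]c, d]%classic `&` `]a, b]%classic = `](Num.max c a), (Num.min d b)]%classic :> set (measurableTypeR R).
  apply/seteqP; split => t; rewrite /= !in_itv /= gt_max le_min.
    by move=> [/andP[-> ->] /andP[-> ->]].
  by move=> /andP[/andP[-> ->] /andP[-> ->]].
rewrite !FQ.
have [h|h] := leP (Num.max c a) (Num.min d b).
  rewrite mus_itv//; congr (_%:E); move: h; rewrite ge_max !le_min => /andP[/andP[_ cb] /andP[ad _]].
  rewrite (min_l cb) (min_r ad); case: (leP c a) => ca; ring.
rewrite set_itv_ge ?measure0; last by rewrite bnd_simp -leNgt ltW.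
congr (_%:E); move: h; rewrite lt_max !gt_min => /orP[/orP[h|h]|/orP[h|h]].
- by have := lt_le_trans h cd; rewrite ltxx.
- have ac := le_trans ab (ltW h); have bd := ltW (lt_le_trans h cd); have ad := le_trans ab bd.
  by rewrite !min_r// ?subrr ?(ltW h)//.
- have ca := ltW (le_lt_trans cd h); have db := ltW (lt_le_trans h ab); have cb := le_trans ca ab.
  by rewrite !min_l// ?(ltW h)// !subrr.
- by have := lt_le_trans h ab; rewrite ltxx.
Qed.

Lemma specprojT : specproj setT 1.
Proof.
split; [by split; [rewrite mulr1|exact: adj1]|by move=> W _; rewrite mulr1 mul1r|].
by move=> x C _; rewrite setTI.
Qed.

(** A monotone class argument from half-open intervals: a proper difference of sets gives the
    difference of the projections, an increasing union gives their strong limit. *)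
Lemma specproj_exists A : measurable A -> exists Q, specproj A Q.
Proof.
pose D := [set A : set (measurableTypeR R) | measurable A /\ exists Q, specproj A Q].
suff : <<s (@ocitv R) >> `<=` D by move=> h mA; have [] := h A mA.
apply: lambda_system_subset => //; first exact: ocitvI.
  split => //.
  - by split; [exact: measurableT|exists 1; exact: specprojT].
  - move=> A' C CA [mA [Q hQ]] [mC [Q' hQ']]; split; first exact: measurableD.
    have e : Q * Q' = Q'.
      have hh := specprojI mA mC hQ hQ'.
      by apply: (specproj_unique hh); rewrite (_ : _ `&` _ = C)//; apply/setIidPr.
    have [pQ cQ rQ] := hQ; have [pQ' cQ' rQ'] := hQ'.
    have cc : Q * Q' = Q' * Q by apply: cQ'; apply/esym/cQ.
    exists (Q - Q'); split.
    + split; last by rewrite adjB pQ.2 pQ'.2.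
      by rewrite mulrBl !mulrBr pQ.1 pQ'.1 -cc e subrr subr0.
    + by move=> W hW; rewrite mulrBr mulrBl cQ// cQ'.
    + move=> x G mG.
      have h1 := mr_setDI x mC (measurableI _ _ mA mG).
      rewrite rQ// in h1.
      have -> : (A' `\` C) `&` G = (A' `&` G) `\` C by rewrite !setDE setIAC.
      have e1 : C `&` (A' `&` G) = C `&` G by rewrite setIA; congr (_ `&` _); apply/setIidPl.
      rewrite e1 rQ'// in h1.
      have : Q' * T = T * Q' by apply/esym/cQ'.
      move=> h3; have := mus_add (Q x) pQ' h3 mG.
      have -> : Q' (Q x) = Q' x by rewrite -bop_mulE -cc e.
      have -> : (1 - Q') (Q x) = (Q - Q') x by rewrite -bop_mulE mulrBl mul1r -cc e.
      lra.
  - move=> Fn nd hF; have mF n : measurable (Fn n) by case: (hF n).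
    split; first by apply: bigcup_measurable => k _; exact: mF.
    have [Qn hQn] := choice (fun n => (hF n).2).
    have pQ n : projection (Qn n) by case: (hQn n).
    have inc n k : (n <= k)%N -> Qn n * Qn k = Qn n.
      move=> nk; have := specprojI (mF n) (mF k) (hQn n) (hQn k).
      have -> : Fn n `&` Fn k = Fn n by apply/setIidPl/subsetPset/nd.
      by move=> h; apply: (specproj_unique h (hQn n)).
    have [P [hP QP hl cP]] := proj_lim pQ inc.
    have mFC C : measurable C -> measurable (\bigcup_n Fn n `&` C).
      by move=> mC; apply: measurableI => //; apply: bigcup_measurable => k _; exact: mF.
    exists P; split => //.
      by move=> W hW; apply: cP => n; have [_ h _] := hQn n; exact: h.
    move=> x C mC.
    have cv : (fun n => mr x (Fn n `&` C)) @ \oo --> mr x (\bigcup_n Fn n `&` C).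
      have := @nondecreasing_cvg_mu _ _ _ (mus x) (fun n => Fn n `&` C).
      rewrite -setI_bigcupl => h; apply: fine_cvg; rewrite fineK; last first.
        by rewrite ge0_fin_numE// mus_lty//; exact: mFC.
      apply: h => [n||n k nk]; first by apply: measurableI; [exact: mF|].
        exact: mFC.
      by apply/subsetPset; apply: setSI; apply/subsetPset/nd.
    apply: (cvg_unique _ cv) => //.
    apply/cvgrPdist_le => e e0; have [n0 hn] := hl x e e0; exists n0 => // n /= hn'.
    have [_ cQ rQ] := hQn n.
    have cT : Qn n * T = T * Qn n by apply/esym/cQ.
    rewrite rQ// (mus_add (P x) (pQ n) cT mC).
    have -> : Qn n (P x) = Qn n x by rewrite -bop_mulE QP.
    rewrite addrAC subrr add0r ger0_norm ?mr_ge0//.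
    have -> : (1 - Qn n) (P x) = P x - Qn n x by rewrite !bopE -bop_mulE QP.
    by apply: le_trans (hn n hn'); rewrite sqnBC -mr_setT; apply: mr_le.
move=> _ [[a b]] _ <- /=; split; first exact: measurable_itv.
have [ab|ba] := leP a b; first by exists (spf b - spf a); exact: specproj_itv.
exists 0; rewrite set_itv_ge; last by rewrite bnd_simp -leNgt ltW.
split; first by split; [rewrite mul0r|exact: adj0].
  by move=> W _; rewrite mulr0 mul0r.
move=> x C mC; rewrite set0I bop_zeroE.
have -> : mr x set0 = 0 by rewrite /mr measure0.
by apply/esym/eqP; rewrite eq_le mr_ge0 andbT -(sqn0 H) -mr_setT mr_le.
Qed.

Definition spm A : B := xget 0 [set Q | specproj A Q].

Lemma spmP A : measurable A -> specproj A (spm A).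
Proof.
by move=> mA; have [Q hQ] := specproj_exists mA; rewrite /spm; case: xgetP => [//|/(_ Q)].
Qed.

Lemma spm_itv a b : a <= b -> spm `]a, b]%classic = spf b - spf a.
Proof. by move=> ab; apply: specproj_unique (specproj_itv ab); apply: spmP; exact: measurable_itv. Qed.

End SpectralFamily.

(** * Spectral integrals and the local characterisation of f(T) *)

Section SpectralMeasures.
Variables (R : realType) (H : hilbertType R).
Local Notation B := (bop H).
Local Notation mT := (measurableTypeR R).

Lemma integral_support (nu : {measure set mT -> \bar R}) (A : set mT) (f : R -> R) :
  measurable A -> nu (~` A) = 0%E -> continuous f ->
  \int[nu]_l f l = \int[nu]_(l in A) f l.
Proof.
move=> mA h fc; rewrite /Rintegral; congr fine; rewrite [RHS]integral_mkcond.
have mf : measurable_fun [set: mT] (fun l : mT => (f l)%:E).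
  by apply/measurable_EFinP; exact: continuous_measurable_fun.
apply: ae_eq_integral => //.
  by apply/(measurable_restrictT _ mA); exact: measurable_funS mf.
exists (~` A); split => //; first exact: measurableC.
move=> t /=; apply: contra_notP => /contrapT At _.
by rewrite patchE mem_set.
Qed.

Variables (T : B) (sT : adj T = T) (M : R) (TM : opnorm T <= M).

Record pvm (E : set mT -> B) (mu : H -> {measure set mT -> \bar R}) : Prop := Pvm {
  pvm_proj : forall A, measurable A -> projection (E A);
  pvmI : forall A A', measurable A -> measurable A' -> E (A `&` A') = E A * E A';
  pvmT : E setT = 1;
  pvm_supp : E `[- M, M]%classic = 1;
  pvm_mu : forall x A, measurable A -> mu x A = (rdot (E A x) x)%:E
}.

Section pvm_theory.
Variables (E : set mT -> B) (mu : H -> {measure set mT -> \bar R}) (hE : pvm E mu).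

Lemma pvm_sqn x A : measurable A -> mu x A = (sqn (E A x))%:E.
Proof. by move=> mA; rewrite (pvm_mu hE)// proj_sqn//; exact: (pvm_proj hE). Qed.

Lemma pvm_restrict x A C : measurable A -> measurable C -> mu (E A x) C = mu x (C `&` A).
Proof.
by move=> mA mC; rewrite !pvm_sqn ?(pvmI hE)//; exact: measurableI.
Qed.

Lemma pvmC A : measurable A -> E (~` A) = 1 - E A.
Proof.
move=> mA; apply: quad_ext.
- exact: (pvm_proj hE (measurableC mA)).2.
- exact: (projC (pvm_proj hE mA)).2.
move=> x.
have h : mu x setT = (mu x A + mu x (~` A))%E.
  rewrite -measureU//; [by rewrite setUCr|exact: measurableC|by rewrite setICr].
move: h; rewrite !(pvm_mu hE)//; last exact: measurableC.
by rewrite -EFinD => -[]; rewrite (pvmT hE) bop_subE rdotBl => ->; rewrite addrC addKr.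
Qed.

Lemma pvm_fin x A : measurable A -> (mu x A < +oo)%E.
Proof. by move=> mA; rewrite pvm_sqn// ltry. Qed.

Lemma cont_integrable x (A : set mT) (f : R -> R) : measurable A -> A `<=` `[- M, M]%classic -> continuous f ->
  (mu x).-integrable A (EFin \o f).
Proof.
move=> mA hA fc; apply: measurable_bounded_integrable => //; first exact: pvm_fin.
  by apply: measurable_funS (continuous_measurable_fun fc).
have Kc : compact (f @` `[- M, M]%classic).
  by apply: continuous_compact; [apply: continuous_subspaceT|exact: segment_compact].
have [K [Kr hK]] := compact_bounded Kc.
exists K; split => // r Kr' t At /=; apply: hK => //.
by exists t => //; exact: hA.
Qed.

Lemma pvm_suppC x : mu x (~` `[- M, M]%classic) = 0%E.
Proof.
rewrite pvm_sqn ?pvmC ?(pvm_supp hE)//; last by apply: measurableC; exact: measurable_itv.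
by rewrite subrr sqn0.
Qed.

Let D : set mT := `[- M, M]%classic.
Let mD : measurable D. Proof. exact: measurable_itv. Qed.

Lemma pvm_int_split x A f : measurable A -> continuous f ->
  \int[mu x]_l f l = \int[mu (E A x)]_l f l + \int[mu ((1 - E A) x)]_l f l.
Proof.
move=> mA fc; rewrite !(integral_support mD (pvm_suppC _) fc) /Rintegral.
have i1 z := @cont_integrable z D f mD (fun _ h => h) fc.
rewrite -fineD; try by apply: integrable_fin_num => //; exact: i1.
have mfD : measurable_fun D (fun l : mT => (f l)%:E).
  by apply/measurable_EFinP; apply: measurable_funS (continuous_measurable_fun fc).
congr fine; rewrite -integral_measure_add//; try exact: i1.
apply: eq_measure_integral => C mC _; rewrite -pvmC//; apply: etrans (esym (measure_addE _ _ _)).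
rewrite !pvm_restrict//; last exact: measurableC.
rewrite -measureU//; try exact: measurableI; try by apply: measurableI => //; exact: measurableC.
  by rewrite -setIUr setUCr setIT.
by rewrite setIACA setICr setI0.
Qed.

Lemma slice_int f a b y e : a < b -> continuous f ->
  (forall l, a <= l <= b -> `|f l - f a| <= e) ->
  E `]a, b]%classic y = y -> `|\int[mu y]_l f l - f a * sqn y| <= e * sqn y.
Proof.
move=> ab fc hf yQ.
have mI : measurable (`]a, b]%classic : set mT) by exact: measurable_itv.
pose A : set mT := `]a, b]%classic `&` D.
have mA : measurable A by exact: measurableI.
have muA : mu y A = (sqn y)%:E.
  by rewrite pvm_sqn// /A (pvmI hE)// (pvm_supp hE) mulr1 yQ.
have muAC : mu y (~` A) = 0%E.
  rewrite pvm_sqn ?pvmC//; last exact: measurableC.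
  have : sqn (E A y) = sqn y by apply: EFin_inj; rewrite -muA pvm_sqn.
  have := proj_pyth y (pvm_proj hE mA) => -> h.
  by congr (_%:E); lra.
rewrite (integral_support mA muAC fc).
have iA g : continuous g -> (mu y).-integrable A (EFin \o g).
  by move=> gc; apply: cont_integrable => // t [].
have cc (k : R) : continuous (fun _ : R => k) by move=> z; exact: cvg_cst.
have -> : f a * sqn y = \int[mu y]_(_ in A) f a by rewrite Rintegral_cst// muA.
rewrite -RintegralB//; [|exact: iA|exact: iA].
apply: le_trans (le_normr_Rintegral _ _) _ => //.
  by apply: (iA (fun l => f l - f a)) => z; apply: cvgB; [exact: fc|exact: cvg_cst].
have -> : e * sqn y = \int[mu y]_(_ in A) e by rewrite Rintegral_cst// muA.
apply: le_Rintegral => //; [|exact: iA|].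
  apply: (iA (fun l => `|f l - f a|)) => z.
  by apply: cvg_norm; apply: cvgB; [exact: fc|exact: cvg_cst].
by move=> l [/= h _]; apply: hf; move: h; rewrite in_itv /= => /andP[/ltW -> ->].
Qed.

(** [slice_comm] and [slice_quad] are the two links between T and E that the comparison needs. They
    follow from the integral representation of T, and for the constructed family they are known
    before that representation. *)
Definition slice_comm := forall A, measurable A -> E A * T = T * E A.

Definition slice_quad := forall a b y, a < b -> E `]a, b]%classic y = y ->
  `|rdot (T y) y - a * sqn y| <= (b - a) * sqn y.

(** The integral splits over a Borel set and its complement, so T has the quadratic form of its
    diagonal blocks and is equal to their sum. *)
Lemma int_slice_comm : (forall x, rdot (T x) x = \int[mu x]_l l) -> slice_comm.
Proof.
move=> h A mA; have hQ := pvm_proj hE mA; have hQ' := projC hQ.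
have ic : continuous (@id R) by move=> z; exact: cvg_id.
have e : T = E A * T * E A + (1 - E A) * T * (1 - E A).
  apply: quad_ext => // [|x]; first by rewrite adjD !adjM sT hQ.2 hQ'.2 !mulrA.
  have hs := pvm_int_split x mA ic; rewrite -!h in hs.
  rewrite hs [in RHS]bop_addE [in RHS]rdotDl !bop_mulE.
  by rewrite [X in _ = X + _]adjP hQ.2 [X in _ = _ + X]adjP hQ'.2.
have z1 : E A * (1 - E A) = 0 by rewrite mulrBr mulr1 hQ.1 subrr.
have z2 : (1 - E A) * E A = 0 by rewrite mulrBl mul1r hQ.1 subrr.
have e1 : E A * T = E A * T * E A.
  by rewrite {1}e mulrDr !mulrA z1 !mul0r addr0 hQ.1.
have e2 : T * E A = E A * T * E A.
  by rewrite {1}e mulrDl -!mulrA z2 !mulr0 addr0 hQ.1.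
by rewrite e1 -e2.
Qed.

Lemma int_slice_quad : (forall x, rdot (T x) x = \int[mu x]_l l) -> slice_quad.
Proof.
move=> h a b y ab hy; rewrite h; have ic : continuous (@id R) by move=> z; exact: cvg_id.
apply: (slice_int ab ic _ hy) => l /andP[h1 h2].
by rewrite ger0_norm ?subr_ge0//; lra.
Qed.

Hypotheses (hcomm : slice_comm) (hslice : slice_quad).

(* This local estimate near approximate eigenvectors characterises [f(T)]; it
   holds both for [Phi] and for the spectral integral. *)
Definition fcalc f (K : B) := forall e, 0 < e -> exists2 c, 0 <= c & forall a y, `|a| <= M + 1 ->
  `|rdot (K y) y - f a * sqn y| <= e * sqn y + c * sqn (T y - a%:C *: y).

(** (T - a) Q is self-adjoint, so the bound on its quadratic form is a bound on its norm. *)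
Lemma slice_dist a b y : a < b -> E `]a, b]%classic y = y ->
  sqn (T y - a%:C *: y) <= (b - a) ^+ 2 * sqn y.
Proof.
move=> ab; set Q := E `]a, b]%classic; move=> yQ.
have mI : measurable (`]a, b]%classic : set mT) by exact: measurable_itv.
have hQ : projection Q by exact: (pvm_proj hE).
have cQ : Q * T = T * Q by exact: hcomm.
pose S := (T - a%:C *: (1 : B)) * Q.
have eS z : rdot (S z) z = rdot (T (Q z)) (Q z) - a * sqn (Q z).
  have -> : S = Q * (T - a%:C *: (1 : B)) * Q.
    by rewrite /S mulrBl bop_scaleAl mul1r mulrBr cQ bop_scaleAr mulr1 mulrBl -mulrA hQ.1 bop_scaleAl hQ.1.
  by rewrite !bop_mulE adjP hQ.2 !bopE rdotDl rdotNl rdotZl.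
have sS : adj S = S.
  by rewrite /S adjM adjB adjZ adj1 sT hQ.2 mulrBr mulrBl cQ bop_scaleAr bop_scaleAl mulr1 mul1r.
have h : opnorm S <= b - a.
  apply: sa_opnorm => [|//|z]; first by rewrite subr_ge0 ltW.
  have QQ : Q (Q z) = Q z by rewrite -bop_mulE hQ.1.
  rewrite eS; apply: le_trans (hslice ab QQ) _.
  have h3 : sqn (Q z) <= sqn z by rewrite (proj_pyth z hQ) lerDl.
  by rewrite ler_wpM2l// subr_ge0 ltW.
have := sqn_opnorm_le y h; rewrite /S bop_mulE yQ !bopE; exact.
Qed.

(** The defect <K y, y> - int f d(mu y) is additive over orthogonal slices commuting with T and K.
    On a thin slice both terms are close to f(a) |y|^2, by the local estimate for K and by
    continuity of f for the integral. *)
Lemma pvm_calculus f K : continuous f -> adj K = K -> (forall W, W * T = T * W -> W * K = K * W) -> fcalc f K ->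
  forall x, rdot (K x) x = \int[mu x]_l f l.
Proof.
move=> fc sK cK hK x.
have M0 : 0 <= M by apply: le_trans TM; exact: opnorm_ge0.
have M1 : 0 < M + 1 by lra.
apply/eqP; rewrite -subr_eq0 -normr_eq0 eq_le normr_ge0 andbT.
apply/ler_addgt0Pl => d d0; rewrite addr0.
have x1 : 0 < sqn x + 1 by have := sqn_ge0 x; lra.
pose e := d / 4 / (sqn x + 1).
have e0 : 0 < e by rewrite !divr_gt0.
have [c1 c10 h1] := hK e e0; have [c2 c20 h2] := cont_modl_itv fc e0 M1.
(* mesh [h] with [(c1 + c2) h^2 <= 2 e] *)
have [N hN] : exists N : nat, (c1 + c2 + 1) * (2 * (M + 1) / N.+1%:R) ^+ 2 <= 2 * e.
  pose k := (c1 + c2 + 1) * (2 * (M + 1)) ^+ 2.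
  have k0 : 0 < k by rewrite mulr_gt0 ?exprn_gt0//; lra.
  have [n0 hn] := inv_small (divr_gt0 e0 k0); exists n0.
  have h := hn _ (leqnn n0); have n1 : 0 < n0.+1%:R :> R by rewrite ltr0n.
  have n2 : n0.+1%:R^-1 <= 1 :> R by rewrite invf_le1// ler1n.
  rewrite exprMn mulrA -/k expr2 mulrA.
  have i0 : 0 <= n0.+1%:R^-1 :> R by rewrite invr_ge0.
  apply: (@le_trans _ _ (k * n0.+1%:R^-1)).
    by rewrite -[leRHS]mulr1 ler_wpM2l// mulr_ge0// ltW.
  have := ltW h; rewrite ler_pdivlMr//; move: (n0.+1%:R^-1) => p; lra.
pose h := 2 * (M + 1) / N.+1%:R; have hp : 0 < h by rewrite divr_gt0//; lra.
(* The grid starts at - (M + 1) because the slices are open on the left and have to cover - M. *)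
pose a (i : nat) := - (M + 1) + i%:R * h.
have aS i : a i.+1 = a i + h by rewrite /a -natr1; ring.
have aN : a N.+1 = M + 1.
  by rewrite /a /h mulrC divfK ?pnatr_eq0//; ring.
have abound i : (i <= N.+1)%N -> `|a i| <= M + 1.
  move=> hi; have : (i%:R : R) <= N.+1%:R by rewrite ler_nat.
  move=> hi'; have : i%:R * h <= N.+1%:R * h by rewrite ler_wpM2r// ltW.
  have : N.+1%:R * h = 2 * (M + 1) by rewrite /h mulrC divfK ?pnatr_eq0.
  have : 0 <= i%:R * h by rewrite mulr_ge0// ltW.
  by rewrite /a ler_norml => *; apply/andP; split; lra.
pose Dif y := rdot (K y) y - \int[mu y]_l f l.
(* One e from the estimate for K, one from the integral, and 2 e from the mesh term (c1 + c2)
   h^2. *)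
pose ee := 4 * e.
have slice i z : (i < N.+1)%N -> `|Dif (E `]a i, a i.+1]%classic z)| <= ee * sqn (E `]a i, a i.+1]%classic z).
  move=> hi; set y := E _ z; have ab : a i < a i.+1 by rewrite aS; lra.
  have yQ : E `]a i, a i.+1]%classic y = y.
    by rewrite /y -bop_mulE (pvm_proj hE (measurable_itv _)).1.
  have ha := abound i (ltnW hi); have hb := abound i.+1 hi.
  have s1 := h1 (a i) y ha; have s2 := slice_dist ab yQ.
  have s3 : `|\int[mu y]_l f l - f (a i) * sqn y| <= (e + c2 * h ^+ 2) * sqn y.
    apply: (slice_int ab fc _ yQ) => l /andP[l1 l2].
    have hl : `|l| <= M + 1.
      by move: ha hb; rewrite !ler_norml => /andP[? ?] /andP[? ?]; apply/andP; split; lra.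
    apply: le_trans (h2 _ _ hl ha) _; rewrite lerD2l ler_wpM2l// ler_pXn2r// ?nnegrE; [|lra|lra].
    by move: l2; rewrite aS; lra.
  have e1 : a i.+1 - a i = h by rewrite aS; lra.
  rewrite e1 in s2; have sy := sqn_ge0 y.
  have s4 := ler_wpM2l c10 s2.
  have s5 : (c1 + c2) * h ^+ 2 <= 2 * e.
    apply: le_trans hN; rewrite ler_wpM2r ?sqr_ge0//; lra.
  have s6 := ler_wpM2r sy s5.
  have tri := ler_distD (f (a i) * sqn y) (rdot (K y) y) (\int[mu y]_l f l).
  rewrite /Dif /ee; apply: le_trans tri _.
  rewrite [X in _ + X <= _]distrC; apply: le_trans (lerD s1 s3) _.
  move: s4 s6; move: (sqn y) (sqn (T y - _)) (h ^+ 2) => u v w; nra.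
have split y A : measurable A -> Dif y = Dif (E A y) + Dif ((1 - E A) y).
  move=> mA; rewrite /Dif (pvm_int_split y mA fc) (@quad_split _ _ K (E A) y (pvm_proj hE mA)).
    lra.
  by apply: cK; exact: hcomm.
have ind i z : (i <= N.+1)%N -> `|Dif (E `]a 0%N, a i]%classic z)| <= ee * sqn (E `]a 0%N, a i]%classic z).
  elim: i => [|i IH] hi.
    rewrite set_itv_ge ?bnd_simp ?ltxx//.
    have E0 : E set0 = 0 by rewrite -setCT pvmC// (pvmT hE) subrr.
    rewrite E0 bop_zeroE /Dif bop0 rdot0l sqn0 mulr0.
    have -> : \int[mu 0]_l f l = 0.
      rewrite (@integral_support _ set0)//; first by rewrite Rintegral_set0.
      by rewrite setC0 pvm_sqn// bop0 sqn0.
    by rewrite subrr normr0.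
  have m0 j : measurable (`]a 0%N, a j]%classic : set mT) by exact: measurable_itv.
  have m1 : measurable (`]a i, a i.+1]%classic : set mT) by exact: measurable_itv.
  have a0i : a 0%N <= a i by rewrite /a mul0r addr0 lerDl mulr_ge0// ltW.
  have ai1 : a i <= a i.+1 by rewrite aS; lra.
  set y := E _ z.
  have e1 : E `]a 0%N, a i]%classic y = E `]a 0%N, a i]%classic z.
    rewrite /y -bop_mulE -(pvmI hE)//; congr (bop_fun _ _); congr E.
    apply/seteqP; split => t; rewrite /= !in_itv /=; first by case.
    by move=> /andP[t1 t2]; rewrite t1 t2 (le_trans t2).
  have e2 : (1 - E `]a 0%N, a i]%classic) y = E `]a i, a i.+1]%classic z.
    rewrite -pvmC// /y -bop_mulE -(pvmI hE)//; last exact: measurableC.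
    congr (bop_fun _ _); congr E.
    apply/seteqP; split => t; rewrite /= !in_itv /=.
      move=> [h3 /andP[t1 t2]]; rewrite t2 andbT ltNge; apply/negP => t3; apply: h3.
      by rewrite t1 t3.
    move=> /andP[t1 t2]; rewrite t2 (le_lt_trans a0i t1); split => //.
    by move=> /andP[_]; rewrite leNgt t1.
  rewrite (split y _ (m0 i)) (proj_pyth y (pvm_proj hE (m0 i))) e1 e2 mulrDr.
  by apply: le_trans (ler_normD _ _) _; apply: lerD; [exact: IH (ltnW hi)|exact: slice].
have := ind N.+1 x (leqnn _); rewrite aN.
have -> : E `]a 0%N, M + 1]%classic = 1.
  have mJ : measurable (`]a 0%N, M + 1]%classic : set mT) by exact: measurable_itv.
  rewrite -[LHS]mulr1 -(pvm_supp hE) -(pvmI hE)//.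
  congr E; apply/seteqP; split => t; rewrite /= !in_itv /=; first by case.
  move=> /andP[t1 t2]; rewrite t1 t2 /a mul0r addr0; split => //; apply/andP; split; lra.
rewrite bop_oneE /Dif => hh; apply: le_trans hh _.
rewrite /ee /e; have -> : 4 * (d / 4 / (sqn x + 1)) * sqn x = d * sqn x / (sqn x + 1).
  by field; rewrite gt_eqF.
by rewrite ler_pdivrMr// ler_wpM2l ?(ltW d0)//; lra.
Qed.

Lemma fcalc_id : fcalc id T.
Proof.
move=> e e0; exists (4 * e)^-1 => [|a y _]; first by rewrite invr_ge0; lra.
have -> : rdot (T y) y - id a * sqn y = rdot (T y - a%:C *: y) y by rewrite rdotBl rdotZl.
have := rdot_le (T y - a%:C *: y) y (c := (2 * e)^-1); have := rdot_le (- (T y - a%:C *: y)) y (c := (2 * e)^-1).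
have p : 0 < (2 * e)^-1 by rewrite invr_gt0; lra.
move=> /(_ p) + /(_ p); rewrite rdotNl sqnN invrK => u1 u2.
have e1 : (2 * e)^-1 = 2 * (4 * e)^-1 by field; rewrite gt_eqF.
rewrite e1 in u1 u2; rewrite ler_norml; apply/andP; split; lra.
Qed.

End pvm_theory.
End SpectralMeasures.

(** * Borel functional calculus *)

Section BorelCalculus.
Variables (R : realType) (H : hilbertType R).
Local Notation B := (bop H).
Local Notation mT := (measurableTypeR R).
Implicit Types T X K P Q : B.

Lemma hdot_sa T x : adj T = T -> hdot (T x) x = (rdot (T x) x)%:C.
Proof.
move=> hT; rewrite hdotE; congr (_ +i* _).
have : rdot (T x) ('i *: x) = - rdot (T x) ('i *: x).
  by rewrite {1}rdotC rdoti (sa_dot x _ hT) bopZ.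
lra.
Qed.

Lemma proj_sub_range P Q y : projection P -> projection Q -> P * Q = P -> (Q - P) y = y ->
  Q y = y /\ P y = 0.
Proof.
move=> hP hQ h hy; have h' := proj_le hP hQ h.
have e1 : Q y = y by rewrite -[in LHS]hy -bop_mulE mulrBr h' hQ.1 hy.
by split=> //; rewrite -[in LHS]hy -bop_mulE mulrBr h hP.1 subrr.
Qed.

Lemma hdot_real_sa T : (forall x, exists r : R, hdot (T x) x = r%:C) -> adj T = T.
Proof.
move=> h; have him x : rdot (T x) ('i *: x) = 0.
  by have [r] := h x; rewrite hdotE => -[].
apply: adj_eq => x y.
have := him (x + y); rewrite scalerDr !bopD !rdotDl !rdotDr !him => h1.
rewrite !add0r !addr0 in h1.
have := him (x + 'i *: y).
have ii (z : H) : 'i *: ('i *: z) = - z by rewrite scalerA -expr2 sqrCi scaleN1r.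
rewrite scalerDr ii !bopD !rdotDl !rdotDr him bopZ rdotNr !rdotNr !rdoti ii rdotNr.
rewrite him (rdotC x (T y)); lra.
Qed.

Lemma spectral_measure_pvm T E mu : spectral_measure T E mu -> pvm (opnorm T) E mu.
Proof. by case=> h1 h2 [h3 h4] h5 h6; split. Qed.

Lemma spectral_measure_int T E mu x : spectral_measure T E mu -> rdot (T x) x = \int[mu x]_l l.
Proof. by case=> h1 h2 [h3 h4] h5 h6; rewrite /rdot h6. Qed.

Lemma spectral_measure_calculus T E mu f K x : adj T = T -> spectral_measure T E mu ->
  continuous f -> adj K = K -> (forall W, W * T = T * W -> W * K = K * W) -> fcalc T (opnorm T) f K ->
  rdot (K x) x = \int[mu x]_l f l.
Proof.
move=> sT hS fc sK cK hK.
have hE := spectral_measure_pvm hS; have hi y := spectral_measure_int y hS.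
apply: (@pvm_calculus _ _ T sT (opnorm T) (lexx _) E mu hE _ _ f K) => //; [exact: int_slice_comm hE hi|exact: int_slice_quad hE hi].
Qed.

Section existence.
Variables (T : B) (sT : adj T = T).
Let spf (l : R) := pker (T - l%:C *: (1 : B)).
Let hF : specfam T spf. Proof. exact: pker_specfam. Qed.
Let M := opnorm T.

(** The intervals ]- M - 1/k, M] carry all the mass, and the complements of these intervals exhaust
    the complement of [- M, M]. *)
Let mus_out x : mus hF x (~` `[- M, M]%classic) = 0%E.
Proof.
pose A (k : nat) : set mT := ~` `]- M - k.+1%:R^-1, M]%classic.
have mA k : measurable (A k) by apply: measurableC; exact: measurable_itv.
have nA k : mus hF x (A k) = 0%E.
  have mI : measurable (`]- M - k.+1%:R^-1, M]%classic : set mT) by exact: measurable_itv.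
  have k0 : 0 < k.+1%:R^-1 :> R by rewrite invr_gt0 ltr0n.
  have M0 : 0 <= M := opnorm_ge0 T.
  have h : mr hF x `]- M - k.+1%:R^-1, M]%classic = sqn x.
    rewrite /mr mus_itv; last by move: (k.+1%:R^-1) k0 => p; lra.
    rewrite (F_top hF)// (F_bot hF) ?subr0//.
    by rewrite -/M; move: (k.+1%:R^-1) k0 => p; lra.
  rewrite mrE//; congr (_%:E).
  have := mr_setDI hF x mI (@measurableT _ mT); rewrite setIT h mr_setT setTD => e.
  by move: e; rewrite -/(A k); lra.
have nn : (mus hF x).-negligible (\bigcup_k A k).
  by apply: negligible_bigcup => k; exists (A k); split.
have mC : measurable (~` `[- M, M]%classic : set mT) by apply: measurableC; exact: measurable_itv.
apply: measure_negligible => //; apply: negligibleS nn => t /= ht.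
have [h1|h1] := leP t M; last first.
  by exists 0%N => //= -[]; rewrite /= in_itv /= leNgt h1 andbF.
have h2 : t < - M by rewrite ltNge; apply/negP => h2; apply: ht; rewrite /= in_itv /= h1 h2.
have t0 : 0 < - M - t by rewrite subr_gt0.
have [n hn] := inv_small t0.
have := hn n (leqnn _) => h3; exists n => //; rewrite /A /= in_itv /= => /andP[h4 _].
by move: h3 h4; move: (n.+1%:R^-1) => p; lra.
Qed.

Let spm_pvm : pvm M (spm hF) (mus hF).
Proof.
have mr1 x A : measurable A -> mus hF x A = (rdot (spm hF A x) x)%:E.
  by move=> mA; rewrite mrE// -(specproj_sqn x (spmP hF mA)) proj_sqn//; case: (spmP hF mA).
split.
- by move=> A mA; case: (spmP hF mA).
- move=> A A' mA mA'; have := specprojI mA mA' (spmP hF mA) (spmP hF mA').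
  by apply: specproj_unique; exact: spmP (measurableI _ _ mA mA').
- by apply: (specproj_unique _ (specprojT hF)); exact: spmP.
- have mI : measurable (`[- M, M]%classic : set mT) by exact: measurable_itv.
  apply: quad_ext; [by case: (spmP hF mI) => -[]|exact: adj1|move=> x].
  have hx := mr1 x _ mI; rewrite bop_oneE; apply: EFin_inj; rewrite -hx mrE//; congr (_%:E).
  have := mr_setDI hF x mI (@measurableT _ mT); rewrite setIT mr_setT setTD => e.
  by rewrite -/(sqn x) e [X in _ = _ + X]/mr mus_out addr0.
- exact: mr1.
Qed.

(** The representation of T by its spectral integral is the case K = T, f = id of [pvm_calculus]. *)
Lemma spectral_measure_exists : exists E mu, spectral_measure T E mu.
Proof.
exists (spm hF), (mus hF).
have [h1 h2 h3 h4 h5] := spm_pvm; split => //.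
move=> x; rewrite hdot_sa//; congr (_%:C).
apply: (@pvm_calculus _ _ T sT M (lexx _) (spm hF) (mus hF) spm_pvm _ _ (@id R)) => //.
- by move=> A mA; have [_ h _] := spmP hF mA; rewrite h.
- move=> a b y ab; rewrite (spm_itv hF (ltW ab)) => hy.
  have e1 := spf_mono hF (ltW ab).
  have pa := spf_proj hF a; have pb := spf_proj hF b.
  have [yb ya] := proj_sub_range pa pb e1 hy.
  have ya' : (1 - spf a) y = y by rewrite bop_subE ya subr0.
  have := spf_le hF b y; have := spf_ge hF a y; rewrite yb ya' => i1 i2.
  have s0 := sqn_ge0 y.
  rewrite ger0_norm; nra.
- by move=> z; exact: cvg_id.
- exact: fcalc_id.
Qed.
End existence.

(** [borel_calculus] picks an unspecified spectral measure, so K must match the integral for every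
    one of them; the existence of one rules out the default value. *)
Lemma borel_calculusE T f K : adj T = T -> adj K = K ->
  (forall E mu, spectral_measure T E mu -> forall x, rdot (K x) x = \int[mu x]_l f l) ->
  borel_calculus f T = K.
Proof.
move=> sT sK h; have [E [mu hS]] := spectral_measure_exists sT.
rewrite /borel_calculus; case: xgetP => [X _ [E' [mu' [hS' hX]]]|/(_ K)[]].
  apply: quad_ext => //; first by apply: hdot_real_sa => x; rewrite hX; eexists.
  by move=> x; rewrite (h _ _ hS') /rdot hX.
by exists E, mu; split => // x; rewrite hdot_sa// (h _ _ hS).
Qed.

Lemma borel_calculus_cont T f K : adj T = T -> continuous f -> adj K = K ->
  (forall W, W * T = T * W -> W * K = K * W) -> fcalc T (opnorm T) f K -> borel_calculus f T = K.
Proof. by move=> sT fc sK cK hK; apply: borel_calculusE => // E mu hS x; exact: (spectral_measure_calculus x sT hS fc sK cK hK). Qed.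

Section halfline.
Variables (T : B) (sT : adj T = T) (E : set mT -> B) (mu : H -> {measure set mT -> \bar R}).
Hypothesis hS : spectral_measure T E mu.
Let M := opnorm T.
Let hE : pvm M E mu := spectral_measure_pvm hS.
Let hi y := spectral_measure_int y hS.
Let cE : slice_comm T E := int_slice_comm sT hE hi.
Let A : set mT := [set x : R | 0 <= x].
Let mA : measurable A.
Proof. by have -> : A = `[0, +oo[%classic by apply/seteqP; split => t; rewrite /A /= in_itv /= andbT. Qed.
Let D : set mT := `[- M, M]%classic.
Let mD : measurable D. Proof. exact: measurable_itv. Qed.
Let idc : continuous (@id R). Proof. by move=> z; exact: cvg_id. Qed.

Let mu0 y C : measurable C -> E C y = y -> mu y (~` (C `&` D)) = 0%E.
Proof.
move=> mC yC; have mCD := measurableI _ _ mC mD.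
rewrite (pvm_sqn hE); last exact: measurableC.
by rewrite (pvmC hE)// (pvmI hE)// (pvm_supp hE) mulr1 bop_subE bop_oneE yC subrr sqn0.
Qed.

Let pos y : E A y = y -> 0 <= rdot (T y) y.
Proof.
move=> yA; rewrite hi (integral_support (measurableI _ _ mA mD) (mu0 mA yA) idc).
by apply: Rintegral_ge0 => t [].
Qed.

(** The indicator is not continuous, so the two projections are compared directly. On the range of E
    A the form of T is nonnegative, whereas off [pker (- T)] it is strictly negative. Conversely, on
    [pker (- T)] the form is nonnegative, so the slices below - 1/n carry no mass. *)
Lemma halfline_pker : E A = pker (- T).
Proof.
have sN : adj (- T) = - T by rewrite adjN sT.
have [P1 P2] := pker_proj (- T); have [Q1 Q2] := pvm_proj hE mA.
have cP C : measurable C -> E C * pker (- T) = pker (- T) * E C.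
  by move=> mC; apply: pker_comm => //; rewrite mulrN mulNr cE.
have e1 : (1 - pker (- T)) * E A = 0.
  apply: bopP => x; rewrite bop_mulE bop_zeroE; apply: pker_pos0 => //; apply/le_anti.
  rewrite pker_pos// andbT bop_oppE rdotNl oppr_le0; apply: pos.
  have -> : E A ((1 - pker (- T)) (E A x)) = (E A * (1 - pker (- T)) * E A) x by [].
  by rewrite mulrBr mulr1 cP// -{1}[E A]mul1r -mulrBl -mulrA Q1.
have e2 : pker (- T) * (1 - E A) = 0.
  apply: bopP => x; rewrite bop_mulE bop_zeroE; set y := pker _ _.
  have Py : pker (- T) y = y by rewrite /y -bop_mulE P1.
  have CC : (1 - E A) y = y.
    have c1 : (1 - E A) * pker (- T) = pker (- T) * (1 - E A).
      by rewrite mulrBl mulrBr mul1r mulr1 cP.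
    have -> : (1 - E A) y = ((1 - E A) * pker (- T) * (1 - E A)) x by [].
    by rewrite c1 -mulrA (projC (pvm_proj hE mA)).1.
  have hz n : mu y `]- M - 1, - n.+1%:R^-1]%classic = 0%E.
    have mI : measurable (`]- M - 1, - n.+1%:R^-1]%classic : set mT) by exact: measurable_itv.
    rewrite (pvm_sqn hE)//; set z := E _ y.
    have Pz : pker (- T) z = z by rewrite /z -bop_mulE -cP// bop_mulE Py.
    have n0 : 0 < n.+1%:R^-1 :> R by rewrite invr_gt0 ltr0n.
    have n1 : n.+1%:R^-1 <= 1 :> R by rewrite invf_le1// ler1n.
    have zI : E `]- M - 1, - n.+1%:R^-1]%classic z = z by rewrite /z -bop_mulE (pvm_proj hE mI).1.
    have := pker_neg z sN; rewrite Pz bop_oppE rdotNl oppr_le0 => t0.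
    congr (_%:E); have s0 := sqn_ge0 z.
    have M0 : 0 <= M := opnorm_ge0 T.
    have [ab|ba] := ltP (- M - 1) (- n.+1%:R^-1).
      have := int_slice_quad hE hi ab zI; move: ab n0 n1; move: (n.+1%:R^-1) => p ab n0 n1.
      rewrite ler_norml => /andP[_]; nra.
    rewrite -zI set_itv_ge ?bnd_simp -?leNgt// -setCT (pvmC hE)// (pvmT hE) subrr.
    by rewrite bop_zeroE sqn0.
  apply: sqn_eq0; apply: EFin_inj; rewrite -[in LHS](bop_oneE y) -(pvmT hE) -(pvm_sqn hE)//.
  apply: measure_negligible => //.
  have -> : (@setT R) = (~` (~` A `&` D)) `|` \bigcup_n `]- M - 1, - n.+1%:R^-1]%classic.
    apply/seteqP; split => // t _; have [[At Dt]|] := pselect ((~` A `&` D) t); last by left.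
    right; have t0 : t < 0 by move: At => /negP; rewrite -ltNge.
    have t1 : 0 < - t by rewrite oppr_gt0.
    have [n hn] := inv_small t1.
    have := hn n (leqnn n) => h3; exists n => //=; rewrite in_itv /=.
    move: Dt; rewrite /D /= in_itv /= => /andP[d1 _]; apply/andP; split; first lra.
    by move: h3; move: (n.+1%:R^-1) => p; lra.
  apply: negligibleU.
    exists (~` (~` A `&` D)); split => //.
      by apply: measurableC; apply: measurableI => //; exact: measurableC.
    by apply: mu0; [exact: measurableC|rewrite (pvmC hE)].
  apply: negligible_bigcup => n; exists `]- M - 1, - n.+1%:R^-1]%classic; split => //.
move: e1 e2 => /eqP; rewrite mulrBl mul1r subr_eq0 => /eqP e1 /eqP.
by rewrite mulrBr mulr1 subr_eq0 => /eqP e2; rewrite e1 -e2.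
Qed.

Let fi (f : R -> R) C x : measurable_fun [set: mT] f -> (forall l, `|f l| <= 1) -> measurable C -> (mu x).-integrable C (EFin \o f).
Proof.
move=> mf bf mC; apply: measurable_bounded_integrable => //; first exact: (pvm_fin hE).
  exact: measurable_funS mf.
by exists 1; split => // r r1 t _ /=; apply: le_trans (bf t) (ltW r1).
Qed.

Lemma int_halfline x : \int[mu x]_l (\1_[set x : R | 0 <= x] l) = rdot (pker (- T) x) x.
Proof.
by rewrite -halfline_pker /Rintegral integral_indic// setIT (pvm_mu hE).
Qed.

Lemma int_sign x : \int[mu x]_l (sign_fun l) = rdot ((2%:R%:C *: pker (- T) - 1) x) x.
Proof.
have -> : \int[mu x]_l (sign_fun l) = \int[mu x]_l (2 * \1_A l - 1).
  apply: eq_Rintegral => l _; rewrite /sign_fun indicE /A.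
  by case: ifPn => h; [rewrite mem_set//= mulr1; lra|rewrite memNset /= ?mulr0 ?add0r//; exact/negP].
have iA : (mu x).-integrable setT (EFin \o (\1_A : R -> R)).
  apply: fi => // l.
  by rewrite indicE; case: (_ \in _); rewrite ?normr1 ?normr0.
have i1 : (mu x).-integrable setT (EFin \o (fun=> 1 : R)).
  by apply: fi => // l; rewrite normr1.
rewrite RintegralB//; last first.
  by rewrite (_ : _ \o _ = (fun l => 2%:E * (EFin \o (\1_A : R -> R)) l)%E)//; exact: integrableZl.
rewrite RintegralZl// int_halfline Rintegral_cst// (pvm_mu hE)// (pvmT hE).
by rewrite bop_subE bop_scaleE rdotBl rdotZl mul1r.
Qed.
End halfline.

Lemma nonneg_projE T : adj T = T -> nonneg_proj T = pker (- T).
Proof.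
move=> sT; apply: borel_calculusE => //; first exact: (pker_proj _).2.
by move=> E mu hS x; rewrite (int_halfline sT hS).
Qed.

Lemma borel_signE T : adj T = T -> borel_calculus (@sign_fun R) T = 2%:R%:C *: pker (- T) - 1.
Proof.
move=> sT; apply: borel_calculusE => //; first by rewrite adjB adjZ adj1 (pker_proj _).2.
by move=> E mu hS x; rewrite (int_sign sT hS).
Qed.

(** The bridge from the calculus of the statement, applied to |T|, to [sfun]: the local estimate for
    [sfun] is taken with respect to |T|. *)
Lemma borel_calculus_abs L f T : 0 < L -> adj T = T -> opnorm T <= L -> continuous f ->
  borel_calculus f (abs_op T) = sfun L f T.
Proof.
move=> L0 sT TL fc; have hA := abs_opE L0 sT TL.
have hp := absv_psd L0 sT TL; have hs := absv_sqr L0 sT TL.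
have hl := sfun_local L0 sT TL fc; rewrite hA; move: hp hs hl.
move: (absv L T) => Q hp hs hl.
apply: borel_calculus_cont => //; [exact: hp.1|exact: sfun_sa| |].
  by move=> W hW; apply: sfun_comm2 => //; rewrite -hs mulrA hW -mulrA hW mulrA.
move=> e e0; have LM : L <= L + opnorm Q + 1 by have := opnorm_ge0 Q; lra.
by have [c c0 h] := hl _ _ e0 LM; exists c => // a y ha; apply: h; lra.
Qed.

End BorelCalculus.

(** * The trace ideal *)

Section Trace.
Variables (R : realType) (H : hilbertType R).
Local Notation B := (bop H).

Lemma sfun_ext (L : R) f g (S : B) : 0 < L -> (forall x, 0 <= x <= L -> f x = g x) -> sfun L f S = sfun L g S.
Proof.
move=> L0 fg; apply: Phi_ext => x /sqrt01/andP[s0 s1]; apply: fg.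
by rewrite mulr_ge0 ?(ltW L0)//= ler_piMr// ltW.
Qed.

(** [sfun] applies a function to |T|, which for a positive T is T itself. *)
Lemma psd_sqrt (T : B) : psd T ->
  exists b : B, [/\ psd b, b * b = T & forall W, W * T = T * W -> W * b = b * W].
Proof.
move=> pT; pose L := opnorm T + 1; have L0 : 0 < L by have := opnorm_ge0 T; rewrite /L; lra.
have hL : opnorm T <= L by rewrite /L; lra.
have sc : continuous (Num.sqrt : R -> R) by exact: sqrt_continuous.
exists (sfun L Num.sqrt T); split.
- by apply: sfun_psd pT.1 hL _ sc _ => // x _; exact: sqrtr_ge0.
- rewrite -(sfun_mul L0 pT.1 hL sc sc) (@sfun_ext L _ id)//; last first.
    by move=> x /andP[x0 _]; rewrite -expr2 sqr_sqrtr.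
  by symmetry; exact: (absv_unique L0 pT.1 hL pT).
- by move=> W hW; apply: sfun_comm => //; exact: pT.1.
Qed.

Variables (N : set B) (tau : B -> \bar R).
Hypotheses (N_vN : von_neumann_algebra N) (tau_trace : fns_trace N tau).
Implicit Types S T K E x y : B.

Lemma vNP T : N T <-> forall W, commutant N W -> W * T = T * W.
Proof. by rewrite -{1}N_vN.2; split=> h W hW; exact: h. Qed.

Lemma vN_adj T : N T -> N (adj T). Proof. exact: N_vN.1. Qed.

Lemma vN0 : N 0. Proof. by apply/vNP => W _; rewrite mulr0 mul0r. Qed.
Lemma vN1 : N 1. Proof. by apply/vNP => W _; rewrite mulr1 mul1r. Qed.

Lemma vND S T : N S -> N T -> N (S + T).
Proof. by move=> /vNP h1 /vNP h2; apply/vNP => W hW; rewrite mulrDl mulrDr h1// h2. Qed.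

Lemma vNN T : N T -> N (- T).
Proof. by move=> /vNP h; apply/vNP => W hW; rewrite mulrN mulNr h. Qed.

Lemma vNB S T : N S -> N T -> N (S - T).
Proof. by move=> h1 h2; apply: vND => //; exact: vNN. Qed.

Lemma vNM S T : N S -> N T -> N (S * T).
Proof. by move=> /vNP h1 /vNP h2; apply/vNP => W hW; rewrite mulrA h1// -mulrA h2// mulrA. Qed.

Lemma vNZ (k : R[i]) T : N T -> N (k *: T).
Proof. by move=> /vNP h; apply/vNP => W hW; rewrite bop_scaleAl bop_scaleAr h. Qed.

Lemma vNX T n : N T -> N (T ^+ n).
Proof. by move=> h; elim: n => [|n IH]; [exact: vN1|rewrite exprS; exact: vNM]. Qed.

Lemma vN_peval p T : N T -> N (peval p T).
Proof. by move=> /vNP h; apply/vNP => W hW; apply: peval_comm; exact: h. Qed.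

Lemma vN_sfun L f S : 0 < L -> adj S = S -> opnorm S <= L -> continuous f -> N S -> N (sfun L f S).
Proof. by move=> L0 sS hS fc /vNP h; apply/vNP => W hW; apply: sfun_comm => //; exact: h. Qed.

Lemma vN_pker S : adj S = S -> N S -> N (pker S).
Proof. by move=> sS /vNP h; apply/vNP => W hW; apply: pker_comm => //; exact: h. Qed.

Lemma positive_partE T : positive_part N T <-> N T /\ psd T.
Proof. by split=> -[h1 /positive_opE h2]; split. Qed.

Definition ft T := [/\ N T, psd T & (tau T < +oo)%E].
Definition tr T : R := fine (tau T).

Lemma ftE T : finite_trace_pos N tau T <-> ft T.
Proof. by split=> [[/positive_partE[? ?] ?]|[? ? ?]]; split => //; exact/positive_partE. Qed.

Lemma tau_ge0 T : N T -> psd T -> (0 <= tau T)%E.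
Proof. by move=> nT pT; apply: (trace_ge0 tau_trace); exact/positive_partE. Qed.

Lemma tauE T : ft T -> tau T = (tr T)%:E.
Proof. by move=> [nT pT fT]; rewrite fineK// ge0_fin_numE//; exact: tau_ge0. Qed.

Lemma tr_ge0 T : N T -> psd T -> 0 <= tr T.
Proof. by move=> nT pT; apply: fine_ge0; exact: tau_ge0. Qed.

Lemma tauD S T : N S -> psd S -> N T -> psd T -> tau (S + T) = (tau S + tau T)%E.
Proof. by move=> *; apply: (trace_add tau_trace); exact/positive_partE. Qed.

Lemma ftD S T : ft S -> ft T -> ft (S + T) /\ tr (S + T) = tr S + tr T.
Proof.
move=> fS fT; have [nS pS _] := fS; have [nT pT _] := fT.
have e : tau (S + T) = (tr S + tr T)%:E by rewrite tauD// !tauE.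
by rewrite /tr e; split => //; split; [exact: vND|exact: psdD|rewrite e ltry].
Qed.

Lemma ftZ (c : R) T : 0 <= c -> ft T -> ft (c%:C *: T) /\ tr (c%:C *: T) = c * tr T.
Proof.
move=> c0 fT; have [nT pT _] := fT.
have e : tau (c%:C *: T) = (c * tr T)%:E.
  by rewrite (trace_scale tau_trace)//; [rewrite tauE|exact/positive_partE].
by rewrite /tr e; split => //; split; [exact: vNZ|exact: psdZ|rewrite e ltry].
Qed.

Lemma tau0 : tau 0 = 0%E.
Proof.
have := @trace_scale _ _ _ _ tau_trace 0 0 (lexx 0); rewrite scaler0 mul0e; apply.
by apply/positive_partE; split; [exact: vN0|exact: psd0].
Qed.

Lemma ft0 : ft 0.
Proof. by split; [exact: vN0|exact: psd0|rewrite tau0 ltry]. Qed.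

Lemma tr0 : tr 0 = 0. Proof. by rewrite /tr tau0. Qed.

Lemma tau_le S T : N S -> psd S -> N T -> psd (T - S) -> (tau S <= tau T)%E.
Proof.
move=> nS pS nT pTS; have -> : T = S + (T - S) by rewrite addrC subrK.
rewrite tauD//; last exact: vNB.
by rewrite leeDl// tau_ge0//; exact: vNB.
Qed.

Lemma ft_le S T : N S -> psd S -> ft T -> psd (T - S) -> ft S /\ tr S <= tr T.
Proof.
move=> nS pS fT pTS; have [nT pT tT] := fT; have h := tau_le nS pS nT pTS.
have fS : ft S by split => //; apply: le_lt_trans tT.
by split => //; rewrite -lee_fin -!tauE.
Qed.

Lemma tauC T : N T -> tau (adj T * T) = tau (T * adj T).
Proof. exact: (trace_cyclic tau_trace). Qed.

Lemma psd_normal_le S (c : R) : opnorm S <= c -> psd ((c ^+ 2)%:C *: (1 : B) - S * adj S).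
Proof.
move=> hc; split.
  by rewrite adjB adjZ adj1 adjM adjK.
move=> z; rewrite bop_subE bop_scaleE rdotBl rdotZl subr_ge0 bop_mulE adjP.
by have := @sqn_opnorm_le _ _ (adj S) c z; rewrite opnorm_adj => /(_ hc).
Qed.

(** With T = b^2 the conjugate is (b S)^* (b S), and the trace property exchanges it for b S S^* b,
    which is at most c^2 T. *)
Lemma ft_conj S T (c : R) : N S -> opnorm S <= c -> ft T -> ft (adj S * T * S) /\ tr (adj S * T * S) <= c ^+ 2 * tr T.
Proof.
move=> nS hc fT; have [nT pT _] := fT; have [b [pb hb cb]] := psd_sqrt pT.
have nb : N b by apply/vNP => W hW; apply: cb; exact: (vNP T).1.
have e1 : adj S * T * S = adj (b * S) * (b * S) by rewrite adjM pb.1 -hb !mulrA.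
have e2 : tau (adj S * T * S) = tau (b * (S * adj S) * b).
  by rewrite e1 tauC; [rewrite adjM pb.1 !mulrA|exact: vNM].
have nS' := vN_adj nS.
have p2 : psd (b * (S * adj S) * b).
  by apply: psd_sa_conj; [exact: pb.1|have := psd_sqr (adj S); rewrite adjK].
have n2 : N (b * (S * adj S) * b) by do ![exact: vNM|apply: vNM].
have [fc tc] := ftZ (sqr_ge0 c) fT.
have p3 : psd ((c ^+ 2)%:C *: T - b * (S * adj S) * b).
  have := psd_sa_conj pb.1 (psd_normal_le hc).
  by rewrite mulrBr mulrBl bop_scaleAr mulr1 bop_scaleAl hb.
have [f2 t2] := ft_le n2 p2 fc p3.
rewrite -tc /tr e2; split => //; split.
- by do ![exact: vNM|apply: vNM].
- exact: psd_conj.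
- by rewrite e2; case: f2.
Qed.

(* [T] lies in the trace ideal with "trace norm" at most [m], in the guise of the
   decompositions into positive operators used by [trace_is]. *)
Definition tnb T (m : R) := exists T1 T2 T3 T4, [/\ ft T1 /\ ft T2, ft T3 /\ ft T4,
  T = (T1 - T2) + 'i *: (T3 - T4) & tr T1 + tr T2 + tr T3 + tr T4 <= m].

Lemma tnb_ft T m : ft T -> tr T <= m -> tnb T m.
Proof.
move=> fT h; exists T, 0, 0, 0; split; [split => //; exact: ft0|split; exact: ft0| |].
  by rewrite !subr0 scaler0 addr0.
by rewrite tr0 !addr0.
Qed.

Lemma tnbW T m m' : m <= m' -> tnb T m -> tnb T m'.
Proof.
by move=> h [T1 [T2 [T3 [T4 [h1 h2 h3 h4]]]]]; exists T1, T2, T3, T4; split => //; exact: le_trans h.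
Qed.

Lemma tnb_ge0 T m : tnb T m -> 0 <= m.
Proof.
move=> [T1 [T2 [T3 [T4 [[[? ? _] [? ? _]] [[? ? _] [? ? _]] _ h]]]]].
by apply: le_trans h; rewrite !addr_ge0// tr_ge0.
Qed.

Lemma tnb_vN T m : tnb T m -> N T.
Proof.
move=> [T1 [T2 [T3 [T4 [[[? ? _] [? ? _]] [[? ? _] [? ? _]] -> _]]]]].
by apply: vND; [|apply: vNZ]; exact: vNB.
Qed.

Lemma tnbD S T m m' : tnb S m -> tnb T m' -> tnb (S + T) (m + m').
Proof.
move=> [S1 [S2 [S3 [S4 [[s1 s2] [s3 s4] -> hS]]]]] [T1 [T2 [T3 [T4 [[t1 t2] [t3 t4] -> hT]]]]].
have [f1 e1] := ftD s1 t1; have [f2 e2] := ftD s2 t2.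
have [f3 e3] := ftD s3 t3; have [f4 e4] := ftD s4 t4.
exists (S1 + T1), (S2 + T2), (S3 + T3), (S4 + T4); split => //.
  by rewrite addrACA -scalerDr; congr (_ + _ *: _); rewrite opprD addrACA.
by rewrite e1 e2 e3 e4; lra.
Qed.

Lemma tnbN T m : tnb T m -> tnb (- T) m.
Proof.
move=> [T1 [T2 [T3 [T4 [[t1 t2] [t3 t4] -> hT]]]]]; exists T2, T1, T4, T3; split => //.
  by rewrite opprD -scalerN !opprB.
lra.
Qed.

Lemma tnbB S T m m' : tnb S m -> tnb T m' -> tnb (S - T) (m + m').
Proof. by move=> h1 h2; apply: tnbD => //; exact: tnbN. Qed.

Lemma tnbi T m : tnb T m -> tnb ('i *: T) m.
Proof.
move=> [T1 [T2 [T3 [T4 [[t1 t2] [t3 t4] -> hT]]]]]; exists T4, T3, T1, T2; split => //.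
  by rewrite scalerDr scalerA -expr2 sqrCi scaleN1r opprB addrC.
lra.
Qed.

Lemma tnbZ (c : R) T m : 0 <= c -> tnb T m -> tnb (c%:C *: T) (c * m).
Proof.
move=> c0 [T1 [T2 [T3 [T4 [[t1 t2] [t3 t4] -> hT]]]]].
have [f1 e1] := ftZ c0 t1; have [f2 e2] := ftZ c0 t2.
have [f3 e3] := ftZ c0 t3; have [f4 e4] := ftZ c0 t4.
exists (c%:C *: T1), (c%:C *: T2), (c%:C *: T3), (c%:C *: T4); split => //.
  by rewrite scalerDr !scalerBr !scalerA ['i * _]mulrC.
by rewrite e1 e2 e3 e4 -!mulrDr ler_wpM2l.
Qed.

Lemma tnb_adj T m : tnb T m -> tnb (adj T) m.
Proof.
move=> [T1 [T2 [T3 [T4 [[t1 t2] [t3 t4] -> hT]]]]]; exists T1, T2, T4, T3; split => //; last lra.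
have [_ [s1 _] _] := t1; have [_ [s2 _] _] := t2; have [_ [s3 _] _] := t3; have [_ [s4 _] _] := t4.
by rewrite adjD adjB adji adjB s1 s2 s3 s4 -scalerN opprB.
Qed.

Lemma adj_sqrD x y : adj (x + y) * (x + y) = (adj x * x + adj y * y) + (adj x * y + adj y * x).
Proof. by rewrite adjD mulrDl !mulrDr [adj y * x + _]addrC addrACA. Qed.

Lemma adj_sqrB x y : adj (x - y) * (x - y) = (adj x * x + adj y * y) - (adj x * y + adj y * x).
Proof. by rewrite adj_sqrD adjN mulrN mulNr opprK mulrN mulNr -opprD. Qed.

Lemma ft_sqrD x y : N x -> N y -> ft (adj x * x) -> ft (adj y * y) ->
  ft (adj (x + y) * (x + y)) /\ tr (adj (x + y) * (x + y)) <= 2 * tr (adj x * x) + 2 * tr (adj y * y).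
Proof.
move=> nx ny fx fy; have [fd ed] := ftD fx fy; have [f2 e2] := @ftZ 2 _ (ler0n _ 2) fd.
rewrite -mulrDr -ed -e2; apply: ft_le => //; [|exact: psd_sqr|].
  by apply: vNM; [apply: vN_adj|]; exact: vND.
have -> : 2%:C *: (adj x * x + adj y * y) - adj (x + y) * (x + y) = adj (x - y) * (x - y).
  by rewrite adj_sqrB adj_sqrD rmorphMn /= scaler_nat mulr2n opprD addrA addrK.
exact: psd_sqr.
Qed.

Lemma ft_sqrN y : ft (adj y * y) -> ft (adj (- y) * - y) /\ tr (adj (- y) * - y) = tr (adj y * y).
Proof. by rewrite adjN mulNr mulrN opprK. Qed.

Lemma polar_identity x y (h := (4^-1)%:C : R[i]) :
  adj y * x = (h *: (adj (x + y) * (x + y)) - h *: (adj (x - y) * (x - y))) +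
    'i *: (h *: (adj (x + 'i *: y) * (x + 'i *: y)) - h *: (adj (x - 'i *: y) * (x - 'i *: y))).
Proof.
pose c := (2^-1)%:C : R[i].
have hc : h + h = c by rewrite /h /c -rmorphD; congr (_%:C); lra.
have c1 : c + c = 1 by rewrite /c -rmorphD -[RHS]/(1%:C); congr (_%:C); lra.
have key (a z : B) : h *: (adj (a + z) * (a + z)) - h *: (adj (a - z) * (a - z)) = c *: (adj a * z + adj z * a).
  rewrite -scalerBr adj_sqrD adj_sqrB; move: (_ + _ : B) (adj a * z + _) => p r.
  by rewrite opprB addrC addrA subrK -mulr2n -scaler_nat scalerA mulr_natr mulr2n hc.
rewrite !key adji mulNr bop_scaleAr bop_scaleAl -scalerBr !scalerA.
have -> : 'i * c * 'i = - c by rewrite mulrAC -expr2 sqrCi mulN1r.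
move: (adj x * y) (adj y * x) => u v.
by rewrite scaleNr -scalerN opprB -scalerDr [u + v]addrC addrACA subrr addr0 scalerDr -scalerDl c1 scale1r.
Qed.

(** A product of two Hilbert-Schmidt operators lies in the trace ideal, by polarisation: four
    squares, each weighted by 1/4 and of trace at most 2 tr + 2 tr. *)
Lemma tnb_prod x y : N x -> N y -> ft (adj x * x) -> ft (adj y * y) ->
  tnb (adj y * x) (2 * tr (adj x * x) + 2 * tr (adj y * y)).
Proof.
move=> nx ny fx fy; have q0 : 0 <= 4^-1 :> R by rewrite invr_ge0.
have [fyi tyi] : ft (adj ('i *: y) * ('i *: y)) /\ tr (adj ('i *: y) * ('i *: y)) = tr (adj y * y).
  suff -> : adj ('i *: y) * ('i *: y) = adj y * y by [].
  by rewrite adji mulNr bop_scaleAl bop_scaleAr scalerA -expr2 sqrCi scaleN1r opprK.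
have nyi : N ('i *: y) by exact: vNZ.
have sub z : N z -> ft (adj z * z) -> ft (adj (x - z) * (x - z)) /\
    tr (adj (x - z) * (x - z)) <= 2 * tr (adj x * x) + 2 * tr (adj z * z).
  move=> nz fz; have [h1 h2] := ft_sqrN fz; rewrite -h2; apply: ft_sqrD => //; exact: vNN.
have [f1 t1] := ft_sqrD nx ny fx fy; have [f2 t2] := sub _ ny fy.
have [f3 t3] := ft_sqrD nx nyi fx fyi; have [f4 t4] := sub _ nyi fyi.
rewrite tyi in t3 t4.
have [g1 e1] := ftZ q0 f1; have [g2 e2] := ftZ q0 f2.
have [g3 e3] := ftZ q0 f3; have [g4 e4] := ftZ q0 f4.
do 4!eexists; split; [split; [exact: g1|exact: g2]|split; [exact: g3|exact: g4]|exact: polar_identity|].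
rewrite e1 e2 e3 e4; lra.
Qed.

Lemma tnb_lmul_ft S T : N S -> opnorm S <= 1 -> ft T -> tnb (S * T) (4 * tr T).
Proof.
move=> nS hS fT; have [nT pT _] := fT; have [b [pb hb cb]] := psd_sqrt pT.
have nb : N b by apply/vNP => W hW; apply: cb; exact: (vNP T).1.
have nS' := vN_adj nS.
have hS' : opnorm (adj S) <= 1 by rewrite opnorm_adj.
have [f1 t1] := ft_conj nS' hS' fT; rewrite adjK expr1n mul1r in f1 t1.
have e1 : adj (b * adj S) * (b * adj S) = S * T * adj S by rewrite adjM adjK pb.1 -hb !mulrA.
have e2 : adj b * b = T by rewrite pb.1.
have := @tnb_prod b (b * adj S) nb (vNM nb nS'); rewrite e1 e2 => /(_ fT f1).
rewrite adjM adjK pb.1 -mulrA hb; apply: tnbW; lra.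
Qed.

Lemma tnb_lmul1 S T m : N S -> opnorm S <= 1 -> tnb T m -> tnb (S * T) (4 * m).
Proof.
move=> nS hS [T1 [T2 [T3 [T4 [[t1 t2] [t3 t4] -> hT]]]]].
have h1 := tnb_lmul_ft nS hS t1; have h2 := tnb_lmul_ft nS hS t2.
have h3 := tnb_lmul_ft nS hS t3; have h4 := tnb_lmul_ft nS hS t4.
rewrite mulrDr bop_scaleAr !mulrBr.
have := tnbD (tnbB h1 h2) (tnbi (tnbB h3 h4)); apply: tnbW; lra.
Qed.

(** The factor 4 is the price of measuring the trace norm by decompositions into positive parts. It
    enters once per multiplication, and there are always boundedly many. *)
Lemma tnb_lmul S T c m : N S -> 0 < c -> opnorm S <= c -> tnb T m -> tnb (S * T) (4 * c * m).
Proof.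
move=> nS c0 hS hT.
have h1 : opnorm ((c^-1)%:C *: S) <= 1.
  by rewrite opnormZ gtr0_norm ?invr_gt0// mulrC ler_pdivrMr// mul1r.
have := tnbZ (ltW c0) (tnb_lmul1 (vNZ _ nS) h1 hT).
by rewrite bop_scaleAl scalerA -rmorphM mulfV ?gt_eqF// scale1r [4 * c]mulrC mulrA.
Qed.

Lemma tnb_rmul S T c m : N S -> 0 < c -> opnorm S <= c -> tnb T m -> tnb (T * S) (4 * c * m).
Proof.
move=> nS c0 hS hT; rewrite -[T * S]adjK adjM; apply: tnb_adj; apply: tnb_lmul => //.
- exact: vN_adj.
- by rewrite opnorm_adj.
- exact: tnb_adj.
Qed.

(* [rtr] is the real part of the trace on the trace ideal. *)
Definition rt T (z : R) := exists T1 T2, [/\ ft T1, ft T2, T + adj T = T1 - T2 & z = (tr T1 - tr T2) / 2].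

Definition rtr T : R := xget 0 (rt T).

Lemma rtrE T z : rt T z -> rtr T = z.
Proof.
move=> h; rewrite /rtr; case: xgetP => [z' _ h'|/(_ z)//].
have [T1 [T2 [f1 f2 e ->]]] := h; have [S1 [S2 [g1 g2 e' ->]]] := h'.
have [_ i1] := ftD f1 g2; have [_ i2] := ftD g1 f2.
suff : T1 + S2 = S1 + T2 by move=> h3; rewrite h3 in i1; lra.
by apply/eqP; rewrite -subr_eq -addrA [S2 - _]addrC addrA -e e' subrK.
Qed.

Lemma rtr_ft T : ft T -> rtr T = tr T.
Proof.
move=> fT; apply: rtrE; have [h1 h2] := ftD fT fT; exists (T + T), 0; split => //; first exact: ft0.
  by have [_ [-> _] _] := fT; rewrite subr0.
rewrite h2 tr0; lra.
Qed.

Lemma tnb_rt T m : tnb T m -> exists2 z, rt T z & `|z| <= m.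
Proof.
move=> [T1 [T2 [T3 [T4 [[t1 t2] [t3 t4] -> hT]]]]]; exists (tr T1 - tr T2).
  have [f1 e1] := ftD t1 t1; have [f2 e2] := ftD t2 t2.
  exists (T1 + T1), (T2 + T2); split => //; last by rewrite e1 e2; lra.
  have [_ [s1 _] _] := t1; have [_ [s2 _] _] := t2; have [_ [s3 _] _] := t3; have [_ [s4 _] _] := t4.
  by rewrite adjD adjB adji adjB s1 s2 s3 s4 addrACA subrr addr0 addrACA -opprD.
have [n1 p1 _] := t1; have [n2 p2 _] := t2; have [n3 p3 _] := t3; have [n4 p4 _] := t4.
have := tr_ge0 n1 p1; have := tr_ge0 n2 p2; have := tr_ge0 n3 p3; have := tr_ge0 n4 p4.
by move=> *; rewrite ler_norml; apply/andP; split; lra.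
Qed.

Definition tc T := exists m, tnb T m.

Lemma rtr_le T m : tnb T m -> `|rtr T| <= m.
Proof. by move=> /tnb_rt[z /rtrE ->]. Qed.

Lemma tc_rt T : tc T -> rt T (rtr T).
Proof. by move=> [m /tnb_rt[z h _]]; rewrite (rtrE h). Qed.

Lemma tcD S T : tc S -> tc T -> tc (S + T).
Proof. by move=> [m h] [m' h']; exists (m + m'); exact: tnbD. Qed.
Lemma tcN T : tc T -> tc (- T). Proof. by move=> [m h]; exists m; exact: tnbN. Qed.
Lemma tcB S T : tc S -> tc T -> tc (S - T).
Proof. by move=> hS hT; apply: tcD => //; exact: tcN. Qed.
Lemma tci T : tc T -> tc ('i *: T). Proof. by move=> [m h]; exists m; exact: tnbi. Qed.
Lemma tc_ft T : ft T -> tc T. Proof. by move=> h; exists (tr T); exact: tnb_ft. Qed.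
Lemma tc_vN T : tc T -> N T. Proof. by move=> [m h]; exact: tnb_vN h. Qed.

Lemma tc_lmul S T : N S -> tc T -> tc (S * T).
Proof.
move=> nS [m h]; exists (4 * (opnorm S + 1) * m); apply: tnb_lmul => //; have := opnorm_ge0 S; lra.
Qed.

Lemma tc_rmul S T : N S -> tc T -> tc (T * S).
Proof.
move=> nS [m h]; exists (4 * (opnorm S + 1) * m); apply: tnb_rmul => //; have := opnorm_ge0 S; lra.
Qed.

Lemma rtrD S T : tc S -> tc T -> rtr (S + T) = rtr S + rtr T.
Proof.
move=> /tc_rt [S1 [S2 [s1 s2 eS ->]]] /tc_rt [T1 [T2 [t1 t2 eT ->]]]; apply: rtrE.
have [f1 e1] := ftD s1 t1; have [f2 e2] := ftD s2 t2.
exists (S1 + T1), (S2 + T2); split => //; last by rewrite e1 e2; lra.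
by rewrite adjD addrACA eS eT opprD addrACA.
Qed.

Lemma rtrN T : tc T -> rtr (- T) = - rtr T.
Proof.
move=> /tc_rt [T1 [T2 [t1 t2 eT ->]]]; apply: rtrE; exists T2, T1; split => //; last lra.
by rewrite adjN -opprD eT opprB.
Qed.

Lemma rtrB S T : tc S -> tc T -> rtr (S - T) = rtr S - rtr T.
Proof. by move=> hS hT; rewrite rtrD ?rtrN//; exact: tcN. Qed.

Lemma rtr_adj T : tc T -> rtr (adj T) = rtr T.
Proof.
move=> /tc_rt [T1 [T2 [t1 t2 eT ->]]]; apply: rtrE; exists T1, T2; split => //.
by rewrite adjK addrC.
Qed.

Lemma rtrZ_ge0 (c : R) T : 0 <= c -> tc T -> rtr (c%:C *: T) = c * rtr T.
Proof.
move=> c0 /tc_rt [T1 [T2 [t1 t2 eT ->]]]; apply: rtrE.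
have [f1 e1] := ftZ c0 t1; have [f2 e2] := ftZ c0 t2.
exists (c%:C *: T1), (c%:C *: T2); split => //; last by rewrite e1 e2; lra.
by rewrite adjZ -scalerDr eT scalerBr.
Qed.

Lemma tcZ (c : R) T : tc T -> tc (c%:C *: T).
Proof. by move=> h; rewrite -[T]mul1r -bop_scaleAl; apply: tc_lmul => //; apply: vNZ; exact: vN1. Qed.

Lemma rtrZ (c : R) T : tc T -> rtr (c%:C *: T) = c * rtr T.
Proof.
move=> hT; have [c0|c0] := leP 0 c; first exact: rtrZ_ge0.
rewrite -[c]opprK rmorphN scaleNr rtrN; last exact: tcZ.
by rewrite rtrZ_ge0 ?mulNr// oppr_ge0 ltW.
Qed.

Lemma rtr0 : rtr 0 = 0. Proof. by rewrite rtr_ft ?tr0//; exact: ft0. Qed.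

Lemma rt_prod x y : N x -> N y -> ft (adj x * x) -> ft (adj y * y) ->
  rtr (adj y * x) = (tr (adj (x + y) * (x + y)) - tr (adj x * x) - tr (adj y * y)) / 2.
Proof.
move=> nx ny fx fy; have [f1 _] := ft_sqrD nx ny fx fy; have [f2 e2] := ftD fx fy.
apply: rtrE; exists (adj (x + y) * (x + y)), (adj x * x + adj y * y); split => //; last by rewrite e2; lra.
by rewrite adj_sqrD adjM adjK addrC [X in X - _]addrC addrK addrC.
Qed.

Lemma ft_swap z : N z -> ft (adj z * z) -> ft (z * adj z) /\ tr (z * adj z) = tr (adj z * z).
Proof.
move=> nz [h1 h2 h3]; rewrite /tr -tauC//; split => //; split.
- by apply: vNM => //; exact: vN_adj.
- by have := psd_sqr (adj z); rewrite adjK.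
- by rewrite -tauC.
Qed.

(** Polarisation expresses both sides by traces of squares z^* z and z z^*, where the trace property
    applies. *)
Lemma rtr_prodC x y : N x -> N y -> ft (adj x * x) -> ft (adj y * y) -> rtr (adj y * x) = rtr (x * adj y).
Proof.
move=> nx ny fx fy; rewrite rt_prod//.
have [fx' ex] := ft_swap nx fx; have [fy' ey] := ft_swap ny fy.
have [f1 _] := ft_sqrD nx ny fx fy; have [_ e1] := ft_swap (vND nx ny) f1.
have h : adj (adj (x + y)) * adj (x + y) = (x + y) * adj (x + y) by rewrite adjK.
have := @rt_prod (adj y) (adj x) (vN_adj ny) (vN_adj nx).
rewrite -adjD [y + x]addrC h !adjK => ->//; rewrite e1 ex ey; lra.
Qed.

(** With T = b^2, the two factors b are moved past S one at a time, each move being an exchange of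
    Hilbert-Schmidt factors. *)
Lemma rtrC_ft S T : N S -> ft T -> rtr (S * T) = rtr (T * S).
Proof.
move=> nS fT; have [nT pT _] := fT; have [b [pb hb cb]] := psd_sqrt pT.
have nb : N b by apply/vNP => W hW; apply: cb; exact: (vNP T).1.
have fb : ft (adj b * b) by rewrite pb.1 hb.
have nS' := vN_adj nS.
have f1 : ft (adj (b * S) * (b * S)).
  have [h _] := ft_conj nS (lexx _) fT; move: h.
  by rewrite adjM pb.1 -hb !mulrA.
have f1' : ft (adj (b * adj S) * (b * adj S)).
  have [h _] := ft_conj nS' (lexx _) fT; move: h.
  by rewrite adjM pb.1 adjK -hb !mulrA.
have n1 := vNM nb nS; have n1' := vNM nb nS'.
have [f2 _] := ft_swap n1 f1.
have := @rtr_prodC b (b * adj S) nb n1' fb f1'; rewrite adjM adjK pb.1 -mulrA hb mulrA => ->.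
have := @rtr_prodC (b * S) b n1 nb f1 fb; rewrite pb.1 => <-.
by rewrite mulrA hb.
Qed.

Lemma rtrC S T : N S -> tc T -> rtr (S * T) = rtr (T * S).
Proof.
move=> nS [m [T1 [T2 [T3 [T4 [[t1 t2] [t3 t4] -> hT]]]]]].
have niS : N ('i *: S) by exact: vNZ.
have L K : ft K -> tc (S * K) /\ tc (K * S) by move=> /tc_ft h; split; [exact: tc_lmul|exact: tc_rmul].
have L' K : ft K -> tc (('i *: S) * K) /\ tc (K * ('i *: S)) by move=> /tc_ft h; split; [exact: tc_lmul|exact: tc_rmul].
have [a1 b1] := L _ t1; have [a2 b2] := L _ t2; have [a3 b3] := L' _ t3; have [a4 b4] := L' _ t4.
have -> : S * (T1 - T2 + 'i *: (T3 - T4)) = (S * T1 - S * T2) + (('i *: S) * T3 - ('i *: S) * T4).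
  by rewrite mulrDr bop_scaleAr !mulrBr scalerBr !bop_scaleAl.
have -> : (T1 - T2 + 'i *: (T3 - T4)) * S = (T1 * S - T2 * S) + (T3 * ('i *: S) - T4 * ('i *: S)).
  by rewrite mulrDl bop_scaleAl !mulrBl scalerBr !bop_scaleAr.
rewrite (rtrD (tcB a1 a2) (tcB a3 a4)) (rtrD (tcB b1 b2) (tcB b3 b4)) !rtrB//.
by rewrite (rtrC_ft nS t1) (rtrC_ft nS t2) (rtrC_ft niS t3) (rtrC_ft niS t4).
Qed.

(** The adjoint of i X K is - i K X, so by cyclicity the real part of the trace of i X K is its own
    negative. Hence the trace of X K is real and [rtr] computes it. *)
Lemma trace_is_rtr X K : N X -> adj X = X -> ft K -> trace_is N tau (X * K) (rtr (X * K))%:C.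
Proof.
move=> nX sX fK; have tK := tc_ft fK; have [nK [sK _] _] := fK.
have niX : N ('i *: X) by exact: vNZ.
have tXK := tc_lmul nX tK.
have : rtr ('i *: (X * K)) = 0.
  have e : rtr (adj ('i *: (X * K))) = - rtr ('i *: (X * K)).
    rewrite adji adjM sX sK rtrN; last by apply: tci; exact: tc_rmul.
    by rewrite -bop_scaleAr -(rtrC niX tK) bop_scaleAl.
  by move: e; rewrite rtr_adj; [lra|exact: tci].
have [m [T1 [T2 [T3 [T4 [[t1 t2] [t3 t4] e hT]]]]]] := tXK.
have [_ [s1 _] _] := t1; have [_ [s2 _] _] := t2; have [_ [s3 _] _] := t3; have [_ [s4 _] _] := t4.
have r1 : rtr (X * K) = tr T1 - tr T2.
  rewrite e rtrD ?rtrB; try by [exact: tc_ft|apply: tcB; exact: tc_ft|apply: tci; apply: tcB; exact: tc_ft].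
  rewrite (rtr_ft t1) (rtr_ft t2); suff -> : rtr ('i *: (T3 - T4)) = 0 by rewrite addr0.
  apply: rtrE; exists 0, 0; split; [exact: ft0|exact: ft0| |by rewrite subrr mul0r].
  by rewrite adji adjB s3 s4 !subrr.
have r2 : rtr ('i *: (X * K)) = tr T4 - tr T3.
  rewrite e scalerDr scalerA -expr2 sqrCi scaleN1r opprB.
  rewrite rtrD ?rtrB; try by [exact: tc_ft|apply: tcB; exact: tc_ft|apply: tci; apply: tcB; exact: tc_ft].
  rewrite (rtr_ft t3) (rtr_ft t4); suff -> : rtr ('i *: (T1 - T2)) = 0 by rewrite add0r.
  apply: rtrE; exists 0, 0; split; [exact: ft0|exact: ft0| |by rewrite subrr mul0r].
  by rewrite adji adjB s1 s2 !subrr.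
rewrite r2 => e0; exists T1, T2, T3, T4; split; [by split; apply/ftE|by split; apply/ftE|exact: e|].
rewrite r1 -[fine (tau T1)]/(tr T1) -[fine (tau T2)]/(tr T2).
rewrite -[fine (tau T3)]/(tr T3) -[fine (tau T4)]/(tr T4).
have -> : tr T3 - tr T4 = 0 by lra.
by [].
Qed.

End Trace.

(** * The ideals Li_0^p *)

Section Smallness.
Variables (R : realType) (H : hilbertType R).
Local Notation B := (bop H).
Variables (N : set B) (tau : B -> \bar R).
Hypotheses (N_vN : von_neumann_algebra N) (tau_trace : fns_trace N tau).
Implicit Types S T K E Q W X Y : B.
Local Notation ft := (ft N tau).
Local Notation tr := (tr tau).
Local Notation tnb := (tnb N tau).

(** A self-adjoint T equals its real part T1 - T2, so a positive T is dominated by T1. *)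
Lemma psd_tnb_ft T m : N T -> psd T -> tnb T m -> ft T /\ tr T <= m.
Proof.
move=> nT pT [T1 [T2 [T3 [T4 [[t1 t2] [t3 t4] e hT]]]]].
have [n1 p1 _] := t1; have [n2 p2 _] := t2; have [n3 p3 _] := t3; have [n4 p4 _] := t4.
have e2 : T = T1 - T2.
  apply: quad_ext => [||z]; [exact: pT.1|by rewrite adjB p1.1 p2.1|].
  have := pT.1; rewrite e adjD adjB adji adjB p1.1 p2.1 p3.1 p4.1.
  move: (T1 - T2) ('i *: (T3 - T4)) => U V /(congr1 (fun X : B => rdot (X z) z)).
  rewrite bop_subE !bop_addE rdotBl !rdotDl; lra.
have pd : psd (T1 - T) by rewrite e2 opprB addrC subrK.
have [fT le] := ft_le N_vN tau_trace nT pT t1 pd; split => //; apply: le_trans le _.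
apply: le_trans hT; rewrite -!addrA lerDl !addr_ge0//; exact: (tr_ge0 tau_trace).
Qed.

(** Q is the spectral projection for |S| > 2 x. On its range |S y| >= 2 x |y| while |T1 y| <= x |y|,
    which leaves |T2 y| >= x |y|; hence x^2 Q <= Q T2^* T2 Q. The constant 64 comes from three
    multiplications of T2, at 4 each. *)
Lemma cut S L x m T1 T2 : N S -> adj S = S -> opnorm S <= L -> 0 < x ->
  S = T1 + T2 -> opnorm T1 <= x -> tnb T2 m ->
  exists Q, [/\ projection Q /\ (forall W, W * (S * S) = S * S * W -> W * Q = Q * W),
    ft Q, tr Q <= 64 * (L + x) * m / x ^+ 2,
    forall z, sqn (S ((1 - Q) z)) <= 4 * x ^+ 2 * sqn ((1 - Q) z) &
    forall z, 4 * x ^+ 2 * sqn (Q z) <= sqn (S (Q z))].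
Proof.
move=> nS sS hS x0 eS h1 h2.
pose D : B := S * S - (4 * x ^+ 2)%:C *: (1 : B).
have sD : adj D = D by rewrite adjB adjM sS adjZ adj1.
have hD y : rdot (D y) y = sqn (S y) - 4 * x ^+ 2 * sqn y.
  by rewrite bop_subE rdotBl bop_mulE (sa_dot _ _ sS) bop_scaleE rdotZl.
have cD W : W * (S * S) = S * S * W -> W * D = D * W.
  by move=> e; rewrite mulrBr mulrBl bop_scaleAl bop_scaleAr mulr1 mul1r e.
have nD : N D by apply: (vNB N_vN); [exact: vNM|apply: vNZ => //; exact: vN1].
have P1 := pker_proj D; have P2 := vN_pker N_vN sD nD.
have P3 W : W * (S * S) = S * S * W -> W * pker D = pker D * W.
  by move=> e; apply: pker_comm => //; exact: cD.
have P4 z := pker_neg z sD; have P5 z := pker_pos z sD.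
move: (pker D) P1 P2 P3 P4 P5 => P P1 P2 P3 P4 P5.
have hQ := projC P1; have nQ : N (1 - P) by apply: (vNB N_vN) => //; exact: vN1.
have Q5 z : 4 * x ^+ 2 * sqn ((1 - P) z) <= sqn (S ((1 - P) z)).
  by rewrite -subr_ge0 -hD; exact: P5.
have PP : 1 - (1 - P) = P by rewrite opprB addrC subrK.
have nT2 := tnb_vN N_vN h2.
have bT2 : opnorm T2 <= L + x.
  have -> : T2 = S - T1 by rewrite eS addrC addKr.
  by apply: le_trans (opnormB _ _) _; exact: lerD.
have Lx : 0 < L + x by have := opnorm_ge0 S; lra.
pose Y : B := (1 - P) * (adj T2 * T2) * (1 - P).
have nY : N Y by do 2![apply: (vNM N_vN) => //]; apply: (vNM N_vN) => //; exact: vN_adj.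
have tY : tnb Y (64 * (L + x) * m).
  have nT2' := vN_adj N_vN nT2.
  have bT2' : opnorm (adj T2) <= L + x by rewrite opnorm_adj.
  have h3 := tnb_lmul N_vN tau_trace nT2' Lx bT2' h2.
  have h4 := tnb_lmul N_vN tau_trace nQ ltr01 (proj_opnorm hQ) h3.
  have := tnb_rmul N_vN tau_trace nQ ltr01 (proj_opnorm hQ) h4; apply: tnbW; lra.
have pY : psd Y by apply: psd_sa_conj; [exact: hQ.2|exact: psd_sqr].
have [fY lY] := psd_tnb_ft nY pY tY.
have i0 : 0 <= (x ^+ 2)^-1 by rewrite invr_ge0 sqr_ge0.
have [fZ lZ] := ftZ N_vN tau_trace i0 fY.
have [fQ lQ] : ft (1 - P) /\ tr (1 - P) <= tr ((x ^+ 2)^-1%:C *: Y).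
  apply: (ft_le N_vN tau_trace) => //; first exact: proj_psd.
  split; first by rewrite adjB adjZ pY.1 hQ.2.
  move=> z; rewrite bop_subE rdotBl bop_scaleE rdotZl (proj_sqn z hQ) subr_ge0.
  rewrite ler_pdivlMl ?exprn_gt0// !bop_mulE (sa_dot _ _ hQ.2) -adjPr -/(sqn _).
  have := Q5 z; set y := (1 - P) z; have := sqn_opnorm_le y h1.
  have -> : S y = T1 y + T2 y by rewrite eS.
  have := sqnD_le (T1 y) (T2 y); nra.
exists (1 - P); split => //.
- split => // W e; rewrite mulrBr mulrBl mul1r mulr1 P3 //.
- by apply: le_trans lQ _; rewrite lZ mulrC ler_wpM2r.
- by move=> z; rewrite PP -subr_le0 -hD.
Qed.

Definition w (p : R) : R := 2^-1 `^ p.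

Lemma w_gt0 p : 0 < w p. Proof. by rewrite powR_gt0// invr_gt0. Qed.

Lemma wD p p' : w (p + p') = w p * w p'.
Proof. by rewrite /w powRD// invr_eq0 pnatr_eq0 implybT. Qed.

Lemma w_anti p p' : p' <= p -> w p <= w p'.
Proof. by move=> h; rewrite /w ger_powR//; apply/andP; split; lra. Qed.

Lemma w_half p : p <= 1 -> 2^-1 <= w p.
Proof. by move=> h; have := w_anti h; rewrite /w powRr1// invr_ge0. Qed.

Lemma w_le1 p : 0 <= p -> w p <= 1.
Proof. by move=> h; have := w_anti h; rewrite /w powRr0. Qed.

Lemma wX p n : w p ^+ n = (2^-1 ^+ n) `^ p.
Proof. by rewrite -powR_mulrn ?ltW ?w_gt0// powRAC powR_mulrn// invr_ge0. Qed.

(** At t = exp(e 2^n) the bound e^p (1 / log t)^p is 2^{- p n}. The little-o thus becomes a constant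
    C independent of e, with a trace norm allowed to grow at the arbitrarily small rate e. *)
Definition sm (p C : R) (M : R -> R) T := forall e, 0 < e -> forall n : nat,
  exists T1 T2, [/\ T = T1 + T2, N T1, opnorm T1 <= C * w p ^+ n & tnb T2 (M e * expR (e * 2 ^+ n))].

(* A bounded family of operators of [Li_0^p], uniformly in the family: the
   operators split as a part of norm O(2^{-pn}) and a part of trace norm
   O(exp(e 2^n)), for every e. *)
Definition usm (p : R) (A : set B) := exists C M L, [/\ 0 < C, 0 < L, forall e, 0 < M e &
  forall T, A T -> [/\ N T, opnorm T <= L & sm p C M T]].

Lemma usm_sub p A A' : A `<=` A' -> usm p A' -> usm p A.
Proof. by move=> s [C [M [L [h1 h2 h3 h4]]]]; exists C, M, L; split => // T /s; exact: h4. Qed.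

Lemma usm_mono p p' A : p' <= p -> usm p A -> usm p' A.
Proof.
move=> hp [C [M [L [C0 L0 M0 h]]]]; exists C, M, L; split => // T /h[nT bT sT]; split => // e e0 n.
have [T1 [T2 [e1 n1 b1 t2]]] := sT e e0 n; exists T1, T2; split => //; apply: le_trans b1 _.
by rewrite ler_wpM2l ?(ltW C0)// lerXn2r ?nnegrE ?(ltW (w_gt0 _))// w_anti.
Qed.

Lemma usmD p A A' Z : usm p A -> usm p A' ->
  (forall X, Z X -> exists S T, [/\ A S, A' T & X = S + T]) -> usm p Z.
Proof.
move=> [C [M [L [C0 L0 M0 h]]]] [C' [M' [L' [C0' L0' M0' h']]]] hZ.
exists (C + C'), (fun e => M e + M' e), (L + L'); split; try by move=> *; rewrite addr_gt0.
move=> X /hZ[S [T [/h[nS bS sS] /h'[nT bT sT] ->]]]; split; first exact: vND.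
  by apply: le_trans (opnormD _ _) _; exact: lerD.
move=> e e0 n; have [S1 [S2 [-> a1 b1 c1]]] := sS e e0 n; have [T1 [T2 [-> a2 b2 c2]]] := sT e e0 n.
exists (S1 + T1), (S2 + T2); split; first by rewrite addrACA.
- exact: vND.
- by rewrite mulrDl; apply: le_trans (opnormD _ _) _; exact: lerD.
- by rewrite mulrDl; exact: tnbD.
Qed.

Lemma usm_conj p A Z c : 0 < c -> usm p A ->
  (forall X, Z X -> exists S W W', [/\ A S, N W /\ opnorm W <= c, N W' /\ opnorm W' <= c & X = W * S * W']) ->
  usm p Z.
Proof.
move=> c0 [C [M [L [C0 L0 M0 h]]]] hZ.
exists (c * C * c), (fun e => 4 * c * (4 * c * M e)), (c * L * c); split; try by move=> *; rewrite !mulr_gt0.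
move=> X /hZ[S [W [W' [/h[nS bS sS] [nW bW] [nW' bW'] ->]]]]; split.
- by do 2![apply: (vNM N_vN) => //].
- by do 2![apply: opnormM_le => //].
move=> e e0 n; have [S1 [S2 [-> a1 b1 c1]]] := sS e e0 n.
exists (W * S1 * W'), (W * S2 * W'); split; first by rewrite mulrDr mulrDl.
- by do 2![apply: (vNM N_vN) => //].
- have := opnormM_le (opnormM_le bW b1) bW'; move=> hh; apply: le_trans hh _.
  by move: (w p ^+ n) => v; rewrite le_eqVlt; apply/orP; left; apply/eqP; ring.
- have := tnb_rmul N_vN tau_trace nW' c0 bW' (tnb_lmul N_vN tau_trace nW c0 bW c1).
  by apply: tnbW; rewrite -!mulrA.
Qed.

(** Only S1 T1 has to be small in norm, with the exponents adding up; S1 T2 + S2 T inherits the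
    growth of the trace, its bounded factors being uniform in n. *)
Lemma usmM p p' A A' Z : 0 <= p -> usm p A -> usm p' A' ->
  (forall X, Z X -> exists S T, [/\ A S, A' T & X = S * T]) -> usm (p + p') Z.
Proof.
move=> p0 [C [M [L [C0 L0 M0 h]]]] [C' [M' [L' [C0' L0' M0' h']]]] hZ.
exists (C * C'), (fun e => 4 * C * M' e + 4 * L' * M e), (L * L'); split; try by move=> *; rewrite ?addr_gt0 ?mulr_gt0.
move=> X /hZ[S [T [/h[nS bS sS] /h'[nT bT sT] ->]]]; split; first exact: vNM.
  exact: opnormM_le.
move=> e e0 n; have [S1 [S2 [eS a1 b1 c1]]] := sS e e0 n; have [T1 [T2 [eT a2 b2 c2]]] := sT e e0 n.
have b1' : opnorm S1 <= C.
  by apply: le_trans b1 _; rewrite ler_piMr ?(ltW C0)// exprn_ile1// ?w_le1// ltW// w_gt0.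
exists (S1 * T1), (S1 * T2 + S2 * T); split.
- by rewrite addrA -mulrDr -eT -mulrDl -eS.
- exact: vNM.
- apply: le_trans (opnormM_le b1 b2) _; rewrite wD exprMn.
  by move: (w p ^+ n) (w p' ^+ n) => v v'; rewrite le_eqVlt; apply/orP; left; apply/eqP; ring.
- have := tnbD N_vN tau_trace (tnb_lmul N_vN tau_trace a1 C0 b1' c2) (tnb_rmul N_vN tau_trace nT L0' bT c1).
  by apply: tnbW; move: (expR _) => E; rewrite le_eqVlt; apply/orP; left; apply/eqP; ring.
Qed.

Lemma sq_le_exp (a : R) : 0 <= a -> a ^+ 2 <= 4 * expR a.
Proof.
move=> a0; have h := expR_ge1Dx (a / 2); have -> : expR a = expR (a / 2) ^+ 2.
  by rewrite -expRM_natl mulrC divfK.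
have e0 := expR_gt0 (a / 2); nra.
Qed.

(** A cut at height 2^{- p n} costs the inverse square of the height, at most 4^n. This is swallowed
    by the exponential. *)
Lemma absorb p (e : R) n : 0 < e -> p <= 1 -> (w p ^+ n) ^- 2 <= 4 / e ^+ 2 * expR (e * 2 ^+ n).
Proof.
move=> e0 p1; have h2 : 0 < 2 ^+ n :> R by rewrite exprn_gt0.
apply: (@le_trans _ _ ((2 ^+ n) ^+ 2)).
  rewrite -exprVn lerXn2r ?nnegrE ?(ltW h2)//.
    by rewrite invr_ge0 exprn_ge0// ltW// w_gt0.
  rewrite invf_ple ?posrE ?exprn_gt0 ?w_gt0// -exprVn.
  by rewrite lerXn2r ?nnegrE ?invr_ge0 ?(ltW (w_gt0 _)) ?w_half.
have := @sq_le_exp (e * 2 ^+ n) (mulr_ge0 (ltW e0) (ltW h2)).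
by rewrite exprMn => h; rewrite mulrAC ler_pdivlMr ?exprn_gt0// mulrC.
Qed.

(** The cut at scale n. Absorbing its polynomial cost doubles e, and the factor 4 of [absorb] turns
    64 into 256. *)
Lemma cut_sm p C M L e n S : 0 < C -> p <= 1 -> 0 < e -> 0 < M e -> 0 <= p ->
  N S -> adj S = S -> opnorm S <= L -> sm p C M S ->
  exists Q, [/\ projection Q /\ (forall W, W * (S * S) = S * S * W -> W * Q = Q * W),
    ft Q, tr Q <= 256 * (L + C) * M e / (e * C) ^+ 2 * expR (2 * e * 2 ^+ n),
    forall z, sqn (S ((1 - Q) z)) <= 4 * (C * w p ^+ n) ^+ 2 * sqn ((1 - Q) z) &
    forall z, 4 * (C * w p ^+ n) ^+ 2 * sqn (Q z) <= sqn (S (Q z))].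
Proof.
move=> C0 p1 e0 M0 p0 nS sS bS hS; have [T1 [T2 [e1 n1 b1 t2]]] := hS e e0 n.
have v0 : 0 < w p ^+ n by rewrite exprn_gt0// w_gt0.
have x0 : 0 < C * w p ^+ n by rewrite mulr_gt0.
have [Q [h1 h2 h3 h4 h5]] := cut nS sS bS x0 e1 b1 t2; exists Q; split => //.
apply: le_trans h3 _; have L0 : 0 <= L by apply: le_trans bS; exact: opnorm_ge0.
have v1 : w p ^+ n <= 1 by rewrite exprn_ile1// ?w_le1// ltW// w_gt0.
have := absorb n e0 p1; have E0 := expR_gt0 (e * 2 ^+ n).
have -> : 2 * e * 2 ^+ n = e * 2 ^+ n + e * 2 ^+ n by ring.
have -> : ((C * w p ^+ n) ^+ 2)^-1 = C ^- 2 * (w p ^+ n) ^- 2 by rewrite exprMn invfM.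
rewrite expRD; move: (w p ^+ n) v0 v1 {h4 h5 x0 t2 b1} => v v0 v1.
move: (expR _) E0 => E E0; have := invr_gt0 (v ^+ 2); rewrite exprn_gt0//; move: (v ^- 2) => u u0 hu.
have -> : 256 * (L + C) * M e / (e * C) ^+ 2 * (E * E) = 64 * (L + C) * M e * E * (C ^- 2 * (4 / e ^+ 2 * E)).
  by field; rewrite !gt_eqF.
have k0 : 0 <= C ^- 2 by rewrite invr_ge0 sqr_ge0.
have h : 64 * (L + C * v) * (M e * E) <= 64 * (L + C) * M e * E.
  rewrite -[leRHS]mulrA; apply: ler_wpM2r (mulr_ge0 (ltW M0) (ltW E0)) _ _ _.
  by rewrite ler_pM2l// lerD2l ler_piMr// ltW.
apply: ler_pM => //.
- by apply: mulr_ge0; apply: mulr_ge0 => //; [apply: addr_ge0 => //; apply: mulr_ge0| |]; exact: ltW.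
- by rewrite mulr_ge0// ltW.
- by rewrite ler_wpM2l.
Qed.

(** A pointwise bound |X z| <= |S z| gives X no decomposition of its own. It is cut along the
    spectral projection Q of |S|: X (1 - Q) is as small as S (1 - Q), and X Q is controlled by the
    trace of Q. *)
Lemma usm_dom p A Z : 0 <= p -> p <= 1 -> usm p A -> (forall S, A S -> adj S = S) ->
  (forall X, Z X -> N X /\ exists2 S, A S & forall z, sqn (X z) <= sqn (S z)) -> usm p Z.
Proof.
move=> p0 p1 [C [M [L [C0 L0 M0 h]]]] sA hZ.
(* M is taken at e / 2 because [cut_sm] doubles the exponent; the last + 1 makes the bound strictly
   positive, as [usm] demands. *)
exists (2 * C), (fun e => 4 * L * (256 * (L + C) * M (e / 2) / ((e / 2) * C) ^+ 2) + 1), L; split; [by rewrite mulr_gt0|exact: L0| |].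
  move=> e; apply: ltr_wpDl => //; apply: mulr_ge0; first by rewrite mulr_ge0// ltW.
  apply: mulr_ge0; last by rewrite invr_ge0 sqr_ge0.
  by apply: mulr_ge0; [rewrite mulr_ge0// addr_ge0// ltW|exact: ltW].
move=> X /hZ[nX [S /[dup]/sA sS /h[nS bS hS] XS]].
have bX : opnorm X <= L.
  apply: opnorm_le_sqn; first exact: ltW.
  by move=> z; apply: le_trans (XS z) _; exact: sqn_opnorm_le.
split => // e e0 n; have e2 : 0 < e / 2 by lra.
have [Q [[hQ _] fQ lQ q1 _]] := cut_sm n C0 p1 e2 (M0 _) p0 nS sS bS hS.
have [nQ _ _] := fQ; have nQ' : N (1 - Q) by apply: (vNB N_vN) => //; exact: vN1.
exists (X * (1 - Q)), (X * Q); split.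
- by rewrite -mulrDr subrK mulr1.
- exact: vNM.
- have v0 : 0 < w p ^+ n by rewrite exprn_gt0// w_gt0.
  apply: opnorm_le_sqn => [|z]; first by rewrite !mulr_ge0 ?(ltW v0) ?(ltW C0).
  rewrite bop_mulE; apply: le_trans (XS _) _; apply: le_trans (q1 z) _.
  have -> : 4 * (C * w p ^+ n) ^+ 2 = (2 * C * w p ^+ n) ^+ 2 by ring.
  by rewrite ler_wpM2l ?sqr_ge0// [X in _ <= X](proj_pyth z hQ) lerDr sqn_ge0.
- have := tnb_lmul N_vN tau_trace nX L0 bX (tnb_ft N_vN tau_trace fQ lQ); apply: tnbW.
  have -> : 2 * (e / 2) * 2 ^+ n = e * 2 ^+ n by field.
  by have := expR_gt0 (e * 2 ^+ n); move: (expR _) (256 * _ * _ / _) => E K E0; lra.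
Qed.

Lemma Li0_usm p T : 0 < p -> Li0 N tau p T -> usm p [set T].
Proof.
move=> p0 [nT hT]; pose L := opnorm T + 1; have L0 : 0 < L by have := opnorm_ge0 T; rewrite /L; lra.
have bL : opnorm T <= L by rewrite /L; lra.
have /choice[M hM] (e : R) : exists m : R, 0 < m /\ (0 < e -> forall n : nat,
    exists T1 T2, [/\ T = T1 + T2, N T1, opnorm T1 <= 2 * w p ^+ n & tnb T2 (m * expR (e * 2 ^+ n))]).
  have [e0|e0] := ltP 0 e; last by exists 1.
  have [A [Ar hA]] := hT _ (powR_gt0 p e0).
  have [n0 hn0] : exists n0 : nat, A < expR (e * 2 ^+ n0).
    have [k hk] : exists k : nat, A / e < k%:R.
      by exists (Num.truncn `|A / e|).+1; apply: le_lt_trans (ler_norm _) _; rewrite truncnS_gt.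
    exists k; apply: lt_le_trans (expR_ge1Dx _).
    rewrite ltr_pdivrMr// in hk; apply: (lt_le_trans hk).
    rewrite mulrC; have : (k%:R : R) <= 2 ^+ k by rewrite -natrX ler_nat ltnW// ltn_expl.
    move=> h3; have := ler_wpM2l (ltW e0) h3; lra.
  have key n : (n0 <= n)%N -> exists E, [/\ N E, projection E, (tau (1 - E)%R <= (expR (e * 2 ^+ n))%:E)%E & opnorm (T * E) <= 2 * w p ^+ n].
    move=> hn; have hA' : A < expR (e * 2 ^+ n).
      by apply: (lt_le_trans hn0); rewrite ler_expR ler_wpM2l ?(ltW e0)// ler_eXn2l// ltr1n.
    have hs := hA _ hA'; rewrite expRK in hs.
    have e2 : e `^ p * (e * 2 ^+ n)^-1 `^ p = w p ^+ n.
      rewrite -powRM ?(ltW e0)//; last by rewrite invr_ge0 mulr_ge0 ?(ltW e0)// exprn_ge0.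
      by rewrite wX invfM mulrA mulfV ?gt_eqF// mul1r exprVn.
    rewrite e2 in hs.
    have v0 : 0 < w p ^+ n by rewrite exprn_gt0// w_gt0.
    (* The factor 2 makes the inequality strict, so that the infimum yields an actual projection. *)
    have hs2 : sing_val N tau (expR (e * 2 ^+ n)) T < 2 * w p ^+ n by lra.
    have [|_ [E [nE pE tE] <-] hE] := inf_lt _ hs2.
      exists (opnorm (T * 1)); exists (1 : B) => //; split; [exact: vN1|by split; rewrite ?mulr1 ?adj1|].
      by rewrite subrr (tau0 N_vN tau_trace) lee_fin ltW// expR_gt0.
    by exists E; split => //; exact: ltW.
  exists (4 * L * expR (e * 2 ^+ n0)); split; first by rewrite !mulr_gt0// expR_gt0.
  (* For n below n0 the projection of index n0 serves, and the excess trace exp(e 2^n0) goes into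
     the constant. *)
  move=> _ n; have [E [nE pE tE bE]] := key (maxn n n0) (leq_maxr _ _).
  have nE' : N (1 - E) by apply: (vNB N_vN) => //; exact: vN1.
  have fE : ft (1 - E).
    by split => //; [apply: proj_psd; exact: projC|apply: le_lt_trans tE _; exact: ltry].
  have lE : tr (1 - E) <= expR (e * 2 ^+ n0) * expR (e * 2 ^+ n).
    have : tr (1 - E) <= expR (e * 2 ^+ (maxn n n0)) by rewrite -lee_fin -(tauE tau_trace fE).
    move=> h; apply: le_trans h _; rewrite -expRD ler_expR -mulrDr ler_wpM2l ?(ltW e0)//.
    have i1 : 0 < 2 ^+ n :> R by rewrite exprn_gt0.
    have i2 : 0 < 2 ^+ n0 :> R by rewrite exprn_gt0.
    by case: (leqP n n0) => _; lra.
  exists (T * E), (T * (1 - E)); split; first by rewrite -mulrDr addrC subrK mulr1.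
  - exact: vNM.
  - apply: le_trans bE _; rewrite ler_wpM2l//.
    by rewrite ler_wiXn2l// ?w_le1 ?leq_maxl// ltW// w_gt0.
  - have := tnb_lmul N_vN tau_trace nT L0 bL (tnb_ft N_vN tau_trace fE lE).
    by apply: tnbW; rewrite !mulrA.
exists 2, M, L; split => // [e|_ ->]; first by have [] := hM e.
by split => // e e0 n; have [_ h] := hM e; exact: h.
Qed.

Lemma usm_Li0 p T : 0 < p -> p <= 1 -> adj T = T -> usm p [set T] -> Li0 N tau p T.
Proof.
move=> p0 p1 sT [C [M [L [C0 L0 M0 h]]]]; have [nT bT hT] := h T erefl; split => // d d0.
(* Chosen so that 2 C (6 e)^p = d: since log t < 6 e 2^n at the scale n attached to t, the norm 2 C
   2^{- p n} is then at most d (log t)^{- p}. *)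
pose e := (d / (2 * C)) `^ p^-1 / 6.
have dC : 0 < d / (2 * C) by rewrite divr_gt0// mulr_gt0.
have e0 : 0 < e by rewrite divr_gt0// powR_gt0.
have e6 : 2 * C * (6 * e) `^ p = d.
  rewrite /e mulrC [6 * _]mulrC divfK// -powRrM mulVf ?gt_eqF// powRr1 ?ltW// divfK//.
  by rewrite gt_eqF// mulr_gt0.
clearbody e.
pose K := 256 * (L + C) * M e / (e * C) ^+ 2.
have [n1 hn1] : exists n1 : nat, K <= expR (e * 2 ^+ n1).
  have [k hk] : exists k : nat, K / e < k%:R.
    by exists (Num.truncn `|K / e|).+1; apply: le_lt_trans (ler_norm _) _; rewrite truncnS_gt.
  exists k; apply: le_trans (expR_ge1Dx _).
  rewrite ltr_pdivrMr// in hk; apply: (le_trans (ltW hk)).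
  rewrite mulrC; have : (k%:R : R) <= 2 ^+ k by rewrite -natrX ler_nat ltnW// ltn_expl.
  move=> h3; have := ler_wpM2l (ltW e0) h3; lra.
(* Beyond this threshold log t lies between 3 e 2^n and 3 e 2^{n+1} for some n >= n1, where K <=
   exp(e 2^n). The cut at scale n then has trace at most K exp(2 e 2^n) <= t. *)
exists (expR (3 * e * 2 ^+ n1)); split => //.
move=> t ht; have t0 : 0 < t by apply: lt_trans ht; exact: expR_gt0.
have lt1 : 3 * e * 2 ^+ n1 < ln t by rewrite -ltr_expR lnK ?posrE.
have l0 : 0 < ln t by apply: lt_trans lt1; rewrite !mulr_gt0.
have ex : exists n : nat, ln t < 3 * e * 2 ^+ n.+1.
  have [k hk] : exists k : nat, ln t / (3 * e) < k%:R.
    by exists (Num.truncn `|ln t / (3 * e)|).+1; apply: le_lt_trans (ler_norm _) _; rewrite truncnS_gt.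
  exists k; rewrite ltr_pdivrMr ?mulr_gt0// in hk; apply: (lt_le_trans hk).
  rewrite mulrC; apply: ler_wpM2l; first by rewrite mulr_ge0// ltW.
  by rewrite -natrX ler_nat ltnW// (ltn_trans _ (ltn_expl _ _)).
have [n hn hmin] := ex_minnP ex.
have n1n : (n1 <= n)%N.
  rewrite leqNgt; apply/negP => hlt; move: hn; apply/negP; rewrite -leNgt; apply: le_trans (ltW lt1).
  by rewrite ler_wpM2l ?mulr_ge0 ?(ltW e0)// ler_eXn2l// ltr1n.
have low : 3 * e * 2 ^+ n <= ln t.
  case: n hn hmin n1n => [|k] hn hmin n1n.
    by move: n1n; rewrite leqn0 => /eqP n10; rewrite n10 in lt1; exact: ltW.
  by rewrite leNgt; apply/negP => /hmin; rewrite ltnn.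
have [Q [[hQ _] fQ lQ q1 _]] := cut_sm n C0 p1 e0 (M0 e) (ltW p0) nT sT bT hT.
have [nQ _ _] := fQ; have nQ' : N (1 - Q) by apply: (vNB N_vN) => //; exact: vN1.
have v0 : 0 < w p ^+ n by rewrite exprn_gt0// w_gt0.
apply: (@le_trans _ _ (2 * C * w p ^+ n)).
  apply: (@le_trans _ _ (opnorm (T * (1 - Q)))).
    apply: ge_inf; first by exists 0 => _ [E _ <-]; exact: opnorm_ge0.
    exists (1 - Q) => //; split => //; first exact: projC.
    rewrite opprB addrC subrK (tauE tau_trace fQ) lee_fin; apply: le_trans lQ _.
    have -> : t = expR (ln t) by rewrite lnK ?posrE.
    apply: le_trans (_ : expR (e * 2 ^+ n) * expR (2 * e * 2 ^+ n) <= _).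
      rewrite ler_wpM2r ?expR_ge0//; apply: le_trans hn1 _.
      by rewrite ler_expR ler_wpM2l ?(ltW e0)// ler_eXn2l// ltr1n.
    by rewrite -expRD ler_expR; move: low; move: (2 ^+ n) => y; lra.
  apply: opnorm_le_sqn => [|z]; first by rewrite !mulr_ge0 ?(ltW v0) ?(ltW C0).
  rewrite bop_mulE; apply: le_trans (q1 z) _.
  have -> : 4 * (C * w p ^+ n) ^+ 2 = (2 * C * w p ^+ n) ^+ 2 by ring.
  by rewrite ler_wpM2l ?sqr_ge0// [X in _ <= X](proj_pyth z hQ) lerDr sqn_ge0.
have C2 : 0 <= 2 * C by rewrite mulr_ge0// ltW.
rewrite -e6 -[leRHS]mulrA; apply: ler_wpM2l => //.
have y0 : 0 < 2 ^+ n :> R by rewrite exprn_gt0.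
rewrite wX -powRM ?invr_ge0 ?(ltW l0)//; last by rewrite mulr_ge0// ltW.
apply: ge0_ler_powR; [exact: ltW|by rewrite nnegrE exprn_ge0// invr_ge0| |].
  by rewrite nnegrE divr_ge0// ?ltW// mulr_gt0.
rewrite ler_pdivlMr// exprVn mulrC ler_pdivrMr//.
by move: hn; rewrite exprS; move: (2 ^+ n) => y; lra.
Qed.

Lemma closed_opnorm (J : set B) T : closed J ->
  (forall e, 0 < e -> exists2 Y, J Y & opnorm (T - Y) <= e) -> J T.
Proof.
move=> cJ h; apply: cJ => U /nbhs_ballP[e /= /posC[e1 e0]].
rewrite -ball_normE => hU.
have e2 : 0 < complex.Re e / 2 by lra.
have [Y JY hY] := h _ e2; exists Y; split => //; apply: hU => /=.
by rewrite bop_normE e1 ltcR; lra.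
Qed.

Lemma tnb_compact T m : tnb T m -> compact_ideal N tau T.
Proof.
move=> [T1 [T2 [T3 [T4 [[t1 t2] [t3 t4] -> _]]]]] J [JN J0 JD JM _] hJ.
have JZ k X : J X -> J (k *: X).
  move=> jX; have := JM (k *: (1 : B)) X (vNZ N_vN k (vN1 N_vN)) jX.
  by rewrite bop_scaleAl mul1r => -[].
have JB X Y : J X -> J Y -> J (X - Y) by move=> h1 h2; apply: JD => //; rewrite -scaleN1r; exact: JZ.
have jt X : ft X -> J X by move=> /ftE; exact: hJ.
by apply: JD; [|apply: JZ]; apply: JB; exact: jt.
Qed.

(** T is a norm limit of the parts in the trace ideal, because the norm parts are O(2^{- p n}). *)
Lemma usm_compact p T : 0 < p -> usm p [set T] -> compact_ideal N tau T.
Proof.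
move=> p0 [C [M [L [C0 L0 M0 h]]]] J hJ ft_J; have [nT bT hT] := h T erefl.
have [_ _ _ _ cJ] := hJ; apply: closed_opnorm => // e e0.
have w1 : w p < 1.
  have -> : (1 : R) = 1 `^ p by rewrite powR1.
  by apply: gt0_ltr_powR; rewrite ?nnegrE ?invr_ge0//; lra.
have [n hn] : exists n : nat, C * w p ^+ n <= e.
  have hw : `|w p| < 1 by rewrite ger0_norm// ltW// w_gt0.
  have /cvgrPdist_le /(_ (e / C) (divr_gt0 e0 C0)) [n0 _ /(_ n0 (leqnn _))] := cvg_expr hw.
  rewrite /= sub0r normrN ger0_norm ?exprn_ge0 ?(ltW (w_gt0 _))// ler_pdivlMr// mulrC => hh.
  by exists n0.
have [T1 [T2 [-> n1 b1 t2]]] := hT 1 ltr01 n; exists T2; first exact: tnb_compact t2 _ hJ ft_J.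
by rewrite addrK; exact: le_trans b1 hn.
Qed.

End Smallness.

(** * Summability of the theta functions *)

Section ThetaFunctions.
Variable R : realType.
Implicit Types a c q x y : R.

(** The extra parameter c closes the family under square roots ([th_sqr]). *)
Definition th a c q x : R := if x <= 0 then 0 else x `^ (- a) * expR (- (c * x `^ (- q^-1))).

Lemma th_theta r q : th r 1 q = theta_fun r q.
Proof. by apply/funext => x; rewrite /th /theta_fun mul1r. Qed.

Lemma th_ge0 a c q x : 0 <= th a c q x.
Proof. by rewrite /th; case: ifP => // _; rewrite mulr_ge0 ?powR_ge0 ?expR_ge0. Qed.

Lemma th_sqr a c q x : th (a / 2) (c / 2) q x * th (a / 2) (c / 2) q x = th a c q x.
Proof.
rewrite /th; case: leP => [_|x0]; first by rewrite mulr0.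
rewrite mulrACA -expRD -powRD; last by rewrite (gt_eqF x0) implybT.
by congr (_ `^ _ * expR _); lra.
Qed.

Lemma exp_dominates_pow (k : nat) c : 0 < c -> exists2 D, 0 < D & forall y, 0 <= y -> y ^+ k <= D * expR (c * y).
Proof.
move=> c0; case: k => [|k].
  exists 1 => // y y0; rewrite expr0 mul1r; have := expR_ge1Dx (c * y); have := mulr_ge0 (ltW c0) y0; lra.
have k0 : 0 < k.+1%:R :> R by rewrite ltr0n.
exists ((k.+1%:R / c) ^+ k.+1) => [|y y0]; first by rewrite exprn_gt0// divr_gt0.
have -> : c * y = k.+1%:R * (c * y / k.+1%:R) by rewrite [RHS]mulrC divfK// gt_eqF.
rewrite expRM_natl -exprMn lerXn2r ?nnegrE//.
  by rewrite mulr_ge0 ?expR_ge0// ltW// divr_gt0.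
move: (k.+1%:R) k0 => K k0; have h : c * y / K <= expR (c * y / K).
  by apply: le_trans (expR_ge1Dx _); rewrite lerDr.
have {1}-> : y = K / c * (c * y / K) by field; rewrite !gt_eqF.
by apply: ler_wpM2l h; rewrite ltW// divr_gt0.
Qed.

(** In the variable y = x^{-1/q} the power x^{-a} is y^{a q}, which half of the exponential decay
    absorbs. *)
Lemma th_bound a c q : 0 <= a -> 0 < c -> 0 < q ->
  exists2 D, 0 < D & forall x, 0 < x -> th a c q x <= D * expR (- (c / 2 * x `^ (- q^-1))).
Proof.
move=> a0 c0 q0; have c2 : 0 < c / 2 by lra.
pose k := (Num.truncn (a * q)).+1; have [D D0 hD] := exp_dominates_pow k c2.
exists (1 + D) => [|x x0]; first by rewrite addr_gt0.
rewrite /th ifF; last by rewrite leNgt x0.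
set y := x `^ (- q^-1).
have y0 : 0 < y by exact: powR_gt0.
have -> : x `^ (- a) = y `^ (a * q).
  by rewrite /y -powRrM; congr (_ `^ _); field; rewrite gt_eqF.
have h : y `^ (a * q) <= (1 + D) * expR (c / 2 * y).
  have E1 : 1 <= expR (c / 2 * y).
    have := expR_ge1Dx (c / 2 * y); have := mulr_ge0 (ltW c2) (ltW y0); lra.
  have aq : 0 <= a * q by rewrite mulr_ge0// ltW.
  have [y1|y1] := leP y 1.
    have : y `^ (a * q) <= 1.
      have -> : (1 : R) = 1 `^ (a * q) by rewrite powR1.
      by apply: ge0_ler_powR; rewrite ?nnegrE ?(ltW y0).
    move=> h1; apply: le_trans h1 _; nra.
  have : y `^ (a * q) <= y ^+ k.
    rewrite -powR_mulrn ?(ltW y0)//; apply: ler_powR; first exact: ltW.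
    by apply: ltW; exact: truncnS_gt.
  move=> h1; apply: le_trans h1 _; have := hD y (ltW y0); nra.
have e1 : expR (- (c * y)) = expR (- (c / 2 * y)) * expR (- (c / 2 * y)).
  by rewrite -expRD; congr expR; lra.
rewrite e1 mulrA; apply: ler_wpM2r (expR_ge0 _) _ _ _.
apply: le_trans (ler_wpM2r (expR_ge0 _) h) _.
by rewrite expRN mulfK// gt_eqF// expR_gt0.
Qed.

Lemma th_le_exp a c q : 0 <= a -> 0 < c -> 0 < q ->
  exists2 D, 0 < D & forall x, th a c q x <= D.
Proof.
move=> a0 c0 q0; have [D D0 h] := th_bound a0 c0 q0; exists D => // x.
have [x0|x0] := leP x 0; first by rewrite /th x0 ltW.
apply: le_trans (h x x0) _; rewrite ler_piMr ?(ltW D0)// -expR0 ler_expR oppr_le0.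
by rewrite mulr_ge0 ?powR_ge0// ltW// divr_gt0.
Qed.

Lemma th_cont a c q : 0 <= a -> 0 < c -> 0 < q -> continuous (th a c q).
Proof.
move=> a0 c0 q0 x0; have [xn|xp|->] := ltgtP x0 0.
- have e : \forall x \near x0, 0 = th a c q x.
    by near=> x; rewrite /th ltW//; near: x; exact: lt_nbhsl.
  apply: cvg_trans (near_eq_cvg e) _.
  by rewrite /th (ltW xn); exact: cvg_cst.
- pose g x := expR (- a * ln x) * expR (- (c * expR (- q^-1 * ln x))).
  have eg x : 0 < x -> g x = th a c q x.
    by move=> h; rewrite /g /th ifF; [rewrite /powR !gt_eqF|rewrite leNgt h].
  have e : \forall x \near x0, g x = th a c q x.
    by near=> x; apply: eg; near: x; exact: lt_nbhsr.
  apply: cvg_trans (near_eq_cvg e) _; rewrite -eg//.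
  have lc : ln x @[x --> x0] --> ln x0 by exact: continuous_ln.
  apply: cvgM; first by apply: continuous_cvg; [exact: continuous_expR|apply: cvgMr; exact: lc].
  apply: continuous_cvg; first exact: continuous_expR.
  apply: cvgN; apply: cvgMr; apply: continuous_cvg; first exact: continuous_expR.
  by apply: cvgMr; exact: lc.
- have [D D0 hD] := th_bound a0 c0 q0.
  have e0 : th a c q 0 = 0 by rewrite /th lexx.
  rewrite /continuous_at e0; apply/cvgrPdist_le => e ep; rewrite /=.
  pose d := (e * c / (2 * D)) `^ q.
  have k0 : 0 < e * c / (2 * D) by rewrite divr_gt0 ?mulr_gt0.
  have d0 : 0 < d by exact: powR_gt0.
  near=> x; rewrite sub0r normrN ger0_norm ?th_ge0//.
  have [xn|xp] := leP x 0; first by rewrite /th xn ltW.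
  have xd : x < d by near: x; exact: lt_nbhsl.
  apply: le_trans (hD x xp) _; set y := x `^ (- q^-1).
  have y0 : 0 < y by exact: powR_gt0.
  have hy : e * c * y / (2 * D) >= 1.
    have -> : e * c * y / (2 * D) = e * c / (2 * D) / x `^ q^-1.
      by rewrite /y powRN mulrAC.
    rewrite ler_pdivlMr ?powR_gt0// mul1r.
    have -> : e * c / (2 * D) = d `^ q^-1 by rewrite /d -powRrM mulfV ?gt_eqF// powRr1// ltW.
    by apply: ge0_ler_powR; rewrite ?nnegrE ?invr_ge0 ?ltW.
  have hE := expR_ge1Dx (c / 2 * y).
  rewrite expRN ler_pdivrMr ?expR_gt0//.
  apply: (@le_trans _ _ (e * (c / 2 * y))); last by rewrite ler_pM2l//; lra.
  move: hy; rewrite ler_pdivlMr ?mulr_gt0// mul1r; lra.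
Unshelve. all: by end_near.
Qed.

End ThetaFunctions.

(** * Locality of the calculus *)

Section Locality.
Variables (R : realType) (H : hilbertType R).
Local Notation B := (bop H).

Lemma peval_local (p : {poly R}) (A A' E : B) : A * E = A' * E -> E * A' = A' * E ->
  peval p A * E = peval p A' * E.
Proof.
move=> h cE; elim/poly_ind: p => [|p c IH]; first by rewrite !peval0.
rewrite !pevalD !pevalMX !pevalC !mulrDl; congr (_ + _).
by rewrite -!mulrA h -cE !mulrA IH.
Qed.

(** True for polynomials in S^2, hence in the limit. The last factor E on the right is essential,
    since f(0) may be nonzero. *)
Lemma sfun_restrict L (f : R -> R) (S E : B) : 0 < L -> continuous f -> adj S = S -> opnorm S <= L ->
  projection E -> E * S = S * E -> sfun L f S * E = sfun L f (S * E) * E.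
Proof.
move=> L0 fc sS hS [E1 E2] c.
have sSE : adj (S * E) = S * E by rewrite adjM sS E2.
have hE : opnorm (S * E) <= L.
  by have := opnormM_le hS (@proj_opnorm _ _ E (conj E1 E2)); rewrite mulr1.
apply/eqP; rewrite -subr_eq0; apply/eqP; apply: opnorm_eq0; apply/le_anti; rewrite opnorm_ge0 andbT.
apply/ler_addgt0Pl => e e0; rewrite addr0; have e2 : 0 < e / 2 by lra.
have [p hp] := sfun_poly H L0 fc e2.
have h1 := hp _ sS hS; have h2 := hp _ sSE hE.
have key : peval p (S * S) * E = peval p (S * E * (S * E)) * E.
  have e1 : S * E * (S * E) = S * S * E by rewrite -mulrA [E * _]mulrA c -[S * E * E]mulrA E1 mulrA.
  by rewrite e1; apply: peval_local; rewrite -?mulrA ?E1// [E * (S * _)]mulrA c -mulrA [E * (S * E)]mulrA c -!mulrA E1.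
have -> : sfun L f S * E - sfun L f (S * E) * E =
  (sfun L f S - peval p (S * S)) * E - (sfun L f (S * E) - peval p (S * E * (S * E))) * E.
  by rewrite !mulrBl key opprB addrA subrK.
apply: le_trans (opnormB _ _) _.
have g1 := opnormM_le h1 (@proj_opnorm _ _ E (conj E1 E2)).
have g2 := opnormM_le h2 (@proj_opnorm _ _ E (conj E1 E2)).
apply: le_trans (lerD g1 g2) _; lra.
Qed.

(** Both sides are the Borel calculus of |S|, in which the bound does not appear. *)
Lemma sfun_indep L L' (f : R -> R) (S : B) : 0 < L -> 0 < L' -> continuous f -> adj S = S ->
  opnorm S <= L -> opnorm S <= L' -> sfun L f S = sfun L' f S.
Proof. by move=> L0 L0' fc sS h h'; rewrite -!borel_calculus_abs. Qed.

End Locality.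

(** * Traces of theta functions over bounded families *)

Section Summability.
Variables (R : realType) (H : hilbertType R).
Local Notation B := (bop H).
Implicit Types S T K E Q P W X Y b : B.

Lemma sfun_ubound L (f : R -> R) k S y : 0 < L -> continuous f -> adj S = S -> opnorm S <= L ->
  (forall x, 0 <= x <= L -> f x <= k) -> rdot (sfun L f S y) y <= k * sqn y.
Proof.
move=> L0 fc sS hS h; have cc : continuous (fun _ : R => k) by move=> z; exact: cvg_cst.
have := sfun_le L0 sS hS fc cc h y.
by rewrite {2}/sfun Phi_cst ?bop_scaleE ?rdotZl //; exact: usqr_unit.
Qed.

(** On the range of E, S may be replaced by S E, whose norm is at most x; [sfun_indep] then lowers
    the bound from L to x. *)
Lemma sfun_cut L (f : R -> R) k x S E z : 0 < L -> continuous f -> adj S = S -> opnorm S <= L ->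
  projection E -> E * S = S * E -> 0 < x -> (forall z, sqn (S (E z)) <= x ^+ 2 * sqn (E z)) ->
  (forall t, 0 <= t <= x -> f t <= k) -> rdot (sfun L f S (E z)) (E z) <= k * sqn (E z).
Proof.
move=> L0 fc sS hS hE c x0 hx hk; have [E1 E2] := hE.
have sSE : adj (S * E) = S * E by rewrite adjM sS E2.
have b1 : opnorm (S * E) <= L.
  by have := opnormM_le hS (proj_opnorm hE); rewrite mulr1.
have b2 : opnorm (S * E) <= x.
  apply: opnorm_le_sqn => [|y]; first exact: ltW.
  rewrite bop_mulE; apply: le_trans (hx y) _.
  by rewrite ler_wpM2l ?sqr_ge0// [X in _ <= X](proj_pyth y hE) lerDl sqn_ge0.
have EE : E (E z) = E z by rewrite -bop_mulE E1.
have -> : sfun L f S (E z) = (sfun L f S * E) (E z) by rewrite bop_mulE EE.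
rewrite sfun_restrict// bop_mulE EE (sfun_indep L0 x0 fc sSE b1 b2).
exact: sfun_ubound.
Qed.

Lemma psd_comm_proj b P : psd b -> projection P -> P * b = b * P -> psd (b * P) /\ forall z, rdot ((b * P) z) z = rdot (b (P z)) (P z).
Proof.
move=> pb hP c; have e : b * P = P * b * P by rewrite c -mulrA hP.1.
split; first by rewrite e; apply: psd_sa_conj => //; exact: hP.2.
by move=> z; rewrite e !bop_mulE adjP hP.2.
Qed.

Variables (N : set B) (tau : B -> \bar R).
Hypotheses (N_vN : von_neumann_algebra N) (tau_trace : fns_trace N tau).
Local Notation ft := (ft N tau).
Local Notation tr := (tr tau).
Local Notation tnb := (tnb N tau).
Variables (q : R) (q0 : 0 < q) (q1 : q <= 1).
Local Notation usm := (usm N tau).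

(** b is the least upper bound of the increasing b Q n, because what is left over tends to 0 in
    norm; normality of the trace concludes. *)
Lemma exhaustion_trace b (Q : nat -> B) (k : nat -> R) m : N b -> psd b ->
  (forall n, projection (Q n)) -> (forall n, N (Q n)) -> (forall n, Q n * b = b * Q n) ->
  (forall n, Q n * Q n.+1 = Q n) ->
  (forall n z, rdot (b ((1 - Q n) z)) ((1 - Q n) z) <= k n * sqn z) ->
  (forall e, 0 < e -> exists n, k n <= e) ->
  (forall n, ft (b * Q n) /\ tr (b * Q n) <= m) -> ft b /\ tr b <= m.
Proof.
move=> nb pb hQ nQ cQ qq hk k0 hm.
have pbQ n := (psd_comm_proj pb (hQ n) (cQ n)).1.
have rbQ n z := (psd_comm_proj pb (hQ n) (cQ n)).2 z.
have split n z : rdot (b z) z = rdot ((b * Q n) z) z + rdot (b ((1 - Q n) z)) ((1 - Q n) z).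
  by rewrite rbQ; apply: quad_split.
pose D := [set b * Q n | n in [set: nat]].
have inc n j : psd (b * Q (n + j)%N - b * Q n).
  elim: j => [|j IH]; first by rewrite addn0 subrr; exact: psd0.
  rewrite -(subrK (b * Q (n + j)%N) (b * Q (n + j.+1)%N)) -addrA.
  apply: psdD => //; rewrite addnS -mulrBr; set i := (n + j)%N.
  have pj : projection (Q i.+1 - Q i).
    have h := proj_le (hQ i) (hQ i.+1) (qq i).
    split; last by rewrite adjB (hQ i).2 (hQ i.+1).2.
    by rewrite mulrBl !mulrBr (hQ i).1 (hQ i.+1).1 h qq subrr subr0.
  by apply: (psd_comm_proj pb pj _).1; rewrite mulrBl mulrBr !cQ.
have lub : is_op_lub N D b.
  split.
  - exact/positive_partE.
  - move=> _ [n _ <-]; apply/positive_opE; split; first by rewrite adjB pb.1 (pbQ n).1.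
    move=> z; rewrite bop_subE rdotBl (split n) addrC addKr; exact: pb.2.
  - move=> X /positive_partE[nX pX] hX; apply/positive_opE; split; first by rewrite adjB pb.1 pX.1.
    move=> z; rewrite bop_subE rdotBl subr_ge0; apply/ler_addgt0Pl => e e0.
    have s0 := sqn_ge0 z.
    have [n hn] := k0 (e / (sqn z + 1)) (divr_gt0 e0 (ltr_wpDl s0 ltr01)).
    have /positive_opE[_ /(_ z)] : op_le (b * Q n) X by apply: hX; exists n.
    rewrite bop_subE rdotBl subr_ge0 => h1; have h2 := hk n z.
    rewrite (split n) addrC; apply: lerD => //; apply: le_trans h2 _.
    apply: le_trans (ler_wpM2r s0 hn) _.
    by rewrite mulrAC ler_pdivrMr ?ltr_wpDl// ler_wpM2l// ?(ltW e0)// lerDl.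
have dD : directed_ops D.
  split; first by exists (b * Q 0%N), 0%N.
  move=> _ _ [n _ <-] [j _ <-]; exists (b * Q (n + j)%N); first by exists (n + j)%N.
  by split; apply/positive_opE => //; rewrite addnC.
have DN : D `<=` positive_part N.
  by move=> _ [n _ <-]; apply/positive_partE; split => //; exact: vNM.
have := trace_normal tau_trace DN dD lub => e.
have le : (tau b <= m%:E)%E.
  rewrite e; apply: ge_ereal_sup => _ [_ [n _ <-] <-]; have [f1 l1] := hm n.
  by rewrite (tauE tau_trace f1) lee_fin.
have fb : ft b by split => //; apply: le_lt_trans le _; exact: ltry.
by split => //; rewrite -lee_fin -(tauE tau_trace fb).
Qed.

(** Shell by shell: off Q n the function is at most D exp(- h 2^n), and Q (n+1) has trace at most K
    exp(4 e 2^n). The resulting bound involves only the constants of the family. *)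
Lemma th_trace a c A : 0 <= a -> 0 < c -> usm q A -> (forall S, A S -> adj S = S) ->
  exists L m, [/\ 0 < L, 0 <= m, forall S, A S -> N S /\ opnorm S <= L &
    forall S, A S -> ft (sfun L (th a c q) S) /\ tr (sfun L (th a c q) S) <= m].
Proof.
move=> a0 c0 [C [M [L [C0 L0 M0 hA]]]] sA.
have [D D0 hD] := th_bound a0 c0 q0; have tc := th_cont a0 c0 q0.
pose h := c / 2 * (2 * C) `^ (- q^-1).
have C2 : 0 < 2 * C by rewrite mulr_gt0.
have h0 : 0 < h by rewrite mulr_gt0 ?powR_gt0//; lra.
(* With this choice 4 e 2^n is half of h 2^n, so the decay of the function beats the growth of the
   trace. *)
pose e := h / 8; have e0 : 0 < e by rewrite /e; lra.
have [K hKE K0] : exists2 K, 256 * (L + C) * M e / (e * C) ^+ 2 = K & 0 < K.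
  eexists; first reflexivity; have := M0 e; move: (M e) => m m0.
  have LC : 0 < L + C by exact: addr_gt0.
  have eC : 0 < (e * C) ^+ 2 by rewrite exprn_gt0// mulr_gt0.
  have z0 : 0 < 256 :> R by rewrite ltr0n.
  move: (256 : R) (L + C) ((e * C) ^+ 2) z0 LC eC => z y v z0 y0 v0.
  by rewrite divr_gt0// mulr_gt0// mulr_gt0.
have DK : 0 < D * K by exact: mulr_gt0.
pose k (n : nat) := D * expR (- (h * 2 ^+ n)).
have k0 n : 0 < k n by rewrite mulr_gt0// expR_gt0.
pose x (n : nat) := 2 * (C * w q ^+ n).
have w0 := w_gt0 q; have x0 n : 0 < x n by rewrite !mulr_gt0// exprn_gt0.
have hk n t : 0 <= t <= x n -> th a c q t <= k n.
  move=> /andP[t0 tx]; have [t00|tp] := leP t 0.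
    by rewrite /th t00 ltW.
  apply: le_trans (hD t tp) _; rewrite ler_pM2l// ler_expR lerN2 /h -mulrA ler_pM2l; last by lra.
  have -> : (2 * C) `^ (- q^-1) * 2 ^+ n = x n `^ (- q^-1).
    rewrite /x mulrA [RHS]powRM ?(ltW C2) ?exprn_ge0 ?(ltW w0)//; congr (_ * _).
    rewrite wX -powRrM mulrN mulfV ?gt_eqF// powR_inv1 ?exprn_ge0 ?invr_ge0//.
    by rewrite exprVn invrK.
  rewrite !powRN lef_pV2 ?posrE ?powR_gt0//.
  by apply: ge0_ler_powR; rewrite ?nnegrE ?invr_ge0 ?(ltW q0) ?(ltW (x0 n)).
(* The first term bounds the part under Q 0, the second the sum of the shells Q (n+1) - Q n. *)
exists L, (D * K * expR (2 * e) + D * K * (4 / h)); split => //.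
- apply: addr_ge0; apply: mulr_ge0; rewrite ?expR_ge0 ?(ltW DK)//.
  by rewrite divr_ge0// ltW.
- by move=> S /hA[nS hS _].
move=> S AS; have sS := sA S AS; have [nS hS smS] := hA S AS.
have /choice[Q hQ] (n : nat) := cut_sm N_vN tau_trace n C0 q1 e0 (M0 e) (ltW q0) nS sS hS smS.
have pQ n : projection (Q n) by have [[]] := hQ n.
have fQ n : ft (Q n) by have [] := hQ n.
have lQ n : tr (Q n) <= K * expR (2 * e * 2 ^+ n) by rewrite -hKE; have [] := hQ n.
have nQ n : N (Q n) by have [] := fQ n.
have cW n W : W * (S * S) = S * S * W -> W * Q n = Q n * W by have [[_ h1] _ _ _ _] := hQ n; exact: h1.
have cS n : Q n * S = S * Q n by rewrite cW// mulrA.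
have ex n : x n ^+ 2 = 4 * (C * w q ^+ n) ^+ 2 by rewrite /x; ring.
have u1 n z : sqn (S ((1 - Q n) z)) <= x n ^+ 2 * sqn ((1 - Q n) z).
  by have [_ _ _ h1 _] := hQ n; rewrite ex.
have u2 n z : x n ^+ 2 * sqn (Q n z) <= sqn (S (Q n z)).
  by have [_ _ _ _ h1] := hQ n; rewrite ex.
move: {hQ} Q pQ fQ lQ nQ cW cS u1 u2 => Q pQ fQ lQ nQ cW cS u1 u2.
have th0 t : 0 <= t <= L -> 0 <= th a c q t by move=> _; exact: th_ge0.
have pb := sfun_psd L0 sS hS tc th0.
have nb := vN_sfun N_vN L0 sS hS tc nS.
have cb n : Q n * sfun L (th a c q) S = sfun L (th a c q) S * Q n by exact: sfun_comm.
have bu n z : rdot (sfun L (th a c q) S ((1 - Q n) z)) ((1 - Q n) z) <= k n * sqn ((1 - Q n) z).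
  apply: (@sfun_cut L _ _ (x n)) => //; [exact: projC|by rewrite mulrBl mulrBr mul1r mulr1 cS|exact: hk].
have bD z : rdot (sfun L (th a c q) S z) z <= D * sqn z.
  apply: sfun_ubound => // t _; have [t0|t0] := leP t 0; first by rewrite /th t0 ltW.
  apply: le_trans (hD t t0) _; rewrite ler_piMr ?(ltW D0)// -[leRHS]expR0 ler_expR oppr_le0.
  by rewrite mulr_ge0 ?powR_ge0//; lra.
move: (sfun L (th a c q) S) pb nb cb bu bD => b pb nb cb bu bD.
(* The projections increase: on a vector of Q n (1 - Q (n+1)), |S| would be at least x n and at most
   x (n+1), which is smaller. *)
have qq n : Q n * Q n.+1 = Q n.
  have cc : Q n * Q n.+1 = Q n.+1 * Q n by apply: cW; rewrite mulrA cS -mulrA cS mulrA.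
  apply/esym/eqP; rewrite -subr_eq0 -{1}[Q n]mulr1 -mulrBr; apply/eqP; apply: bopP => z.
  rewrite bop_zeroE; set y := (Q n * _) z.
  have y1 : Q n y = y by rewrite /y -bop_mulE mulrA (pQ n).1.
  have y2 : (1 - Q n.+1) y = y.
    have c1 : (1 - Q n.+1) * Q n = Q n * (1 - Q n.+1) by rewrite mulrBl mulrBr mul1r mulr1 cc.
    by rewrite /y -bop_mulE mulrA c1 -mulrA (projC (pQ n.+1)).1.
  have v1 := u2 n y; have v2 := u1 n.+1 y; rewrite y1 in v1; rewrite y2 in v2.
  have xx : x n.+1 < x n.
    rewrite /x !ltr_pM2l// exprS gtr_pMl ?exprn_gt0//.
    have -> : (1 : R) = 1 `^ q by rewrite powR1.
    by apply: gt0_ltr_powR; rewrite ?nnegrE ?invr_ge0//; lra.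
  apply: sqn_eq0; have s0 := sqn_ge0 y; have xx0 := x0 n.+1.
  have : (x n ^+ 2 - x n.+1 ^+ 2) * sqn y <= 0 by lra.
  have : 0 < x n ^+ 2 - x n.+1 ^+ 2 by rewrite subr_gt0 ltrXn2r// ltW.
  by move=> p1 p2; apply/le_anti; rewrite s0 andbT -(pmulr_rle0 _ p1).
have bQ0 (P : B) kk T : projection P -> N P -> P * b = b * P -> 0 <= kk -> ft T -> adj T = T ->
    (forall z, rdot (b (P z)) (P z) <= kk * rdot (T z) z) -> ft (b * P) /\ tr (b * P) <= kk * tr T.
  move=> hP nP cP kk0 fT sT hT; have [p1 p2] := psd_comm_proj pb hP cP.
  have [f1 l1] := ftZ N_vN tau_trace kk0 fT; rewrite -l1.
  apply: (ft_le N_vN tau_trace) => //; first exact: vNM.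
  split; first by rewrite adjB adjZ p1.1 sT.
  by move=> z; rewrite bop_subE rdotBl bop_scaleE rdotZl subr_ge0 p2.
have ind n : ft (b * Q n) /\ tr (b * Q n) <= D * K * expR (2 * e) + D * K * (4 / h) * (1 - (2 ^+ n)^-1).
  elim: n => [|n [IH1 IH2]].
    have hz z : rdot (b (Q 0%N z)) (Q 0%N z) <= D * rdot (Q 0%N z) z.
      by rewrite (proj_sqn z (pQ _)); exact: bD.
    have [g1 g2] := bQ0 _ _ _ (pQ _) (nQ _) (cb _) (ltW D0) (fQ _) (pQ _).2 hz.
    split => //; apply: le_trans g2 _; rewrite expr0 invr1 subrr mulr0 addr0 -mulrA ler_pM2l//.
    by have := lQ 0%N; rewrite expr0 mulr1.
  have cc := proj_le (pQ n) (pQ n.+1) (qq n).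
  have hP : projection (Q n.+1 - Q n).
    split; last by rewrite adjB (pQ n).2 (pQ n.+1).2.
    by rewrite mulrBl !mulrBr (pQ n).1 (pQ n.+1).1 cc qq subrr subr0.
  have nP : N (Q n.+1 - Q n) by exact: vNB.
  have cP : (Q n.+1 - Q n) * b = b * (Q n.+1 - Q n) by rewrite mulrBl mulrBr !cb.
  have hz z : rdot (b ((Q n.+1 - Q n) z)) ((Q n.+1 - Q n) z) <= k n * rdot (Q n.+1 z) z.
    have -> : (Q n.+1 - Q n) z = (1 - Q n) (Q n.+1 z).
      by rewrite -bop_mulE mulrBl mul1r qq.
    rewrite (proj_sqn z (pQ _)); apply: le_trans (bu n _) _; rewrite ler_pM2l//.
    by rewrite [leRHS](proj_pyth _ (pQ n)) lerDr sqn_ge0.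
  have [g1 g2] := bQ0 _ _ _ hP nP cP (ltW (k0 n)) (fQ _) (pQ _).2 hz.
  have [f1 f2] := ftD N_vN tau_trace IH1 g1.
  have eb : b * Q n + b * (Q n.+1 - Q n) = b * Q n.+1 by rewrite -mulrDr addrC subrK.
  rewrite eb in f1 f2; split => //; rewrite f2.
  have y0 : 0 < h * 2 ^+ n / 2 by rewrite divr_gt0// mulr_gt0// exprn_gt0.
  (* The crude bound exp(- y) <= 1 / y suffices; it makes the shells sum geometrically, to 4 / h (1
     - 2^{- n}). *)
  have g3 : k n * tr (Q n.+1) <= D * K * (h * 2 ^+ n / 2)^-1.
    apply: le_trans (ler_wpM2l (ltW (k0 n)) (lQ n.+1)) _.
    have -> : k n * (K * expR (2 * e * 2 ^+ n.+1)) = D * K * expR (- (h * 2 ^+ n / 2)).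
      by rewrite /k mulrACA -expRD; congr (_ * expR _); rewrite /e exprS; field.
    rewrite ler_pM2l// expRN lef_pV2 ?posrE ?expR_gt0//.
    by apply: le_trans (expR_ge1Dx _); rewrite lerDr.
  have e3 : D * K * (h * 2 ^+ n / 2)^-1 = D * K * (4 / h) * (1 - (2 ^+ n.+1)^-1) - D * K * (4 / h) * (1 - (2 ^+ n)^-1).
    have : 0 < 2 ^+ n :> R by rewrite exprn_gt0.
    by rewrite exprS; move: (2 ^+ n) => v v0; field; rewrite !gt_eqF.
  by rewrite e3 in g3; move: g2 g3 IH2; clear; move=> *; lra.
have DK0 : 0 <= D * K * (4 / h).
  by apply: mulr_ge0; [exact: ltW|rewrite divr_ge0// ltW].
apply: (@exhaustion_trace b Q k) => //.
- move=> n z; apply: le_trans (bu n z) _; rewrite ler_pM2l//.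
  by rewrite [leRHS](proj_pyth z (pQ n)) lerDr sqn_ge0.
- move=> d d0; have [j hj] : exists j : nat, D / (h * d) < j%:R.
    by exists (Num.truncn `|D / (h * d)|).+1; apply: le_lt_trans (ler_norm _) _; rewrite truncnS_gt.
  exists j; rewrite /k expRN ler_pdivrMr ?expR_gt0//.
  apply: (@le_trans _ _ (d * (h * 2 ^+ j))); last first.
    by rewrite ler_pM2l//; apply: le_trans (expR_ge1Dx _); rewrite lerDr.
  move: hj; rewrite (ltr_pdivrMr _ _ (mulr_gt0 h0 d0)) => hj; apply: le_trans (ltW hj) _.
  have : (j%:R : R) <= 2 ^+ j by rewrite -natrX ler_nat ltnW// ltn_expl.
  have hd : 0 < h * d := mulr_gt0 h0 d0.
  move=> h3; have := ler_wpM2r (ltW hd) h3; move: (2 ^+ j) (j%:R) => u v; lra.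
- move=> n; have [g1 g2] := ind n; split => //; apply: le_trans g2 _.
  by rewrite lerD2l ler_piMr// gerDl oppr_le0 invr_ge0 exprn_ge0.
Qed.

Lemma theta_opE r S L : 0 <= r -> 0 < L -> adj S = S -> opnorm S <= L -> theta_op r q S = sfun L (th r 1 q) S.
Proof. by move=> r0 L0 sS hS; rewrite /theta_op -th_theta (borel_calculus_abs L0 sS hS)//; exact: th_cont. Qed.

(** The calculus is continuous in operator norm only. With theta = b^2, b = k(|S|) and b' = k(|S'|),
    the identity b^2 - b'^2 = b (b - b') + (b - b') b' pairs the uniform trace bound on b and b'
    with the small norm of b - b'. *)
Lemma theta_family r A : 0 <= r -> usm q A -> (forall S, A S -> adj S = S) ->
  [/\ forall S, A S -> ft (theta_op r q S),
    exists2 m, 0 <= m & forall S, A S -> tnb (theta_op r q S) m &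
    forall e, 0 < e -> exists2 d, 0 < d & forall S S', A S -> A S' -> opnorm (S - S') <= d ->
      tnb (theta_op r q S - theta_op r q S') e].
Proof.
move=> r0 uA sA; have r2 : 0 <= r / 2 by lra.
have h2 : 0 < 1 / 2 :> R by lra.
have [L [m [L0 m0 hL hb]]] := th_trace r2 h2 uA sA.
have kc := th_cont r2 h2 q0; have [D D0 kD] := th_le_exp r2 h2 q0.
have tE S : A S -> theta_op r q S = sfun L (th (r / 2) (1 / 2) q) S * sfun L (th (r / 2) (1 / 2) q) S.
  move=> AS; have [nS hS] := hL S AS; have sS := sA S AS.
  rewrite (theta_opE r0 L0 sS hS) -(sfun_mul L0 sS hS kc kc).
  by congr (sfun L _ S); apply/funext => x; rewrite th_sqr.
have pb S : A S -> psd (sfun L (th (r / 2) (1 / 2) q) S).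
  move=> AS; have [nS hS] := hL S AS; apply: (sfun_psd L0 (sA S AS) hS kc).
  by move=> x _; exact: th_ge0.
have bD S : A S -> opnorm (sfun L (th (r / 2) (1 / 2) q) S) <= D.
  move=> AS; have [nS hS] := hL S AS; have pS := pb S AS.
  apply: sa_opnorm => [||z]; [exact: ltW|exact: pS.1|].
  rewrite ger0_norm; last exact: pS.2.
  by apply: (sfun_ubound z L0 kc (sA S AS) hS) => x _.
have cont e : 0 < e -> exists2 d, 0 < d & forall S S', A S -> A S' -> opnorm (S - S') <= d ->
    opnorm (sfun L (th (r / 2) (1 / 2) q) S - sfun L (th (r / 2) (1 / 2) q) S') <= e.
  move=> e0; have [d d0 hd] := sfun_norm_cont H L0 kc e0; exists d => // S S' AS AS' hh.
  by apply: hd => //; [exact: sA|exact: sA|exact: (hL S AS).2|exact: (hL S' AS').2].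
move: (sfun L (th (r / 2) (1 / 2) q)) hb tE pb bD cont => b hb tE pb bD cont.
have tb S : A S -> tnb (b S) m by move=> AS; have [f1 l1] := hb S AS; exact: (tnb_ft N_vN tau_trace).
have nb S : A S -> N (b S) by move=> AS; have [[]] := hb S AS.
have tt S : A S -> tnb (theta_op r q S) (4 * D * m).
  by move=> AS; rewrite tE//; apply: tnb_lmul => //; [exact: nb|exact: bD|exact: tb].
split.
- move=> S AS; have [] // := @psd_tnb_ft _ _ N tau N_vN tau_trace (theta_op r q S) (4 * D * m).
  + by rewrite tE//; apply: (vNM N_vN); exact: nb.
  + by rewrite tE//; have := psd_sqr (b S); rewrite (pb S AS).1.
  + exact: tt.
- by exists (4 * D * m) => //; rewrite !mulr_ge0// ltW.
move=> e e0; pose e' := e / (8 * m + 8).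
have m8 : 0 < 8 * m + 8 by lra.
have e0' : 0 < e' by rewrite divr_gt0.
have [d d0 hd] := cont e' e0'; exists d => // S S' AS AS' hh.
have hbb := hd S S' AS AS' hh.
have nB : N (b S - b S') by apply: (vNB N_vN); exact: nb.
have -> : theta_op r q S - theta_op r q S' = b S * (b S - b S') + (b S - b S') * b S'.
  by rewrite !tE// mulrBr mulrBl addrA subrK.
have := tnbD N_vN tau_trace (tnb_rmul N_vN tau_trace nB e0' hbb (tb S AS)) (tnb_lmul N_vN tau_trace nB e0' hbb (tb S' AS')).
apply: tnbW; have -> : e = e' * (8 * m + 8) by rewrite /e' divfK// gt_eqF.
have := mulr_ge0 (ltW e0') m0; lra.
Qed.

End Summability.

(** * Integration on the unit interval *)

Section UnitInterval.
Variable R : realType.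
Implicit Types f g Phi phi : R -> R.

Definition int01 g := \int[lebesgue_measure]_(t in `[0, 1]) g t.

Definition ucont g := forall e, 0 < e -> exists2 d, 0 < d &
  forall t s : R, 0 <= t <= 1 -> 0 <= s <= 1 -> `|t - s| <= d -> `|g t - g s| <= e.

Lemma ucont_within g : ucont g -> {within `[0, 1], continuous g}.
Proof.
move=> h; apply/subspace_continuousP => t /= t01; apply/cvgrPdist_le => e e0.
have [d d0 hd] := h e e0; rewrite near_withinE /=.
near=> s => s01; apply: hd; [by move: t01; rewrite in_itv|by move: s01; rewrite in_itv|].
by near: s; apply: cvgr_dist_le.
Unshelve. all: by end_near.
Qed.

Lemma ucont_integrable g : ucont g -> lebesgue_measure.-integrable `[0, 1] (EFin \o g).
Proof. by move=> h; apply: continuous_compact_integrable; [exact: segment_compact|exact: ucont_within]. Qed.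

Let m01 : measurable (`[0, 1]%classic : set (measurableTypeR R)).
Proof. exact: measurable_itv. Qed.

Lemma int01B f g : ucont f -> ucont g -> int01 (fun t => f t - g t) = int01 f - int01 g.
Proof. by move=> hf hg; rewrite /int01 RintegralB//; exact: ucont_integrable. Qed.

Lemma int01_cst (k : R) : int01 (fun=> k) = k.
Proof.
rewrite /int01 Rintegral_cst//.
have : lebesgue_measure (`[0, 1]%classic : set R) = 1%E.
  by rewrite lebesgue_measure_itv /= lte_fin ltr01 oppr0 adde0.
move=> e1; apply: etrans (_ : k * fine 1%E = k); last by rewrite mulr1.
by congr (_ * fine _); exact: e1.
Qed.

Lemma eq_int01 f g : (forall t, 0 <= t <= 1 -> f t = g t) -> int01 f = int01 g.
Proof. by move=> h; apply: eq_Rintegral => t; rewrite inE /= in_itv => /h. Qed.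

Lemma ucontB f g : ucont f -> ucont g -> ucont (fun t => f t - g t).
Proof.
move=> hf hg e e0; have e2 : 0 < e / 2 by lra.
have [d d0 hd] := hf _ e2; have [d' d0' hd'] := hg _ e2.
exists (Num.min d d'); first by rewrite lt_min d0.
move=> t s ht hs; rewrite le_min => /andP[h1 h2].
have := hd t s ht hs h1; have := hd' t s ht hs h2.
rewrite !ler_norml => /andP[? ?] /andP[? ?]; apply/andP; split; lra.
Qed.

Lemma int01_dist f g e : ucont f -> ucont g -> (forall t, 0 <= t <= 1 -> `|f t - g t| <= e) ->
  `|int01 f - int01 g| <= e.
Proof.
move=> hf hg h; rewrite -int01B//; have hi := ucont_integrable (ucontB hf hg).
have hu : ucont (fun t => `|f t - g t|).
  move=> e' e0'; have [d d0 hd] := ucontB hf hg e0'; exists d => // t s ht hs ts.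
  by apply: le_trans (ler_dist_dist _ _) _; exact: hd.
have hc : ucont (fun=> e) by move=> e' e0'; exists 1 => // t s _ _ _; rewrite subrr normr0 ltW.
rewrite /int01; apply: le_trans (le_normr_Rintegral m01 hi) _.
rewrite -[leRHS](int01_cst e); apply: (le_Rintegral m01 (ucont_integrable hu) (ucont_integrable hc)).
by move=> t /=; rewrite in_itv; exact: h.
Qed.

(** The quadratic remainder, uniform up to the end points, yields both the derivative inside and the
    one-sided continuity at 0 and 1 that the fundamental theorem asks for. *)
Lemma ftc_estimate Phi phi c : ucont phi ->
  (forall s t, 0 <= s <= 1 -> 0 <= t <= 1 -> `|Phi s - Phi t - (s - t) * phi t| <= c * (s - t) ^+ 2) ->
  int01 phi = Phi 1 - Phi 0.
Proof.
move=> uphi h; have z1 : 0 <= (1 : R) <= 1 by rewrite ler01 lexx.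
have z0 : 0 <= (0 : R) <= 1 by rewrite lexx ler01.
have c0 : 0 <= c.
  by have := h 1 0 z1 z0; rewrite subr0 expr1n mulr1; apply: le_trans.
have lip s t : 0 <= s <= 1 -> 0 <= t <= 1 -> `|Phi t - Phi s| <= (`|phi t| + c) * `|t - s|.
  move=> hs ht; have h1 := h s t hs ht; rewrite distrC [`|t - s|]distrC.
  have h2 : `|s - t| <= 1 by move: hs ht => /andP[? ?] /andP[? ?]; rewrite ler_norml; apply/andP; split; lra.
  have h3 : (s - t) ^+ 2 <= `|s - t|.
    by rewrite -real_normK ?num_real// expr2 ler_piMr.
  have -> : Phi s - Phi t = (Phi s - Phi t - (s - t) * phi t) + (s - t) * phi t by rewrite subrK.
  apply: le_trans (ler_normD _ _) _; rewrite normrM.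
  have := ler_wpM2l c0 h3; lra.
have der t : 0 < t < 1 -> h^-1 *: ((Phi \o shift t) (h *: (1 : R)) - Phi t) @[h --> (0 : R)^'] --> phi t.
  move=> /andP[t0 t1]; apply/cvgrPdist_le => e e0.
  pose d := Num.min (Num.min t (1 - t)) (e / (c + 1)).
  have c1 : 0 < c + 1 by lra.
  have d0 : 0 < d by rewrite !lt_min t0 subr_gt0 t1 divr_gt0.
  near=> k; have k0 : k != 0 by near: k; exact: nbhs_dnbhs_neq.
  have kd : `|k| <= d by near: k; exact: dnbhs0_le.
  move: kd; rewrite !le_min => /andP[/andP[k1 k2] k3].
  have hk : 0 <= k + t <= 1.
    by move: k1 k2; rewrite !ler_norml => /andP[? ?] /andP[? ?]; apply/andP; split; lra.
  have ht : 0 <= t <= 1 by rewrite !ltW.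
  have := h _ _ hk ht; rewrite addrK => h1.
  rewrite /= /shift /= -[k *: 1]/(k * 1) mulr1 distrC -[k^-1 *: _]/(k^-1 * _).
  have -> : k^-1 * (Phi (k + t) - Phi t) - phi t = k^-1 * (Phi (k + t) - Phi t - k * phi t).
    by rewrite [RHS]mulrBr mulKf.
  rewrite normrM normfV mulrC ler_pdivrMr ?normr_gt0//; apply: le_trans h1 _.
  rewrite -[k ^+ 2]real_normK ?num_real// expr2 mulrA ler_wpM2r//.
  move: k3; rewrite ler_pdivlMr// => k3; apply: le_trans k3.
  by rewrite mulrC ler_wpM2l// lerDl.
have := @continuous_FTC2 R phi Phi 0 1 ltr01 (ucont_within uphi).
rewrite /int01 /Rintegral => -> //.
- split.
  + move=> t; rewrite in_itv /= => t01; apply/cvg_ex; exists (phi t); exact: der.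
  + apply/cvgrPdist_le => e e0; pose d := e / (`|phi 0| + c + 1).
    have c1 : 0 < `|phi 0| + c + 1 by have := normr_ge0 (phi 0); lra.
    have d0 : 0 < d by rewrite divr_gt0.
    near=> s; have s0 : 0 < s by near: s; exact: nbhs_right_gt.
    have s1 : s < 1 by near: s; exact: nbhs_right_lt.
    have sd : s < d by near: s; exact: nbhs_right_lt.
    have hs : 0 <= s <= 1 by rewrite !ltW.
    apply: le_trans (lip s 0 hs z0) _; rewrite sub0r normrN (gtr0_norm s0).
    move: sd; rewrite /d ltr_pdivlMr//; lra.
  + apply/cvgrPdist_le => e e0; pose d := e / (`|phi 1| + c + 1).
    have c1 : 0 < `|phi 1| + c + 1 by have := normr_ge0 (phi 1); lra.
    have d0 : 0 < d by rewrite divr_gt0.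
    near=> s; have s0 : s < 1 by near: s; exact: nbhs_left_lt.
    have s1 : 0 < s by near: s; exact: nbhs_left_gt.
    have sd : 1 - d < s by near: s; apply: nbhs_left_gt; lra.
    have hs : 0 <= s <= 1 by rewrite !ltW.
    apply: le_trans (lip s 1 hs z1) _; have s2 : 0 < 1 - s by lra.
    rewrite (gtr0_norm s2); have : 1 - s < d by lra.
    rewrite /d ltr_pdivlMr//; lra.
- move=> t; rewrite in_itv /= => t01; rewrite derive1E /derive; apply: cvg_lim => //; exact: der.
Unshelve. all: by end_near.
Qed.

End UnitInterval.

(** * The one-form and its exactness *)

(** Operators do not commute, so [ring] is not applied to them. Both sides are expanded on vectors,
    where products of operators become real atoms. *)
Ltac bop_ring := apply: rdot_ext => ? ?;
  rewrite ?(bop_mulE, bop_addE, bop_oppE, bop_scaleE, bop_oneE, bop_zeroE, bopD, bopN, bopZ, bop0);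
  rewrite ?(rdotDl, rdotNl, rdotZl, rdot0l); ring.

Lemma common_bound (R : realType) (j a b : R) : 0 <= j -> 0 <= a -> 0 <= b ->
  exists x : R, [/\ 0 < x, j + a <= x, j + b <= x & (j + b) + (j + a) <= x].
Proof. by move=> *; exists (2 * j + a + b + 1); split; lra. Qed.

Lemma mul4_le (R : realType) (u v : R) : 0 <= u -> 0 <= v -> 2 * v * (2 * u) <= u * (8 * v).
Proof. by move=> u0 v0; have := mulr_ge0 u0 v0; lra. Qed.

Lemma close_bound (R : realType) (u m e : R) : u * (16 * (m + 1)) <= e / 2 -> 0 <= m -> 0 <= u -> 0 < e ->
  4 * (4 * u) * m + e / 4 <= e.
Proof. by move=> h m0 u0 e0; have := mulr_ge0 u0 m0; lra. Qed.

Section OneForm.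
Variables (R : realType) (H : hilbertType R).
Local Notation B := (bop H).
Variables (N : set B) (tau : B -> \bar R).
Hypotheses (N_vN : von_neumann_algebra N) (tau_trace : fns_trace N tau).
Local Notation ft := (ft N tau).
Local Notation tnb := (tnb N tau).
Local Notation tc := (tc N tau).
Local Notation rtr := (rtr N tau).
Local Notation usm := (usm N tau).
Variables (q : R) (q0 : 0 < q) (q1 : q <= 1) (r : R) (r0 : 0 <= r).

(* The one-form [X |-> tau (X k(F))] with [k(F) = f_r(1 - F^2)], and its
   integral [I A A'] along the segment from [A] to [A']. *)
Definition kq (F : B) : B := theta_op r q (1 - F ^+ 2).
Definition pt (A A' : B) (t : R) : B := A + t%:C *: (A' - A).
Definition fm (A A' : B) (t : R) : R := rtr ((A' - A) * kq (pt A A' t)).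
Definition I (A A' : B) : R := int01 (fm A A').

Lemma usm_scal p T : usm p [set T] -> usm p [set X | exists2 s : R, 0 <= s <= 1 & X = s%:C *: T].
Proof.
move=> h; apply: (usm_conj N_vN tau_trace ltr01 h) => X [s /andP[s0 s1] ->].
exists T, (s%:C *: (1 : B)), 1; split => //.
- split; first by apply: (vNZ N_vN); exact: vN1.
  rewrite opnormZ ger0_norm//; have := @opnorm1 R H; have := opnorm_ge0 (1 : B); nra.
- by split; [exact: vN1|exact: opnorm1].
- by rewrite bop_scaleAl mul1r mulr1.
Qed.

(** This is where the exponent q / 2 for the tangent vectors pays off: the square of A' - A is in
    Li_0^q, hence so is 1 - F_t^2 along the whole segment. *)
Lemma pt_sqr (A A' : B) t : 1 - pt A A' t ^+ 2 =
  ((1 - t)%:C *: (1 - A ^+ 2) + t%:C *: (1 - A' ^+ 2)) + (t * (1 - t))%:C *: ((A' - A) * (A' - A)).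
Proof. by rewrite /pt !expr2; bop_ring. Qed.

Lemma usm_pt (A A' : B) : usm q [set 1 - A ^+ 2] -> usm q [set 1 - A' ^+ 2] -> usm (q / 2) [set A' - A] ->
  usm q [set X | exists2 t : R, 0 <= t <= 1 & X = 1 - pt A A' t ^+ 2].
Proof.
move=> h1 h2 h3.
have h4 : usm q [set (A' - A) * (A' - A)].
  rewrite [X in usm X](splitr q); apply: (usmM N_vN tau_trace _ h3 h3); first by rewrite divr_ge0// ltW.
  by move=> X ->; exists (A' - A), (A' - A).
have u1 := usm_scal h1; have u2 := usm_scal h2; have u4 := usm_scal h4.
have u12 : usm q [set X | exists2 t : R, 0 <= t <= 1 & X = (1 - t)%:C *: (1 - A ^+ 2) + t%:C *: (1 - A' ^+ 2)].
  apply: (usmD N_vN tau_trace u1 u2) => X [t /andP[t0 t1] ->].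
  exists ((1 - t)%:C *: (1 - A ^+ 2)), (t%:C *: (1 - A' ^+ 2)); split => //.
    by exists (1 - t) => //; apply/andP; split; lra.
  by exists t => //; rewrite t0.
apply: (usmD N_vN tau_trace u12 u4) => X [t /andP[t0 t1] ->].
exists ((1 - t)%:C *: (1 - A ^+ 2) + t%:C *: (1 - A' ^+ 2)), ((t * (1 - t))%:C *: ((A' - A) * (A' - A))).
split; [by exists t => //; rewrite t0| |exact: pt_sqr].
by exists (t * (1 - t)) => //; apply/andP; split; nra.
Qed.

Lemma pt_sa (A A' : B) t : adj A = A -> adj A' = A' -> adj (pt A A' t) = pt A A' t.
Proof. by move=> h h'; rewrite /pt adjD adjZ adjB h h'. Qed.

Lemma sqr_sa (A : B) : adj A = A -> adj (1 - A ^+ 2) = 1 - A ^+ 2.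
Proof. by move=> h; rewrite expr2 adjB adj1 adjM h. Qed.

Lemma opnorm_sqrB (F F' : B) c : opnorm F <= c -> opnorm F' <= c ->
  opnorm ((1 - F ^+ 2) - (1 - F' ^+ 2)) <= 2 * c * opnorm (F - F').
Proof.
move=> h h'; have -> : (1 - F ^+ 2) - (1 - F' ^+ 2) = F' * (F' - F) + (F' - F) * F.
  by rewrite !expr2; bop_ring.
apply: le_trans (opnormD _ _) _; rewrite [opnorm (F - F')]opnormBC.
have := opnormM_le h' (lexx (opnorm (F' - F))); have := opnormM_le (lexx (opnorm (F' - F))) h.
lra.
Qed.

Lemma opnorm_pt (A A' : B) t : 0 <= t <= 1 -> opnorm (pt A A' t) <= opnorm A + opnorm (A' - A).
Proof.
move=> /andP[t0 t1]; apply: le_trans (opnormD _ _) _; rewrite lerD2l opnormZ ger0_norm//.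
by rewrite ler_piMl// opnorm_ge0.
Qed.

Lemma opnorm_ptB (A A' : B) t s : opnorm (pt A A' t - pt A A' s) = `|t - s| * opnorm (A' - A).
Proof.
rewrite -opnormZ; congr opnorm.
by rewrite /pt opprD addrACA subrr add0r rmorphB scalerBl.
Qed.

Lemma opnorm_pt_le (Y Y' : B) y t : 0 <= t <= 1 -> opnorm Y <= y -> opnorm Y' <= y -> opnorm (pt Y Y' t) <= y.
Proof.
move=> /andP[t0 t1] hY hY'; have -> : pt Y Y' t = (1 - t)%:C *: Y + t%:C *: Y' by rewrite /pt; bop_ring.
have t2 : 0 <= 1 - t by rewrite subr_ge0.
apply: le_trans (opnormD _ _) _; rewrite !opnormZ (ger0_norm t0) (ger0_norm t2).
have := lerD (ler_wpM2l t2 hY) (ler_wpM2l t0 hY'); rewrite -mulrDl subrK mul1r; exact.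
Qed.

Lemma rtr_mul_le X K c m : N X -> 0 < c -> opnorm X <= c -> tnb K m -> `|rtr (X * K)| <= 4 * c * m.
Proof. by move=> nX c0 hX tK; apply: rtr_le => //; exact: tnb_lmul. Qed.

Lemma fm_ucont (D : set B) (A A' : B) : usm q D -> (forall S, D S -> adj S = S) -> N A -> N A' ->
  (forall t, 0 <= t <= 1 -> D (1 - pt A A' t ^+ 2)) -> ucont (fm A A').
Proof.
move=> uD sD nA nA' hD e e0; have [fK _ cK] := theta_family N_vN tau_trace q0 q1 r0 uD sD.
pose x := opnorm (A' - A) + 1; have x0 : 0 < x by have := opnorm_ge0 (A' - A); rewrite /x; lra.
have e1 : 0 < e / (4 * x) by rewrite divr_gt0// mulr_gt0.
have [d d0 hd] := cK _ e1.
pose c := opnorm A + x; have c0 : 0 < c by have := opnorm_ge0 A; rewrite /c; lra.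
have k0 : 0 < 2 * c * x by rewrite !mulr_gt0.
exists (d / (2 * c * x)); first by rewrite divr_gt0.
move=> t s ht hs; rewrite ler_pdivlMr// => ts.
have nX : N (A' - A) by exact: vNB.
have tK u : 0 <= u <= 1 -> tc (kq (pt A A' u)) by move=> hu; apply: tc_ft => //; apply: fK; exact: hD.
have tXK u : 0 <= u <= 1 -> tc ((A' - A) * kq (pt A A' u)) by move=> hu; apply: tc_lmul => //; exact: tK.
rewrite /fm -rtrB//; [|exact: tXK|exact: tXK]; rewrite -mulrBr.
have hX : opnorm (A' - A) <= x by rewrite /x; lra.
have -> : e = 4 * x * (e / (4 * x)) by rewrite mulrC divfK// gt_eqF// mulr_gt0.
apply: rtr_mul_le => //; apply: hd; [exact: hD|exact: hD|].
have b u : 0 <= u <= 1 -> opnorm (pt A A' u) <= c.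
  by move=> hu; apply: le_trans (opnorm_pt _ _ hu) _; rewrite lerD2l.
apply: le_trans (opnorm_sqrB (b t ht) (b s hs)) _; rewrite opnorm_ptB.
apply: le_trans ts; have a0 := normr_ge0 (t - s); have := ler_wpM2l a0 hX; nra.
Qed.

Variables (J : B) (nJ : N J) (sJ : adj J = J) (JJ : J * J = 1).

(* [Cl] plays the role of M_q, with the symmetry [J] as base point. The compression
   [trunc E A] by a finite projection commuting with [J] differs from [J] only on
   the range of [E]. *)
Definition Cl (A : B) := [/\ N A, adj A = A, usm q [set 1 - A ^+ 2] & usm (q / 2) [set A - J]].
Definition trunc (E A : B) : B := J + E * (A - J) * E.
Definition comp E := [/\ projection E, N E & E * J = J * E].
(** One family for all compressions at once, because the limit E -> 1 needs estimates that do not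
    depend on E. The case E = 1 is the segment itself. *)
Definition TS (A A' : B) : set B :=
  [set S | exists t E, [/\ 0 <= t <= 1, comp E & S = 1 - (trunc E (pt A A' t)) ^+ 2]].

Lemma trunc_pt E (A A' : B) t : trunc E (pt A A' t) = pt (trunc E A) (trunc E A') t.
Proof. by rewrite /trunc /pt; bop_ring. Qed.

Lemma trunc1 (A : B) : trunc 1 A = A.
Proof. by rewrite /trunc mul1r mulr1 addrC subrK. Qed.

Lemma comp1 : comp 1.
Proof. by split; [split; rewrite ?mulr1 ?adj1|exact: vN1|rewrite mul1r mulr1]. Qed.

Lemma trunc_sa E (A : B) : comp E -> adj A = A -> adj (trunc E A) = trunc E A.
Proof. by move=> [[_ E2] _ _] sA; rewrite /trunc adjD !adjM adjB sJ sA E2 mulrA. Qed.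

Lemma trunc_vN E (A : B) : comp E -> N A -> N (trunc E A).
Proof.
by move=> [_ nE _] nA; apply: (vND N_vN) => //; do 2![apply: (vNM N_vN) => //]; exact: vNB.
Qed.

(** With Y = A - J, the constant term cancels by J^2 = 1, and the terms J Y + Y J compress because E
    commutes with J. The defect comes from Y^2 alone: it is E Y (1 - E) Y E, a product of two
    factors of order q / 2. *)
Lemma sqr_trunc E (A : B) : comp E -> 1 - trunc E A ^+ 2 =
  E * (1 - A ^+ 2) * E + E * (A - J) * ((1 - E) * (A - J) * E).
Proof.
move=> [[EE _] _ cE]; set Y := A - J.
have -> : A = J + Y by rewrite /Y addrC subrK.
have k (Z : B) : 1 - (J + Z) ^+ 2 = - (J * Z + Z * J + Z * Z).
  by rewrite expr2 mulrDl !mulrDr JJ !opprD !addrA subrr add0r.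
rewrite /trunc -/Y !k.
have -> : J + Y - J = Y by rewrite addrC addKr.
have e1 : J * (E * Y * E) = E * (J * Y) * E by rewrite !mulrA cE.
have e2 : E * Y * E * J = E * (Y * J) * E by rewrite -mulrA cE !mulrA.
have e3 : E * Y * E * (E * Y * E) = E * (Y * E * Y) * E by rewrite !mulrA -[E * Y * E * E]mulrA EE.
rewrite e1 e2 e3; clearbody Y; bop_ring.
Qed.

Lemma ClB (A A' : B) : Cl A -> Cl A' -> usm (q / 2) [set A' - A].
Proof.
move=> [_ _ _ h] [_ _ _ h'].
have hN : usm (q / 2) [set J - A].
  apply: (usm_conj N_vN tau_trace ltr01 h) => X ->; exists (A - J), (- 1), 1; split => //.
  - by split; [apply: (vNN N_vN); exact: vN1|rewrite opnormN opnorm1].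
  - by split; [exact: vN1|exact: opnorm1].
  - by rewrite mulr1 mulNr mul1r opprB.
apply: (usmD N_vN tau_trace h' hN) => X ->; exists (A' - J), (J - A); split => //.
by rewrite addrA subrK.
Qed.

Lemma TS_usm (A A' : B) : Cl A -> Cl A' -> usm q (TS A A').
Proof.
move=> hA hA'; have [nA sA uA yA] := hA; have [nA' sA' uA' yA'] := hA'.
have u1 := usm_pt uA uA' (ClB hA hA').
have v1 := usm_scal yA; have v2 := usm_scal yA'.
have v : usm (q / 2) [set X | exists2 t : R, 0 <= t <= 1 & X = pt A A' t - J].
  apply: (usmD N_vN tau_trace v1 v2) => X [t /andP[t0 t1] ->].
  exists ((1 - t)%:C *: (A - J)), (t%:C *: (A' - J)); split.
  - by exists (1 - t) => //; apply/andP; split; lra.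
  - by exists t => //; rewrite t0.
  - by rewrite /pt; bop_ring.
have cb E : comp E -> N E /\ opnorm E <= 1 by move=> [pE nE _]; split => //; exact: proj_opnorm.
have cb' E : comp E -> N (1 - E) /\ opnorm (1 - E) <= 1.
  move=> [pE nE _]; split; first by apply: (vNB N_vN) => //; exact: vN1.
  by apply: proj_opnorm; exact: projC.
have w1 : usm q [set X | exists t E, [/\ 0 <= t <= 1, comp E & X = E * (1 - pt A A' t ^+ 2) * E]].
  apply: (usm_conj N_vN tau_trace ltr01 u1) => X [t [E [ht hE ->]]].
  by exists (1 - pt A A' t ^+ 2), E, E; split => //; [exists t|exact: cb|exact: cb].
have w2 : usm (q / 2) [set X | exists t E, [/\ 0 <= t <= 1, comp E & X = E * (pt A A' t - J)]].
  apply: (usm_conj N_vN tau_trace ltr01 v) => X [t [E [ht hE ->]]].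
  exists (pt A A' t - J), E, 1; split => //; [by exists t|exact: cb| |by rewrite mulr1].
  by split; [exact: vN1|exact: opnorm1].
have w3 : usm (q / 2) [set X | exists t E, [/\ 0 <= t <= 1, comp E & X = (1 - E) * (pt A A' t - J) * E]].
  apply: (usm_conj N_vN tau_trace ltr01 v) => X [t [E [ht hE ->]]].
  by exists (pt A A' t - J), (1 - E), E; split => //; [exists t|exact: cb'|exact: cb].
have w4 : usm q [set X | exists t E, [/\ 0 <= t <= 1, comp E &
    X = E * (pt A A' t - J) * ((1 - E) * (pt A A' t - J) * E)]].
  rewrite [X in usm X](splitr q); apply: (usmM N_vN tau_trace _ w2 w3); first by rewrite divr_ge0// ltW.
  by move=> X [t [E [ht hE ->]]]; do 2!eexists; split; [exists t, E|exists t, E|].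
apply: (usmD N_vN tau_trace w1 w4) => X [t [E [ht hE ->]]].
do 2!eexists; split; [by exists t, E|by exists t, E|exact: sqr_trunc].
Qed.

Lemma TS_sa (A A' : B) S : Cl A -> Cl A' -> TS A A' S -> adj S = S.
Proof.
move=> [_ sA _ _] [_ sA' _ _] [t [E [_ hE ->]]]; apply: sqr_sa; apply: trunc_sa => //.
exact: pt_sa.
Qed.

Lemma fm_trunc_ucont E (A A' : B) : Cl A -> Cl A' -> comp E -> ucont (fm (trunc E A) (trunc E A')).
Proof.
move=> hA hA' hE; have [nA _ _ _] := hA; have [nA' _ _ _] := hA'.
apply: (fm_ucont (TS_usm hA hA')) => [S| | |t ht].
- exact: TS_sa.
- exact: trunc_vN.
- exact: trunc_vN.
- by exists t, E; split => //; rewrite trunc_pt.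
Qed.

Lemma fm_Cl_ucont (A A' : B) : Cl A -> Cl A' -> ucont (fm A A').
Proof. by move=> hA hA'; have := fm_trunc_ucont hA hA' comp1; rewrite !trunc1. Qed.

Lemma fm_Cl_ft (A A' : B) t : Cl A -> Cl A' -> 0 <= t <= 1 -> ft (kq (pt A A' t)).
Proof.
move=> hA hA' ht.
have [fK _ _] := theta_family N_vN tau_trace q0 q1 r0 (TS_usm hA hA') (fun S => TS_sa hA hA').
by apply: fK; exists t, 1; split => //; [exact: comp1|rewrite trunc1].
Qed.

Lemma trunc_dist E (A : B) d : comp E -> adj A = A -> opnorm ((A - J) * (1 - E)) <= d ->
  opnorm (A - trunc E A) <= 2 * d.
Proof.
move=> hE sA hd; have [pE _ _] := hE; set Y := A - J in hd *.
have -> : A - trunc E A = Y * (1 - E) + adj (Y * (1 - E)) * E.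
  by rewrite adjM (projC pE).2 adjB sA sJ -/Y /trunc -/Y /Y; bop_ring.
have d0 : 0 <= d by apply: le_trans hd; exact: opnorm_ge0.
apply: le_trans (opnormD _ _) _.
have h2 : opnorm (adj (Y * (1 - E))) <= d by rewrite opnorm_adj.
by have := opnormM_le h2 (proj_opnorm pE); rewrite mulr1; lra.
Qed.

Lemma opnorm_trunc E (A : B) : comp E -> opnorm (trunc E A) <= opnorm J + opnorm (A - J).
Proof.
move=> [pE _ _]; apply: le_trans (opnormD _ _) _; rewrite lerD2l.
have := opnormM_le (opnormM_le (proj_opnorm pE) (lexx (opnorm (A - J)))) (proj_opnorm pE).
by rewrite mul1r mulr1.
Qed.

(** Two errors: the tangent vector changes by a small norm against a bounded trace norm, and k(F)
    changes by a small trace norm, by [theta_family], against a bounded norm. The resulting d is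
    independent of E. *)
Lemma fm_trunc_close (A A' : B) e : Cl A -> Cl A' -> 0 < e -> exists2 d, 0 < d &
  forall E, comp E -> opnorm ((A - J) * (1 - E)) <= d -> opnorm ((A' - J) * (1 - E)) <= d ->
    forall t, 0 <= t <= 1 -> `|fm A A' t - fm (trunc E A) (trunc E A') t| <= e.
Proof.
move=> hA hA' e0; have uT := TS_usm hA hA'; have sT S := @TS_sa A A' S hA hA'.
have [nA sA _ _] := hA; have [nA' sA' _ _] := hA'.
have [fK [m m0 tK] cK] := theta_family N_vN tau_trace q0 q1 r0 uT sT.
have [j hj j0] : exists2 j, opnorm J <= j & 0 <= j by exists (opnorm J) => //; exact: opnorm_ge0.
have [a ha a0] : exists2 a, opnorm (A - J) <= a & 0 <= a by exists (opnorm (A - J)) => //; exact: opnorm_ge0.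
have [b hb b0] : exists2 b, opnorm (A' - J) <= b & 0 <= b by exists (opnorm (A' - J)) => //; exact: opnorm_ge0.
have [x [x0 xa xb xab]] : exists x : R, [/\ 0 < x, j + a <= x, j + b <= x & (j + b) + (j + a) <= x].
  exact: common_bound.
have e1 : 0 < e / 2 / (8 * x) by rewrite !divr_gt0// mulr_gt0.
have [d d0 hd] := cK _ e1.
pose d1 := Num.min (d / (8 * x)) (e / 2 / (16 * (m + 1))).
have m1 : 0 < 16 * (m + 1) by rewrite mulr_gt0// ltr_wpDl.
have x8 : 0 < 8 * x by rewrite mulr_gt0.
have d10 : 0 < d1 by rewrite lt_min !divr_gt0.
have [d1d d1e] : d1 * (8 * x) <= d /\ d1 * (16 * (m + 1)) <= e / 2.
  by split; rewrite -ler_pdivlMr// /d1 ge_min lexx ?orbT.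
exists d1 => // E hE h1 h2 t ht.
have g1 := trunc_dist hE sA h1; have g2 := trunc_dist hE sA' h2.
have b1 : opnorm A <= x.
  have -> : A = J + (A - J) by rewrite addrC subrK.
  exact: le_trans (opnormD _ _) (le_trans (lerD hj ha) xa).
have b2 : opnorm A' <= x.
  have -> : A' = J + (A' - J) by rewrite addrC subrK.
  exact: le_trans (opnormD _ _) (le_trans (lerD hj hb) xb).
have c1 := le_trans (opnorm_trunc A hE) (lerD hj ha); have c2 := le_trans (opnorm_trunc A' hE) (lerD hj hb).
have hS : opnorm ((1 - pt A A' t ^+ 2) - (1 - pt (trunc E A) (trunc E A') t ^+ 2)) <= d.
  have p1 := opnorm_pt_le ht b1 b2.
  have p2 := opnorm_pt_le ht (le_trans c1 xa) (le_trans c2 xb).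
  apply: le_trans (opnorm_sqrB p1 p2) _.
  have -> : pt A A' t - pt (trunc E A) (trunc E A') t = pt (A - trunc E A) (A' - trunc E A') t.
    by rewrite /pt; bop_ring.
  have p3 := opnorm_pt_le ht g1 g2; have x2 : 0 <= 2 * x by rewrite mulr_ge0// ltW.
  apply: le_trans (ler_wpM2l x2 p3) _; apply: le_trans d1d; exact: mul4_le (ltW d10) (ltW x0).
have TE : TS A A' (1 - pt (trunc E A) (trunc E A') t ^+ 2) by exists t, E; split => //; rewrite trunc_pt.
have T1 : TS A A' (1 - pt A A' t ^+ 2) by exists t, 1; split => //; [exact: comp1|rewrite trunc1].
have k1 := hd _ _ T1 TE hS; have k2 := tK _ T1.
have nX : N (A' - A) by exact: vNB.
have nE := trunc_vN hE nA; have nE' := trunc_vN hE nA'.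
have nXE : N (trunc E A' - trunc E A) by exact: vNB.
rewrite -/(kq _) -/(kq _) in k1; rewrite -/(kq _) in k2.
have tk1 : tc (kq (pt A A' t)) by exists m.
have tk2 : tc (kq (pt (trunc E A) (trunc E A') t)) by apply: tc_ft => //; exact: fK.
have -> : fm A A' t - fm (trunc E A) (trunc E A') t =
   rtr ((A' - trunc E A' - (A - trunc E A)) * kq (pt A A' t)) +
   rtr ((trunc E A' - trunc E A) * (kq (pt A A' t) - kq (pt (trunc E A) (trunc E A') t))).
  have nDX : N (A' - trunc E A' - (A - trunc E A)) by do 2!apply: (vNB N_vN) => //.
  rewrite /fm -!(rtrB, rtrD)//; try by apply: tc_lmul => //; apply: tcB.
  congr rtr; rewrite mulrBr addrA; congr (_ - _); rewrite -mulrDl; congr (_ * _); bop_ring.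
apply: le_trans (ler_normD _ _) _.
have i1 : `|rtr ((A' - trunc E A' - (A - trunc E A)) * kq (pt A A' t))| <= 4 * (4 * d1) * m.
  apply: rtr_mul_le => //; [by do 2!apply: (vNB N_vN) => //|by rewrite mulr_gt0|].
  by apply: le_trans (opnormB _ _) _; apply: le_trans (lerD g2 g1) _; rewrite -mulrDl -natrD.
have i2 : `|rtr ((trunc E A' - trunc E A) * (kq (pt A A' t) - kq (pt (trunc E A) (trunc E A') t)))| <= 4 * x * (e / 2 / (8 * x)).
  apply: rtr_mul_le => //; exact: le_trans (opnormB _ _) (le_trans (lerD c2 c1) xab).
have i3 : 4 * x * (e / 2 / (8 * x)) = e / 4 by field; rewrite gt_eqF.
rewrite i3 in i2; apply: le_trans (lerD i1 i2) _.
exact: close_bound d1e m0 (ltW d10) e0.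
Qed.

End OneForm.

(** * Exactness of the one-form *)

Lemma close3 (R : realType) (a b c a' b' c' e : R) : `|a - a'| <= e / 3 -> `|b - b'| <= e / 3 ->
  `|c - c'| <= e / 3 -> a' + b' + c' = 0 -> `|a + b + c| <= e.
Proof.
by rewrite !ler_norml => /andP[? ?] /andP[? ?] /andP[? ?] ?; apply/andP; split; lra.
Qed.

Lemma half_le (R : realType) (a b : R) : 2 * a <= b + b -> a <= b.
Proof. by move=> ?; lra. Qed.

Section Exactness.
Variables (R : realType) (H : hilbertType R).
Local Notation B := (bop H).

Lemma peval_comp (p s : {poly R}) (A : B) : peval (p \Po s) A = peval p (peval s A).
Proof.
elim/poly_ind: p => [|p c IH]; first by rewrite comp_poly0 !peval0.
by rewrite comp_polyD comp_polyM comp_polyX comp_polyC pevalD pevalM IH pevalC pevalD pevalMX pevalC.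
Qed.

Lemma opnormX (F : B) L n : 0 <= L -> opnorm F <= L -> opnorm (F ^+ n) <= L ^+ n.
Proof.
move=> L0 h; elim: n => [|n IH]; first by rewrite !expr0 opnorm1.
by rewrite !exprS; exact: opnormM_le.
Qed.

(** The derivative of F |-> F^n in the direction Y, that is, the sum of the products F^i Y
    F^{n-1-i}. *)
Fixpoint dpow (F Y : B) n : B := if n is m.+1 then dpow F Y m * F + F ^+ m * Y else 0.

Lemma dpow_scale F Y s n : dpow F (s%:C *: Y) n = s%:C *: dpow F Y n.
Proof.
elim: n => [|n IH] /=; first by rewrite scaler0.
by rewrite IH bop_scaleAl bop_scaleAr scalerDr.
Qed.

Lemma dpow_bound n L : 0 <= L -> exists2 c, 0 <= c & forall F Y, opnorm F <= L -> opnorm (F + Y) <= L ->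
  opnorm (dpow F Y n) <= c * opnorm Y /\ opnorm ((F + Y) ^+ n - F ^+ n - dpow F Y n) <= c * opnorm Y ^+ 2.
Proof.
move=> L0; elim: n => [|n [c c0 IH]].
  by exists 0 => // F Y _ _; rewrite /= !expr0 subrr subr0 !mul0r opnorm0.
exists (c * L + L ^+ n + c).
  by rewrite !addr_ge0 ?mulr_ge0 ?exprn_ge0.
move=> F Y hF hFY; have [h1 h2] := IH F Y hF hFY; have hn := opnormX n L0 hF.
have y0 := opnorm_ge0 Y; have p0 : 0 <= L ^+ n by rewrite exprn_ge0.
split.
  apply: le_trans (opnormD _ _) _.
  have i1 := opnormM_le h1 hF; have i2 := opnormM_le hn (lexx (opnorm Y)).
  apply: le_trans (lerD i1 i2) _; move: (opnorm Y) y0 (L ^+ n) => y y0 l.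
  by have := mulr_ge0 c0 y0; lra.
have -> : (F + Y) ^+ n.+1 - F ^+ n.+1 - dpow F Y n.+1 =
    ((F + Y) ^+ n - F ^+ n - dpow F Y n) * (F + Y) + dpow F Y n * Y.
  rewrite /= !exprSr; move: ((F + Y) ^+ n) (F ^+ n) (dpow F Y n) => U V W; bop_ring.
apply: le_trans (opnormD _ _) _.
have i1 := opnormM_le h2 hFY; have i2 := opnormM_le h1 (lexx (opnorm Y)).
apply: le_trans (lerD i1 i2) _; move: (opnorm Y) y0 (L ^+ n) p0 => y y0 l l0.
by have := mulr_ge0 l0 (sqr_ge0 y); rewrite expr2; lra.
Qed.

Variables (N : set B) (tau : B -> \bar R).
Hypotheses (N_vN : von_neumann_algebra N) (tau_trace : fns_trace N tau).
Local Notation ft := (ft N tau).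
Local Notation tnb := (tnb N tau).
Local Notation tc := (tc N tau).
Local Notation rtr := (rtr N tau).
Local Notation usm := (usm N tau).
Variables (q : R) (q0 : 0 < q) (q1 : q <= 1) (r : R) (r0 : 0 <= r).
Variables (J : B) (nJ : N J) (sJ : adj J = J) (JJ : J * J = 1).
Local Notation I := (I N tau q r).
Local Notation fm := (fm N tau q r).
Local Notation kq := (kq q r).
Local Notation Cl := (Cl N tau q J).
Local Notation trc := (trunc J).
Local Notation comp := (comp N J).

Section truncated.
Variables (E : B) (cE : comp E) (fE : ft E).

(** Operators that differ from J only inside the finite projection E, so that their differences are
    in the trace ideal. *)
Definition good (F : B) := [/\ N F, E * F = F * E & E * (F - J) = F - J].

Lemma trunc_good (A : B) : N A -> good (trc E A).
Proof.
have [[EE _] nE eJ] := cE => nA; split; first exact: trunc_vN.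
  by rewrite /trunc mulrDr mulrDl eJ !mulrA EE -[_ * E * E]mulrA EE.
by rewrite /trunc [J + _]addrC addrK !mulrA EE.
Qed.

Lemma good_pt F F' t : good F -> good F' -> good (pt F F' t).
Proof.
move=> [n1 c1 e1] [n2 c2 e2]; split.
- by apply: (vND N_vN) => //; apply: (vNZ N_vN); exact: vNB.
- by rewrite /pt mulrDr mulrDl bop_scaleAl bop_scaleAr mulrBl mulrBr c1 c2.
- have -> : pt F F' t - J = (1 - t)%:C *: (F - J) + t%:C *: (F' - J) by rewrite /pt; bop_ring.
  by rewrite mulrDr !bop_scaleAr e1 e2.
Qed.

Lemma good_diff F F' : good F -> good F' -> [/\ N (F' - F), E * (F' - F) = F' - F & tc (F' - F)].
Proof.
move=> [n1 c1 e1] [n2 c2 e2]; have nX : N (F' - F) by exact: vNB.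
have e : E * (F' - F) = F' - F.
  have -> : F' - F = (F' - J) - (F - J) by rewrite opprB addrA subrK.
  by rewrite mulrBr e1 e2.
by split => //; rewrite -e; apply: tc_rmul => //; exact: tc_ft.
Qed.

(** By cyclicity all n terms of the derivative have the same trace. The factor F^k is there for the
    induction, which moves powers of F across; E is absorbed by Y. *)
Lemma dpow_trace F Y n k : N F -> E * F = F * E -> N Y -> E * Y = Y -> tc Y ->
  rtr (E * dpow F Y n * F ^+ k) = n%:R * rtr (Y * F ^+ (n.-1 + k)).
Proof.
move=> nF cF nY eY tY; have nX i := vNX N_vN i nF.
have nD i : N (dpow F Y i).
  elim: i => [|i IH] /=; first exact: vN0.
  by apply: (vND N_vN); apply: (vNM N_vN).
have tE := tc_ft N_vN tau_trace fE.
elim: n k => [|n IH] k /=; first by rewrite mulr0 mul0r mul0r rtr0.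
have cFn : E * F ^+ n = F ^+ n * E.
  elim: n {IH} => [|i IH]; first by rewrite expr0 mul1r mulr1.
  by rewrite exprS mulrA cF -mulrA IH mulrA.
have -> : E * (dpow F Y n * F + F ^+ n * Y) * F ^+ k = E * dpow F Y n * F ^+ k.+1 + F ^+ n * (Y * F ^+ k).
  rewrite mulrDr mulrDl exprS !mulrA; congr (_ + _).
  by rewrite cFn -[F ^+ n * E * Y]mulrA eY.
have t1 : tc (E * dpow F Y n * F ^+ k.+1) by do 2!apply: tc_rmul => //.
have t2 : tc (Y * F ^+ k) by exact: tc_rmul.
rewrite rtrD//; last exact: tc_lmul.
rewrite IH (rtrC N_vN tau_trace (nX n) t2) -mulrA -exprD [(k + n)%N]addnC -natr1 mulrDl mul1r.
by case: n {IH cFn t1} => [|n]; [rewrite !mul0r|rewrite addnS].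
Qed.

(* Along segments, [Phi] is a primitive of the one-form [X |-> tau (X P(F))]; the
   finite projection [E] makes every trace finite. *)
Definition has_prim (P : {poly R}) := exists Phi : B -> R, forall F F', good F -> good F' ->
  exists c, forall s t, 0 <= s <= 1 -> 0 <= t <= 1 ->
    `|Phi (pt F F' s) - Phi (pt F F' t) - (s - t) * rtr ((F' - F) * peval P (pt F F' t))| <= c * (s - t) ^+ 2.

Lemma prim0 : has_prim 0.
Proof.
exists (fun=> 0) => F F' _ _; exists 0 => s t _ _.
by rewrite peval0 mulr0 (rtr0 N_vN tau_trace) mulr0 !subr0 normr0 mul0r.
Qed.

Lemma primD P Q : has_prim P -> has_prim Q -> has_prim (P + Q).
Proof.
move=> [f hf] [g hg]; exists (fun F => f F + g F) => F F' gF gF'.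
have [c hc] := hf F F' gF gF'; have [d hd] := hg F F' gF gF'; exists (c + d) => s t hs ht.
have [nX _ tX] := good_diff gF gF'; have [nF _ _] := good_pt t gF gF'.
rewrite pevalD mulrDr rtrD//; try by apply: tc_rmul => //; exact: vN_peval.
have := hc s t hs ht; have := hd s t hs ht; rewrite !ler_norml => /andP[a1 a2] /andP[b1 b2].
by apply/andP; split; lra.
Qed.

Lemma prim_mon a n : has_prim (a *: 'X^n).
Proof.
(* The naive primitive tau(F^{n+1}) may be infinite; with E it is finite, and its derivative is the
   same because directions Y satisfy E Y = Y. *)
exists (fun F => a / n.+1%:R * rtr (E * F ^+ n.+1)) => F F' gF gF'.
have [nX eX tX] := good_diff gF gF'; have tE := tc_ft N_vN tau_trace fE.
pose L := opnorm F + opnorm (F' - F); have L0 : 0 <= L by rewrite addr_ge0// opnorm_ge0.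
have [c c0 hc] := dpow_bound n.+1 L0.
have [m hm] := tE; have m0 := tnb_ge0 tau_trace hm.
pose d := c * opnorm (F' - F) ^+ 2 + 1.
have d0 : 0 < d by rewrite ltr_wpDl// mulr_ge0// sqr_ge0.
exists (`|a / n.+1%:R| * (4 * d * m)) => s t hs ht.
have [nF cF _] := good_pt t gF gF'; have [nFs _ _] := good_pt s gF gF'.
have eS : pt F F' s = pt F F' t + (s - t)%:C *: (F' - F) by rewrite /pt; bop_ring.
have bF := opnorm_pt F F' ht; have bFs := opnorm_pt F F' hs; rewrite -/L in bF bFs.
have [|h1 h2] := hc (pt F F' t) ((s - t)%:C *: (F' - F)) bF; first by rewrite -eS.
rewrite -eS opnormZ dpow_scale in h2.
pose D := dpow (pt F F' t) (F' - F) n.+1.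
have nD : N D.
  rewrite /D; elim: (n.+1) => [|i IH] /=; first exact: vN0.
  by apply: (vND N_vN); apply: (vNM N_vN) => //; exact: vNX.
have trD : rtr (E * D) = n.+1%:R * rtr ((F' - F) * pt F F' t ^+ n).
  by have := dpow_trace n.+1 0 nF cF nX eX tX; rewrite expr0 mulr1 addn0.
have ep : peval (a *: 'X^n) (pt F F' t) = a%:C *: pt F F' t ^+ n.
  by rewrite pevalZ peval_exp pevalX.
have tXF : tc ((F' - F) * pt F F' t ^+ n) by apply: tc_rmul => //; exact: vNX.
rewrite ep bop_scaleAr rtrZ//.
have tEF i (G : B) : N G -> tc (E * G ^+ i) by move=> nG; apply: tc_rmul => //; exact: vNX.
have tED : tc (E * D) by exact: tc_rmul.
have n0 : n.+1%:R != 0 :> R by rewrite pnatr_eq0.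
have -> : a / n.+1%:R * rtr (E * pt F F' s ^+ n.+1) - a / n.+1%:R * rtr (E * pt F F' t ^+ n.+1) -
    (s - t) * (a * rtr ((F' - F) * pt F F' t ^+ n)) =
    a / n.+1%:R * rtr (E * (pt F F' s ^+ n.+1 - pt F F' t ^+ n.+1 - (s - t)%:C *: D)).
  have tA := tEF n.+1 _ nFs; have tB := tEF n.+1 _ nF.
  have tAB : tc (E * pt F F' s ^+ n.+1 - E * pt F F' t ^+ n.+1) by exact: tcB.
  have tZ : tc ((s - t)%:C *: (E * D)) by exact: tcZ.
  by rewrite !mulrBr bop_scaleAr (rtrB N_vN tau_trace tAB tZ) (rtrB N_vN tau_trace tA tB) rtrZ// trD; field.
rewrite normrM -mulrA; apply: ler_wpM2l (normr_ge0 _) _ _ _.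
have [->|st] := eqVneq s t.
  by rewrite !subrr scale0r subrr mulr0 (rtr0 N_vN tau_trace) normr0 expr2 !mulr0.
have st0 : 0 < (s - t) ^+ 2 by rewrite exprn_even_gt0 //= subr_eq0.
have dd : 0 < d * (s - t) ^+ 2 by exact: mulr_gt0.
have : tnb (E * (pt F F' s ^+ n.+1 - pt F F' t ^+ n.+1 - (s - t)%:C *: D)) (4 * (d * (s - t) ^+ 2) * m).
  apply: tnb_rmul => //.
    by apply: (vNB N_vN); [apply: (vNB N_vN); exact: vNX|exact: vNZ].
  apply: le_trans h2 _; rewrite exprMn real_normK ?num_real// mulrCA mulrC.
  by apply: ler_wpM2r (ltW st0) _ _ _; rewrite /d lerDl.
move=> /(rtr_le N_vN tau_trace) h; apply: le_trans h _.
by rewrite le_eqVlt; apply/orP; left; apply/eqP; ring.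
Qed.

Lemma has_primP P : has_prim P.
Proof.
rewrite -[P]coefK poly_def; elim/big_ind : _ => [|P1 P2|i _]; [exact: prim0|exact: primD|exact: prim_mon].
Qed.

(** Adding the estimates for (t, s) and (s, t) cancels Phi and leaves (t - s) (phi t - phi s). *)
Lemma estimate_ucont (Phi phi : R -> R) c :
  (forall s t, 0 <= s <= 1 -> 0 <= t <= 1 -> `|Phi s - Phi t - (s - t) * phi t| <= c * (s - t) ^+ 2) ->
  ucont phi.
Proof.
move=> h e e0; have c0 : 0 <= c.
  have z1 : 0 <= (1 : R) <= 1 by rewrite ler01 lexx.
  have z0 : 0 <= (0 : R) <= 1 by rewrite lexx ler01.
  by have := h 1 0 z1 z0; rewrite subr0 expr1n mulr1; apply: le_trans.
have c1 : 0 < 2 * c + 1 by lra.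
exists (e / (2 * c + 1)) => [|t s ht hs]; first by rewrite divr_gt0.
rewrite ler_pdivlMr// => hd; have [->|ts] := eqVneq t s; first by rewrite subrr normr0 ltW.
have ts0 : 0 < `|t - s| by rewrite normr_gt0 subr_eq0.
rewrite -(ler_pM2l ts0) -normrM.
have -> : (t - s) * (phi t - phi s) = (Phi t - Phi s - (t - s) * phi s) + (Phi s - Phi t - (s - t) * phi t) by ring.
apply: le_trans (ler_normD _ _) _; apply: le_trans (lerD (h t s ht hs) (h s t hs ht)) _.
have -> : (s - t) ^+ 2 = `|t - s| * `|t - s| by rewrite -expr2 real_normK ?num_real// -sqrrN opprB.
have -> : (t - s) ^+ 2 = `|t - s| * `|t - s| by rewrite -expr2 real_normK ?num_real.
move: hd (ts0); move: (`|t - s|) => v hd v0.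
have := ler_wpM2l (ltW v0) hd; have := mulr_ge0 (ltW v0) (ltW v0); lra.
Qed.

(** [sfun] is approximated by polynomials in S^2 with S = 1 - F^2, whence p composed with (1 -
    X^2)^2. The error is a small norm times the trace norm of F' - F. *)
Lemma trunc_approx L (p : {poly R}) Phi e F F' : 0 < L -> good F -> good F' -> adj F = F -> adj F' = F' ->
  (forall S : B, adj S = S -> opnorm S <= L -> opnorm (sfun L (th r 1 q) S - peval p (S * S)) <= e) -> 0 < e ->
  (forall t, 0 <= t <= 1 -> opnorm (1 - pt F F' t ^+ 2) <= L) -> ucont (fm F F') ->
  (exists c, forall s t, 0 <= s <= 1 -> 0 <= t <= 1 ->
    `|Phi (pt F F' s) - Phi (pt F F' t) -
      (s - t) * rtr ((F' - F) * peval (p \Po ((1 - 'X^2) ^+ 2)) (pt F F' t))| <= c * (s - t) ^+ 2) ->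
  forall m, tnb (F' - F) m -> `|I F F' - (Phi F' - Phi F)| <= 4 * e * m.
Proof.
move=> L0 gF gF' sF sF' hp e0 hL uf [c hc] m hm.
have up := estimate_ucont hc; have := ftc_estimate up hc.
have -> : pt F F' 1 = F' by rewrite /pt scale1r addrC subrK.
have -> : pt F F' 0 = F by rewrite /pt scale0r addr0.
move=> <-; apply: int01_dist => // t ht.
have [nF _ _] := good_pt t gF gF'; have [nX _ tX] := good_diff gF gF'.
have nS : N (1 - pt F F' t ^+ 2) by apply: (vNB N_vN); [exact: vN1|exact: vNX].
have sS : adj (1 - pt F F' t ^+ 2) = 1 - pt F F' t ^+ 2 by apply: sqr_sa; exact: pt_sa.
have thc : continuous (th r 1 q) by exact: th_cont.
have nK : N (kq (pt F F' t)).
  by rewrite /kq (theta_opE q0 r0 L0 sS (hL t ht)); exact: (vN_sfun N_vN L0 sS (hL t ht)).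
have nP := vN_peval N_vN (p \Po ((1 - 'X^2) ^+ 2)) nF.
have tr1 : tc ((F' - F) * kq (pt F F' t)) by exact: tc_rmul.
have tr2 : tc ((F' - F) * peval (p \Po ((1 - 'X^2) ^+ 2)) (pt F F' t)) by exact: tc_rmul.
rewrite /fm -(rtrB N_vN tau_trace tr1 tr2) -mulrBr; apply: (rtr_le N_vN tau_trace).
apply: tnb_rmul => //; first exact: vNB.
have := hp _ sS (hL t ht); rewrite -(theta_opE q0 r0 L0 sS (hL t ht)).
suff -> : peval (p \Po ((1 - 'X^2) ^+ 2)) (pt F F' t) = peval p ((1 - pt F F' t ^+ 2) * (1 - pt F F' t ^+ 2)) by [].
by rewrite peval_comp peval_exp pevalB peval1 peval_exp pevalX expr2.
Qed.

(** Around the triangle the differences of one common primitive cancel; the remaining error is the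
    approximation error times the sum of the three trace norms. *)
Lemma trunc_exact (A A' A'' : B) : Cl A -> Cl A' -> Cl A'' ->
  I (trc E A) (trc E A') + I (trc E A') (trc E A'') + I (trc E A'') (trc E A) = 0.
Proof.
move=> hA hA' hA''.
have uf := fm_trunc_ucont N_vN tau_trace q0 q1 r0 nJ sJ JJ.
have u1 := uf E A A' hA hA' cE; have u2 := uf E A' A'' hA' hA'' cE; have u3 := uf E A'' A hA'' hA cE.
have [nA sA _ _] := hA; have [nA' sA' _ _] := hA'; have [nA'' sA'' _ _] := hA''.
have g1 := trunc_good nA; have g2 := trunc_good nA'; have g3 := trunc_good nA''.
have s1 := trunc_sa sJ cE sA; have s2 := trunc_sa sJ cE sA'; have s3 := trunc_sa sJ cE sA''.
move: (trc E A) (trc E A') (trc E A'') g1 g2 g3 s1 s2 s3 u1 u2 u3 => F F' F'' g1 g2 g3 s1 s2 s3 u1 u2 u3.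
have [x [x0 x1 x2 x3]] : exists x : R, [/\ 0 < x, opnorm F <= x, opnorm F' <= x & opnorm F'' <= x].
  exists (opnorm F + opnorm F' + opnorm F'' + 1).
  have := opnorm_ge0 F; have := opnorm_ge0 F'; have := opnorm_ge0 F''.
  by move: (opnorm F) (opnorm F') (opnorm F'') => *; split; lra.
pose L := 1 + x * x; have L0 : 0 < L by rewrite /L addr_gt0// mulr_gt0.
have bL (G G' : B) t : opnorm G <= x -> opnorm G' <= x -> 0 <= t <= 1 -> opnorm (1 - pt G G' t ^+ 2) <= L.
  move=> hG hG' ht; have hp := opnorm_pt_le ht hG hG'.
  apply: le_trans (opnormB _ _) _; rewrite expr2; apply: lerD; first exact: opnorm1.
  exact: opnormM_le.
have [_ _ [m1 hm1]] := good_diff g1 g2; have [_ _ [m2 hm2]] := good_diff g2 g3.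
have [_ _ [m3 hm3]] := good_diff g3 g1.
have M0 := tnb_ge0 tau_trace hm1; have M0' := tnb_ge0 tau_trace hm2; have M0'' := tnb_ge0 tau_trace hm3.
apply/eqP; rewrite -normr_eq0 eq_le normr_ge0 andbT; apply/ler_addgt0Pl => e e0; rewrite addr0.
have mm : 0 < 4 * (m1 + m2 + m3 + 1) by lra.
pose d := e / (4 * (m1 + m2 + m3 + 1)); have d0 : 0 < d by rewrite divr_gt0.
have thc : continuous (th r 1 q) by exact: th_cont.
have [p hp] := sfun_poly H L0 thc d0.
have [Phi hPhi] := has_primP (p \Po ((1 - 'X^2) ^+ 2)).
have i1 := trunc_approx L0 g1 g2 s1 s2 hp d0 (fun t => bL _ _ t x1 x2) u1 (hPhi _ _ g1 g2) hm1.
have i2 := trunc_approx L0 g2 g3 s2 s3 hp d0 (fun t => bL _ _ t x2 x3) u2 (hPhi _ _ g2 g3) hm2.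
have i3 := trunc_approx L0 g3 g1 s3 s1 hp d0 (fun t => bL _ _ t x3 x1) u3 (hPhi _ _ g3 g1) hm3.
have he : e = 4 * d * (m1 + m2 + m3 + 1) by rewrite /d; field; rewrite gt_eqF// -[X in 0 < X]mul1r; lra.
move: i1 i2 i3; rewrite !ler_norml => /andP[a1 b1] /andP[a2 b2] /andP[a3 b3].
rewrite he; clearbody d; move: (I F F') (I F' F'') (I F'' F) a1 b1 a2 b2 a3 b3 => *.
by apply/andP; split; lra.
Qed.

End truncated.

(** E has to commute with J and serve three operators at once. So one cuts Z, the sum of the X^2 + J
    X^2 J: it commutes with J because J^2 = 1, lies in Li_0^q and dominates every X^2, so smallness
    of Z off E gives smallness of each X. *)
Lemma trunc_proj_exists (Y Y' Y'' : B) d : 0 < d ->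
  (forall X : B, X = Y \/ X = Y' \/ X = Y'' -> [/\ N X, adj X = X & usm (q / 2) [set X]]) ->
  exists E, [/\ comp E, ft E & forall X : B, X = Y \/ X = Y' \/ X = Y'' -> opnorm (X * (1 - E)) <= d].
Proof.
move=> d0 hY.
pose z (X : B) : B := X * X + J * (X * X) * J.
have hz X : X = Y \/ X = Y' \/ X = Y'' -> [/\ N (z X), psd (z X), J * z X = z X * J & usm q [set z X]].
  move=> hX; have [nX sX uX] := hY X hX; split.
  - by apply: (vND N_vN); do ?[apply: (vNM N_vN) => //].
  - have := psd_sqr X; rewrite sX => p; apply: psdD => //; exact: psd_sa_conj.
  - by rewrite /z mulrDr mulrDl !mulrA JJ mul1r -[J * X * X * J * J]mulrA JJ mulr1 addrC.
  - have h1 : usm q [set X * X].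
      rewrite [Q in usm Q](splitr q); apply: (usmM N_vN tau_trace _ uX uX); first by rewrite divr_ge0// ltW.
      by move=> W ->; exists X, X.
    have [c [c0 hc]] : exists c, 0 < c /\ opnorm J <= c by exists (opnorm J + 1); have := opnorm_ge0 J; split; lra.
    have h2 : usm q [set J * (X * X) * J].
      by apply: (usm_conj N_vN tau_trace c0 h1) => W ->; exists (X * X), J, J.
    by apply: (usmD N_vN tau_trace h1 h2) => W ->; do 2!eexists; split.
have [n1 p1 c1 u1] := hz Y (or_introl erefl).
have [n2 p2 c2 u2] := hz Y' (or_intror (or_introl erefl)).
have [n3 p3 c3 u3] := hz Y'' (or_intror (or_intror erefl)).
pose Z : B := z Y + z Y' + z Y''.
have pZ : psd Z by do 2?[apply: psdD => //].
have uZ : usm q [set Z].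
  have u12 : usm q [set z Y + z Y'] by apply: (usmD N_vN tau_trace u1 u2) => W ->; do 2!eexists; split.
  by apply: (usmD N_vN tau_trace u12 u3) => W ->; do 2!eexists; split.
have cZ : J * Z = Z * J.
  rewrite /Z; move: (z Y) (z Y') (z Y'') c1 c2 c3 => a b c c1 c2 c3.
  by rewrite !mulrDr !mulrDl c1 c2 c3.
have leZ X u : X = Y \/ X = Y' \/ X = Y'' -> sqn (X u) <= rdot (Z u) u.
  move=> hX; have [nX sX _] := hY X hX.
  have e1 : rdot (z X u) u = sqn (X u) + rdot ((J * (X * X) * J) u) u.
    by rewrite /z bop_addE rdotDl bop_mulE (sa_dot _ _ sX).
  have g : 0 <= rdot ((J * (X * X) * J) u) u.
    by have := psd_sqr X; rewrite sX => p; apply: (psd_sa_conj sJ p).2.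
  have q1' := p1.2 u; have q2 := p2.2 u; have q3 := p3.2 u.
  have -> : rdot (Z u) u = rdot (z Y u) u + rdot (z Y' u) u + rdot (z Y'' u) u by rewrite /Z !bop_addE !rdotDl.
  move: e1 g q1' q2 q3; clearbody z; case: hX => [->|[->|->]]; lra.
have [C [M [L [C0 L0 M0 hM]]]] := uZ; have [nZ hZ sZ] := hM Z erefl.
have [n hn] : exists n : nat, 2 * (C * w q ^+ n) <= d ^+ 2.
  have w1 : w q < 1.
    have -> : (1 : R) = 1 `^ q by rewrite powR1.
    by apply: gt0_ltr_powR; rewrite ?nnegrE ?invr_ge0//; lra.
  have hw : `|w q| < 1 by rewrite ger0_norm// ltW// w_gt0.
  have e0 : 0 < d ^+ 2 / (2 * C) by rewrite divr_gt0 ?exprn_gt0 ?mulr_gt0.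
  have /cvgrPdist_le /(_ _ e0) [n0 _ /(_ n0 (leqnn _))] := cvg_expr hw.
  rewrite /= sub0r normrN ger0_norm ?exprn_ge0 ?(ltW (w_gt0 _))// ler_pdivlMr ?mulr_gt0// => hh.
  by exists n0; apply: le_trans hh; rewrite mulrA mulrC.
have [E [[pE hE] fE _ h1 _]] := cut_sm N_vN tau_trace n C0 q1 ltr01 (M0 1) (ltW q0) nZ pZ.1 hZ sZ.
have [nE _ _] := fE.
exists E; split => //.
  by split => //; rewrite hE// mulrA cZ -mulrA cZ mulrA.
move=> X hX; apply: opnorm_le_sqn => [|y]; first exact: ltW.
rewrite bop_mulE; set u := (1 - E) y; apply: le_trans (leZ X u hX) _.
have x0 : 0 < 2 * (C * w q ^+ n) by rewrite !mulr_gt0// exprn_gt0// w_gt0.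
have uy : sqn u <= sqn y by rewrite [leRHS](proj_pyth y pE) lerDr sqn_ge0.
have k1 := h1 y; rewrite -/u in k1.
have k2 : rdot (Z u) u <= 2 * (C * w q ^+ n) * sqn u.
  have i0 : 0 < (2 * (C * w q ^+ n))^-1 by rewrite invr_gt0.
  have := rdot_le (Z u) u i0; rewrite invrK.
  have k3 : (2 * (C * w q ^+ n))^-1 * sqn (Z u) <= 2 * (C * w q ^+ n) * sqn u.
    rewrite ler_pdivrMl//; apply: le_trans k1 _; rewrite le_eqVlt; apply/orP; left; apply/eqP; ring.
  move=> k4; have := le_trans k4 (lerD k3 (lexx _)).
  exact: half_le.
by apply: le_trans k2 _; apply: ler_pM (ltW x0) (sqn_ge0 u) hn uy.
Qed.

Theorem I_exact (A A' A'' : B) : Cl A -> Cl A' -> Cl A'' -> I A A' + I A' A'' + I A'' A = 0.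
Proof.
move=> hA hA' hA''.
apply/eqP; rewrite -normr_eq0 eq_le normr_ge0 andbT; apply/ler_addgt0Pl => e e0; rewrite addr0.
have e3 : 0 < e / 3 by rewrite divr_gt0.
have close := fm_trunc_close N_vN tau_trace q0 q1 r0 nJ sJ JJ.
have [d1 d10 h1] := close _ _ _ hA hA' e3; have [d2 d20 h2] := close _ _ _ hA' hA'' e3.
have [d3 d30 h3] := close _ _ _ hA'' hA e3.
pose d := Num.min d1 (Num.min d2 d3); have d0 : 0 < d by rewrite !lt_min d10 d20.
have [dd1 dd2 dd3] : [/\ d <= d1, d <= d2 & d <= d3].
  by split; rewrite /d !ge_min lexx ?orbT.
have [E [cE fE hE]] : exists E, [/\ comp E, ft E & forall X : B,
    X = A - J \/ X = A' - J \/ X = A'' - J -> opnorm (X * (1 - E)) <= d].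
  apply: trunc_proj_exists => // X hX.
  have [B1 hB ->] : exists2 B1, Cl B1 & X = B1 - J by case: hX => [->|[->|->]]; [exists A|exists A'|exists A''].
  have [nB sB _ uB] := hB; split => //; first exact: vNB.
  by rewrite adjB sB sJ.
have b1 := hE _ (or_introl erefl); have b2 := hE _ (or_intror (or_introl erefl)).
have b3 := hE _ (or_intror (or_intror erefl)).
have ex := trunc_exact cE fE hA hA' hA''.
have uf := fm_trunc_ucont N_vN tau_trace q0 q1 r0 nJ sJ JJ.
have ug := fm_Cl_ucont N_vN tau_trace q0 q1 r0 nJ sJ JJ.
have i1 : `|I A A' - I (trc E A) (trc E A')| <= e / 3.
  apply: int01_dist; [exact: ug|exact: uf|move=> t ht].
  by apply: h1 => //; [exact: le_trans b1 dd1|exact: le_trans b2 dd1].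
have i2 : `|I A' A'' - I (trc E A') (trc E A'')| <= e / 3.
  apply: int01_dist; [exact: ug|exact: uf|move=> t ht].
  by apply: h2 => //; [exact: le_trans b2 dd2|exact: le_trans b3 dd2].
have i3 : `|I A'' A - I (trc E A'') (trc E A)| <= e / 3.
  apply: int01_dist; [exact: ug|exact: uf|move=> t ht].
  by apply: h3 => //; [exact: le_trans b3 dd3|exact: le_trans b1 dd3].
exact: close3 i1 i2 i3 ex.
Qed.

Lemma I_refl (A : B) : I A A = 0.
Proof.
rewrite /I -[RHS](int01_cst 0); apply: eq_int01 => t _.
by rewrite /fm subrr mul0r (rtr0 N_vN tau_trace).
Qed.

Lemma I_anti (A A' : B) : Cl A -> Cl A' -> I A' A = - I A A'.
Proof. by move=> hA hA'; have := I_exact hA hA' hA; rewrite I_refl addr0 => /eqP; rewrite addrC addr_eq0 => /eqP. Qed.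

Lemma I_add (A A' A'' : B) : Cl A -> Cl A' -> Cl A'' -> I A A'' = I A A' + I A' A''.
Proof. by move=> hA hA' hA''; have := I_exact hA hA' hA''; rewrite (I_anti hA hA'') => /eqP; rewrite subr_eq0 => /eqP. Qed.

End Exactness.

(** * Pairs of projections *)

Ltac bop_field := apply: rdot_ext => ? ?;
  rewrite ?(bop_mulE, bop_addE, bop_oppE, bop_scaleE, bop_oneE, bop_zeroE, bopD, bopN, bopZ, bop0);
  rewrite ?(rdotDl, rdotNl, rdotZl, rdot0l); field.

(** * The normalising constant *)

Section ThetaConstant.
Variables (R : realType) (q : R) (q0 : 0 < q) (r : R) (r0 : 0 <= r).

Let thc : continuous (th r 1 q). Proof. by apply: th_cont. Qed.

Lemma affine_derive (t : R) : is_derive t 1 (fun s : R => 2 * s - 1) 2.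
Proof.
have -> : (fun s : R => 2 * s - 1) = (2%:R *: (@id R)) - cst 1.
  by apply/funext => s; rewrite /= !fctE.
by apply: is_derive_eq; rewrite subr0 -[2%:R *: 1]/(2 * 1) mulr1.
Qed.

Lemma sqr_cont : continuous (fun x : R => 1 - x ^+ 2).
Proof.
move=> x; apply: cvgB; first exact: cvg_cst.
exact: (@cvgM R R (nbhs x) _ id id x x cvg_id cvg_id).
Qed.

Lemma theta_sqr_cont : continuous (fun x : R => th r 1 q (1 - x ^+ 2)).
Proof.
move=> x; apply: (@continuous_comp R R R (fun x => 1 - x ^+ 2) (th r 1 q) x); first exact: sqr_cont.
exact: thc.
Qed.

(** The substitution x = 2 t - 1 gives 1 - x^2 = 4 t (1 - t), the scalar that occurs along the
    segment between two symmetries. *)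
Lemma theta_const_int01 : theta_const r q = int01 (fun t => 2 * th r 1 q (4 * t * (1 - t))).
Proof.
rewrite /theta_const -th_theta.
pose F (s : R) := 2 * s - 1.
have dF t : F^`()%classic t = 2 by rewrite derive1E; apply: (@derive_val _ _ _ _ _ _ _ (affine_derive t)).
have cF : continuous F.
  by move=> t; apply: cvgB; [apply: cvgMr; exact: cvg_id|exact: cvg_cst].
have dc : F^`()%classic = cst 2 by apply/funext => t; rewrite dF.
have F0 : F 0 = -1 by rewrite /F mulr0 sub0r.
have F1 : F 1 = 1 by rewrite /F mulr1 addrK.
have c1 : {in `[0, 1] &, {homo F : x y / x < y}} by move=> x y _ _ xy; rewrite /F ltrD2r ltr_pM2l.
have c2 : {in `]0, 1[, continuous F^`()%classic} by rewrite dc => t _; exact: cvg_cst.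
have c3 : cvg (F^`()%classic x @[x --> 0^'+]) by rewrite dc; exact: is_cvg_cst.
have c4 : cvg (F^`()%classic x @[x --> 1^'-]) by rewrite dc; exact: is_cvg_cst.
have c5 : derivable_oo_LRcontinuous F 0 1.
  split; first by move=> t _; have [] := affine_derive t.
  - by apply: cvg_at_right_filter; exact: cF.
  - by apply: cvg_at_left_filter; exact: cF.
have c6 : {within `[F 0, F 1], continuous (fun x => th r 1 q (1 - x ^+ 2))}.
  by apply: continuous_subspaceT; exact: theta_sqr_cont.
have := integration_by_substitution_increasing ler01 c1 c2 c3 c4 c5 c6.
rewrite F0 F1 dc /int01 /Rintegral => ->.
congr fine; apply: eq_integral => t _; congr (_%:E).
rewrite /= !fctE mulrC /F; congr (2 * th _ _ _ _); ring.
Qed.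

(** On [-1/2, 1/2], an interval of length 1, one has 3/4 <= 1 - x^2 <= 1, so the integrand there is
    at least [eta]. *)
Lemma theta_const_gt0 : 0 < theta_const r q.
Proof.
pose eta := expR (- (3 / 4) `^ (- q^-1)); have eta0 : 0 < eta by exact: expR_gt0.
have m1 : measurable (`[-1, 1]%classic : set (measurableTypeR R)) by exact: measurable_itv.
have m2 : measurable (`[(- 2^-1)%R, (2^-1)%R]%classic : set (measurableTypeR R)) by exact: measurable_itv.
pose f (x : R) := th r 1 q (1 - x ^+ 2).
have mf (D : set (measurableTypeR R)) : measurable D -> measurable_fun D (fun x => (f x)%:E).
  move=> mD; apply/measurable_EFinP; apply: measurable_funS (continuous_measurable_fun theta_sqr_cont) => //.
have fi : lebesgue_measure.-integrable `[-1, 1] (EFin \o f).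
  by apply: continuous_compact_integrable; [exact: segment_compact|apply: continuous_subspaceT; exact: theta_sqr_cont].
have h1 : (\int[lebesgue_measure]_(x in `[(- 2^-1)%R, (2^-1)%R]) (cst eta x)%:E <= \int[lebesgue_measure]_(x in `[(- 2^-1)%R, (2^-1)%R]) (f x)%:E)%E.
  apply: ge0_le_integral => //.
  - by move=> x _; rewrite lee_fin ltW.
  - by apply/measurable_EFinP; exact: measurable_cst.
  - exact: mf.
  - move=> x /=; rewrite in_itv /= => /andP[x1 x2]; rewrite lee_fin /f /eta.
    have y1 : 3 / 4 <= 1 - x ^+ 2 by nra.
    have y2 : 1 - x ^+ 2 <= 1 by rewrite gerBl sqr_ge0.
    move: (1 - x ^+ 2) y1 y2 => y y1 y2.
    have y0 : 0 < y by lra.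
    rewrite /th ifF; last by rewrite leNgt y0.
    have r1 : 1 <= y `^ (- r).
      rewrite powRN -[leLHS]invr1 lef_pV2 ?posrE ?powR_gt0//.
      have -> : (1 : R) = 1 `^ r by rewrite powR1.
      by apply: ge0_ler_powR; rewrite ?nnegrE ?(ltW y0).
    have e1 : expR (- (3 / 4) `^ (- q^-1)) <= expR (- (1 * y `^ (- q^-1))).
      have q34 : 0 < 3 / 4 :> R by lra.
      rewrite mul1r ler_expR lerN2 !powRN lef_pV2 ?posrE ?powR_gt0//.
      by apply: ge0_ler_powR; rewrite ?nnegrE ?invr_ge0 ?(ltW q0) ?(ltW y0) ?(ltW q34).
    by apply: le_trans e1 _; rewrite ler_peMl// expR_ge0.
have h2 : (\int[lebesgue_measure]_(x in `[(- 2^-1)%R, (2^-1)%R]) (f x)%:E <= \int[lebesgue_measure]_(x in `[(-1)%R, 1%R]) (f x)%:E)%E.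
  apply: ge0_subset_integral => //; first exact: mf.
    by move=> x _; rewrite lee_fin; exact: th_ge0.
  by move=> x /=; rewrite !in_itv /= => /andP[x1 x2]; apply/andP; split; lra.
have h3 := le_trans h1 h2.
have l1 : lebesgue_measure (`[(- 2^-1)%R, (2^-1)%R]%classic : set R) = 1%E.
  rewrite lebesgue_measure_itv /= lte_fin ifT; last by lra.
  by rewrite -EFinD; congr (_%:E); lra.
have e1 : (\int[lebesgue_measure]_(x in `[(- 2^-1)%R, (2^-1)%R]) (cst eta x)%:E = eta%:E)%E.
  rewrite (_ : (fun x : R => (cst eta x)%:E) = cst eta%:E)// integral_cst//.
  by apply: etrans (mule1 _); congr (_ * _)%E; exact: l1.
rewrite e1 in h3.
have fin : (\int[lebesgue_measure]_(x in `[(-1)%R, 1%R]) (f x)%:E)%E \is a fin_num by exact: integrable_fin_num.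
apply: (lt_le_trans eta0); rewrite /theta_const -th_theta /Rintegral.
by rewrite -lee_fin fineK.
Qed.

End ThetaConstant.

(** * The integral between two symmetries *)

Section Involutions.
Variables (R : realType) (H : hilbertType R).
Local Notation B := (bop H).
Implicit Types P Q : B.

Lemma abp_opp (S : B) : adj S = S -> abp (- S) = abp S.
Proof.
move=> sS; have sN : adj (- S) = - S by rewrite adjN sS.
have [p1 e1 _] := abpP sN; have L0 : 0 < opnorm S + 1 by have := opnorm_ge0 S; lra.
rewrite [RHS]abpE; apply: (absv_unique L0 sS) => //; first by lra.
by rewrite e1 mulrNN.
Qed.

Section anticommuting.
Variables (D b : B) (sD : adj D = D) (sb : adj b = b) (Db : D * b = - (b * D)) (DD : D * D = 1 - b * b).

(** The projection onto the kernel of b, written as a product of two commuting spectral projections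
    so that membership in N is inherited. *)
Definition kerb : B := pker b * pker (- b).

(* [pker b] and [pker (- b)] are the spectral projections of b for the half
   lines, and V is the sign of b, vanishing on the kernel of b. *)
Lemma anticomm_sign : exists V : B, [/\ V * D = - (D * V) /\ V * V = 1 - kerb,
  projection kerb /\ D * kerb = kerb * D,
  b * kerb = 0, forall x, b x = 0 -> kerb x = x &
  forall N : set B, von_neumann_algebra N -> N b -> N V /\ N kerb].
Proof.
have sN : adj (- b) = - b by rewrite adjN sb.
have [pa ea ca] := abpP sb; have ab := abp_opp sb.
have b0 : 0 < opnorm b + 1 by have := opnorm_ge0 b; lra.
have b1 : opnorm b <= opnorm b + 1 by lra.
have Dbb : D * (b * b) = b * b * D by rewrite [LHS]mulrA Db mulNr -[b * D * b]mulrA Db mulrN opprK mulrA.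
have bD : b * D = - (D * b) by rewrite Db opprK.
have Da : D * abp b = abp b * D.
  by rewrite abpE; apply: sfun_comm2 => //; move=> z; exact: cvg_id.
have p1 := pker_proj b; have p2 := pker_proj (- b).
have k1 z := pker_ker b z; have k2 z := pker_ker (- b) z; rewrite ab in k2.
have i1 z : (abp b + b) z = 0 -> pker b z = z by exact: pker_id.
have i2 z : (abp b - b) z = 0 -> pker (- b) z = z by move=> h; apply: pker_id; rewrite ab.
have c2 : b * pker (- b) = pker (- b) * b by apply: pker_comm => //; rewrite mulrN mulNr.
have cpp : pker b * pker (- b) = pker (- b) * pker b.
  by symmetry; apply: pker_comm.
have cm1 x := pker_compl x sb; have cm2 x := pker_compl x sN; rewrite ab in cm2.
have po x := @pker_pos0 _ _ b x sb.
have nV N : von_neumann_algebra N -> N b -> N (pker b) /\ N (pker (- b)).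
  by move=> vN nb; split; apply: (vN_pker vN) => //; exact: (vNN vN).
have az z : b z = 0 -> abp b z = 0.
  move=> bz; apply: sqn_eq0; rewrite /sqn -(sa_dot _ _ pa.1) -bop_mulE ea bop_mulE bz bop0.
  exact: rdot0l.
rewrite /kerb; move: (pker b) (pker (- b)) p1 p2 k1 k2 i1 i2 c2 cpp cm1 cm2 po nV.
move=> p p' p1 p2 k1 k2 i1 i2 c2 cpp cm1 cm2 po nV.
move: (abp b) pa ea ca ab Da k1 k2 i1 i2 cm1 cm2 az => a pa ea ca ab Da k1 k2 i1 i2 cm1 cm2 az.
(* D commutes with |b| and anticommutes with b, so it carries the kernel of |b| - b into that of |b|
   + b. [g2] is the converse, and adjoints turn the pair into D p' = p D and D p = p' D. *)
have g1 : p * D * p' = D * p'.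
  apply: bopP => z; rewrite -mulrA bop_mulE; apply: i1.
  have := k2 z; rewrite -bop_mulE => h.
  have -> : (a + b) ((D * p') z) = D (((a - b) * p') z).
    by rewrite -!bop_mulE; congr (bop_fun _ _); rewrite !mulrA mulrDl mulrBr -Da bD.
  by rewrite h bop0.
have g2 : p' * D * p = D * p.
  apply: bopP => z; rewrite -mulrA bop_mulE; apply: i2.
  have := k1 z; rewrite -bop_mulE => h.
  have -> : (a - b) ((D * p) z) = D (((a + b) * p) z).
    by rewrite -!bop_mulE; congr (bop_fun _ _); rewrite !mulrA mulrBl mulrDr -Da bD opprK.
  by rewrite h bop0.
have g3 : D * p' = p * D.
  by rewrite -g1; have := congr1 (@adj _ _) g2; rewrite !adjM p1.2 p2.2 sD mulrA.
have g4 : D * p = p' * D.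
  by rewrite -g2; have := congr1 (@adj _ _) g1; rewrite !adjM p1.2 p2.2 sD mulrA.
(* On this range b = |b| and - b = |b|, so b vanishes there, whereas off p the form of b is strictly
   positive. *)
have u0 : (1 - p) * (1 - p') = 0.
  apply: bopP => x; rewrite bop_mulE bop_zeroE; apply: po.
  have e1 := cm1 ((1 - p') x); set u := (1 - p) ((1 - p') x) in e1 *.
  have eu : u = (1 - p') ((1 - p) x).
    rewrite /u -!bop_mulE; congr (bop_fun _ _).
    by rewrite !mulrBl !mulrBr !mul1r !mulr1 cpp; move: (p' * p) => s; bop_ring.
  have e2 : (- b) u = a u by rewrite eu; exact: cm2.
  have : b u = 0.
    have h : b u + b u = 0 by rewrite {2}e1 -e2 bop_oppE subrr.
    by apply: sqn_eq0; have := congr1 (fun y => rdot y (b u)) h; rewrite rdotDl rdot0l /sqn; lra.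
  by move=> ->; rewrite rdot0l.
have sum : p + p' - p * p' = 1.
  have : 1 - (1 - p) * (1 - p') = 1 by rewrite u0 subr0.
  by move=> <-; bop_ring.
have z0 z : b ((p * p') z) = 0.
  have h1 := k1 (p' z); have h2 := k2 (p z); rewrite -[p' (p z)]bop_mulE -cpp in h2.
  rewrite -[p (p' z)]bop_mulE in h1; set y := (p * p') z in h1 h2 *.
  move: h1 h2; rewrite !bop_addE bop_oppE => h1 h2.
  have h : b y + b y = 0.
    by rewrite -[RHS](subrr 0) -{1}h1 -h2 opprD opprK addrACA subrr add0r.
  by apply: sqn_eq0; have := congr1 (fun w => rdot w (b y)) h; rewrite rdotDl rdot0l /sqn; lra.
exists (p' - p); split.
- split; first by rewrite mulrBl mulrBr -g3 -g4 opprB.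
  by rewrite mulrBl !mulrBr p1.1 p2.1 -cpp -sum; bop_ring.
- split.
    split; last by rewrite adjM p1.2 p2.2 cpp.
    by rewrite -mulrA [p' * _]mulrA -cpp -[p * p' * p']mulrA p2.1 mulrA p1.1.
  by rewrite mulrA g4 -mulrA g3 mulrA -cpp.
- by apply: bopP => z; rewrite bop_mulE z0.
- move=> x bx; have ax := az x bx.
  have px : p x = x by apply: i1; rewrite bop_addE ax bx addr0.
  have px' : p' x = x by apply: i2; rewrite bop_subE ax bx subr0.
  by rewrite bop_mulE px' px.
- by move=> N vN nb; have [n1 n2] := nV N vN nb; split; [exact: (vNB vN)|exact: (vNM vN)].
Qed.

Lemma dif_sqr_kerb : D * D * kerb = kerb.
Proof.
have [V [_ _ h _ _]] := anticomm_sign.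
by rewrite DD mulrBl mul1r -mulrA h mulr0 subr0.
Qed.

End anticommuting.

Definition dif P Q : B := Q - P.
Definition ave P Q : B := 1 - P - Q.

Lemma aveC P Q : ave Q P = ave P Q. Proof. by rewrite /ave addrAC. Qed.

(* The projection onto [range Q `&` ker P]: on the kernel of [1 - P - Q] the
   difference Q - P is an involution. *)
Definition Ep P Q : B := (2^-1)%:C *: (kerb (ave P Q) + dif P Q * kerb (ave P Q)).

Section pair.
Variables (P Q : B) (hP : projection P) (hQ : projection Q).

Let PP z : P (P z) = P z. Proof. by rewrite -bop_mulE hP.1. Qed.
Let QQ z : Q (Q z) = Q z. Proof. by rewrite -bop_mulE hQ.1. Qed.

Lemma ave_sa : adj (ave P Q) = ave P Q. Proof. by rewrite /ave !adjB adj1 hP.2 hQ.2. Qed.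
Lemma dif_sa : adj (dif P Q) = dif P Q. Proof. by rewrite /dif adjB hP.2 hQ.2. Qed.

Lemma dif_ave : dif P Q * ave P Q = - (ave P Q * dif P Q).
Proof.
rewrite /dif /ave; apply: rdot_ext => x y.
rewrite !(bop_mulE, bop_addE, bop_oppE, bop_oneE, bopD, bopN, PP, QQ).
by rewrite !(rdotDl, rdotNl); ring.
Qed.

Lemma dif_sqr : dif P Q * dif P Q = 1 - ave P Q * ave P Q.
Proof.
rewrite /dif /ave; apply: rdot_ext => x y.
rewrite !(bop_mulE, bop_addE, bop_oppE, bop_oneE, bopD, bopN, PP, QQ).
by rewrite !(rdotDl, rdotNl); ring.
Qed.

Lemma Ep_facts : [/\ projection (Ep P Q), dif P Q * Ep P Q = Ep P Q,
  kerb (ave P Q) * Ep P Q = Ep P Q & range (Ep P Q) = range Q `&` ker_op P].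
Proof.
have [V [_ [[EE sE] cE] bE kE _]] := anticomm_sign dif_sa ave_sa dif_ave.
have DE := dif_sqr_kerb dif_sa ave_sa dif_ave dif_sqr.
have sD := dif_sa.
rewrite /Ep; have bx x : Q x = x -> P x = 0 -> ave P Q x = 0.
  by move=> qx px; rewrite /ave !bop_subE bop_oneE qx px subr0 subrr.
move: (kerb _) EE sE cE kE DE => E EE sE cE kE DE {bE V}.
pose U := dif P Q * E.
have EU : E * U = U by rewrite /U mulrA -cE -mulrA EE.
have UE : U * E = U by rewrite /U -mulrA EE.
have UU : U * U = E by rewrite /U {2}cE mulrA -[_ * E * E]mulrA EE -mulrA -cE mulrA DE.
have DU : dif P Q * U = E by rewrite /U mulrA DE.
rewrite -/U; set X := _ *: _.
have XX : X * X = X.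
  rewrite /X bop_scaleAl bop_scaleAr scalerA mulrDl !mulrDr EE EU UE UU; clearbody U.
  by rewrite -rmorphM; bop_field.
have sX : adj X = X by rewrite /X adjZ adjD /U adjM sE sD -cE.
have DX : dif P Q * X = X by rewrite /X bop_scaleAr mulrDr DU -/U addrC.
have EX : E * X = X by rewrite /X bop_scaleAr mulrDr EE EU.
split => //; apply/seteqP; split => x /=.
  (* From (Q - P) x = x one gets |Q x|^2 - |P x|^2 = |x|^2, and |Q x| <= |x| forces P x = 0. *)
  move=> [y _ <-]; set x' := X y.
  have dx : Q x' - P x' = x'.
    by rewrite -bop_subE -/(dif P Q) /x' -bop_mulE DX.
  have h : sqn (Q x') - sqn (P x') = sqn x'.
    by rewrite -(proj_sqn x' hP) -(proj_sqn x' hQ) -rdotBl dx.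
  have h2 := proj_pyth x' hQ; have h3 := sqn_ge0 ((1 - Q) x'); have h4 := sqn_ge0 (P x').
  have px : P x' = 0 by apply: sqn_eq0; apply/le_anti; rewrite h4 andbT; lra.
  split; last exact: px.
  by exists x' => //; move: dx; rewrite px subr0.
move=> [[y _ yx]]; rewrite /ker_op /= => px.
have qx : Q x = x by rewrite -yx QQ.
have Ex := kE _ (bx _ qx px).
suff h : X x = x by exists x.
have -> : X x = (2^-1)%:C *: (E x + dif P Q (E x)) by [].
rewrite Ex /dif bop_subE qx px subr0.
have h : (2^-1)%:C + (2^-1)%:C = 1 :> R[i] by rewrite -rmorphD -[RHS]/(1%:C); congr (_%:C); lra.
by rewrite scalerDr -scalerDl h scale1r.
Qed.

End pair.

Variables (N : set B) (tau : B -> \bar R).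
Hypotheses (N_vN : von_neumann_algebra N) (tau_trace : fns_trace N tau).
Local Notation ft := (ft N tau).
Local Notation tr := (tr tau).
Local Notation tc := (tc N tau).
Local Notation rtr := (rtr N tau).
Variables (q : R) (q0 : 0 < q) (r : R) (r0 : 0 <= r).

Definition invol P : B := 2%:R%:C *: P - 1.

Lemma invol_facts P : projection P -> adj (invol P) = invol P /\ invol P * invol P = 1.
Proof.
move=> hP; split; first by rewrite /invol adjB adjZ adj1 hP.2.
have PP z : P (P z) = P z by rewrite -bop_mulE hP.1.
rewrite /invol; apply: rdot_ext => x y.
rewrite !(bop_mulE, bop_addE, bop_oppE, bop_oneE, bop_scaleE, bopD, bopN, bopZ, PP).
by rewrite !(rdotDl, rdotNl, rdotZl); ring.
Qed.

Theorem I_invol P Q : projection P -> projection Q -> N P -> N Q ->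
  (forall t, 0 <= t <= 1 -> ft (kq q r (pt (invol P) (invol Q) t))) ->
  pair_index tau P Q = ((theta_const r q)^-1 * I N tau q r (invol P) (invol Q))%:E.
Proof.
move=> hP hQ nP nQ fK.
have [pE1 dE1 eE1 rE1] := Ep_facts hP hQ; have [pE2 dE2 eE2 rE2] := Ep_facts hQ hP.
have sD := dif_sa hP hQ; have sb := ave_sa hP hQ.
have Db := dif_ave hP hQ; have DD := dif_sqr hP hQ.
have [V [[VD VV] [[EE sE] cE] bE _ hN]] := anticomm_sign sD sb Db.
have DE := dif_sqr_kerb sD sb Db DD.
have nb : N (ave P Q) by do 2?[apply: (vNB N_vN) => //]; exact: vN1.
have [nV nE] := hN N N_vN nb.
have nD : N (dif P Q) by exact: vNB.
have nEp : N (Ep P Q) by apply: vNZ => //; apply: vND => //; exact: vNM.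
have nEm : N (Ep Q P).
  by rewrite /Ep aveC; apply: vNZ => //; apply: vND => //; apply: vNM => //; exact: vNB.
have eEm : Ep P Q - Ep Q P = dif P Q * kerb (ave P Q).
  rewrite /Ep [ave Q P]aveC; have -> : dif Q P = - dif P Q by rewrite /dif opprB.
  by move: (kerb _) (dif P Q) => E D; bop_field.
have eE0 : kerb (ave P Q) = Ep P Q + Ep Q P.
  rewrite /Ep [ave Q P]aveC; have -> : dif Q P = - dif P Q by rewrite /dif opprB.
  by move: (kerb _) (dif P Q) => E D; bop_field.
rewrite aveC in eE2.
have dE2' : dif P Q * Ep Q P = - Ep Q P.
  by have -> : dif P Q = - dif Q P; [rewrite /dif opprB|rewrite mulNr dE2].
have [sA AA] := invol_facts hP; have [sA' AA'] := invol_facts hQ.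
have eX : invol Q - invol P = 2%:R%:C *: dif P Q by rewrite /invol /dif; bop_ring.
(* Symmetries square to 1, so only the cross term of [pt_sqr] survives. *)
have eS t : 1 - pt (invol P) (invol Q) t ^+ 2 = (4 * t * (1 - t))%:C *: (dif P Q * dif P Q).
  rewrite pt_sqr !expr2 AA AA' subrr !scaler0 !add0r eX; bop_ring.
have t4 (t : R) : 0 <= t <= 1 -> 0 <= 4 * t * (1 - t) <= 1.
  move=> /andP[u0 u1]; have u2 : 0 <= 1 - t by rewrite subr_ge0.
  by have := mulr_ge0 u0 u2; have := sqr_ge0 (2 * t - 1); rewrite expr2 => *; apply/andP; split; lra.
have dn : opnorm (dif P Q) <= 2.
  apply: le_trans (opnormB _ _) _; have := proj_opnorm hP; have := proj_opnorm hQ; lra.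
have hS t : 0 <= t <= 1 -> opnorm (1 - pt (invol P) (invol Q) t ^+ 2) <= 4.
  move=> /t4/andP[a0 a1]; rewrite eS opnormZ ger0_norm//.
  have dd := opnormM_le dn dn; have d0 := opnorm_ge0 (dif P Q * dif P Q).
  apply: le_trans (ler_wpM2r d0 a1) _; rewrite mul1r; apply: le_trans dd _; lra.
have sS t : adj (1 - pt (invol P) (invol Q) t ^+ 2) = 1 - pt (invol P) (invol Q) t ^+ 2.
  by apply: sqr_sa; exact: pt_sa.
have thc : continuous (th r 1 q) by exact: th_cont.
have L4 : 0 < 4 :> R by [].
have kE t : 0 <= t <= 1 -> kq q r (pt (invol P) (invol Q) t) = sfun 4 (th r 1 q) (1 - pt (invol P) (invol Q) t ^+ 2).
  by move=> ht; rewrite /kq (theta_opE q0 r0 L4 (sS t) (hS t ht)).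
have kcomm t W : 0 <= t <= 1 -> W * (dif P Q * dif P Q) = dif P Q * dif P Q * W ->
    W * kq q r (pt (invol P) (invol Q) t) = kq q r (pt (invol P) (invol Q) t) * W.
  move=> ht hW; rewrite kE//; apply: sfun_comm => //; [exact: hS|].
  by rewrite eS bop_scaleAl bop_scaleAr hW.
(* On the kernel of b one has D^2 = 1, so 1 - F_t^2 acts there as the scalar 4 t (1 - t). *)
have kker t : 0 <= t <= 1 -> kq q r (pt (invol P) (invol Q) t) * kerb (ave P Q) =
    (th r 1 q (4 * t * (1 - t)))%:C *: kerb (ave P Q).
  move=> ht; rewrite kE//; apply: bopP => z; rewrite bop_mulE bop_scaleE.
  have [a0 a1] := andP (t4 t ht).
  apply: (sfun_eigen L4 (sS t) (hS t ht)) => //; first by rewrite a0 (le_trans a1)//; lra.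
  by rewrite eS bop_scaleE -bop_mulE DE.
move: (kerb (ave P Q)) EE sE cE VV nE DE eE1 eE2 eEm eE0 kker => E EE sE cE VV nE DE eE1 eE2 eEm eE0 kker {bE hN}.
move: (dif P Q) sD nD VD cE DE dE1 dE2' eEm eX kcomm {dn eS hS DD Db dE2} => D sD nD VD cE DE dE1 dE2 eEm eX kcomm.
have DDD : D * (D * D) = D * D * D by rewrite mulrA.
have VDD : V * (D * D) = D * D * V by rewrite [LHS]mulrA VD mulNr -[D * V * D]mulrA VD mulrN opprK mulrA.
have EDD : E * (D * D) = D * D * E by rewrite [LHS]mulrA -cE -[D * E * D]mulrA -cE mulrA.
(* At t = 1/2 both projections are dominated by a multiple of K, hence finite. *)
have half : 0 <= (2^-1 : R) <= 1 by apply/andP; split; lra.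
have finE F : projection F -> N F -> E * F = F -> F * (D * D) = D * D * F -> ft F.
  move=> pF nF EF cF; have fK2 := fK _ half; have k1 := kker _ half; have cK := kcomm _ F half cF.
  have q1 : 4 * 2^-1 * (1 - 2^-1) = 1 :> R by lra.
  rewrite q1 in k1; move: (kq _ _ _) fK2 k1 cK => K fK2 k1 cK.
  have c0 : 0 < th r 1 q 1 by rewrite /th ler10 mulr_gt0 ?powR_gt0 ?expR_gt0.
  have [nK pK _] := fK2.
  have KF : K * F = (th r 1 q 1)%:C *: F by rewrite -{1}EF mulrA k1 bop_scaleAl EF.
  have [pKF _] := psd_comm_proj pK pF cK.
  have pC : psd (K - K * F).
    have -> : K - K * F = K * (1 - F) by rewrite mulrBr mulr1.
    by apply: (psd_comm_proj pK (projC pF) _).1; rewrite mulrBl mulrBr mul1r mulr1 cK.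
  have [fKF _] := ft_le N_vN tau_trace (vNM N_vN nK nF) pKF fK2 pC.
  have ci : 0 <= (th r 1 q 1)^-1 by rewrite invr_ge0 ltW.
  have [+ _] := ftZ N_vN tau_trace ci fKF.
  by rewrite KF scalerA -rmorphM mulVf ?gt_eqF// scale1r.
have cF1 : Ep P Q * (D * D) = D * D * Ep P Q.
  have h : Ep P Q * D = Ep P Q by have := congr1 (@adj _ _) dE1; rewrite adjM pE1.2 sD.
  by rewrite mulrA h h -mulrA dE1 dE1.
have cF2 : Ep Q P * (D * D) = D * D * Ep Q P.
  have h : Ep Q P * D = - Ep Q P by have := congr1 (@adj _ _) dE2; rewrite adjM adjN pE2.2 sD.
  by rewrite mulrA h mulNr h opprK -mulrA dE2 mulrN dE2 opprK.
have f1 := finE _ pE1 nEp eE1 cF1; have f2 := finE _ pE2 nEm eE2 cF2.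
have t1 := tc_ft N_vN tau_trace f1; have t2 := tc_ft N_vN tau_trace f2.
have main t : 0 <= t <= 1 -> fm N tau q r (invol P) (invol Q) t =
    (tr (Ep P Q) - tr (Ep Q P)) * (2 * th r 1 q (4 * t * (1 - t))).
  move=> ht; have fKt := fK t ht; have kk := kker t ht; have kc := kcomm t ^~ ht.
  rewrite /fm eX; move: (kq _ _ _) fKt kk kc => K fKt kk kc.
  have tK := tc_ft N_vN tau_trace fKt; have nK := tc_vN N_vN tK.
  have tDK := tc_lmul N_vN tau_trace nD tK.
  rewrite bop_scaleAl rtrZ//.
  (* V^2 = 1 - E separates the kernel of b from its complement; on the complement, cyclicity against
     V reverses the sign of the trace. *)
  have e1 : D * K = E * (D * K) + V * (V * (D * K)) by rewrite [V * (V * _)]mulrA VV mulrBl mul1r addrC subrK.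
  have tV := tc_lmul N_vN tau_trace nV tDK; have tVV := tc_lmul N_vN tau_trace nV tV.
  have tE := tc_lmul N_vN tau_trace nE tDK.
  have z : rtr (V * (V * (D * K))) = 0.
    have h := rtrC N_vN tau_trace nV tV.
    have e2 : V * (D * K) * V = - (V * (V * (D * K))).
      by rewrite -mulrA -[D * K * V]mulrA -(kc _ VDD) [D * (V * K)]mulrA -[D * V]opprK -VD mulNr mulrN -mulrA.
    by move: h; rewrite e2 rtrN//; lra.
  rewrite e1 rtrD// z addr0.
  have -> : E * (D * K) = (th r 1 q (4 * t * (1 - t)))%:C *: (Ep P Q - Ep Q P).
    by rewrite (kc _ DDD) mulrA (kc _ EDD) kk bop_scaleAl -cE eEm.
  have tB := tcB N_vN tau_trace t1 t2.
  by rewrite (rtrZ N_vN tau_trace _ tB) (rtrB N_vN tau_trace t1 t2) !rtr_ft//; ring.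
have -> : I N tau q r (invol P) (invol Q) = (tr (Ep P Q) - tr (Ep Q P)) * theta_const r q.
  rewrite theta_const_int01// /I (eq_int01 main) /int01 RintegralZl//.
  apply: continuous_compact_integrable; first exact: segment_compact.
  apply: continuous_subspaceT => t; apply: cvgMr.
  apply: (@continuous_comp R R R (fun t => 4 * t * (1 - t)) (th r 1 q) t); last exact: thc.
  by apply: cvgM; [apply: cvgMr; exact: cvg_id|apply: cvgB; [exact: cvg_cst|exact: cvg_id]].
have c0 := theta_const_gt0 q0 r0.
rewrite mulrC mulfK ?gt_eqF// EFinB -(tauE tau_trace f1) -(tauE tau_trace f2).
rewrite /pair_index /tau_dim (proj_ontoE pE1 rE1) setIC (proj_ontoE pE2 rE2) //.
Qed.

End Involutions.

(** * Unitary covariance and spectral flow *)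

Section UnitaryCovariance.
Variables (R : realType) (H : hilbertType R).
Local Notation B := (bop H).
Variables (U : B) (uU : adj U * U = 1) (Uu : U * adj U = 1).

Definition cj (S : B) : B := U * S * adj U.

Lemma cjM S T : cj (S * T) = cj S * cj T.
Proof. by rewrite /cj -!mulrA [adj U * (U * _)]mulrA uU mul1r. Qed.

Lemma cj1 : cj 1 = 1. Proof. by rewrite /cj mulr1. Qed.

Lemma cjB S T : cj (S - T) = cj S - cj T. Proof. by rewrite /cj mulrBr mulrBl. Qed.

Lemma cjD S T : cj (S + T) = cj S + cj T. Proof. by rewrite /cj mulrDr mulrDl. Qed.

Lemma cjZ (c : R[i]) S : cj (c *: S) = c *: cj S.
Proof. by rewrite /cj bop_scaleAr bop_scaleAl. Qed.

Lemma cj_adj S : adj (cj S) = cj (adj S).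
Proof. by rewrite /cj !adjM adjK mulrA. Qed.

Lemma cj_sa S : adj S = S -> adj (cj S) = cj S.
Proof. by move=> h; rewrite cj_adj h. Qed.

Lemma cj_peval p S : cj (peval p S) = peval p (cj S).
Proof.
elim/poly_ind: p => [|p c IH]; first by rewrite !peval0 /cj mulr0 mul0r.
by rewrite !pevalD !pevalMX !pevalC cjD cjM IH cjZ cj1.
Qed.

Lemma opnormU : opnorm U <= 1.
Proof.
apply: opnorm_le_sqn => // x; rewrite expr1n mul1r.
by rewrite /sqn adjP -bop_mulE uU.
Qed.

Lemma opnormUa : opnorm (adj U) <= 1. Proof. by rewrite opnorm_adj opnormU. Qed.

Lemma opnorm_cj S c : opnorm S <= c -> opnorm (cj S) <= c.
Proof.
by move=> h; have := opnormM_le (opnormM_le opnormU h) opnormUa; rewrite mul1r mulr1.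
Qed.

Lemma cj_proj P : projection P -> projection (cj P).
Proof. by move=> [h1 h2]; split; [rewrite -cjM h1|rewrite cj_adj h2]. Qed.

Lemma cj_psd S : psd S -> psd (cj S).
Proof. by move=> h; have := psd_conj (adj U) h; rewrite adjK. Qed.

Lemma cj_sfun L f S : 0 < L -> continuous f -> adj S = S -> opnorm S <= L ->
  cj (sfun L f S) = sfun L f (cj S).
Proof.
move=> L0 fc sS hS; apply/eqP; rewrite -subr_eq0; apply/eqP; apply: opnorm_eq0; apply/le_anti.
rewrite opnorm_ge0 andbT; apply/ler_addgt0Pl => e e0; rewrite addr0; have e2 : 0 < e / 2 by lra.
have [p hp] := sfun_poly H L0 fc e2.
have h1 := opnorm_cj (hp _ sS hS); have h2 := hp _ (cj_sa sS) (opnorm_cj hS).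
rewrite cjB cj_peval cjM in h1.
have -> : cj (sfun L f S) - sfun L f (cj S) = (cj (sfun L f S) - peval p (cj S * cj S)) -
   (sfun L f (cj S) - peval p (cj S * cj S)) by rewrite opprB addrA subrK.
apply: le_trans (opnormB _ _) _; apply: le_trans (lerD h1 h2) _; lra.
Qed.

Lemma cj_abp S : adj S = S -> abp (cj S) = cj (abp S).
Proof.
move=> sS; have [p e _] := abpP sS.
have L0 : 0 < opnorm (cj S) + 1 by have := opnorm_ge0 (cj S); lra.
rewrite abpE; symmetry; apply: (absv_unique L0 (cj_sa sS)); first by lra.
  exact: cj_psd.
by rewrite -!cjM e.
Qed.

Lemma cj_pker S : adj S = S -> pker (cj S) = cj (pker S).
Proof.
move=> sS; have [pp rp] := pkerP (cj S); apply: proj_unique => //; first exact: cj_proj (pker_proj S).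
rewrite rp cj_abp// -cjD; have k := pker_ker S; have i := @pker_id _ _ S.
move: (pker S) (abp S + S) k i => p D k i; apply/seteqP; split => x /=.
  rewrite /ker_op /= => h; exists x => //.
  have h2 : D (adj U x) = 0.
    have : adj U (U (D (adj U x))) = 0 by rewrite h bop0.
    by rewrite -bop_mulE uU bop_oneE.
  by rewrite (i _ h2) -bop_mulE Uu.
move=> [y _ <-]; rewrite /ker_op /= -[adj U (U _)]bop_mulE uU bop_oneE.
by rewrite k bop0.
Qed.

Lemma cj_invol P : cj (invol P) = invol (cj P).
Proof. by rewrite /invol cjB cjZ cj1. Qed.

Lemma cj_pt (A A' : B) t : cj (pt A A' t) = pt (cj A) (cj A') t.
Proof. by rewrite /pt cjD cjZ cjB. Qed.

Variables (N : set B) (tau : B -> \bar R).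
Hypotheses (N_vN : von_neumann_algebra N) (tau_trace : fns_trace N tau) (nU : N U).
Variables (q : R) (q0 : 0 < q) (r : R) (r0 : 0 <= r).

Lemma cj_kq F : adj F = F -> kq q r (cj F) = cj (kq q r F).
Proof.
move=> sF; have sS : adj (1 - F ^+ 2) = 1 - F ^+ 2 by exact: sqr_sa.
pose L := opnorm (1 - F ^+ 2) + 1.
have L0 : 0 < L by have := opnorm_ge0 (1 - F ^+ 2); rewrite /L; lra.
have hL : opnorm (1 - F ^+ 2) <= L by rewrite /L; lra.
have thc : continuous (th r 1 q) by exact: th_cont.
have e : 1 - cj F ^+ 2 = cj (1 - F ^+ 2) by rewrite cjB cj1 !expr2 cjM.
rewrite /kq e (theta_opE q0 r0 L0 (cj_sa sS) (opnorm_cj hL)) (theta_opE q0 r0 L0 sS hL).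
by rewrite (cj_sfun L0 thc sS hL).
Qed.

Lemma rtr_cj T : tc N tau T -> rtr N tau (cj T) = rtr N tau T.
Proof.
move=> tT; rewrite /cj -mulrA; have nU' := vN_adj N_vN nU.
by rewrite (rtrC N_vN tau_trace nU (tc_rmul N_vN tau_trace nU' tT)) -mulrA uU mulr1.
Qed.

Lemma I_cj (A A' : B) : adj A = A -> adj A' = A' -> N A -> N A' ->
  (forall t, 0 <= t <= 1 -> tc N tau (kq q r (pt A A' t))) ->
  I N tau q r (cj A) (cj A') = I N tau q r A A'.
Proof.
move=> sA sA' nA nA' tK; apply: eq_int01 => t ht; rewrite /fm -cj_pt cj_kq; last exact: pt_sa.
by rewrite -cjB -cjM rtr_cj//; apply: tc_lmul => //; [exact: vNB|exact: tK].
Qed.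

(** With Q = U P U^*, the kernel of P U P in the range of P is the image under U^* of the range of Q
    intersected with the kernel of P, and the trace is unitarily invariant. The other two subspaces
    coincide, as Q x = 0 exactly when P U^* x = 0. *)
Lemma corner_pair_index P : projection P -> N P ->
  corner_index tau P U = pair_index tau P (cj P).
Proof.
move=> hP nP; have nU' := vN_adj N_vN nU.
have nQ : N (cj P) by do 2![apply: (vNM N_vN) => //].
rewrite /corner_index /pair_index /tau_dim; congr (_ - tau (proj_onto _))%E.
  have hQ := cj_proj hP.
  have [pE _ _ rE] := Ep_facts hP hQ.
  have nE : N (Ep P (cj P)).
    have [V [_ _ _ _ hN]] := anticomm_sign (dif_sa hP hQ) (ave_sa hP hQ) (dif_ave hP hQ).
    have nb : N (ave P (cj P)) by do 2?[apply: (vNB N_vN) => //]; exact: vN1.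
    have [_ nK] := hN N N_vN nb.
    by apply: vNZ => //; apply: vND => //; apply: vNM => //; exact: vNB.
  rewrite (proj_ontoE pE rE); have idE := proj_id pE; rewrite rE in idE.
  have rE' z : (range (cj P) `&` ker_op P) (Ep P (cj P) z) by rewrite -rE; exists z.
  move: (Ep P (cj P)) pE nE idE rE' {rE} => E [EE sE] nE idE rE'.
  have -> : tau E = tau (adj U * E * U).
    have := trace_cyclic tau_trace (vNM N_vN nE nU); rewrite adjM sE.
    have -> : adj U * E * (E * U) = adj U * E * U by rewrite !mulrA -[adj U * E * E]mulrA EE.
    have -> : E * U * (adj U * E) = E by rewrite -mulrA [U * (_ * _)]mulrA Uu mul1r EE.
    by [].
  have pW : projection (adj U * E * U).
    split; last by rewrite !adjM adjK sE mulrA.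
    by rewrite -!mulrA [U * (adj U * _)]mulrA Uu mul1r [E * (E * _)]mulrA EE.
  have UUx z : adj U (U z) = z by rewrite -bop_mulE uU.
  rewrite (proj_ontoE pW)//; apply/seteqP; split => x /=; rewrite /ker_op /=.
    move=> [y _ <-]; have [[z _ hz] hk] := rE' (U y).
    have e1 : adj U (E (U y)) = P (adj U z) by rewrite -hz /= UUx.
    split; first by exists (adj U z).
    by rewrite e1 -[P (P _)]bop_mulE hP.1 -hk -hz.
  move=> [[y _ yx] h]; have px : P x = x by rewrite -yx -bop_mulE hP.1.
  exists x => //; rewrite idE ?UUx//; split; last by move: h; rewrite px.
  by exists (U x) => //; rewrite /cj !bop_mulE UUx px.
apply/seteqP; split => x /=; rewrite /ker_op /=.
  move=> [[y _ yx] h]; split; last by exists y.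
  have px : P x = x by rewrite -yx -bop_mulE hP.1.
  by move: h; rewrite px => ->; rewrite bop0.
move=> [h [y _ yx]]; split; first by exists y.
have px : P x = x by rewrite -yx -bop_mulE hP.1.
rewrite px; have := congr1 (adj U) h; rewrite bop0.
by rewrite -[adj U (U _)]bop_mulE uU.
Qed.

End UnitaryCovariance.

(** * Index and spectral flow along the conjugation path *)

Section SpectralFlowFormula.
Variables (R : realType) (H : hilbertType R).
Local Notation B := (bop H).
Variables (N : set B) (tau : B -> \bar R).
Hypotheses (N_vN : von_neumann_algebra N) (tau_trace : fns_trace N tau).
Local Notation ft := (ft N tau).
Local Notation tc := (tc N tau).
Local Notation usm := (usm N tau).
Variables (q : R) (q0 : 0 < q) (q1 : q <= 1).

Lemma usmN p T : usm p [set T] -> usm p [set - T].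
Proof.
move=> h; apply: (usm_conj N_vN tau_trace ltr01 h) => X ->; exists T, (- 1), 1; split => //.
- by split; [apply: (vNN N_vN); exact: vN1|rewrite opnormN opnorm1].
- by split; [exact: vN1|exact: opnorm1].
- by rewrite mulr1 mulNr mul1r.
Qed.

Lemma usm_add p S T : usm p [set S] -> usm p [set T] -> usm p [set S + T].
Proof. by move=> h1 h2; apply: (usmD N_vN tau_trace h1 h2) => X ->; exists S, T. Qed.

Lemma usm_sub1 p S T : usm p [set S] -> usm p [set T] -> usm p [set S - T].
Proof. by move=> h1 h2; apply: usm_add => //; exact: usmN. Qed.

Lemma usm_zero p T : usm p [set T] -> usm p [set 0].
Proof. by move=> h; have := usm_sub1 h h; rewrite subrr. Qed.

Lemma usm_scale1 p T s : 0 <= s <= 1 -> usm p [set T] -> usm p [set s%:C *: T].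
Proof. by move=> hs h; apply: usm_sub (usm_scal N_vN tau_trace h) => X ->; exists s. Qed.

Definition sgn (F : B) : B := invol (pker (- F)).

Lemma sgn_facts F : adj F = F -> N F -> [/\ N (sgn F), adj (sgn F) = sgn F & sgn F * sgn F = 1].
Proof.
move=> sF nF; have sN : adj (- F) = - F by rewrite adjN sF.
have [h1 h2] := invol_facts (pker_proj (- F)); split => //.
apply: (vNB N_vN); last exact: vN1.
by apply: (vNZ N_vN); apply: (vN_pker N_vN sN); exact: (vNN N_vN).
Qed.

(* With a = |F| = F sgn(F), sgn(F) - F = (1 - a) sgn(F) is dominated by
   1 - F^2 = (1 + a)(1 - a). *)
Lemma sgn_close F : adj F = F -> N F -> usm q [set 1 - F ^+ 2] -> usm q [set sgn F - F].
Proof.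
move=> sF nF uF; have [nJ sJ JJ] := sgn_facts sF nF.
apply: (usm_dom N_vN tau_trace (ltW q0) q1 uF) => [S ->|X ->]; first exact: sqr_sa.
split; first exact: vNB.
exists (1 - F ^+ 2) => //.
have sN : adj (- F) = - F by rewrite adjN sF.
have [pa aa ca] := abpP sN; rewrite abp_opp// in pa aa ca.
have k z := pker_ker (- F) z; have kc z := pker_compl z sN; rewrite abp_opp// in k kc.
have c1 : F * pker (- F) = pker (- F) * F by apply: pker_comm => //; rewrite mulrN mulNr.
have aF : F * abp F = abp F * F by apply: ca; rewrite mulrN mulNr.
have eF : F = abp F * sgn F.
  apply: bopP => z; rewrite /sgn /invol; move: (pker (- F)) k kc => p k kc.
  have h1 := k z; have h2 := kc z; rewrite bop_addE bop_oppE in h1; rewrite bop_oppE in h2.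
  have e1 : abp F (p z) = F (p z) by apply/eqP; rewrite -subr_eq0 h1.
  have e2 : F ((1 - p) z) = - abp F ((1 - p) z) by rewrite -h2 opprK.
  have -> : F z = F (p z) + F ((1 - p) z).
    by rewrite -bopD bop_subE bop_oneE addrC subrK.
  rewrite -e1 e2 -bopN -bopD bop_mulE; congr (bop_fun _ _).
  have -> : (2%:R%:C *: p - 1) z = 2%:R%:C *: p z - z by [].
  have -> : 2%:R%:C *: p z = p z + p z by rewrite -[2%:R%:C]/((1 + 1)%:C) rmorphD scalerDl !scale1r.
  by rewrite bop_subE bop_oneE opprB addrA.
have aJ : abp F * sgn F = sgn F * abp F.
  have h := congr1 (@adj _ _) eF; rewrite adjM sJ sF pa.1 in h.
  by rewrite -h -eF.
have e1 : sgn F - F = (1 - abp F) * sgn F by rewrite mulrBl mul1r -eF.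
have e2 : 1 - F ^+ 2 = sgn F * ((1 + abp F) * ((1 - abp F) * sgn F)).
  have -> : (1 + abp F) * ((1 - abp F) * sgn F) = (1 - abp F * abp F) * sgn F.
    by rewrite mulrA; congr (_ * _); bop_ring.
  have -> : (1 - abp F * abp F) * sgn F = sgn F * (1 - abp F * abp F).
    by move: (sgn F) aJ => s e; rewrite mulrBl mulrBr mul1r mulr1 -mulrA e mulrA e mulrA.
  by rewrite mulrA JJ mul1r aa expr2 mulrNN.
move=> z; rewrite e1 e2; set y := ((1 - abp F) * sgn F) z.
have -> : (sgn F * ((1 + abp F) * ((1 - abp F) * sgn F))) z = sgn F ((1 + abp F) y) by [].
have -> x : sqn (sgn F x) = sqn x by rewrite /sqn (sa_dot _ _ sJ) -bop_mulE JJ.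
rewrite bop_addE bop_oneE sqnD; have := pa.2 y; rewrite rdotC; have := sqn_ge0 (abp F y); lra.
Qed.

Section path.
Variables (F0 U : B) (uU : adj U * U = 1) (Uu : U * adj U = 1) (nU : N U).
Hypotheses (nF : N F0) (sF : adj F0 = F0) (uF : usm q [set 1 - F0 ^+ 2]).
Hypothesis uc : usm (q / 2) [set commutator F0 U].

Local Notation F1 := (cj U F0).
Local Notation J := (sgn F0).

Let nF1 : N F1. Proof. by apply: (vNM N_vN); [apply: (vNM N_vN)|exact: vN_adj]. Qed.
Let sF1 : adj F1 = F1. Proof. exact: cj_sa. Qed.
Let nJ : N J. Proof. by have [] := sgn_facts sF nF. Qed.
Let sJ : adj J = J. Proof. by have [] := sgn_facts sF nF. Qed.
Let JJ : J * J = 1. Proof. by have [] := sgn_facts sF nF. Qed.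
Let q2 : 0 < q / 2. Proof. by rewrite divr_gt0. Qed.
Let q12 : q / 2 <= 1. Proof. by apply: le_trans q1; rewrite ler_pdivrMr// ler_peMr ?(ltW q0)// ler1n. Qed.

(** The hypothesis on the commutator enters here: U F0 U^* - F0 = - [F0, U] U^*. *)
Let uX : usm (q / 2) [set F1 - F0].
Proof.
apply: (usm_conj N_vN tau_trace ltr01 uc) => X ->; exists (commutator F0 U), (- 1), (adj U); split => //.
- by split; [apply: (vNN N_vN); exact: vN1|rewrite opnormN opnorm1].
- by split; [exact: vN_adj|exact: opnormUa].
- have -> : -1 * commutator F0 U * adj U = - (commutator F0 U * adj U) by rewrite mulN1r mulNr.
  by rewrite /commutator mulrBl -[F0 * U * adj U]mulrA Uu mulr1 opprB.
Qed.

Let uF1 : usm q [set 1 - F1 ^+ 2].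
Proof.
apply: (usm_conj N_vN tau_trace ltr01 uF) => X ->; exists (1 - F0 ^+ 2), U, (adj U); split => //.
- by split; [|exact: opnormU].
- by split; [exact: vN_adj|exact: opnormUa].
- by rewrite -/(cj U (1 - F0 ^+ 2)) cjB cj1// !expr2 cjM.
Qed.

Lemma path_vN t : N (pt F0 F1 t).
Proof. by apply: (vND N_vN) => //; apply: (vNZ N_vN); exact: vNB. Qed.

Lemma path_sa t : adj (pt F0 F1 t) = pt F0 F1 t.
Proof. exact: pt_sa. Qed.

Lemma path_usm t : 0 <= t <= 1 -> usm q [set 1 - pt F0 F1 t ^+ 2].
Proof. by move=> ht; apply: usm_sub (usm_pt N_vN tau_trace q0 uF uF1 uX) => X ->; exists t. Qed.

Let half T : usm q [set T] -> usm (q / 2) [set T].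
Proof. by apply: usm_mono; rewrite ler_pdivrMr// ler_peMr ?(ltW q0)// ler1n. Qed.

(** Both F_t and its sign stay in the class based at J = sgn F0, so the integrals between any of
    them are defined and additive. *)
Lemma path_Cl t : 0 <= t <= 1 -> Cl N tau q J (pt F0 F1 t) /\ Cl N tau q J (sgn (pt F0 F1 t)).
Proof.
move=> ht; have u1 := path_usm ht; have nP := path_vN t; have sP := path_sa t.
have u0 : usm (q / 2) [set F0 - J].
  by have := usmN (half (sgn_close sF nF uF)); rewrite opprB.
have u2 : usm (q / 2) [set pt F0 F1 t - J].
  have := usm_add (usm_scale1 ht uX) u0.
  by rewrite /pt addrA [_ *: _ + _]addrC.
have [n3 s3 j3] := sgn_facts sP nP; split; split => //.
- by rewrite expr2 j3 subrr; exact: usm_zero u1.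
- by have := usm_add (half (sgn_close sP nP u1)) u2; rewrite addrA subrK.
Qed.

Lemma pt0 : pt F0 F1 0 = F0. Proof. by rewrite /pt scale0r addr0. Qed.
Lemma pt1 : pt F0 F1 1 = F1. Proof. by rewrite /pt scale1r addrC subrK. Qed.

(** With X = F1 - F0, the anticommutator is F0 X + X F0 = (1 - F0^2) - (1 - F1^2) - X^2, a
    combination of elements of Li_0^q. *)
Lemma path_Mq t : 0 <= t <= 1 -> Mq N tau q F0 (pt F0 F1 t).
Proof.
move=> ht; exists (t%:C *: (F1 - F0)) => //; split.
- by apply: usm_Li0 => //; [rewrite adjZ adjB sF sF1|exact: usm_scale1].
- by rewrite /selfadjoint adjZ adjB sF sF1.
- apply: usm_Li0 => //.
    by rewrite adjD !adjM adjZ adjB sF sF1 addrC.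
  have uXX : usm q [set (F1 - F0) * (F1 - F0)].
    rewrite [X in usm X](splitr q); apply: (usmM N_vN tau_trace (ltW q2) uX uX).
    by move=> X ->; exists (F1 - F0), (F1 - F0).
  have -> : F0 * (t%:C *: (F1 - F0)) + t%:C *: (F1 - F0) * F0 =
      t%:C *: ((1 - F0 ^+ 2) - (1 - F1 ^+ 2) - (F1 - F0) * (F1 - F0)).
    by rewrite !expr2; move: (cj U F0) => G; bop_ring.
  by apply: usm_scale1 => //; apply: usm_sub1 => //; exact: usm_sub1.
Qed.

Lemma path_derivative t : norm_derivative (conj_path F0 U) t = F1 - F0.
Proof.
rewrite /norm_derivative; apply: cvg_lim; first exact: norm_hausdorff.
apply: cvg_near_cst; near=> h; have h0 : h != 0 by near: h; exact: nbhs_dnbhs_neq.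
have -> : conj_path F0 U (t + h) - conj_path F0 U t = h%:C *: (F1 - F0).
  by rewrite /conj_path -/F1 opprD addrACA subrr add0r -scalerBl -rmorphB addrC addKr.
by rewrite scalerA -rmorphM mulVf// scale1r.
Unshelve. all: by end_near.
Qed.

Lemma path_continuous : continuous (conj_path F0 U).
Proof.
move=> t; apply/cvgrPdist_le => e /posC[-> e0].
pose x := opnorm (F1 - F0) + 1; have x0 : 0 < x by rewrite /x ltr_wpDl// opnorm_ge0.
near=> s; rewrite bop_normE lecR -/(pt F0 F1 t) -/(pt F0 F1 s) opnorm_ptB.
have : `|t - s| <= complex.Re e / x.
  by near: s; apply: cvgr_dist_le => //; exact: divr_gt0.
rewrite ler_pdivlMr// => h; apply: le_trans h; rewrite ler_wpM2l// /x lerDl//.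
Unshelve. all: by end_near.
Qed.

(** F_t is its own parametrix, since F_t^2 - 1 is in the compact ideal. *)
Lemma path_fredholm t : 0 <= t <= 1 -> breuer_fredholm N tau (pt F0 F1 t).
Proof.
move=> ht; split; first exact: path_vN.
exists (pt F0 F1 t); split; first exact: path_vN.
all: have := usm_compact N_vN q0 (usmN (path_usm ht)); rewrite opprB expr2; exact.
Qed.

Lemma flow_projE t : nonneg_proj (pt F0 F1 t) = pker (- pt F0 F1 t).
Proof. by rewrite nonneg_projE// path_sa. Qed.

(** Half the difference of the two signs is the difference of the projections; it lies in the
    compact ideal, so the quotient norm is 0. *)
Lemma path_quotient t s : 0 <= t <= 1 -> 0 <= s <= 1 ->
  quotient_norm N tau (nonneg_proj (pt F0 F1 t) - nonneg_proj (pt F0 F1 s)) < 1.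
Proof.
move=> ht hs; rewrite !flow_projE.
have [_ [_ _ _ u1]] := path_Cl ht; have [_ [_ _ _ u2]] := path_Cl hs.
have h01 : 0 <= (2^-1 : R) <= 1 by apply/andP; split; lra.
have u := usm_scale1 h01 (usm_sub1 u1 u2).
have e : (2^-1)%:C *: (sgn (pt F0 F1 t) - J - (sgn (pt F0 F1 s) - J)) =
    pker (- pt F0 F1 t) - pker (- pt F0 F1 s).
  by rewrite /sgn /invol; move: (pker _) (pker _) (pker _) => a b c; bop_field.
rewrite e in u; have cu := usm_compact N_vN q2 u.
apply: (@le_lt_trans _ _ 0) => //; apply: ge_inf.
  by exists 0 => _ [X _ <-]; exact: opnorm_ge0.
by exists (pker (- pt F0 F1 t) - pker (- pt F0 F1 s)) => //; rewrite subrr opnorm0.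
Qed.

Section formula.
Variables (r : R) (r0 : 0 <= r).
Local Notation I := (I N tau q r).

Lemma pair_index_I t s : 0 <= t <= 1 -> 0 <= s <= 1 ->
  pair_index tau (pker (- pt F0 F1 t)) (pker (- pt F0 F1 s)) =
  ((theta_const r q)^-1 * I (sgn (pt F0 F1 t)) (sgn (pt F0 F1 s)))%:E.
Proof.
move=> ht hs; have [_ c1] := path_Cl ht; have [_ c2] := path_Cl hs.
have pN u : N (pker (- pt F0 F1 u)).
  by apply: (vN_pker N_vN); [rewrite adjN path_sa|apply: (vNN N_vN); exact: path_vN].
apply: I_invol => //; try exact: pker_proj.
by move=> u hu; exact: (fm_Cl_ft N_vN tau_trace q0 q1 r0 sJ JJ c1 c2 hu).
Qed.

Let z0 : 0 <= (0 : R) <= 1. Proof. by rewrite lexx ler01. Qed.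
Let z1 : 0 <= (1 : R) <= 1. Proof. by rewrite ler01 lexx. Qed.
Let Iadd := I_add N_vN tau_trace q0 q1 r0 nJ sJ JJ.

Lemma I_path_sgn : I F0 F1 = I (sgn F0) (sgn F1).
Proof.
have [c0 c0'] := path_Cl z0; have [c1 c1'] := path_Cl z1; rewrite pt0 in c0 c0'; rewrite pt1 in c1 c1'.
rewrite (Iadd c0 c0' c1) (Iadd c0' c1' c1).
have -> : I (sgn F1) F1 = I (sgn F0) F0.
  have -> : sgn F1 = cj U (sgn F0).
    rewrite /sgn cj_invol// -(cj_pker uU Uu); last by rewrite adjN sF.
    by rewrite /cj mulrN mulNr.
  apply: I_cj => //; move=> t ht; apply: tc_ft => //.
  exact: (fm_Cl_ft N_vN tau_trace q0 q1 r0 sJ JJ c0' c0 ht).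
rewrite (I_anti N_vN tau_trace q0 q1 r0 nJ sJ JJ c0 c0').
by set x := I _ _; set y := I _ _; clearbody x y; rewrite addrC subrK.
Qed.

(** Each pair index is an integral between two symmetries, and additivity of [I] makes the partial
    sums telescope from sgn F0 to the sign at the last knot, which is 1. *)
Lemma path_flow_sum (s : seq R) : itv_partition 0 1 s ->
  flow_sum tau (conj_path F0 U) 0 1 s = ((theta_const r q)^-1 * I F0 F1)%:E.
Proof.
move=> hs; have kn i : (i < (size s).+1)%N -> 0 <= knot 0 1 s i <= 1.
  move=> hi; rewrite /knot; apply/andP; split.
    exact: (itv_partition_nth_ge hi hs).
  exact: (itv_partition_nth_le hi hs).
have ind n : (n < (size s).+1)%N -> (\sum_(0 <= i < n)
    pair_index tau (nonneg_proj (conj_path F0 U (knot 0 1 s i))) (nonneg_proj (conj_path F0 U (knot 0 1 s i.+1))))%E =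
    ((theta_const r q)^-1 * I (sgn F0) (sgn (pt F0 F1 (knot 0 1 s n))))%:E.
  elim: n => [|n IH] hn.
    by rewrite big_geq// /knot /= pt0 (I_refl N_vN tau_trace) mulr0.
  have hn' : (n < (size s).+1)%N by exact: ltnW.
  rewrite big_nat_recr//= IH// !flow_projE pair_index_I//; try exact: kn.
  rewrite -EFinD -mulrDr; congr (_ * _)%:E.
  have [_ c0] := path_Cl z0; have [_ c1] := path_Cl (kn _ hn'); have [_ c2] := path_Cl (kn _ hn).
  by rewrite pt0 in c0; rewrite -(Iadd c0 c1 c2).
rewrite /flow_sum (ind (size s) (ltnSn _)) I_path_sgn.
have -> : knot 0 1 s (size s) = 1 by rewrite /knot (itv_partition_nth_size _ hs).
by rewrite pt1.
Qed.

Lemma path_spectral_flow : is_spectral_flow N tau (conj_path F0 U) 0 1 ((theta_const r q)^-1 * I F0 F1)%:E.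
Proof.
split.
- by apply: continuous_subspaceT; exact: path_continuous.
- move=> t; rewrite in_itv /= => ht; split; [exact: path_sa|exact: path_fredholm].
(* The single interval [0, 1] is already fine, the projections being equal modulo the compact
   ideal. *)
- exists [:: 1]; split; first exact: itv_partition1 ltr01.
  move=> i /=; rewrite ltnS leqn0 => /eqP -> t t'; rewrite /knot /= !in_itv /= => ht ht'.
  exact: path_quotient.
- by move=> s [hs _]; exact: path_flow_sum.
Qed.

Lemma path_corner_index : corner_index tau (pker (- F0)) U = ((theta_const r q)^-1 * I F0 F1)%:E.
Proof.
have sN : adj (- F0) = - F0 by rewrite adjN sF.
have nP : N (pker (- F0)) by apply: (vN_pker N_vN) => //; exact: (vNN N_vN).
rewrite (corner_pair_index uU Uu N_vN tau_trace nU (pker_proj _) nP) -(cj_pker uU Uu sN).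
have -> : cj U (- F0) = - F1 by rewrite /cj mulrN mulNr.
by have := pair_index_I z0 z1; rewrite pt0 pt1 => ->; rewrite I_path_sgn.
Qed.

Lemma path_trace t : 0 <= t <= 1 ->
  trace_is N tau (norm_derivative (conj_path F0 U) t * theta_op r q (1 - conj_path F0 U t ^+ 2))
    (fm N tau q r F0 F1 t)%:C.
Proof.
move=> ht; rewrite path_derivative.
have [c0 _] := path_Cl z0; have [c1 _] := path_Cl z1; rewrite pt0 in c0; rewrite pt1 in c1.
have fK := fm_Cl_ft N_vN tau_trace q0 q1 r0 sJ JJ c0 c1 ht.
apply: (trace_is_rtr N_vN tau_trace) => //; first exact: vNB.
by rewrite adjB sF sF1.
Qed.

Lemma path_integrable : lebesgue_measure.-integrable `[0, 1] (EFin \o fm N tau q r F0 F1).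
Proof.
have [c0 _] := path_Cl z0; have [c1 _] := path_Cl z1; rewrite pt0 in c0; rewrite pt1 in c1.
exact: (ucont_integrable (fm_Cl_ucont N_vN tau_trace q0 q1 r0 nJ sJ JJ c0 c1)).
Qed.

End formula.
End path.
End SpectralFlowFormula.

Theorem theorem5p9 (R : realType) (H : hilbertType R)
    (N : set (bop H)) (tau : bop H -> \bar R)
    (N_vN : von_neumann_algebra N) (N_sep : separable_predual N)
    (tau_trace : fns_trace N tau)
    (A : banachStarAlgType R) (rho : A -> bop H) (F0 : bop H)
    (q : R) (q_gt0 : 0 < q) (q_le1 : q <= 1)
    (F0_mod : pre_breuer_fredholm_module N tau q rho F0)
    (u : A) (u_unitary : unitary_elt u)
    (u_comm : Li0 N tau (q / 2) (commutator F0 (rho u))) :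
  let P := 2^-1 *: (borel_calculus (@sign_fun R) F0 + 1) in
  let F := conj_path F0 (rho u) in
  (forall t : R, t \in `[0, 1] -> Mq N tau q F0 (F t)) /\
  (forall r : R, 0 <= r ->
    exists g : R -> R,
      [/\ forall t : R, t \in `[0, 1] ->
            trace_is N tau (norm_derivative F t * theta_op r q (1 - F t ^+ 2))
              (g t)%:C,
          lebesgue_measure.-integrable `[0, 1] (EFin \o g),
          corner_index tau P (rho u) =
            ((theta_const r q)^-1 *
               \int[lebesgue_measure]_(t in `[0, 1]) g t)%:E &
          is_spectral_flow N tau F 0 1
            ((theta_const r q)^-1 *
               \int[lebesgue_measure]_(t in `[0, 1]) g t)%:E]).
Proof.
have rep := mod_rep F0_mod; have [uu1 uu2] := u_unitary.
have uU : adj (rho u) * rho u = 1 by rewrite -(rep_star rep) -(rep_mul rep) uu1 (rep_one rep).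
have Uu : rho u * adj (rho u) = 1 by rewrite -(rep_star rep) -(rep_mul rep) uu2 (rep_one rep).
have nU := rep_mem rep u.
have nF := (mod_fredholm F0_mod).1.
have sF : adj F0 = F0 := mod_selfadjoint F0_mod.
have uF := Li0_usm N_vN tau_trace q_gt0 (mod_summable F0_mod).
have q2 : 0 < q / 2 by rewrite divr_gt0.
have uc := Li0_usm N_vN tau_trace q2 u_comm.
move=> P F.
(* The sign takes the value 1 at 0, so P is the spectral projection for the closed half line. *)
have -> : P = pker (- F0).
  rewrite /P borel_signE// subrK scalerA.
  have -> : 2^-1 * 2%:R%:C = 1 :> R[i]; last by rewrite scale1r.
  by rewrite rmorph_nat mulVf// pnatr_eq0.
split=> [t|r r0].
  rewrite in_itv /= => ht.
  by apply: (path_Mq N_vN tau_trace).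
(* The witness is the real one-form along the path; the derivative of the path is constantly u F0
   u^* - F0. *)
exists (fm N tau q r F0 (cj (rho u) F0)); split.
- move=> t; rewrite in_itv /= => ht.
  by apply: (path_trace N_vN tau_trace).
- by apply: (path_integrable N_vN tau_trace).
- by apply: (path_corner_index N_vN tau_trace).
- by apply: (path_spectral_flow N_vN tau_trace).
Qed.
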